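(* Let $\tilde w=s_{\beta_1}\cdots s_{\beta_r}$ be an expression (not necessarily reduced) in simple reflections of the Weyl group of a Kac-Moody group $G$, and let $Z(\tilde w)$ be the associated Bott-Samelson-Demazure-Hansen variety. Let $a_{\rho_i^+},a_{\rho_i^-}$ ($1\le i\le r$) be integers, and let $d_i$ and $g_i$ be the integers defined from them in the context. Let $D'=\sum_{i=1}^r g_iZ_i$. If $d_i\ge0$ for all $1\le i\le r$, then $H^j(Z(\tilde w),\mathcal O_{Z(\tilde w)}(D'))=0$ for all $j>0$.
   Context: We work over $\mathbb C$. $G$ is the Kac-Moody group of a generalized Cartan matrix, with maximal torus $T$, Borel subgroup $B\supset T$, simple roots $S$, minimal parabolic subgroups $P_\alpha$ ($\alpha\in S$). An expression is a finite sequence $\tilde w=s_{\beta_1}\cdots s_{\beta_r}$ of simple reflections, $\beta_i\in S$. Put $\beta_{ij}:=\langle\beta_j,\check\beta_i\rangle$, where $\check\beta_i$ is the coroot of $\beta_i$. $Z(\tilde w)=P_{\beta_1}\times\cdots\times P_{\beta_r}/B^r$ with action $(p_1,\dots,p_r)\cdot(b_1,\dots,b_r)=(p_1b_1,b_1^{-1}p_2b_2,\dots,b_{r-1}^{-1}p_rb_r)$; it is a smooth projective variety of dimension $r$. $Z_i:=\{[(p_1,\dots,p_r)]\in Z(\tilde w):p_i\in B\}$, a divisor. Fan: let $e_1^+,\dots,e_r^+$ be the standard basis of $\mathbb Z^r$ and $e_i^-:=-e_i^+-\sum_{j>i}\beta_{ij}e_j^+$; let $\Sigma$ be the complete smooth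 fan in $\mathbb R^r$ whose cones are generated by the subsets of $\{e_1^\pm,\dots,e_r^\pm\}$ containing no pair $\{e_i^+,e_i^-\}$ (this is the fan of the toric limit $Y_{\tilde w}$ of $Z(\tilde w)$). Let $\rho_i^{\pm}$ be the ray generated by $e_i^\pm$; the $a_\rho$ are the coefficients of a toric divisor $\sum_\rho a_\rho D_\rho$ on $Y_{\tilde w}$. Let $\gamma_{P_i}\in\Sigma$ be the cone containing $e_i^++e_i^-$ in its relative interior ($\{0\}$ if the sum is zero), $\gamma_{P_i}(1)$ its set of rays, and write uniquely $e_i^++e_i^-=\sum_{\rho\in\gamma_{P_i}(1)}c_\rho u_\rho$ with $c_\rho>0$, $u_\rho$ the primitive generator of $\rho$. Define $$d_i:=a_{\rho_i^+}+a_{\rho_i^-}-\sum_{\rho\in\gamma_{P_i}(1)}c_\rho a_\rho .$$ Define $h_i^j$ for $1\le i,j\le r$ by $h_i^j=0$ if $j>i$, $h_i^i=1$, and $h_i^j=-\sum_{k=j}^{i-1}\beta_{ki}h_k^j$ if $j<i$. Define $g_i:=a_{\rho_i^+}+\sum_{j=i}^r a_{\rho_j^-}h_j^i$. *)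

(* Defs.v *)
From HB Require Import structures.
From mathcomp Require Import all_boot all_order all_algebra.
From mathcomp Require Import all_classical all_reals.
From mathcomp Require Import topology_structure.
From mathcomp.real_closed Require Import complex.
From mathcomp.multinomials Require Import -(notations) mpoly.

Set Implicit Arguments.
Unset Strict Implicit.
Unset Printing Implicit Defensive.
Import Order.TTheory GRing.Theory Num.Theory.
Local Open Scope classical_set_scope.
Local Open Scope ring_scope.

(* Generalized Cartan matrices and Kac-Moody groups.  Convention:
   A i j = <alpha_j, alpha_i^vee>. *)

Definition is_gcm (l : nat) (A : 'M[int]_l) : Prop :=
  [/\ forall i, A i i = 2,
      forall i j, i != j -> A i j <= 0
    & forall i j, A i j = 0 -> A j i = 0].

(* An integral realization (Kumar, "Kac-Moody groups, their flag varieties and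
   representation theory", 6.1.6): h_Z = Z^n, with n = dim h = 2l - rank A, and
   h_Z^* = Z^n under the dot product; the rows of the two matrices are the
   simple roots, in h_Z^*, and the simple coroots, in h_Z. *)
Record realization (l : nat) (A : 'M[int]_l) := Realization {
  rlz_dim : nat;
  rlz_root : 'M[int]_(l, rlz_dim);
  rlz_coroot : 'M[int]_(l, rlz_dim);
  rlz_dimE : rlz_dim = (l.*2 - \rank (map_mx intr A : 'M[rat]_l))%N;
  rlz_root_free : row_free (map_mx intr rlz_root : 'M[rat]_(l, rlz_dim));
  rlz_coroot_free : row_free (map_mx intr rlz_coroot : 'M[rat]_(l, rlz_dim));
  rlz_pairing : rlz_coroot *m rlz_root^T = A;
  (* h_Z / (+)_i Z alpha_i^vee is torsion free *)
  rlz_saturated : forall (h : 'rV[int]_rlz_dim) (m : int), m != 0 ->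
    (exists c : 'rV[int]_l, m *: h = c *m rlz_coroot) ->
    exists c : 'rV[int]_l, h = c *m rlz_coroot
}.

Section KacMoody.
Variables (R : realType) (l : nat) (A : 'M[int]_l) (D : realization A).
Local Notation C := R[i].
Local Notation n := (rlz_dim D).

Definition ad_op (V : lmodType C) (x y : V -> V) : V -> V :=
  fun v => x (y v) - y (x v).

Definition weight_vector (V : lmodType C) (oph : 'I_n -> V -> V)
    (lam : 'rV[int]_n) (v : V) : Prop :=
  forall k, oph k v = (lam 0 k)%:~R *: v.

(* Integrable modules over the Kac-Moody algebra g(A), presented by the
   Chevalley generators e_i, f_i and the basis h_k of h_Z: weight modules with
   weights in h_Z^* on which the e_i and f_i are locally nilpotent. *)
Record integrable_module := IntegrableModule {
  im_sort :> lmodType C;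
  im_h : 'I_n -> {linear im_sort -> im_sort};
  im_e : 'I_l -> {linear im_sort -> im_sort};
  im_f : 'I_l -> {linear im_sort -> im_sort};
  im_hh : forall k k' v, ad_op (im_h k) (im_h k') v = 0;
  im_he : forall k i v,
    ad_op (im_h k) (im_e i) v = (rlz_root D i k)%:~R *: im_e i v;
  im_hf : forall k i v,
    ad_op (im_h k) (im_f i) v = - ((rlz_root D i k)%:~R *: im_f i v);
  im_ef : forall i j v, ad_op (im_e i) (im_f j) v =
    if i == j then \sum_k (rlz_coroot D i k)%:~R *: im_h k v else 0;
  im_serre_e : forall i j v, i != j ->
    iter (absz (1 - A i j)) (ad_op (im_e i)) (im_e j) v = 0;
  im_serre_f : forall i j v, i != j ->
    iter (absz (1 - A i j)) (ad_op (im_f i)) (im_f j) v = 0;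
  im_weight : forall v, exists s : seq im_sort, v = \sum_(x <- s) x /\
    forall x, x \in s -> exists lam, weight_vector im_h lam x;
  im_e_nilp : forall i v, exists m, iter m (im_e i) v = 0;
  im_f_nilp : forall i v, exists m, iter m (im_f i) v = 0
}.

(* U acts on V as exp (a x), where x is locally nilpotent. *)
Definition acts_as_exp (V : lmodType C) (x : V -> V) (a : C) (U : V -> V) :=
  forall m v, iter m x v = 0 ->
    U v = \sum_(0 <= k < m) (a ^+ k / k`!%:R) *: iter k x v.

(* T is Hom(h_Z', C - {0}) for the dual h_Z' of h_Z, so n copies of C - {0}. *)
Definition torus : set 'rV[C]_n := [set t | forall k, t 0 k != 0].

Definition torus_char (lam : 'rV[int]_n) (t : 'rV[C]_n) : C :=
  \prod_k t 0 k ^ lam 0 k.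

Definition is_subgroup (G : groupType) (H : set G) : Prop :=
  H 1%g /\ forall x y, H x -> H y -> H (x * y^-1)%g.

Definition generated_by (G : groupType) (S : set G) : set G :=
  smallest (@is_subgroup G) S.

(* The (minimal) Kac-Moody group of Kac and Peterson: the group generated by T
   and by one-parameter groups x_i(a) = exp (a e_i), y_i(a) = exp (a f_i),
   subject to exactly those relations that hold in all integrable modules.
   These conditions determine the group up to a unique isomorphism that
   respects the generators. *)
Record kac_moody_group := KacMoodyGroup {
  km_sort :> groupType;
  km_t : 'rV[C]_n -> km_sort;
  km_x : 'I_l -> C -> km_sort;
  km_y : 'I_l -> C -> km_sort;
  km_rep : forall M : integrable_module, km_sort -> {linear M -> M};
  km_rep1 : forall M v, km_rep M 1%g v = v;
  km_repM : forall M g h v, km_rep M (g * h)%g v = km_rep M g (km_rep M h v);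
  km_rep_t : forall M t lam v, torus t -> weight_vector (@im_h M) lam v ->
    km_rep M (km_t t) v = torus_char lam t *: v;
  km_rep_x : forall M i a, acts_as_exp (@im_e M i) a (km_rep M (km_x i a));
  km_rep_y : forall M i a, acts_as_exp (@im_f M i) a (km_rep M (km_y i a));
  km_faithful : forall g, (forall M v, km_rep M g v = v) -> g = 1%g;
  km_generated : generated_by (km_t @` torus `|`
    \bigcup_i (range (km_x i) `|` range (km_y i))) = setT
}.

Variable G : kac_moody_group.

Definition simple_lift (i : 'I_l) : G :=
  (km_x G i 1%R * km_y G i (- 1)%R * km_x G i 1%R)%g.

Definition word_lift (u : seq 'I_l) : G :=
  foldr (fun i g => simple_lift i * g)%g 1%g u.

(* s_i on the root lattice, in the basis of simple roots *)
Definition simple_refl (i : 'I_l) (v : 'rV[int]_l) : 'rV[int]_l :=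
  v - (\sum_j v 0 j * A i j) *: delta_mx 0 i.

Definition real_root (u : seq 'I_l) (i : 'I_l) : 'rV[int]_l :=
  foldr simple_refl (delta_mx 0 i) u.

Definition positive_root_element : set G :=
  [set g | exists u i a, (forall j, 0 <= real_root u i 0 j) /\
                         g = (word_lift u * km_x G i a * (word_lift u)^-1)%g].

Definition borel : set G :=
  generated_by (km_t G @` torus `|` positive_root_element).

Definition min_parabolic (i : 'I_l) : set G :=
  generated_by (borel `|` range (km_y G i)).

Lemma generated_sub (S : set G) : S `<=` generated_by S.
Proof. exact: sub_gen_smallest. Qed.

Lemma generated_subgroup (S : set G) : is_subgroup (generated_by S).
Proof.
split=> [M [[] //]|x y Hx Hy M MS].
by have [[_ h] _] := MS; apply: h; [exact: Hx|exact: Hy].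
Qed.

Lemma is_subgroupM (H : set G) : is_subgroup H ->
  forall x y, H x -> H y -> H (x * y)%g.
Proof.
move=> [H1 HP] x y Hx Hy.
by rewrite -[y]invgK; apply: (HP) => //; rewrite -[_^-1%g]mul1g; apply: HP.
Qed.

Lemma km_y_parabolic i a : min_parabolic i (km_y G i a).
Proof. by apply: generated_sub; right; exists a. Qed.

Lemma km_x_parabolic i a : min_parabolic i (km_x G i a).
Proof.
apply: generated_sub; left; apply: generated_sub; right.
exists [::], i, a; split=> [j|]; last by rewrite /= invg1 mulg1 mul1g.
by rewrite /real_root /= mxE; case: (_ && _).
Qed.

Section BottSamelson.
Variables (r : nat) (w : 'I_r -> 'I_l).

(* q = p . b for some b in B^r; b is stored with b_0 = 1 in front. *)
Definition bs_rel (p q : 'I_r -> G) : Prop :=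
  exists b : 'I_r.+1 -> G, [/\ b ord0 = 1%g, forall k, borel (b k) &
    forall i, q i =
      ((b (widen_ord (leqnSn r) i))^-1 * p i * b (lift ord0 i))%g].

Definition bs_tuple (p : 'I_r -> G) : Prop :=
  forall i, min_parabolic (w i) (p i).

(* The points of Z(w), i.e. the B^r-orbits in the product of the P_{w i}. *)
Definition bsdh : Type :=
  {z : set ('I_r -> G) | exists2 p, bs_tuple p & z = [set q | bs_rel p q]}.

HB.instance Definition _ := gen_eqMixin bsdh.
HB.instance Definition _ := gen_choiceMixin bsdh.

Definition bs_point (p : 'I_r -> G) (hp : bs_tuple p) : bsdh :=
  exist _ _ (ex_intro2 _ _ p hp erefl).

Definition bs_divisor (i : 'I_r) : set bsdh :=
  [set z | exists2 p, sval z p & borel (p i)].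

Definition bs_boundary : set bsdh := \bigcup_i bs_divisor i.

(* Z(w) is covered by 2^r open affine charts C^r -> Z(w): P_alpha / B = P^1 is
   covered by the two cells a |-> y_alpha(a) B and a |-> x_alpha(a) s_alpha B,
   and over each of them P_alpha -> P_alpha / B has the indicated section. *)
Definition chart_coord (i : 'I_l) (e : bool) (a : C) : G :=
  if e then km_y G i a else (km_x G i a * simple_lift i)%g.

Lemma chart_tuple (e : 'I_r -> bool) (t : 'I_r -> C) :
  bs_tuple (fun i => chart_coord (w i) (e i) (t i)).
Proof.
move=> i; rewrite /chart_coord; case: (e i); first exact: km_y_parabolic.
have M : forall x y, min_parabolic (w i) x -> min_parabolic (w i) y ->
    min_parabolic (w i) (x * y)%g := is_subgroupM (generated_subgroup _).
by rewrite /simple_lift; do ![apply: (M) |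
  exact: km_x_parabolic | exact: km_y_parabolic].
Qed.

Definition chart (e : 'I_r -> bool) (t : 'I_r -> C) : bsdh :=
  bs_point (chart_tuple e t).

Local Notation peval t p := (@mpoly.meval r C t p).

Definition zariski_open (S : set ('I_r -> C)) : Prop :=
  forall t, S t -> exists q : mpoly.mpoly r C, peval t q != 0 /\
    forall t', peval t' q != 0 -> S t'.

Definition bsdh_open (U : set bsdh) : Prop :=
  forall e, zariski_open (chart e @^-1` U).

Lemma bsdh_openT : bsdh_open setT.
Proof. by move=> e t _; exists 1; rewrite mpoly.meval1 oner_neq0. Qed.

Lemma bsdh_openI : setI_closed bsdh_open.
Proof.
move=> U V oU oV e t [Ut Vt].
have [p [pt pU]] := oU e t Ut; have [q [qt qV]] := oV e t Vt.
exists (p * q); rewrite mpoly.mevalM mulf_neq0 //; split=> // t'.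
by rewrite mpoly.mevalM mulf_eq0 negb_or => /andP[p' q']; split; [apply: pU|apply: qV].
Qed.

Lemma bsdh_open_bigU (I : Type) (f : I -> set bsdh) :
  (forall i, bsdh_open (f i)) -> bsdh_open (\bigcup_i f i).
Proof.
move=> of_ e t [i _ fit]; have [q [qt qf]] := of_ i e t fit.
by exists q; split=> // t' /qf ft'; exists i.
Qed.

HB.instance Definition _ := isOpenTopological.Build bsdh
  bsdh_openT bsdh_openI bsdh_open_bigU.


Definition regular_on (W : set bsdh) (h : bsdh -> C) : Prop :=
  forall e t, W (chart e t) -> exists p q : mpoly.mpoly r C,
    peval t q != 0 /\ forall t', W (chart e t') -> peval t' q != 0 ->
      h (chart e t') = peval t' p / peval t' q.

(* z generates the ideal sheaf of the closed set Y on the open set W. *)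
Definition ideal_generator (Y W : set bsdh) (z : bsdh -> C) : Prop :=
  [/\ regular_on W z, forall x, W x -> Y x -> z x = 0 &
    forall V h, open V -> V `<=` W -> regular_on V h ->
      (forall x, V x -> Y x -> h x = 0) ->
      exists2 k, regular_on V k & forall x, V x -> h x = z x * k x].

(* f is a section over U of O(sum_i g_i Z_i).  As Z(w) is integral, sections
   are determined by their values off the Z_i; f is set to 0 elsewhere.  The
   z_i generating the O(- Z_i) exist locally, and the condition is that
   f * prod_i z_i ^ g_i extends, locally, to a regular function. *)
Definition divisor_section (g : 'I_r -> int) (U : set bsdh) (f : bsdh -> C) :=
  (forall x, ~ (U `\` bs_boundary) x -> f x = 0) /\
  forall (W : set bsdh) (z : 'I_r -> bsdh -> C), open W -> W `<=` U ->
    (forall i, ideal_generator (bs_divisor i) W (z i)) ->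
    forall x, W x -> exists V h,
      [/\ open V, V x, V `<=` W, regular_on V h &
        forall y, V y -> ~ bs_boundary y -> f y * \prod_i z i y ^ g i = h y].

End BottSamelson.
End KacMoody.

(* Sheaves of abelian groups and their cohomology.  Only the values on open
   sets are meaningful. *)
Section Sheaves.
Variable X : topologicalType.

Record sheaf := Sheaf {
  sec :> set X -> zmodType;
  res : forall U V : set X, V `<=` U -> sec U -> sec V;
  res_additive : forall U V (UV : V `<=` U), open U -> open V ->
    forall s t, res UV (s + t) = res UV s + res UV t;
  res_id : forall U (UU : U `<=` U) s, open U -> res UU s = s;
  res_comp : forall U V W (UV : V `<=` U) (VW : W `<=` V) (UW : W `<=` U) s,
    open U -> open V -> open W -> res VW (res UV s) = res UW s;
  sheaf_glue : forall (I : Type) (U : I -> set X) (s : forall i, sec (U i)),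
    (forall i, open (U i)) ->
    (forall i j (V : set X) (iV : V `<=` U i) (jV : V `<=` U j), open V ->
      res iV (s i) = res jV (s j)) ->
    exists! t : sec (\bigcup_i U i),
      forall i (iU : U i `<=` \bigcup_i U i), res iU t = s i
}.

Definition sheaf_map (F G : sheaf) := forall U, F U -> G U.

Definition is_sheaf_morphism (F G : sheaf) (phi : sheaf_map F G) : Prop :=
  (forall U, open U -> forall s t, phi U (s + t) = phi U s + phi U t) /\
  (forall U V (UV : V `<=` U) s, open U -> open V ->
    phi V (res UV s) = res UV (phi U s)).

Definition is_monomorphism (F G : sheaf) (phi : sheaf_map F G) : Prop :=
  is_sheaf_morphism phi /\ forall U, open U -> injective (phi U).

Definition exact_at (F G H : sheaf) (phi : sheaf_map F G)
    (psi : sheaf_map G H) : Prop :=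
  forall U, open U ->
    (forall s, psi U (phi U s) = 0) /\
    forall s, psi U s = 0 -> forall x, U x ->
      exists (V : set X) (UV : V `<=` U) (t : F V),
        [/\ open V, V x & phi V t = res UV s].

Definition injective_sheaf (J : sheaf) : Prop :=
  forall (F G : sheaf) (i : sheaf_map F G) (f : sheaf_map F J),
    is_monomorphism i -> is_sheaf_morphism f ->
    exists2 g : sheaf_map G J, is_sheaf_morphism g &
      forall U, open U -> forall s, g U (i U s) = f U s.

Record injective_resolution (F : sheaf) := InjectiveResolution {
  ir_obj : nat -> sheaf;
  ir_eta : sheaf_map F (ir_obj 0%N);
  ir_d : forall n, sheaf_map (ir_obj n) (ir_obj n.+1);
  ir_injective : forall n, injective_sheaf (ir_obj n);
  ir_eta_mono : is_monomorphism ir_eta;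
  ir_d_morphism : forall n, is_sheaf_morphism (@ir_d n);
  ir_exact0 : exact_at ir_eta (@ir_d 0%N);
  ir_exact : forall n, exact_at (@ir_d n) (@ir_d n.+1)
}.

Arguments ir_d {F} _ n U _.

Definition global_coboundary (F : sheaf) (J : injective_resolution F) (j : nat) :
    ir_obj J j setT -> Prop :=
  match j with
  | 0%N => fun s => s = 0
  | k.+1 => fun s => exists t, ir_d J k setT t = s
  end.

(* H^j(X, F) = 0, where H^j(X, F) is the j-th cohomology of the global sections
   of an injective resolution of F (whichever one is used). *)
Definition cohomology_vanishes (F : sheaf) (j : nat) : Prop :=
  forall (J : injective_resolution F) (s : ir_obj J j setT),
    ir_d J j setT s = 0 -> global_coboundary s.

End Sheaves.

Section DivisorSheaf.
Variables (R : realType) (l : nat) (A : 'M[int]_l) (D : realization A).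
Variables (G : kac_moody_group R D) (r : nat) (w : 'I_r -> 'I_l).
Variable g : 'I_r -> int.
Local Notation C := R[i].
Local Notation Z := (bsdh G w).
Local Notation peval t p := (@mpoly.meval r C t p).

Lemma regular_onS (V W : set Z) (h : Z -> C) :
  V `<=` W -> regular_on W h -> regular_on V h.
Proof.
move=> VW hW e t Vt; have [p [q [qt pq]]] := hW e t (VW _ Vt).
by exists p, q; split=> // t' /VW; exact: pq.
Qed.

Lemma regular_on0 (W : set Z) : regular_on W (fun=> 0).
Proof.
move=> e t _; exists 0, 1; rewrite mpoly.meval1 oner_neq0; split=> // t' _ _.
by rewrite mpoly.meval0 mul0r.
Qed.

Lemma regular_onB (W : set Z) (h k : Z -> C) :
  regular_on W h -> regular_on W k -> regular_on W (fun x => h x - k x).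
Proof.
move=> hW kW e t Wt.
have [p [q [qt pq]]] := hW e t Wt; have [p' [q' [qt' pq']]] := kW e t Wt.
exists (p * q' - p' * q), (q * q'); rewrite mpoly.mevalM mulf_neq0 //.
split=> // u Wu; rewrite mpoly.mevalM mulf_eq0 negb_or => /andP[qu qu'].
rewrite pq // pq' // mpoly.mevalB !mpoly.mevalM -mulNr addf_div //.
by rewrite mulNr.
Qed.

Lemma ideal_generatorS (Y V W : set Z) z :
  V `<=` W -> ideal_generator Y W z -> ideal_generator Y V z.
Proof.
move=> VW [zr z0 zg]; split; first exact: regular_onS zr.
  by move=> x /VW; exact: z0.
by move=> V' h oV' V'V; apply: zg => //; exact: subset_trans VW.
Qed.

Lemma divisor_section0 U : divisor_section g U (0 : Z -> C).
Proof.
split=> // W z oW WU gz x Wx; exists W, (fun=> 0); split=> //.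
  exact: regular_on0.
by move=> y _ _; rewrite mul0r.
Qed.

Lemma divisor_sectionB U (f f' : Z -> C) : divisor_section g U f ->
  divisor_section g U f' -> divisor_section g U (f - f').
Proof.
have fB y : (f - f') y = f y - f' y by [].
move=> [f0 fs] [f0' fs']; split=> [x Ux|W z oW WU gz x Wx].
  by rewrite fB f0 // f0' // subr0.
have [V [h [oV Vx VW hr hE]]] := fs W z oW WU gz x Wx.
have [V' [h' [oV' Vx' VW' hr' hE']]] := fs' W z oW WU gz x Wx.
exists (V `&` V'), (fun x => h x - h' x); split.
- exact: openI.
- by [].
- by move=> y [/VW].
- by apply: regular_onB; [apply: regular_onS hr|apply: regular_onS hr'] => y [].
- by move=> y [Vy Vy'] By; rewrite fB mulrBl hE // hE'.
Qed.

Definition section_pred (U : set Z) : {pred Z -> C} :=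
  fun f => `[< divisor_section g U f >].

Lemma section_zmod_closed U : zmod_closed (section_pred U).
Proof.
split=> [|f f' /asboolP sf /asboolP sf']; apply/asboolP.
  exact: divisor_section0.
exact: divisor_sectionB.
Qed.

HB.instance Definition _ U :=
  GRing.isZmodClosed.Build (Z -> C) (section_pred U) (section_zmod_closed U).

Record dsection (U : set Z) :=
  DSection { dsval :> Z -> C; dsvalP : dsval \in section_pred U }.
HB.instance Definition _ U := [isSub for @dsval U].
HB.instance Definition _ U := [Choice of dsection U by <:].
HB.instance Definition _ U := [SubChoice_isSubZmodule of dsection U by <:].

Lemma dsectionP U (s : dsection U) : divisor_section g U s.
Proof. by apply/asboolP; exact: dsvalP. Qed.

Definition restrict_fun (V : set Z) (f : Z -> C) : Z -> C :=
  fun x => if `[< V x >] then f x else 0.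

Lemma restrictP U V (f : Z -> C) : V `<=` U -> divisor_section g U f ->
  restrict_fun V f \in section_pred V.
Proof.
move=> VU [f0 fs]; apply/asboolP; split=> [x nV|W z oW WV gz x Wx].
  rewrite /restrict_fun; case: asboolP => // Vx; apply: f0 => -[_ Bx].
  exact: nV.
have [V' [h [oV' Vx' VW' hr' hE']]] := fs W z oW (subset_trans WV VU) gz x Wx.
exists V', h; split=> // y Vy By.
by rewrite /restrict_fun asboolT ?hE' //; exact/WV/VW'.
Qed.

Definition dres U V (UV : V `<=` U) (s : dsection U) : dsection V :=
  DSection (restrictP UV (dsectionP s)).

Lemma dsection_eq U (s t : dsection U) : dsval s =1 dsval t -> s = t.
Proof. by move=> st; apply: val_inj; apply/funext. Qed.

Lemma dsection_out U (s : dsection U) x : ~ U x -> s x = 0.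
Proof. by move=> Ux; have [s0 _] := dsectionP s; apply: s0 => -[]. Qed.

Lemma dres_additive U V (UV : V `<=` U) s t :
  dres UV (s + t) = dres UV s + dres UV t.
Proof.
apply: dsection_eq => x.
rewrite -[RHS]/(dres UV s x + dres UV t x) /= /restrict_fun.
by case: asboolP => _; rewrite ?addr0.
Qed.

Lemma dres_id U (UU : U `<=` U) s : dres UU s = s.
Proof.
apply: dsection_eq => x; rewrite /= /restrict_fun; case: asboolP => // Ux.
by rewrite dsection_out.
Qed.

Lemma dres_comp U V W (UV : V `<=` U) (VW : W `<=` V) (UW : W `<=` U) s :
  dres VW (dres UV s) = dres UW s.
Proof.
apply: dsection_eq => x; rewrite /= /restrict_fun; case: asboolP => // Wx.
by rewrite asboolT //; exact: VW.
Qed.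

Lemma dsection_glue (I : Type) (U : I -> set Z) (s : forall i, dsection (U i)) :
  (forall i, open (U i)) ->
  (forall i j (V : set Z) (iV : V `<=` U i) (jV : V `<=` U j), open V ->
    dres iV (s i) = dres jV (s j)) ->
  exists! t : dsection (\bigcup_i U i),
    forall i (iU : U i `<=` \bigcup_i U i), dres iU t = s i.
Proof.
move=> oU sE.
have agree i j x : U i x -> U j x -> s i x = s j x.
  move=> Uix Ujx.
  have /(congr1 (fun u => dsval u x)) :=
    sE i j _ (@subIsetl _ _ _) (@subIsetr _ _ _) (openI (oU i) (oU j)).
  by rewrite /= /restrict_fun asboolT.
pose f (x : Z) : C :=
  if pselect (exists i, U i x) is left e then s (sval (cid e)) x else 0.
have fE i x : U i x -> f x = s i x.
  move=> Uix; rewrite /f; case: pselect => [e|[]]; last by exists i.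
  by apply: agree => //; case: (cid e).
have fP : f \in section_pred (\bigcup_i U i).
  apply/asboolP; split=> [x nU|W z oW WU gz x Wx].
    rewrite /f; case: pselect => // e; case: cid => i Uix /=.
    have [s0 _] := dsectionP (s i); apply: s0 => -[_ Bx].
    by apply: nU; split=> //; exists i.
  have [i _ Uix] := WU _ Wx; have [_ ss] := dsectionP (s i).
  have [j|V [h [oV Vx VW hr hE]]] :=
      ss (W `&` U i) z (openI oW (oU i)) (@subIsetr _ _ _) _ x (conj Wx Uix).
    by apply: ideal_generatorS (gz j) => y [].
  exists V, h; split=> // [y /VW[]//|y Vy By].
  by rewrite (fE i) ?hE //; case: (VW _ Vy).
exists (DSection fP); split=> [i iU|t tE]; apply: dsection_eq => x /=.
  rewrite /restrict_fun; case: asboolP => [Ux|nUx]; first exact: fE.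
  by rewrite dsection_out.
have [[i Uix]|nU] := pselect (exists i, U i x).
  rewrite (fE i) // -(tE i (bigcup_sup _)) //= /restrict_fun asboolT //.
rewrite dsection_out => [|[i _ Uix]]; last by apply: nU; exists i.
by rewrite /f; case: pselect.
Qed.

Definition divisor_sheaf : sheaf Z :=
  @Sheaf Z (fun U => dsection U) dres
    (fun U V UV _ _ s t => dres_additive UV s t)
    (fun U UU s _ => dres_id UU s)
    (fun U V W UV VW UW s _ _ _ => dres_comp UV VW UW s)
    dsection_glue.

End DivisorSheaf.

(* The fan of the toric limit and the integers d_i, h_i^j, g_i.  The ray
   rho_i^+ is (i, true) and rho_i^- is (i, false). *)
Section Combinatorics.
Variables (R : realType) (l : nat) (A : 'M[int]_l) (r : nat).
Variable w : 'I_r -> 'I_l.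

Definition pairing (i j : 'I_r) : int := A (w i) (w j).

Definition ray : finType := ('I_r * bool)%type.

Definition ray_gen (rho : ray) : 'rV[R]_r :=
  let ep i := delta_mx 0 i in
  if rho.2 then ep rho.1
  else - ep rho.1 - \sum_(j < r | (rho.1 < j)%N) (pairing rho.1 j)%:~R *: ep j.

(* sigma is the set of rays of a cone of the fan *)
Definition fan_cone (sigma : {set ray}) : Prop :=
  forall i, ~ ((i, true) \in sigma /\ (i, false) \in sigma).

(* Cones being simplicial, v is in the relative interior of sigma if and only
   if it is a combination of its rays with positive coefficients c. *)
Definition cone_expansion (v : 'rV[R]_r) : set ({set ray} * {ffun ray -> R}) :=
  [set sc : {set ray} * {ffun ray -> R} | [/\ fan_cone sc.1, forall rho, rho \in sc.1 -> 0 < sc.2 rho,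
                forall rho, rho \notin sc.1 -> sc.2 rho = 0
              & v = \sum_(rho in sc.1) sc.2 rho *: ray_gen rho]].

(* the pair (gamma_{P_i}(1), c) *)
Definition primitive_relation (i : 'I_r) : {set ray} * {ffun ray -> R} :=
  xget (finset.set0, [ffun=> 0])
    (cone_expansion (ray_gen (i, true) + ray_gen (i, false))).

Definition d_coef (a : ray -> int) (i : 'I_r) : R :=
  let: (gam, c) := primitive_relation i in
  (a (i, true))%:~R + (a (i, false))%:~R - \sum_(rho in gam) c rho * (a rho)%:~R.

Fixpoint h_rec (m : nat) (i j : 'I_r) : int :=
  if m is m'.+1 then
    if (i < j)%N then 0 else if i == j then 1
    else - \sum_(k < r | (j <= k < i)%N) pairing k i * h_rec m' k j
  else 0.

(* h_coef i j is h_i^j *)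
Definition h_coef (i j : 'I_r) : int := h_rec i.+1 i j.

Lemma h_rec_fuel m m' (i j : 'I_r) : (i < m)%N -> (i < m')%N ->
  h_rec m i j = h_rec m' i j.
Proof.
elim: m m' i => [|m IH] [|m'] i //= im im'.
case: ifP => // _; case: ifP => // _; congr (- _).
apply: eq_bigr => k /andP[_ ki]; congr (_ * _).
by apply: IH; apply: leq_trans ki _.
Qed.

Lemma h_coef_gt (i j : 'I_r) : (i < j)%N -> h_coef i j = 0.
Proof. by rewrite /h_coef /= => ->. Qed.

Lemma h_coef_diag (i : 'I_r) : h_coef i i = 1.
Proof. by rewrite /h_coef /= ltnn eqxx. Qed.

Lemma h_coef_lt (i j : 'I_r) : (j < i)%N ->
  h_coef i j = - \sum_(k < r | (j <= k < i)%N) pairing k i * h_coef k j.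
Proof.
move=> ji; rewrite {1}/h_coef /= ltnNge ltnW //= -val_eqE /= gtn_eqF //.
congr (- _); apply: eq_bigr => k /andP[_ ki]; congr (_ * _).
exact: h_rec_fuel.
Qed.

Definition g_coef (a : ray -> int) (i : 'I_r) : int :=
  a (i, true) + \sum_(j < r | (i <= j)%N) a (j, false) * h_coef j i.

End Combinatorics.

(* Main.v *)
(* Over the chart with bits e, the divisor Z_i is the hyperplane t_i = 0 if e_i
   holds and empty otherwise, so a section of O(sum_i g_i Z_i) is a polynomial
   divided by the monomial prod_i t_i ^ g_i, taken over those i.  Principal open
   subsets of a chart are acyclic by the Nullstellensatz.  Consider the open set
   where the first k factors lie in given cells: it is the union of two such sets
   for k + 1, which meet in t_k <> 0, so by Mayer-Vietoris and descending
   induction on k it is acyclic if every section over the intersection is a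
   difference of sections over the two pieces.  Split a section into its part
   with nonnegative and its part with negative powers of t_k.  The first extends
   to one piece.  For the second, Hartogs reduces the extension to the other
   piece, along t_k = oo, to a single chart.  There x(a) s = y(1/a) x(-a)
   alpha^vee(-a), and the cocharacter is moved past the factors i > k; choosing
   the cell of each of them according to the sign of the weight n_i that occurs
   makes all coordinates rescale by nonnegative powers of a, and the section
   extends if g_k - sum |n_i| g_i >= 0, the sum being over the i > k with
   n_i <= 0.  The same choices compute the primitive relation of
   e_k^+ + e_k^-, and the number is d_k.
   The facts needed about the group, such as y_i(b) x_gamma(c) y_i(-b) lying in
   B for positive real roots gamma <> alpha_i, are verified in the integrable
   modules, on which the group acts faithfully.  If
   some e_i acts by zero on all of them, then P_i = B and the sheaf is zero. *)
From HB Require Import structures.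
Require Import Defs.
From mathcomp Require Import all_boot all_order all_algebra.
From mathcomp Require Import all_classical all_reals.
From mathcomp Require Import topology_structure.
From mathcomp.real_closed Require Import complex.
From mathcomp.multinomials Require Import -(notations) mpoly.
From mathcomp Require Import ring lra zify.

Set Implicit Arguments.
Unset Strict Implicit.
Unset Printing Implicit Defensive.
Import Order.TTheory GRing.Theory Num.Theory.
Local Open Scope classical_set_scope.
Local Open Scope ring_scope.

(** * Exponentials of locally nilpotent operators *)

(** The group carries no variety structure; it is known only through its action on integrable
    modules. Two consequences shape the proof. A relation between group elements has to be checked
    in all modules at once, and a scalar found in one module must serve in all; so [fam] adds to a
    module one fixed witness for each e_j that is nonzero somewhere. And transition functions
    between charts are regular because they are ratios of matrix coefficients: modulo a B-stable
    span of higher weights, B acts on a weight vector v0 and on e_i v0 by triangular matrices, hence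
    on the coordinate of P_i / B by affine maps with regular coefficients.

    The algebra may act through a proper quotient, so only roots that occur there are considered.
    For a positive real root gamma <> alpha_i, one of gamma and s_i gamma pairs nonpositively with
    alpha_i both ways; for it, conjugation by y_i(b) adds at most a term of the root gamma -
    alpha_i, which is then real.

    The number d_k does not change under addition of a principal toric divisor; a suitable one
    leaves the coefficients g_i on rho_i^+ and 0 on rho_i^-, which gives g_k - sum |n_i| g_i. *)

Section Operators.
Variables (R : realType) (l : nat) (A : 'M[int]_l) (D : realization A).
Local Notation C := R[i].
Variables (I : Type) (Ms : I -> integrable_module R D).

(** A family of linear operators, one on each module [Ms M]. With sum, composition and scaling they
    form a ring and a C-module, so that an identity valid in all the modules of the family is a
    single equation. *)
Record op := Op {
  opf :> forall M : I, Ms M -> Ms M;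
  op_linear : forall M, linear (@opf M) }.

HB.instance Definition _ (X : op) (M : I) :=
  GRing.isLinear.Build C (Ms M) (Ms M) _ (opf X (M:=M)) (@op_linear X M).

Lemma opP (X Y : op) : (forall M v, X M v = Y M v) -> X = Y.
Proof.
case: X Y => [f hf] [g hg] /= fg.
have E : f = g by apply: functional_extensionality_dep => M; apply/funext => v; exact: fg.
by case: _ / E hg => hg; congr Op; exact: Prop_irrelevance.
Qed.

HB.instance Definition _ := gen_eqMixin op.
HB.instance Definition _ := gen_choiceMixin op.

Definition op0 : op.
Proof. by exists (fun M _ => 0) => M a u v; rewrite scaler0 addr0. Defined.
Definition op1 : op.
Proof. by exists (fun M v => v) => M a u v. Defined.
Definition opD (X Y : op) : op.
Proof.
exists (fun M v => X M v + Y M v) => M a u v.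
by rewrite !linearP scalerDr addrACA.
Defined.
Definition opN (X : op) : op.
Proof.
by exists (fun M v => - X M v) => M a u v; rewrite linearP opprD scalerN.
Defined.
Definition opZ (c : C) (X : op) : op.
Proof.
exists (fun M v => c *: X M v) => M a u v.
by rewrite linearP scalerDr !scalerA mulrC.
Defined.
Definition opM (X Y : op) : op.
Proof. by exists (fun M v => X M (Y M v)) => M a u v; rewrite !linearP. Defined.

Let opDA : associative opD.
Proof. by move=> X Y Z; apply: opP => M v /=; rewrite addrA. Qed.
Let opDC : commutative opD.
Proof. by move=> X Y; apply: opP => M v /=; rewrite addrC. Qed.
Let op0D : left_id op0 opD.
Proof. by move=> X; apply: opP => M v /=; rewrite add0r. Qed.
Let opND : left_inverse op0 opN opD.
Proof. by move=> X; apply: opP => M v /=; rewrite addNr. Qed.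
HB.instance Definition _ := GRing.isZmodule.Build op opDA opDC op0D opND.

Let opMA : associative opM.
Proof. by move=> X Y Z; apply: opP. Qed.
Let op1M : left_id op1 opM. Proof. by move=> X; apply: opP. Qed.
Let opM1 : right_id op1 opM. Proof. by move=> X; apply: opP. Qed.
Let opMDl : left_distributive opM +%R. Proof. by move=> X Y Z; apply: opP. Qed.
Let opMDr : right_distributive opM +%R.
Proof. by move=> X Y Z; apply: opP => M v /=; rewrite linearD. Qed.
HB.instance Definition _ :=
  GRing.Zmodule_isPzRing.Build op opMA op1M opM1 opMDl opMDr.

Let opZA a b (X : op) : opZ a (opZ b X) = opZ (a * b) X.
Proof. by apply: opP => M v /=; rewrite scalerA. Qed.
Let op1Z : left_id 1 opZ. Proof. by move=> X; apply: opP => M v /=; rewrite scale1r. Qed.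
Let opZDr : right_distributive opZ +%R.
Proof. by move=> a X Y; apply: opP => M v /=; rewrite scalerDr. Qed.
Let opZDl X : {morph opZ^~ X : a b / a + b}.
Proof. by move=> a b; apply: opP => M v /=; rewrite scalerDl. Qed.
HB.instance Definition _ := GRing.Zmodule_isLmodule.Build C op opZA op1Z opZDr opZDl.

Lemma opDE (X Y : op) M v : (X + Y) M v = X M v + Y M v. Proof. by []. Qed.
Lemma opNE (X : op) M v : (- X) M v = - X M v. Proof. by []. Qed.
Lemma opME (X Y : op) M v : (X * Y) M v = X M (Y M v). Proof. by []. Qed.
Lemma opZE c (X : op) M v : (c *: X) M v = c *: X M v. Proof. by []. Qed.
Lemma op0E M v : (0 : op) M v = 0. Proof. by []. Qed.
Lemma op1E M v : (1 : op) M v = v. Proof. by []. Qed.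
Lemma op_sumE J (s : seq J) P (F : J -> op) M v :
  (\sum_(i <- s | P i) F i) M v = \sum_(i <- s | P i) F i M v.
Proof. by elim/big_rec2: _ => // i x y _ <-. Qed.
Lemma opXE (X : op) n M v : (X ^+ n) M v = iter n (X M) v.
Proof. by elim: n => [|n IH] //; rewrite exprS opME IH. Qed.

Lemma opZMl c (X Y : op) : c *: X * Y = c *: (X * Y). Proof. exact: opP. Qed.
Lemma opZMr c (X Y : op) : X * (c *: Y) = c *: (X * Y).
Proof. by apply: opP => M v; rewrite opME !opZE linearZ. Qed.
Lemma opZX c (X : op) n : (c *: X) ^+ n = c ^+ n *: X ^+ n.
Proof.
elim: n => [|n IH]; first by rewrite !expr0 scale1r.
by rewrite !exprS IH opZMl opZMr scalerA.
Qed.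

Definition locnil (X : op) := forall M v, exists m, (X ^+ m) M v = 0.

Lemma nil_le (X : op) m n M v : (m <= n)%N -> (X ^+ m) M v = 0 -> (X ^+ n) M v = 0.
Proof. by move=> /subnK <- h; rewrite exprD opME h linear0. Qed.

Lemma locnilZ c X : locnil X -> locnil (c *: X).
Proof.
move=> h M v; have [m hm] := h M v; exists m.
by rewrite opZX opZE hm scaler0.
Qed.

(* U = exp X; each vector is killed by some power of X. *)
Definition is_exp (X U : op) := forall M v m, (X ^+ m) M v = 0 ->
  U M v = \sum_(0 <= k < m) (k`!%:R^-1 : C) *: (X ^+ k) M v.

Lemma is_exp_uniq X U U' : locnil X -> is_exp X U -> is_exp X U' -> U = U'.
Proof.
move=> nX eU eU'; apply: opP => M v; have [m hm] := nX M v.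
by rewrite (eU _ _ _ hm) (eU' _ _ _ hm).
Qed.

Lemma is_exp0 : is_exp 0 1.
Proof.
move=> M v [|m]; first by rewrite expr0 op1E => ->; rewrite big_geq.
move=> _; rewrite big_nat_recl // big1 => [|k _]; last by rewrite exprS mul0r op0E scaler0.
by rewrite expr0 op1E fact0 invr1 scale1r addr0.
Qed.

Lemma is_exp_conj X U g g' : g * g' = 1 -> g' * g = 1 ->
  is_exp X U -> is_exp (g * X * g') (g * U * g').
Proof.
move=> gg' g'g eU M v m.
have cX k : (g * X * g') ^+ k = g * X ^+ k * g'.
  elim: k => [|k IH]; first by rewrite !expr0 mulr1 gg'.
  by rewrite !exprS IH -!mulrA (mulrA g' g) g'g mul1r.
rewrite cX !opME => h.
have {h} h : (X ^+ m) M (g' M v) = 0.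
  by rewrite -[LHS](@op1E M) -g'g opME h linear0.
rewrite (eU _ _ _ h) linear_sum; apply: eq_bigr => k _.
by rewrite cX !opME linearZ.
Qed.

Lemma locnil_conj X g g' : g' * g = 1 -> g * g' = 1 -> locnil X -> locnil (g * X * g').
Proof.
move=> g'g gg' nX M v; have [m hm] := nX M (g' M v); exists m.
have cX k : (g * X * g') ^+ k = g * X ^+ k * g'.
  elim: k => [|k IH]; first by rewrite !expr0 mulr1 gg'.
  by rewrite !exprS IH -!mulrA (mulrA g' g) g'g mul1r.
by rewrite cX !opME hm linear0.
Qed.

Lemma opMnE (X : op) n M v : (X *+ n) M v = (n%:R : C) *: X M v.
Proof. by rewrite -opZE scaler_nat. Qed.

Lemma is_exp_comm X Y U V : X * Y = Y * X -> locnil X -> locnil Y ->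
  is_exp X U -> is_exp Y V -> is_exp (X + Y) (U * V).
Proof.
move=> XY nX nY eU eV M v m hm.
have cXY : GRing.comm X Y by [].
have [p hp] := nX M v; have [q hq] := nY M v.
pose N := (p + q + m)%N.
have zX a b : (N <= a)%N -> (X ^+ a * Y ^+ b) M v = 0.
  move=> h; have -> : X ^+ a * Y ^+ b = Y ^+ b * X ^+ a.
    by apply: commrX; apply: commr_sym; apply: commrX; apply: commr_sym.
  by rewrite opME (@nil_le X p) ?linear0 // (leq_trans _ h) // /N -addnA leq_addr.
have zY a b : (N <= b)%N -> (X ^+ a * Y ^+ b) M v = 0.
  move=> h; rewrite opME (@nil_le Y q) ?linear0 // (leq_trans _ h) // /N; lia.
have -> : \sum_(0 <= k < m) (k`!%:R^-1 : C) *: ((X + Y) ^+ k) M v =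
    \sum_(0 <= k < N + N) (k`!%:R^-1 : C) *: ((X + Y) ^+ k) M v.
  rewrite [RHS](@big_cat_nat _ _ _ m) //=; last by rewrite /N; lia.
  rewrite [X in _ = _ + X]big1_seq ?addr0 // => k /andP[_].
  by rewrite mem_index_iota => /andP[mk _]; rewrite (nil_le mk) ?scaler0.
have hN : (Y ^+ N) M v = 0 by have := zY 0%N N (leqnn _); rewrite expr0 mul1r.
rewrite opME (eV _ _ _ hN) linear_sum /=.
pose T a b := (a`!%:R^-1 * b`!%:R^-1 : C) *: (X ^+ a * Y ^+ b) M v.
have TX a b : (N <= a)%N -> T a b = 0 by move=> h; rewrite /T zX // scaler0.
have TY a b : (N <= b)%N -> T a b = 0 by move=> h; rewrite /T zY // scaler0.
(* Both sides are sums of T: the left one over the square a, b < N, the right one over the triangle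
   a + b < 2N. Where these differ, a >= N or b >= N, and T vanishes. *)
transitivity (\sum_(0 <= b < N) \sum_(0 <= a < N) T a b).
  apply: eq_bigr => b _; rewrite linearZ /= (eU _ _ N); last by rewrite -opME zX.
  rewrite scaler_sumr; apply: eq_bigr => a _.
  by rewrite scalerA mulrC.
transitivity (\sum_(0 <= k < N + N) \sum_(0 <= b < k.+1) T (k - b)%N b); last first.
  apply: eq_bigr => k _; rewrite exprDn_comm // op_sumE scaler_sumr big_mkord.
  apply: eq_bigr => b _; rewrite /T opMnE scalerA; congr (_ *: _).
  have bk : (b <= k)%N by rewrite -ltnS.
  rewrite -(bin_fact bk) !natrM.
  have f0 i : i`!%:R != 0 :> C by rewrite pnatr_eq0 -lt0n fact_gt0.
  have c0 : 'C(k, b)%:R != 0 :> C by rewrite pnatr_eq0 -lt0n bin_gt0.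
  by field; rewrite !f0 c0.
transitivity (\sum_(0 <= k < N + N) \sum_(0 <= b < N + N | (b <= k)%N) T (k - b)%N b);
    last first.
  apply: eq_big_nat => k /andP[_ kN]; rewrite (@big_nat_widen _ _ _ _ k.+1 (N + N)) //.
transitivity (\sum_(0 <= b < N + N) \sum_(0 <= k < N + N | (b <= k)%N) T (k - b)%N b);
    last first.
  under eq_bigr do rewrite big_mkcond.
  rewrite exchange_big_nat; apply: eq_bigr => b _; by rewrite -big_mkcond.
rewrite [RHS](@big_cat_nat _ _ _ N) //=; last by rewrite leq_addr.
rewrite [X in _ = _ + X]big1_seq ?addr0; last first.
  move=> b /andP[_]; rewrite mem_index_iota => /andP[h _]; rewrite big1 // => a _.
  by rewrite TY.
apply: eq_big_nat => b /andP[_ bN].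
rewrite -(@big_nat_widenl _ _ _ b 0 (N + N) xpredT) //.
have -> : \sum_(b <= k < N + N) T (k - b)%N b = \sum_(0 <= k < N + N - b) T k b.
  by rewrite -{1}[b]add0n big_addn; apply: eq_bigr => k _; rewrite addnK.
rewrite [RHS](@big_cat_nat _ _ _ N) //=; last by lia.
rewrite [X in _ = _ + X]big1_seq ?addr0 //.
by move=> a /andP[_]; rewrite mem_index_iota => /andP[h _]; rewrite TX.
Qed.

Lemma locnilD X Y : X * Y = Y * X -> locnil X -> locnil Y -> locnil (X + Y).
Proof.
move=> XY nX nY M v; have [p hp] := nX M v; have [q hq] := nY M v.
exists (p + q)%N; rewrite exprDn_comm // op_sumE big1 // => i _.
rewrite opMnE opME; have [h|h] := leqP q i.
  by rewrite (nil_le h hq) linear0 scaler0.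
rewrite -opME.
have -> : X ^+ (p + q - i) * Y ^+ i = Y ^+ i * X ^+ (p + q - i).
  by apply: commrX; apply: commr_sym; apply: commrX; apply: commr_sym.
by rewrite opME (@nil_le X p) ?linear0 ?scaler0 //; lia.
Qed.

Definition ad (X Y : op) : op := X * Y - Y * X.

Lemma adD X Y Z : ad X (Y + Z) = ad X Y + ad X Z.
Proof. by rewrite /ad mulrDr mulrDl opprD addrACA. Qed.
Lemma adDl X Y Z : ad (X + Y) Z = ad X Z + ad Y Z.
Proof. by rewrite /ad mulrDr mulrDl opprD addrACA. Qed.
Lemma adN X Y : ad X (- Y) = - ad X Y.
Proof. by rewrite /ad mulrN mulNr opprB opprK addrC. Qed.
Lemma adZ c X Y : ad X (c *: Y) = c *: ad X Y.
Proof. by rewrite /ad opZMl opZMr scalerBr. Qed.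
Lemma adZl c X Y : ad (c *: X) Y = c *: ad X Y.
Proof. by rewrite /ad opZMl opZMr scalerBr. Qed.
Lemma ad0 X : ad X 0 = 0. Proof. by rewrite /ad mulr0 mul0r subr0. Qed.
Lemma ad0l X : ad 0 X = 0. Proof. by rewrite /ad mulr0 mul0r subr0. Qed.
Lemma adXX X : ad X X = 0. Proof. by rewrite /ad subrr. Qed.
Lemma adC X Y : ad Y X = - ad X Y. Proof. by rewrite /ad opprB. Qed.
Lemma ad_sum X J (s : seq J) P F : ad X (\sum_(i <- s | P i) F i) =
  \sum_(i <- s | P i) ad X (F i).
Proof. by elim/big_rec2: _ => [|i y z _ <-]; rewrite ?ad0 ?adD. Qed.

Lemma jacobi X Y Z : ad X (ad Y Z) = ad (ad X Y) Z + ad Y (ad X Z).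
Proof.
rewrite /ad !mulrBr !mulrBl !mulrA !opprB [RHS]addrACA !subrKA.
by rewrite [LHS]addrACA [RHS]addrACA (addrC (- (X * Z * Y))).
Qed.

Lemma ad_conj g g' X Y : g' * g = 1 ->
  ad (g * X * g') (g * Y * g') = g * ad X Y * g'.
Proof.
move=> g'g; rewrite /ad mulrBr mulrBl.
by congr (_ - _); rewrite !mulrA -(mulrA _ g' g) g'g mulr1.
Qed.

Lemma ad_iterE X n Y : X ^+ n * Y =
  \sum_(0 <= k < n.+1) iter k (ad X) Y * X ^+ (n - k) *+ 'C(n, k).
Proof.
elim: n => [|n IH]; first by rewrite big_nat1 !expr0 mul1r bin0 mulr1.
rewrite exprS -mulrA IH mulr_sumr.
have E k : X * iter k (ad X) Y = iter k.+1 (ad X) Y + iter k (ad X) Y * X.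
  by rewrite /= /ad subrK.
under eq_big_nat => k /andP[_ kn].
  rewrite mulrnAr mulrA E mulrDl mulrnDl -mulrA -exprS -subSn //.
  over.
rewrite big_split /= [in RHS]big_nat_recl // [in X in _ + X = _]big_nat_recl //.
rewrite [in X in X + _ = _]big_nat_recr //= !bin0 !binn addrCA; congr (_ + _).
rewrite [in RHS]big_nat_recr //= !subnn binn addrC addrA; congr (_ + _).
rewrite -big_split /=; apply: eq_bigr => k _.
by rewrite binS mulrnDr addrC.
Qed.

(* exp X Y exp (-X) = exp (ad X) Y, with the inverse cleared. *)
Lemma exp_ad X U Y K : locnil X -> is_exp X U -> iter K (ad X) Y = 0 ->
  U * Y = (\sum_(0 <= k < K) (k`!%:R^-1 : C) *: iter k (ad X) Y) * U.
Proof.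
move=> nX eU hK; apply: opP => M v.
have zK k : (K <= k)%N -> iter k (ad X) Y = 0.
  by move=> /subnK <-; rewrite iterD hK; elim: (k - K)%N => //= m ->; rewrite ad0.
have [p hp] := nX M v; have [q hq] := nX M (Y M v).
pose N := (p + q + K)%N.
have hvN a : (N <= a)%N -> (X ^+ a) M v = 0.
  by move=> h; apply: nil_le hp; rewrite /N in h; lia.
have hYN a : (N <= a)%N -> (X ^+ a) M (Y M v) = 0.
  by move=> h; apply: nil_le hq; rewrite /N in h; lia.
pose T a b := (a`!%:R^-1 * b`!%:R^-1 : C) *: (iter a (ad X) Y * X ^+ b) M v.
have TX a b : (N <= a)%N -> T a b = 0.
  by move=> h; rewrite /T zK ?mul0r ?scaler0 //; rewrite /N in h; lia.
have TY a b : (N <= b)%N -> T a b = 0.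
  by move=> h; rewrite /T opME hvN // linear0 scaler0.
rewrite !opME (eU _ _ (N + N)) ?hYN ?leq_addr // (eU _ _ N) ?hvN //.
have -> : \sum_(0 <= k < K) (k`!%:R^-1 : C) *: iter k (ad X) Y =
          \sum_(0 <= k < N) (k`!%:R^-1 : C) *: iter k (ad X) Y.
  rewrite [RHS](@big_cat_nat _ _ _ K) //=; last by rewrite /N; lia.
  rewrite [X in _ = _ + X]big1_seq ?addr0 // => k /andP[_].
  by rewrite mem_index_iota => /andP[h _]; rewrite zK ?scaler0.
rewrite linear_sum /=; symmetry.
transitivity (\sum_(0 <= b < N) \sum_(0 <= a < N) T a b).
  apply: eq_bigr => b _; rewrite linearZ /= op_sumE scaler_sumr.
  by apply: eq_bigr => a _; rewrite opZE scalerA mulrC.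
transitivity (\sum_(0 <= k < N + N) \sum_(0 <= a < k.+1) T a (k - a)%N); last first.
  apply: eq_bigr => k _; rewrite -opME ad_iterE op_sumE scaler_sumr.
  apply: eq_big_nat => a /andP[_ bk]; rewrite /T opMnE scalerA; congr (_ *: _).
  rewrite ltnS in bk; rewrite -(bin_fact bk) !natrM.
  have f0 i : i`!%:R != 0 :> C by rewrite pnatr_eq0 -lt0n fact_gt0.
  have c0 : 'C(k, a)%:R != 0 :> C by rewrite pnatr_eq0 -lt0n bin_gt0.
  by field; rewrite !f0 c0.
transitivity (\sum_(0 <= k < N + N) \sum_(0 <= a < N + N | (a <= k)%N) T a (k - a)%N);
    last first.
  apply: eq_big_nat => k /andP[_ kN]; rewrite (@big_nat_widen _ _ _ _ k.+1 (N + N)) //.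
transitivity (\sum_(0 <= a < N + N) \sum_(0 <= k < N + N | (a <= k)%N) T a (k - a)%N);
    last first.
  under eq_bigr do rewrite big_mkcond.
  rewrite exchange_big_nat; apply: eq_bigr => b _; by rewrite -big_mkcond.
rewrite exchange_big_nat.
rewrite [RHS](@big_cat_nat _ _ _ N) //=; last by rewrite leq_addr.
rewrite [X in _ = _ + X]big1_seq ?addr0; last first.
  move=> b /andP[_]; rewrite mem_index_iota => /andP[h _]; rewrite big1 // => a _.
  by rewrite TX.
apply: eq_big_nat => b /andP[_ bN].
rewrite -(@big_nat_widenl _ _ _ b 0 (N + N) xpredT) //.
have -> : \sum_(b <= k < N + N) T b (k - b)%N = \sum_(0 <= k < N + N - b) T b k.
  by rewrite -{1}[b]add0n big_addn; apply: eq_bigr => k _; rewrite addnK.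
rewrite [RHS](@big_cat_nat _ _ _ N) //=; last by lia.
rewrite [X in _ = _ + X]big1_seq ?addr0 //.
by move=> a /andP[_]; rewrite mem_index_iota => /andP[h _]; rewrite TY.
Qed.

End Operators.

(** * Chevalley generators, weights, and conjugation by group elements *)

Section Weights.
Variables (R : realType) (l : nat) (A : 'M[int]_l) (D : realization A).
Variable G : kac_moody_group R D.
Local Notation C := R[i].
Local Notation n := (rlz_dim D).
Variables (I : Type) (Ms : I -> integrable_module R D).
Local Notation op := (op Ms).

Definition rho (g : G) : op.
Proof. by exists (fun k => km_rep (Ms k) g) => k a u v; rewrite linearP. Defined.
Definition oE (i : 'I_l) : op.
Proof. by exists (fun k => @im_e _ _ _ _ (Ms k) i) => k a u v; rewrite linearP. Defined.
Definition oF (i : 'I_l) : op.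
Proof. by exists (fun k => @im_f _ _ _ _ (Ms k) i) => k a u v; rewrite linearP. Defined.
Definition oH (i : 'I_n) : op.
Proof. by exists (fun k => @im_h _ _ _ _ (Ms k) i) => k a u v; rewrite linearP. Defined.

Lemma rho1 : rho 1%g = 1. Proof. by apply: opP => k v; exact: km_rep1. Qed.
Lemma rhoM g h : rho (g * h)%g = rho g * rho h.
Proof. by apply: opP => k v; exact: km_repM. Qed.
Lemma rhoV g : rho g * rho (g^-1)%g = 1. Proof. by rewrite -rhoM mulgV rho1. Qed.
Lemma rhoVl g : rho (g^-1)%g * rho g = 1. Proof. by rewrite -rhoM mulVg rho1. Qed.

Definition cj (g : G) (X : op) : op := rho g * X * rho (g^-1)%g.

Lemma cjM g h X : cj (g * h)%g X = cj g (cj h X).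
Proof. by rewrite /cj invgM !rhoM !mulrA. Qed.
Lemma cj1 X : cj 1%g X = X. Proof. by rewrite /cj invg1 rho1 mul1r mulr1. Qed.
Lemma cjK g X : cj (g^-1)%g (cj g X) = X. Proof. by rewrite -cjM mulVg cj1. Qed.
Lemma cjVK g X : cj g (cj (g^-1)%g X) = X. Proof. by rewrite -cjM mulgV cj1. Qed.
Lemma cjD g X Y : cj g (X + Y) = cj g X + cj g Y.
Proof. by rewrite /cj mulrDr mulrDl. Qed.
Lemma cjN g X : cj g (- X) = - cj g X.
Proof. by rewrite /cj mulrN mulNr. Qed.
Lemma cjZ g c X : cj g (c *: X) = c *: cj g X.
Proof. by rewrite /cj opZMr opZMl. Qed.
Lemma cj0 g : cj g 0 = 0. Proof. by rewrite /cj mulr0 mul0r. Qed.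
Lemma cj_sum g J (s : seq J) P (f : J -> op) :
  cj g (\sum_(i <- s | P i) f i) = \sum_(i <- s | P i) cj g (f i).
Proof. by elim/big_rec2: _ => [|i y z _ <-]; rewrite ?cj0 ?cjD. Qed.
Lemma cj_ad g X Y : cj g (ad X Y) = ad (cj g X) (cj g Y).
Proof. by rewrite /cj ad_conj // rhoVl. Qed.
Lemma cj_exp g h X : is_exp X (rho h) -> is_exp (cj g X) (rho (g * h * g^-1)%g).
Proof. by move=> e; rewrite !rhoM; apply: is_exp_conj; rewrite ?rhoV ?rhoVl. Qed.
Lemma cj_locnil g X : locnil X -> locnil (cj g X).
Proof. by apply: locnil_conj; rewrite ?rhoV ?rhoVl. Qed.
Lemma cj_eq0 g X : cj g X = 0 -> X = 0.
Proof. by move=> h; rewrite -(cjK g X) h cj0. Qed.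

Lemma oE_nil i : locnil (oE i).
Proof. by move=> k v; have [m hm] := @im_e_nilp _ _ _ _ (Ms k) i v; exists m; rewrite opXE. Qed.
Lemma oF_nil i : locnil (oF i).
Proof. by move=> k v; have [m hm] := @im_f_nilp _ _ _ _ (Ms k) i v; exists m; rewrite opXE. Qed.

Lemma exp_of_acts a (X : op) g : (forall k, acts_as_exp (X k) a (km_rep (Ms k) g)) ->
  locnil X -> is_exp (a *: X) (rho g).
Proof.
(* For a = 0 the condition (a X)^m v = 0 says nothing about X^m v; the exponent is then taken from
   the local nilpotency of X. *)
move=> h nX k v m; move: h; have [->|a0] := eqVneq a 0 => h; last first.
  rewrite opZX opZE => /eqP; rewrite scaler_eq0 expf_eq0 (negPf a0) andbF /= => /eqP hm.
  rewrite [LHS](h k m) -?opXE //; apply: eq_bigr => j _.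
  by rewrite opZX opZE scalerA -opXE; congr (_ *: _); rewrite mulrC.
rewrite scale0r => hm; rewrite -(is_exp0 hm) op1E.
have [p hp] := nX k v; rewrite [LHS](h k p) -?opXE //.
case: p hp => [|p] hp; first by rewrite big_geq // -[LHS]hp.
rewrite big_nat_recl // big1 => [|j _]; last by rewrite exprS !mul0r scale0r.
by rewrite expr0 fact0 invr1 mulr1 scale1r addr0.
Qed.

Lemma exp_x i a : is_exp (a *: oE i) (rho (km_x G i a)).
Proof. by apply: exp_of_acts => // [k|]; [exact: km_rep_x|exact: oE_nil]. Qed.
Lemma exp_y i a : is_exp (a *: oF i) (rho (km_y G i a)).
Proof. by apply: exp_of_acts => // [k|]; [exact: km_rep_y|exact: oF_nil]. Qed.

Arguments exp_x : clear implicits.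
Arguments exp_y : clear implicits.
Lemma cj_expE (X : op) g Y K : locnil X -> is_exp X (rho g) -> iter K (ad X) Y = 0 ->
  cj g Y = \sum_(0 <= k < K) (k`!%:R^-1 : C) *: iter k (ad X) Y.
Proof. by move=> nX eX hK; rewrite /cj (exp_ad nX eX hK) -mulrA rhoV mulr1. Qed.

(** The pairing of x, an element of the root lattice in the basis of simple roots, with the coroot
    alpha_i^vee. *)
Definition pr (x : 'rV[int]_l) (i : 'I_l) : int := \sum_j x 0 j * A i j.
Definition al (i : 'I_l) : 'rV[int]_l := delta_mx 0 i.

Lemma prD x y i : pr (x + y) i = pr x i + pr y i.
Proof. by rewrite /pr -big_split; apply: eq_bigr => j _; rewrite mxE mulrDl. Qed.
Lemma prZ c x i : pr (c *: x) i = c * pr x i.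
Proof. by rewrite /pr mulr_sumr; apply: eq_bigr => j _; rewrite mxE mulrA. Qed.
Lemma prN x i : pr (- x) i = - pr x i.
Proof. by rewrite -scaleN1r prZ mulN1r. Qed.
Lemma prB x y i : pr (x - y) i = pr x i - pr y i. Proof. by rewrite prD prN. Qed.
Lemma pr_al i j : pr (al j) i = A i j.
Proof.
rewrite /pr (bigD1 j) //= big1 => [|k kj]; rewrite !mxE ?eqxx ?mul1r ?addr0 //.
by rewrite (negPf kj) mul0r.
Qed.

Lemma simple_reflE i x : simple_refl A i x = x - pr x i *: al i. Proof. by []. Qed.

Definition hal i : op := \sum_k (rlz_coroot D i k)%:~R *: oH k.

Lemma HE k i : ad (oH k) (oE i) = (rlz_root D i k)%:~R *: oE i.
Proof. by apply: opP => m v; exact: im_he. Qed.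
Lemma HF k i : ad (oH k) (oF i) = - (rlz_root D i k)%:~R *: oF i.
Proof. by apply: opP => m v; rewrite scaleNr; exact: im_hf. Qed.
Lemma HH k k' : ad (oH k) (oH k') = 0.
Proof. by apply: opP => m v; exact: im_hh. Qed.
Lemma EF i j : ad (oE i) (oF j) = if i == j then hal i else 0.
Proof.
apply: opP => m v; rewrite [LHS]im_ef; case: ifP => // _.
by rewrite op_sumE; apply: eq_bigr => k _.
Qed.
Lemma ad_iter (X : op) (Y : op) m k v :
  iter m (ad_op (X k)) (Y k) v = iter m (ad X) Y k v.
Proof.
elim: m v => [//|m IH] v; rewrite !iterS /ad_op {2}/ad opDE opNE !opME !IH.
by congr (X k _ - _).
Qed.
Lemma serre_e i j : i != j -> iter (absz (1 - A i j)) (ad (oE i)) (oE j) = 0.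
Proof. by move=> ij; apply: opP => k v; rewrite -ad_iter; exact: im_serre_e. Qed.
Lemma serre_f i j : i != j -> iter (absz (1 - A i j)) (ad (oF i)) (oF j) = 0.
Proof. by move=> ij; apply: opP => k v; rewrite -ad_iter; exact: im_serre_f. Qed.

Definition rwt (b : 'rV[int]_l) : 'rV[int]_n := b *m rlz_root D.
Definition has_wt (lam : 'rV[int]_n) (X : op) :=
  forall k, ad (oH k) X = (lam 0 k)%:~R *: X.

Lemma rwtD b c : rwt (b + c) = rwt b + rwt c. Proof. exact: mulmxDl. Qed.
Lemma rwtN b : rwt (- b) = - rwt b. Proof. exact: mulNmx. Qed.
Lemma rwtZ z b : rwt (z *: b) = z *: rwt b. Proof. by rewrite /rwt -scalemxAl. Qed.
Lemma rwt_al i : rwt (al i) = row i (rlz_root D). Proof. by rewrite rowE. Qed.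
Lemma rwt_inj : injective rwt.
Proof.
move=> b c h; apply/eqP; rewrite -subr_eq0; apply/eqP.
have {h} : rwt (b - c) = 0 by rewrite rwtD rwtN h subrr.
move: (b - c) => {b c} b h.
have : map_mx intr b *m (map_mx intr (rlz_root D) : 'M[rat]_(_, _)) = 0.
  by rewrite -map_mxM -/(rwt b) h map_mx0.
move/eqP; rewrite mulmx_free_eq0 ?rlz_root_free // => /eqP hb.
apply/rowP => j; have /rowP/(_ j) := hb; rewrite !mxE => /eqP.
by rewrite intr_eq0 => /eqP.
Qed.

Lemma pr_rwt b i : pr b i = \sum_k rlz_coroot D i k * rwt b 0 k.
Proof.
have E j : A i j = \sum_k rlz_coroot D i k * rlz_root D j k.
  have /matrixP/(_ i j) := rlz_pairing D; rewrite mxE => <-.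
  by apply: eq_bigr => k _; rewrite mxE.
rewrite /pr; under eq_bigr do rewrite E mulr_sumr.
rewrite exchange_big; apply: eq_bigr => k _ /=; rewrite mxE mulr_sumr.
by apply: eq_bigr => j _; ring.
Qed.

Lemma hal_wt b X i : has_wt (rwt b) X -> ad (hal i) X = (pr b i)%:~R *: X.
Proof.
move=> h; rewrite adC /hal ad_sum pr_rwt rmorph_sum scaler_suml -sumrN.
apply: eq_bigr => k _; rewrite adZ adC h scalerN opprK scalerA.
by rewrite -rmorphM.
Qed.

Lemma has_wt_ad b c X Y : has_wt b X -> has_wt c Y -> has_wt (b + c) (ad X Y).
Proof.
move=> hX hY k; rewrite jacobi hX hY adZl adZ -scalerDl; congr (_ *: _).
by rewrite mxE rmorphD.
Qed.
Lemma has_wt0 b : has_wt b 0. Proof. by move=> k; rewrite ad0 scaler0. Qed.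
Lemma has_wtD b X Y : has_wt b X -> has_wt b Y -> has_wt b (X + Y).
Proof. by move=> hX hY k; rewrite adD hX hY scalerDr. Qed.
Lemma has_wtZ b c X : has_wt b X -> has_wt b (c *: X).
Proof. by move=> hX k; rewrite adZ hX !scalerA mulrC. Qed.
Lemma wt_E i : has_wt (rwt (al i)) (oE i).
Proof. by move=> k; rewrite rwt_al mxE HE. Qed.
Lemma wt_F i : has_wt (rwt (- al i)) (oF i).
Proof. by move=> k; rewrite rwtN rwt_al !mxE HF rmorphN. Qed.
Lemma wt_H k : has_wt (rwt 0) (oH k).
Proof. by move=> k'; rewrite HH /rwt mul0mx mxE scale0r. Qed.

Hypothesis hA : is_gcm A.

Lemma gcm2 i : A i i = 2. Proof. by have [h _ _] := hA. Qed.
Lemma halE i j : ad (hal i) (oE j) = (A i j)%:~R *: oE j.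
Proof. by rewrite (hal_wt _ (wt_E j)) pr_al. Qed.
Lemma halF i j : ad (hal i) (oF j) = - (A i j)%:~R *: oF j.
Proof. by rewrite (hal_wt _ (wt_F j)) prN pr_al rmorphN. Qed.

Lemma cj_lin2 (X : op) g Y : locnil X -> is_exp X (rho g) -> ad X (ad X Y) = 0 ->
  cj g Y = Y + ad X Y.
Proof.
move=> nX eX h; rewrite (cj_expE (K := 2) nX eX) //.
by rewrite big_nat_recl // big_nat1 fact0 (_ : 1`! = 1%N) // invr1 !scale1r.
Qed.
Lemma cj_lin3 (X : op) g Y : locnil X -> is_exp X (rho g) -> ad X (ad X (ad X Y)) = 0 ->
  cj g Y = Y + ad X Y + 2^-1 *: ad X (ad X Y).
Proof.
move=> nX eX h; rewrite (cj_expE (K := 3) nX eX) //.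
rewrite !big_nat_recl // big_geq // fact0 (_ : 1`! = 1%N) // (_ : 2`! = 2%N) //.
by rewrite invr1 !scale1r addr0 addrA.
Qed.

Lemma nilE i a : locnil (a *: oE i). Proof. exact: locnilZ (oE_nil i). Qed.
Lemma nilF i a : locnil (a *: oF i). Proof. exact: locnilZ (oF_nil i). Qed.

Arguments nilE : clear implicits.
Arguments nilF : clear implicits.
Lemma ad_EF i : ad (oE i) (oF i) = hal i. Proof. by rewrite EF eqxx. Qed.
Lemma ad_FE i : ad (oF i) (oE i) = - hal i. Proof. by rewrite adC ad_EF. Qed.
Lemma ad_Eh i : ad (oE i) (hal i) = - (2 *: oE i).
Proof. by rewrite adC halE gcm2. Qed.
Lemma ad_Fh i : ad (oF i) (hal i) = 2 *: oF i.
Proof. by rewrite adC halF gcm2 scaleNr opprK. Qed.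
Lemma ad_EH i k : ad (oE i) (oH k) = - ((rlz_root D i k)%:~R *: oE i).
Proof. by rewrite adC HE. Qed.
Lemma ad_FH i k : ad (oF i) (oH k) = (rlz_root D i k)%:~R *: oF i.
Proof. by rewrite adC HF scaleNr opprK. Qed.

Lemma cjxE i a : cj (km_x G i a) (oE i) = oE i.
Proof.
have h : ad (a *: oE i) (oE i) = 0 by rewrite adZl adXX scaler0.
by rewrite (cj_lin2 (nilE i a) (exp_x i a)) h ?ad0 ?addr0.
Qed.
Lemma cjyF i a : cj (km_y G i a) (oF i) = oF i.
Proof.
have h : ad (a *: oF i) (oF i) = 0 by rewrite adZl adXX scaler0.
by rewrite (cj_lin2 (nilF i a) (exp_y i a)) h ?ad0 ?addr0.
Qed.
Lemma cjxH i a k : cj (km_x G i a) (oH k) = oH k - (a * (rlz_root D i k)%:~R) *: oE i.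
Proof.
rewrite (cj_lin2 (nilE i a) (exp_x i a)); last first.
  by rewrite !adZl ad_EH adZ adN adZ adXX !(scaler0, oppr0).
by rewrite adZl ad_EH scalerN scalerA.
Qed.
Lemma cjyH i a k : cj (km_y G i a) (oH k) = oH k + (a * (rlz_root D i k)%:~R) *: oF i.
Proof.
rewrite (cj_lin2 (nilF i a) (exp_y i a)); last first.
  by rewrite !adZl ad_FH !adZ adXX !(scaler0, oppr0).
by rewrite adZl ad_FH scalerA.
Qed.
Lemma cjxh i a : cj (km_x G i a) (hal i) = hal i - (a * 2) *: oE i.
Proof.
rewrite (cj_lin2 (nilE i a) (exp_x i a)); last first.
  by rewrite !adZl ad_Eh adZ adN adZ adXX !(scaler0, oppr0).
by rewrite adZl ad_Eh scalerN scalerA.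
Qed.
Lemma cjyh i a : cj (km_y G i a) (hal i) = hal i + (a * 2) *: oF i.
Proof.
rewrite (cj_lin2 (nilF i a) (exp_y i a)); last first.
  by rewrite !adZl ad_Fh !adZ adXX !(scaler0, oppr0).
by rewrite adZl ad_Fh scalerA.
Qed.
Lemma cjxF i a : cj (km_x G i a) (oF i) = oF i + a *: hal i - (a ^+ 2) *: oE i.
Proof.
have h2 : ad (a *: oE i) (ad (a *: oE i) (oF i)) = - ((a ^+ 2 * 2) *: oE i).
  by rewrite !adZl ad_EF adZ ad_Eh !scalerN !scalerA expr2.
rewrite (cj_lin3 (nilE i a) (exp_x i a)) h2; last by rewrite adN adZ adZl adXX !scaler0 oppr0.
rewrite adZl ad_EF scalerN scalerA; congr (_ - _ *: _).
by rewrite mulrC mulfK // pnatr_eq0.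
Qed.
Lemma cjyE i a : cj (km_y G i a) (oE i) = oE i - a *: hal i - (a ^+ 2) *: oF i.
Proof.
have h2 : ad (a *: oF i) (ad (a *: oF i) (oE i)) = - ((a ^+ 2 * 2) *: oF i).
  by rewrite !adZl ad_FE adZ adN ad_Fh !scalerN !scalerA expr2.
rewrite (cj_lin3 (nilF i a) (exp_y i a)) h2; last by rewrite adN adZ adZl adXX !scaler0 oppr0.
rewrite adZl ad_FE !scalerN scalerA; congr (_ - _ - _ *: _).
by rewrite mulrC mulfK // pnatr_eq0.
Qed.

Local Notation S i := (simple_lift G i).

(** In these coordinates conjugation by x_i(t) and by y_i(t) is an explicit substitution, so the
    action of [simple_lift] becomes a [ring] identity. *)
Definition sl2 i (a b c : C) : op := a *: oE i + b *: hal i + c *: oF i.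

Lemma opNZ c (X : op) : - (c *: X) = (- c) *: X. Proof. by rewrite scaleNr. Qed.
Lemma sl2D i a b c a' b' c' :
  sl2 i a b c + sl2 i a' b' c' = sl2 i (a + a') (b + b') (c + c').
Proof. by rewrite /sl2 !scalerDl addrACA; congr (_ + _); rewrite addrACA. Qed.
Lemma sl2Z i k a b c : k *: sl2 i a b c = sl2 i (k * a) (k * b) (k * c).
Proof. by rewrite /sl2 !scalerDr !scalerA. Qed.
Lemma sl2E i : oE i = sl2 i 1 0 0.
Proof. by rewrite /sl2 !scale0r !addr0 scale1r. Qed.
Lemma sl2F i : oF i = sl2 i 0 0 1.
Proof. by rewrite /sl2 !scale0r !add0r scale1r. Qed.
Lemma sl2h i : hal i = sl2 i 0 1 0.
Proof. by rewrite /sl2 !scale0r addr0 add0r scale1r. Qed.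

Lemma cjx_sl2 i t a b c : cj (km_x G i t) (sl2 i a b c) =
  sl2 i (a - t * 2 * b - t ^+ 2 * c) (b + t * c) c.
Proof.
rewrite {1}/sl2 !cjD !cjZ cjxE cjxh cjxF !opNZ sl2E sl2h sl2F.
by rewrite !(sl2D, sl2Z); congr (sl2 i _ _ _); ring.
Qed.
Lemma cjy_sl2 i t a b c : cj (km_y G i t) (sl2 i a b c) =
  sl2 i a (b - t * a) (c + t * 2 * b - t ^+ 2 * a).
Proof.
rewrite {1}/sl2 !cjD !cjZ cjyF cjyh cjyE !opNZ sl2E sl2h sl2F.
by rewrite !(sl2D, sl2Z); congr (sl2 i _ _ _); ring.
Qed.

Lemma cjSE i : cj (S i) (oE i) = - oF i.
Proof.
rewrite /simple_lift !cjM sl2E cjx_sl2 cjy_sl2 cjx_sl2 [in RHS]sl2F -[sl2 i 0 0 1]scale1r opNZ.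
by rewrite sl2Z; congr (sl2 i _ _ _); ring.
Qed.
Lemma cjSF i : cj (S i) (oF i) = - oE i.
Proof.
rewrite /simple_lift !cjM sl2F cjx_sl2 cjy_sl2 cjx_sl2 [in RHS]sl2E -[sl2 i 1 0 0]scale1r opNZ.
by rewrite sl2Z; congr (sl2 i _ _ _); ring.
Qed.
Lemma cjSH i k : cj (S i) (oH k) = oH k - (rlz_root D i k)%:~R *: hal i.
Proof.
pose r : C := (rlz_root D i k)%:~R.
have xr t a b c : cj (km_x G i t) (oH k + sl2 i a b c) =
    oH k + (sl2 i (- (t * r)) 0 0 + cj (km_x G i t) (sl2 i a b c)).
  by rewrite cjD cjxH addrA /sl2 !scale0r !addr0 scaleNr.
have yr t a b c : cj (km_y G i t) (oH k + sl2 i a b c) =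
    oH k + (sl2 i 0 0 (t * r) + cj (km_y G i t) (sl2 i a b c)).
  by rewrite cjD cjyH addrA /sl2 !scale0r !add0r.
have sD := sl2D i.
rewrite /simple_lift !cjM -{1}[oH k]addr0 (_ : 0 = sl2 i 0 0 0); last first.
  by rewrite /sl2 !scale0r !addr0.
rewrite xr cjx_sl2 sD yr cjy_sl2 sD xr cjx_sl2 sD [in RHS]sl2h opNZ.
by rewrite sl2Z; congr (_ + sl2 i _ _ _); rewrite -/r; ring.
Qed.

End Weights.

(* The eigenvector components of an eigenvector of commuting operators: the
   components with another eigenvalue are killed one after the other. *)
Lemma eigen_component (R : realType) (V : lmodType R[i]) m (T : 'I_m -> V -> V)
    (S : 'rV[int]_m -> V -> Prop) :
  (forall k, linear (T k)) -> (forall b, S b 0) ->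
  (forall b u v, S b u -> S b v -> S b (u + v)) ->
  (forall b c u, S b u -> S b (c *: u)) ->
  (forall (b : 'rV[int]_m) u k, S b u -> T k u = (b 0 k)%:~R *: u) ->
  forall (s : seq ('rV[int]_m * V)) (b : 'rV[int]_m) (v : V),
    (forall p, p \in s -> S p.1 p.2) -> (forall k, T k v = (b 0 k)%:~R *: v) ->
    v = \sum_(p <- s) p.2 -> S b v.
Proof.
move=> lT S0 SD SZ ST s; move: {2}(size s) (erefl (size s)) => N.
have TB k u v : T k (u - v) = T k u - T k v.
  by rewrite addrC -[in LHS]scaleN1r lT scaleN1r addrC.
have TD k u v : T k (u + v) = T k u + T k v by have := lT k 1 u v; rewrite !scale1r.
have TZ k c u : T k (c *: u) = c *: T k u.
  have T0 : T k 0 = 0 by have := TB k 0 0; rewrite !subrr.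
  by rewrite -[c *: u]addr0 lT T0 addr0.
have Tsum k (q : seq ('rV[int]_m * V)) : T k (\sum_(p <- q) p.2) = \sum_(p <- q) T k p.2.
  elim: q => [|p q IH]; first by rewrite !big_nil; have := TB k 0 0; rewrite !subrr.
  by rewrite !big_cons TD IH.
elim: N s => [|N IH] [|p s] //= sz b v hS hv hE; first by rewrite hE big_nil.
case: sz => sz; rewrite big_cons in hE.
have Sp : S p.1 p.2 by apply: hS; rewrite mem_head.
have Ss q : q \in s -> S q.1 q.2 by move=> h; apply: hS; rewrite inE h orbT.
have [pb|pb] := eqVneq p.1 b.
  rewrite -[v](subrK p.2); apply: SD; last by rewrite -pb.
  apply: (IH s) => // [k|]; last by rewrite hE addrC addKr.
  by rewrite TB hv (ST _ _ _ Sp) pb scalerBr.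
have [k hk] : exists k, p.1 0 k != b 0 k.
  by apply/existsP; rewrite -negb_forall; apply: contra pb => /forallP h;
     apply/eqP/rowP => k; exact/eqP.
have nz : (b 0 k)%:~R - (p.1 0 k)%:~R != 0 :> R[i].
  by rewrite -rmorphB intr_eq0 subr_eq0 eq_sym.
pose f u := ((b 0 k)%:~R - (p.1 0 k)%:~R : R[i])^-1 *: (T k u - (p.1 0 k)%:~R *: u).
have fv : f v = v by rewrite /f hv -scalerBl scalerA mulVf ?scale1r.
pose c (q : 'rV[int]_m * V) : R[i] :=
  ((b 0 k)%:~R - (p.1 0 k)%:~R)^-1 * ((q.1 0 k)%:~R - (p.1 0 k)%:~R).
pose s' := [seq (q.1, c q *: q.2) | q <- s].
apply: (IH s'); rewrite ?size_map //.
  by move=> q /mapP[q' q's ->] /=; apply/SZ/Ss.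
rewrite /s' big_map /= -[LHS]fv hE /f.
rewrite TD (ST _ _ _ Sp) [(p.1 0 k)%:~R *: (_ + _)]scalerDr opprD addrACA subrr add0r Tsum.
rewrite !scaler_sumr -sumrB scaler_sumr; apply: eq_big_seq => q /Ss Sq.
by rewrite (ST _ _ _ Sq) -scalerBl scalerA.
Qed.

(** * Root spaces and the triangular decomposition *)

Section Graded.
Variables (R : realType) (l : nat) (A : 'M[int]_l) (D : realization A).
Variable G : kac_moody_group R D.
Hypothesis hA : is_gcm A.
Local Notation C := R[i].
Local Notation n := (rlz_dim D).
Variables (I : Type) (Ms : I -> integrable_module R D).
Local Notation op := (op Ms).
Local Notation E i := (oE Ms i).
Local Notation F i := (oF Ms i).
Local Notation H i := (oH Ms i).

(* The root spaces of the image of the Kac-Moody algebra. *)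
Inductive gsp : 'rV[int]_l -> op -> Prop :=
| gsp_E i : gsp (al i) (E i)
| gsp_F i : gsp (- al i) (F i)
| gsp_H k : gsp 0 (H k)
| gsp_0 b : gsp b 0
| gsp_D b X Y : gsp b X -> gsp b Y -> gsp b (X + Y)
| gsp_Z b c X : gsp b X -> gsp b (c *: X)
| gsp_br b c X Y : gsp b X -> gsp c Y -> gsp (b + c) (ad X Y).

Lemma gsp_wt b X : gsp b X -> has_wt (rwt D b) X.
Proof.
elim=> {b X} [i|i|k|b|b X Y _ hX _ hY|b c X _ hX|b c X Y _ hX _ hY].
- exact: wt_E.
- exact: wt_F.
- exact: wt_H.
- exact: has_wt0.
- exact: has_wtD.
- exact: has_wtZ.
- by rewrite rwtD; exact: has_wt_ad.
Qed.

Definition Es (b : bool) i := if b then E i else F i.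
Definition sg (b : bool) : int := if b then 1 else -1.

Lemma gsp_Es b i : gsp (sg b *: al i) (Es b i).
Proof. by case: b; rewrite /sg ?scale1r ?scaleN1r; [exact: gsp_E|exact: gsp_F]. Qed.

Lemma ad_nil_br (e X Y : op) p q : iter p (ad e) X = 0 -> iter q (ad e) Y = 0 ->
  iter (p + q) (ad e) (ad X Y) = 0.
Proof.
move: {2}(p + q)%N (erefl (p + q)%N) => N.
have it0 m : iter m (ad e) 0 = 0 by elim: m => //= m ->; rewrite ad0.
have itD m U V : iter m (ad e) (U + V) = iter m (ad e) U + iter m (ad e) V.
  by elim: m => //= m ->; rewrite adD.
elim: N p q X Y => [|N IH] [|p] [|q] X Y // e0 hX hY;
  try by [rewrite [X]hX ad0l it0 | rewrite [Y]hY ad0 it0].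
rewrite addSn iterSr jacobi itD.
rewrite (IH p q.+1) ?(addnS p) -?addSnnS ?(IH p.+1 q) ?add0r //; try by rewrite -iterSr.
all: by lia.
Qed.

(** On generators this is the Serre relations and the relations of sl2; brackets follow by the
    Leibniz rule. It makes the series for conjugation by x_i(a) and y_i(a) finite. *)
Lemma Es_nil b i g X : gsp g X -> exists K, iter K (ad (Es b i)) X = 0.
Proof.
have it0 m e : iter m (ad e) 0 = 0 :> op by elim: m => //= m ->; rewrite ad0.
have itD m e (U V : op) : iter m (ad e) (U + V) = iter m (ad e) U + iter m (ad e) V.
  by elim: m => //= m ->; rewrite adD.
have itZ m e c (U : op) : iter m (ad e) (c *: U) = c *: iter m (ad e) U.
  by elim: m => //= m ->; rewrite adZ.
elim=> {g X} [j|j|k|g|g X Y _ [p hX] _ [q hY]|g c X _ [p hX]|g c X Y _ [p hX] _ [q hY]].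
- have [->|ij] := eqVneq i j.
    exists 3%N; case: b => /=; first by rewrite adXX !ad0.
    by rewrite ad_FE adN (ad_Fh _ hA) adN adZ adXX scaler0 oppr0.
  case: b => /=; first by exists (absz (1 - A i j)); exact: serre_e.
  by exists 1%N => /=; rewrite adC EF eq_sym (negPf ij) oppr0.
- have [->|ij] := eqVneq i j.
    exists 3%N; case: b => /=; last by rewrite adXX !ad0.
    by rewrite ad_EF (ad_Eh _ hA) adN adZ adXX scaler0 oppr0.
  case: b => /=; last by exists (absz (1 - A i j)); exact: serre_f.
  by exists 1%N => /=; rewrite EF (negPf ij).
- exists 2%N; case: b => /=; first by rewrite ad_EH adN adZ adXX scaler0 oppr0.
  by rewrite ad_FH adZ adXX scaler0.
- by exists 0%N.
- exists (p + q)%N; rewrite itD addnC iterD hX it0 add0r addnC iterD hY it0 //.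
- by exists p; rewrite itZ hX scaler0.
- by exists (p + q)%N; exact: ad_nil_br.
Qed.

Definition gsum X := exists s : seq ('rV[int]_l * op),
  (forall p, p \in s -> gsp p.1 p.2) /\ X = \sum_(p <- s) p.2.

(** Conjugation by x_i or y_i spreads a root vector over several root spaces. If the result has a
    weight, [eigen_component] for the commuting operators ad h_k isolates the component of that
    weight; [rwt] is injective, so the weight determines the root space. *)
Lemma gsum_gsp g X : gsum X -> has_wt (rwt D g) X -> gsp g X.
Proof.
move=> [s [hs ->]] hX.
pose S lam (Y : op) := Y = 0 \/ exists2 b, lam = rwt D b & gsp b Y.
suff [->|[b /rwt_inj -> //]] : S (rwt D g) (\sum_(p <- s) p.2); first exact: gsp_0.
apply: (@eigen_component _ op _ (fun k => ad (H k)) S _ _ _ _ _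
   [seq (rwt D p.1, p.2) | p <- s]) => //.
- by move=> k a u v; rewrite adD adZ.
- by left.
- move=> b u v [->|[b1 e1 h1]]; first by rewrite add0r.
  move=> [->|[b2 e2 h2]]; first by rewrite addr0; right; exists b1.
  right; exists b1 => //; apply: gsp_D => //.
  by have -> : b1 = b2 by apply: (@rwt_inj _ _ D); rewrite -e1 -e2.
- by move=> b c u [->|[b1 e1 h1]]; [left; rewrite scaler0|right; exists b1 => //; exact: gsp_Z].
- by move=> b u k [->|[b1 -> /gsp_wt ->]] //; rewrite ad0 scaler0.
- by move=> p /mapP[q /hs hq ->] /=; right; exists q.1.
- by rewrite big_map.
Qed.

Lemma gsum0 : gsum 0. Proof. by exists [::]; rewrite big_nil. Qed.
Lemma gsum_g b X : gsp b X -> gsum X.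
Proof.
by exists [:: (b, X)]; split=> [p|]; rewrite ?big_seq1 // inE => /eqP ->.
Qed.
Lemma gsumD X Y : gsum X -> gsum Y -> gsum (X + Y).
Proof.
move=> [s [hs ->]] [t [ht ->]]; exists (s ++ t); split; last by rewrite big_cat.
by move=> p; rewrite mem_cat => /orP[/hs|/ht].
Qed.
Lemma gsum_sum J (s : seq J) (f : J -> op) :
  (forall j, gsum (f j)) -> gsum (\sum_(j <- s) f j).
Proof. by move=> h; elim/big_rec: _ => [|j X _]; [exact: gsum0|exact: gsumD]. Qed.

Lemma gsp_iter b i g X k : gsp g X ->
  gsp (g + k%:Z *: (sg b *: al i)) (iter k (ad (Es b i)) X).
Proof.
move=> hX; elim: k => [|k IH]; first by rewrite scale0r addr0.
rewrite iterS (_ : g + _ = sg b *: al i + (g + k%:Z *: (sg b *: al i))).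
  by apply: gsp_br => //; exact: gsp_Es.
by rewrite addrCA -{2}[sg b *: _]scale1r -scalerDl.
Qed.

Definition kg b i a : G := if b then km_x G i a else km_y G i a.
Lemma exp_kg b i a : is_exp (a *: Es b i) (rho Ms (kg b i a)).
Proof. by case: b; [exact: exp_x|exact: exp_y]. Qed.
Lemma Es_locnil b i a : locnil (a *: Es b i).
Proof. by apply: locnilZ; case: b; [exact: oE_nil|exact: oF_nil]. Qed.

Lemma iter_adZ m (e : op) c (U : op) : iter m (ad (c *: e)) U = c ^+ m *: iter m (ad e) U.
Proof.
elim: m => [|m IH]; first by rewrite scale1r.
by rewrite !iterS IH adZ adZl scalerA exprSr.
Qed.

Lemma cj_kgE b i a g X : gsp g X -> exists K, iter K (ad (Es b i)) X = 0 /\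
  cj (kg b i a) X = \sum_(0 <= k < K) ((k`!%:R^-1 * a ^+ k) : C) *: iter k (ad (Es b i)) X.
Proof.
move=> hX; have [K hK] := Es_nil b i hX; exists K; split=> //.
have hK' : iter K (ad (a *: Es b i)) X = 0 by rewrite iter_adZ hK scaler0.
rewrite (cj_expE (@Es_locnil b i a) (@exp_kg b i a) hK').
by apply: eq_bigr => k _; rewrite iter_adZ scalerA.
Qed.

Lemma gsum_cj b i a X : gsum X -> gsum (cj (kg b i a) X).
Proof.
move=> [s [hs ->]]; rewrite cj_sum; elim: s hs => [|p s IH] hs.
  by rewrite big_nil; exact: gsum0.
rewrite big_cons; apply: gsumD; last by apply: IH => q h; apply: hs; rewrite inE h orbT.
have hp : gsp p.1 p.2 by apply: hs; rewrite mem_head.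
have [K [_ ->]] := cj_kgE b i a hp.
by apply: gsum_sum => k; exact: gsum_g (gsp_Z _ (gsp_iter b i k hp)).
Qed.

Local Notation S i := (simple_lift G i).
Definition act (u : seq 'I_l) (x : 'rV[int]_l) := foldr (simple_refl A) x u.

Lemma cjSh i : cj (S i) (hal Ms i) = - hal Ms i.
Proof. by rewrite -ad_EF cj_ad (cjSE _ _ hA) (cjSF _ _ hA) adN adC adN !opprK. Qed.

Lemma cjS_wt i g (X : op) : has_wt (rwt D g) X -> has_wt (rwt D (simple_refl A i g)) (cj (S i) X).
Proof.
move=> hX k; pose r : C := (rlz_root D i k)%:~R.
have -> : H k = cj (S i) (H k - r *: hal Ms i).
  by rewrite cjD cjN cjZ (cjSH _ _ hA) cjSh scalerN opprK subrK.
rewrite -cj_ad adDl -scaleN1r !adZl (hal_wt _ hX) hX scaleN1r scalerA -scalerBl cjZ.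
congr (_ *: _); rewrite simple_reflE rwtD rwtN rwtZ rwt_al !mxE -rmorphM -rmorphB.
by congr (_%:~R); ring.
Qed.

Lemma gsp_S i g X : gsp g X -> gsp (simple_refl A i g) (cj (S i) X).
Proof.
move=> hX; apply: gsum_gsp; last by apply: cjS_wt; exact: gsp_wt.
rewrite /simple_lift !cjM; apply: (@gsum_cj true); apply: (@gsum_cj false).
by apply: (@gsum_cj true); exact: gsum_g hX.
Qed.

Lemma gsp_W u g X : gsp g X -> gsp (act u g) (cj (word_lift G u) X).
Proof. by elim: u => [|i u IH] hX /=; rewrite ?cj1 // cjM; apply: gsp_S; exact: IH. Qed.

(* The two halves n+ and n-, spanned by iterated brackets. *)
Inductive np (b : bool) : 'rV[int]_l -> op -> Prop :=
| np_g i : np b (al i) (Es b i)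
| np_br i g X : np b g X -> np b (al i + g) (ad (Es b i) X)
| np_0 g : np b g 0
| np_D g X Y : np b g X -> np b g Y -> np b g (X + Y)
| np_Z g c X : np b g X -> np b g (c *: X).

Inductive hs : op -> Prop :=
| hs_H k : hs (H k)
| hs_0 : hs 0
| hs_D X Y : hs X -> hs Y -> hs (X + Y)
| hs_Z c X : hs X -> hs (c *: X).

Definition hs0 (g : 'rV[int]_l) X := X = 0 \/ (g = 0 /\ hs X).

Lemma hs0_0 g : hs0 g 0. Proof. by left. Qed.
Lemma hs0D g X Y : hs0 g X -> hs0 g Y -> hs0 g (X + Y).
Proof.
move=> [->|[-> hX]]; first by rewrite add0r.
by move=> [->|[_ hY]]; right; rewrite ?addr0; split=> //; exact: hs_D.
Qed.
Lemma hs0Z g c X : hs0 g X -> hs0 g (c *: X).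
Proof. by move=> [->|[-> hX]]; [left; rewrite scaler0|right; split=> //; exact: hs_Z]. Qed.
Lemma hs_hal i : hs (hal Ms i).
Proof.
rewrite /hal; elim/big_rec: _ => [|k X _ hX]; first exact: hs_0.
by apply: hs_D => //; apply/hs_Z/hs_H.
Qed.

Lemma np_gsp b g X : np b g X -> gsp (sg b *: g) X.
Proof.
elim=> {g X} [i|i g X _ IH|g|g X Y _ IX _ IY|g c X _ IX].
- exact: gsp_Es.
- by rewrite scalerDr; apply: gsp_br => //; exact: gsp_Es.
- exact: gsp_0.
- exact: gsp_D.
- exact: gsp_Z.
Qed.

Lemma ad_hs X b i : hs X -> exists c : C, ad (Es b i) X = c *: Es b i.
Proof.
elim=> {X} [k||X Y _ [c hX] _ [d hY]|c X _ [d hX]].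
- case: b; first by exists (- (rlz_root D i k)%:~R); rewrite ad_EH scaleNr.
  by exists (rlz_root D i k)%:~R; rewrite ad_FH.
- by exists 0; rewrite ad0 scale0r.
- by exists (c + d); rewrite adD hX hY scalerDl.
- by exists (c * d); rewrite adZ hX scalerA.
Qed.

(** Bracketing one half with the opposite generator stays in that half, up to the Cartan term
    produced by [e_j, f_j]; that term is kept apart as [X0]. *)
Lemma np_low b j g X : np b g X -> exists X1 X0,
  [/\ np b (g - al j) X1, hs0 (g - al j) X0 & ad (Es (~~ b) j) X = X1 + X0].
Proof.
elim=> {g X} [i|i g X hX IH|g|g X Y _ IX _ IY|g c X _ IX].
- exists 0, (ad (Es (~~ b) j) (Es b i)); split; rewrite ?add0r //; first exact: np_0.
  have [<-|ij] := eqVneq j i.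
    right; split; first by rewrite subrr.
    case: b => /=; rewrite ?ad_FE ?ad_EF; last exact: hs_hal.
    by rewrite -scaleN1r; apply/hs_Z/hs_hal.
  left; case: b => /=; last by rewrite EF (negPf ij).
  by rewrite adC EF eq_sym (negPf ij) oppr0.
- have [X1 [X0 [h1 h0 e]]] := IH; rewrite jacobi e adD.
  have h1' : np b (al i + g - al j) (ad (Es b i) X1).
    by rewrite -addrA; exact: np_br.
  have [Y hY eY] : exists2 Y, np b (al i + g - al j) Y & Y = ad (Es b i) X0.
    exists (ad (Es b i) X0) => //; case: h0 => [->|[h0 hX0]]; first by rewrite ad0; exact: np_0.
    have [c ->] := ad_hs b i hX0; apply: np_Z.
    by rewrite -addrA h0 addr0; exact: np_g.
  have hZ : np b (al i + g - al j) (ad (ad (Es (~~ b) j) (Es b i)) X).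
    clear Y hY eY IH X1 X0 h1 h1' h0 e.
    have [<-|ij] := eqVneq j i.
      rewrite addrC addKr; have hw := gsp_wt (np_gsp hX).
      case: b hX hw => /= hX hw.
        by rewrite ad_FE -scaleN1r adZl (hal_wt _ hw) scalerA; exact: np_Z.
      by rewrite ad_EF (hal_wt _ hw); exact: np_Z.
    have -> : ad (Es (~~ b) j) (Es b i) = 0.
      case: b {hX} => /=; last by rewrite EF (negPf ij).
      by rewrite adC EF eq_sym (negPf ij) oppr0.
    by rewrite ad0l; exact: np_0.
  eexists; exists 0; split; [|exact: hs0_0|by rewrite addr0].
  by apply: np_D => //; apply: np_D; rewrite // -eY.
- by exists 0, 0; rewrite ad0 addr0; split=> //; [exact: np_0|exact: hs0_0].
- have [X1 [X0 [h1 h0 eX]]] := IX; have [Y1 [Y0 [k1 k0 eY]]] := IY.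
  exists (X1 + Y1), (X0 + Y0); rewrite adD eX eY addrACA.
  by split=> //; [exact: np_D|exact: hs0D].
- have [X1 [X0 [h1 h0 eX]]] := IX; exists (c *: X1), (c *: X0).
  by rewrite adZ eX scalerDr; split=> //; [exact: np_Z|exact: hs0Z].
Qed.

Definition tri g X := exists Xp Xm X0,
  [/\ np true g Xp, np false (- g) Xm, hs0 g X0 & X = Xp + Xm + X0].

Lemma tri0 g : tri g 0.
Proof. by exists 0, 0, 0; rewrite !addr0; split=> //; [exact: np_0|exact: np_0|left]. Qed.
Lemma triD g X Y : tri g X -> tri g Y -> tri g (X + Y).
Proof.
move=> [Xp [Xm [X0 [h1 h2 h3 ->]]]] [Yp [Ym [Y0 [k1 k2 k3 ->]]]].
exists (Xp + Yp), (Xm + Ym), (X0 + Y0); split; try exact: np_D; first exact: hs0D.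
by rewrite addrACA; congr (_ + _); rewrite addrACA.
Qed.
Lemma triZ g c X : tri g X -> tri g (c *: X).
Proof.
move=> [Xp [Xm [X0 [h1 h2 h3 ->]]]].
exists (c *: Xp), (c *: Xm), (c *: X0); split; try exact: np_Z; first exact: hs0Z.
by rewrite !scalerDr.
Qed.
Lemma tri_np b g X : np b (sg b *: g) X -> tri g X.
Proof.
case: b; rewrite /sg ?scale1r ?scaleN1r => hX.
  by exists X, 0, 0; rewrite !addr0; split=> //; [exact: np_0|left].
by exists 0, X, 0; rewrite addr0 add0r; split=> //; [exact: np_0|left].
Qed.
Lemma tri_hs g X : hs0 g X -> tri g X.
Proof. by exists 0, 0, X; rewrite !add0r; split=> //; exact: np_0. Qed.

Lemma tri_Es b j g X : tri g X -> tri (sg b *: al j + g) (ad (Es b j) X).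
Proof.
have sgN c (x : 'rV[int]_l) : sg c *: (sg (~~ c) *: x) = - x.
  by case: c; rewrite /sg /= ?scale1r ?scaleN1r.
have sgK c (x : 'rV[int]_l) : sg c *: (sg c *: x) = x.
  by case: c; rewrite /sg /= ?scale1r ?scaleN1r ?opprK.
have same c y Y : np c (sg c *: y) Y -> tri (sg c *: al j + y) (ad (Es c j) Y).
  by move=> h; apply: (@tri_np c); rewrite scalerDr sgK; apply: np_br.
have diff c y Y : np (~~ c) (sg (~~ c) *: y) Y -> tri (sg c *: al j + y) (ad (Es c j) Y).
  move=> h; have [Y1 [Y0 [h1 h0]]] := np_low j h; rewrite negbK => ->.
  apply: triD; [apply: (@tri_np (~~ c))|apply: tri_hs].
    by rewrite scalerDr; rewrite addrC (_ : sg (~~ c) *: (sg c *: al j) = - al j) //;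
      case: (c); rewrite /sg /= ?scale1r ?scaleN1r.
  case: h0 => [->|[e h0]]; first by left.
  right; split=> //; rewrite -[LHS](sgK (~~ c)) scalerDr.
  rewrite (_ : sg (~~ c) *: (sg c *: al j) = - al j); last first.
    by case: (c); rewrite /sg /= ?scale1r ?scaleN1r.
  by rewrite addrC e scaler0.
move=> [Xp [Xm [X0 [h1 h2 h3 ->]]]]; rewrite !adD; apply: triD; last first.
  case: h3 => [->|[-> hX0]]; first by rewrite ad0; exact: tri0.
  have [c ->] := ad_hs b j hX0; apply: triZ; apply: (@tri_np b).
  by rewrite addr0 sgK; exact: np_g.
case: b; apply: triD.
- by apply: same; rewrite scale1r.
- by apply: diff; rewrite scaleN1r.
- by apply: diff; rewrite scale1r.
- by apply: same; rewrite scaleN1r.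
Qed.

Lemma tri_gsp g X : tri g X -> has_wt (rwt D g) X.
Proof.
move=> [Xp [Xm [X0 [/np_gsp h1 /np_gsp h2 h3 ->]]]].
apply: has_wtD; first by apply: has_wtD; apply: gsp_wt; move: h1 h2;
   rewrite /sg ?scale1r ?scaleN1r ?opprK.
case: h3 => [->|[-> ]]; first exact: has_wt0.
elim=> [k||Y Z _ hY _ hZ|c Y _ hY]; [exact: wt_H|exact: has_wt0|exact: has_wtD|exact: has_wtZ].
Qed.

(** The triangular decomposition. The induction also carries that ad X preserves [tri]: for
    generators this is [tri_Es], for a bracket the Jacobi identity. *)
Lemma gsp_tri g X : gsp g X -> tri g X.
Proof.
suff h : gsp g X -> tri g X /\ forall c Y, tri c Y -> tri (g + c) (ad X Y) by case/h.
elim=> {g X} [i|i|k|b|b X Y _ [hX aX] _ [hY aY]|b c X _ [hX aX]|b c X Y _ [hX aX] _ [hY aY]].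
- split; first by apply: (@tri_np true); rewrite scale1r; exact: (np_g true).
  by move=> c Y /(@tri_Es true i); rewrite scale1r.
- split; first by apply: (@tri_np false); rewrite scaleN1r opprK; exact: (np_g false).
  by move=> c Y /(@tri_Es false i); rewrite scaleN1r.
- split; first by apply: tri_hs; right; split=> //; exact: hs_H.
  by move=> c Y hY; rewrite add0r (tri_gsp hY); exact: triZ.
- split; first exact: tri0.
  by move=> c Y _; rewrite ad0l; exact: tri0.
- split; first exact: triD.
  by move=> c Z hZ; rewrite adDl; apply: triD; [exact: aX|exact: aY].
- split; first exact: triZ.
  by move=> d Z hZ; rewrite adZl; apply: triZ; exact: aX.
- split; first exact: aX.
  move=> d Z hZ; have -> : ad (ad X Y) Z = ad X (ad Y Z) - ad Y (ad X Z).
    by rewrite jacobi addrK.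
  rewrite -scaleN1r; apply: triD; last apply: triZ.
    by rewrite -addrA; apply/aX/aY.
  by rewrite addrAC -addrA addrC addrAC -addrA addrC -addrA addrC -addrA; apply/aY; rewrite addrC; apply/aX.
Qed.

Definition nneg (x : 'rV[int]_l) := forall k, 0 <= x 0 k.

Lemma al_nneg (i : 'I_l) : nneg (al i). Proof. by move=> k; rewrite mxE; case: (_ && _). Qed.
Lemma al_sum (i : 'I_l) : \sum_k al i 0 k = 1.
Proof.
rewrite (bigD1 i) //= big1 => [|k ki]; rewrite !mxE ?eqxx ?addr0 //.
by rewrite (negPf ki).
Qed.
Lemma al_k (i k : 'I_l) : al i 0 k = (k == i)%:R. Proof. by rewrite mxE. Qed.

(** Each bracket adds a simple root to g. A multiple z alpha_i with z >= 2 cannot be reached: the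
    first step towards it would be [e_i, c e_i] = 0. *)
Lemma np_inv b g X : np b g X -> X = 0 \/ [/\ nneg g, 1 <= \sum_k g 0 k,
  forall i, g = al i -> exists c : C, X = c *: Es b i &
  forall i (z : int), 2 <= z -> g <> z *: al i].
Proof.
elim=> {g X} [i|i g X hX [->|[h1 h2 h3 h4]]|g|g X Y _ IX _ IY|g c X _ IX].
- right; split; first exact: al_nneg; rewrite ?al_sum //.
    move=> j /rowP/(_ i); rewrite !al_k eqxx; case: eqP => // -> _.
    by exists 1; rewrite scale1r.
  move=> j z z2 /(congr1 (fun x : 'rV_l => \sum_k x 0 k)); rewrite al_sum.
  under eq_bigr do rewrite mxE.
  by rewrite -mulr_sumr al_sum; lia.
- by left; rewrite ad0.
- have [e0|/eqP n0] := eqVneq (ad (Es b i) X) 0; [by left|right].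
  have sm : \sum_k (al i + g) 0 k = 1 + \sum_k g 0 k.
    by under eq_bigr do rewrite mxE; rewrite big_split al_sum.
  split.
  + by move=> k; rewrite mxE; apply: addr_ge0; [exact: al_nneg|exact: h1].
  + by rewrite sm; lia.
  + by move=> j e; move: sm; rewrite e al_sum; lia.
  + move=> j z z2 e.
    have ij : i = j.
      move/rowP/(_ i): e; rewrite !mxE !eqxx /=; case: (i =P j) => // _.
      by rewrite mulr1n mulr0n mulr0 => e2; have := h1 i; lia.
    subst j; have eg : g = (z - 1) *: al i by rewrite scalerBl scale1r -e addrC addKr.
    have [z3|z3] := leP 3 z; first by apply: (h4 i (z - 1)) => //; lia.
    have ez : z = 2 by lia.
    have [|c eX] := h3 i; first by rewrite eg ez scale1r.
    by apply: n0; rewrite eX adZ adXX scaler0.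
- by left.
- case: IX => [->|[h1 h2 h3 h4]]; first by rewrite add0r.
  case: IY => [->|[k1 k2 k3 k4]]; first by rewrite addr0; right.
  right; split=> // i e; have [c ->] := h3 i e; have [d ->] := k3 i e.
  by exists (c + d); rewrite scalerDl.
- case: IX => [->|[h1 h2 h3 h4]]; first by left; rewrite scaler0.
  right; split=> // i e; have [d ->] := h3 i e.
  by exists (c * d); rewrite scalerA.
Qed.

Lemma gsp_coh g X : gsp g X -> X <> 0 -> nneg g \/ nneg (- g).
Proof.
move=> /gsp_tri[Xp [Xm [X0 [/np_inv[->|[h1 _ _ _]] h2 h3 ->]]]]; last by left.
move: h2 => /np_inv[->|[h1 _ _ _]]; last by right.
by case: h3 => [->|[-> _]]; rewrite ?addr0 // => _; left => k; rewrite mxE.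
Qed.

Lemma gsp_mul i z X : gsp (z *: al i) X -> X <> 0 -> [\/ z = 0, z = 1 | z = -1].
Proof.
have s z' : \sum_k (z' *: al i) 0 k = z'.
  by under eq_bigr do rewrite mxE; rewrite -mulr_sumr al_sum mulr1.
move=> /gsp_tri[Xp [Xm [X0 [/np_inv[->|[_ h2 _ h4]] h5 h3 ->]]]]; last first.
  move=> _; rewrite s in h2.
  have [z2|z2] := leP 2 z; first by case: (h4 i z z2 erefl).
  by apply: Or32; lia.
move: h5; rewrite -scaleNr => /np_inv[->|[_ h2 _ h4]]; last first.
  move=> _; rewrite s in h2.
  have [z2|z2] := leP 2 (- z); first by case: (h4 i (- z) z2 erefl).
  by apply: Or33; lia.
case: h3 => [->|[e _]]; first by rewrite !addr0.
by move=> _; apply: Or31; rewrite -(s z) e big1 // => k _; rewrite mxE.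
Qed.

Lemma al_neq0 (i : 'I_l) : al i <> 0.
Proof. by move/(congr1 (fun x : 'rV[int]_l => x 0 i)); rewrite !mxE !eqxx. Qed.

Lemma gsp_al i X : gsp (al i) X -> exists c : C, X = c *: E i.
Proof.
move=> /gsp_tri[Xp [Xm [X0 [h1 h5 h3 ->]]]].
case: h3 => [->|[/al_neq0 //]].
have -> : Xm = 0.
  case: (np_inv h5) => // -[_ h _ _]; move: h.
  by under eq_bigr do rewrite mxE; rewrite sumrN al_sum.
rewrite !addr0; case: (np_inv h1) => [->|[_ _ h _]]; last exact: (h i).
by exists 0; rewrite scale0r.
Qed.
Lemma gsp_alN i X : gsp (- al i) X -> exists c : C, X = c *: F i.
Proof.
move=> /gsp_tri[Xp [Xm [X0 [h1 h5 h3 ->]]]].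
case: h3 => [->|[/eqP]]; last by rewrite oppr_eq0 => /eqP/al_neq0.
have -> : Xp = 0.
  case: (np_inv h1) => // -[_ h _ _]; move: h.
  by under eq_bigr do rewrite mxE; rewrite sumrN al_sum.
rewrite addr0 add0r; rewrite opprK in h5.
case: (np_inv h5) => [->|[_ _ h _]]; last exact: (h i).
by exists 0; rewrite scale0r.
Qed.

End Graded.

(** * Real roots *)

Section Roots.
Variables (R : realType) (l : nat) (A : 'M[int]_l) (D : realization A).
Variable G : kac_moody_group R D.
Hypothesis hA : is_gcm A.
Local Notation C := R[i].
Variables (I : Type) (Ms : I -> integrable_module R D).
Local Notation op := (op Ms).
Local Notation E i := (oE Ms i).
Local Notation F i := (oF Ms i).
Local Notation pr := (pr A).
Local Notation act := (act A).
Local Notation s := (simple_refl A).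

Lemma s_def i x : s i x = x - pr x i *: al i. Proof. by []. Qed.
Lemma sD i x y : s i (x + y) = s i x + s i y.
Proof. by rewrite !s_def prD scalerDl opprD addrACA. Qed.
Lemma sZ i c x : s i (c *: x) = c *: s i x.
Proof. by rewrite !s_def prZ scalerBr scalerA. Qed.
Lemma s_al i : s i (al i) = - al i.
Proof. by rewrite s_def pr_al (gcm2 hA) -{1}[al i]scale1r -scalerBl -scaleN1r. Qed.
Lemma pr_s i x : pr (s i x) i = - pr x i.
Proof. by rewrite s_def prB prZ pr_al (gcm2 hA); ring. Qed.
Lemma sK i x : s i (s i x) = x.
Proof. by rewrite [LHS]s_def pr_s s_def scaleNr opprK subrK. Qed.
Lemma s_k i x k : k != i -> s i x 0 k = x 0 k.
Proof. by move=> ki; rewrite s_def !mxE (negPf ki) andbF mulr0 subr0. Qed.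

Lemma act_cat u v x : act (u ++ v) x = act u (act v x).
Proof. by rewrite /act foldr_cat. Qed.
Lemma actD u x y : act u (x + y) = act u x + act u y.
Proof. by elim: u => //= i u ->; rewrite sD. Qed.
Lemma actZ u c x : act u (c *: x) = c *: act u x.
Proof. by elim: u => //= i u ->; rewrite sZ. Qed.
Lemma actN u x : act u (- x) = - act u x.
Proof. by rewrite -scaleN1r actZ scaleN1r. Qed.
Lemma actB u x y : act u (x - y) = act u x - act u y.
Proof. by rewrite actD actN. Qed.
Lemma act0 u : act u 0 = 0. Proof. by have := actZ u 0 0; rewrite !scale0r. Qed.
Lemma actVK u x : act (rev u) (act u x) = x.
Proof.
elim: u x => // i u IH x; rewrite rev_cons -cats1 act_cat /= -/(act u x).
by rewrite (sK i) IH.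
Qed.
Lemma actK u x : act u (act (rev u) x) = x.
Proof. by rewrite -{1}[u]revK actVK. Qed.

Definition nd j := E j <> 0.
Definition rt (x : 'rV[int]_l) :=
  x <> 0 /\ exists X : op, X <> 0 /\ (gsp x X \/ gsp (- x) X).

Lemma rtN x : rt x -> rt (- x).
Proof.
move=> [x0 [X [X0 hX]]]; split; first by move/eqP; rewrite oppr_eq0 => /eqP.
by exists X; split=> //; rewrite opprK; case: hX; [right|left].
Qed.
Lemma s_eq0 i x : s i x = 0 -> x = 0.
Proof. by move=> h; rewrite -(sK i x) h; exact: (act0 [:: i]). Qed.
Lemma sN i x : s i (- x) = - s i x. Proof. exact: (actN [:: i]). Qed.
Lemma rt_s i x : rt x -> rt (s i x).
Proof.
move=> [x0 [X [X0 hX]]]; split; first by move/s_eq0.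
exists (cj (simple_lift G i) X); split; first by move/cj_eq0.
by rewrite -sN; case: hX => /(gsp_S G hA i) h; [left|right]; exact: h.
Qed.
Lemma rt_act u x : rt x -> rt (act u x).
Proof. by move=> hx; elim: u => //= i u; exact: rt_s. Qed.

Lemma nneg0 (x : 'rV[int]_l) : nneg x -> nneg (- x) -> x = 0.
Proof.
move=> h1 h2; apply/rowP => k; apply/eqP; have := h2 k.
by rewrite !mxE oppr_ge0 eq_le (h1 k) => ->.
Qed.
Lemma nnegD (x y : 'rV[int]_l) : nneg x -> nneg y -> nneg (x + y).
Proof. by move=> h1 h2 k; rewrite mxE addr_ge0. Qed.
Lemma nnegZ c (x : 'rV[int]_l) : 0 <= c -> nneg x -> nneg (c *: x).
Proof. by move=> h1 h2 k; rewrite mxE mulr_ge0. Qed.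
Lemma nnegN0 (x : 'rV[int]_l) : nneg (- x) -> forall k, x 0 k <= 0.
Proof. by move=> h k; have := h k; rewrite mxE oppr_ge0. Qed.

Lemma rt_coh x : rt x -> nneg x \/ nneg (- x).
Proof.
move=> [_ [X [X0 [/gsp_coh|/gsp_coh]]]] h; first exact: h.
by case: (h X0); rewrite ?opprK; [right|left].
Qed.
Lemma rt_not x : rt x -> ~ nneg x -> nneg (- x).
Proof. by move=> /rt_coh[]. Qed.
Lemma rt_pm x : rt x -> nneg x -> ~ nneg (- x).
Proof. by move=> [x0 _] h1 h2; apply: x0; exact: nneg0. Qed.

Lemma rt_mul i z : rt (z *: al i) -> z = 1 \/ z = -1.
Proof.
move=> [x0 [X [X0 hX]]].
have z0 : z <> 0 by move=> e; apply: x0; rewrite e scale0r.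
case: hX => [/gsp_mul/(_ X0)[]|]; [by []|by left|by right|].
rewrite -scaleNr => /gsp_mul/(_ X0)[] e; [|right|left]; lia.
Qed.
Lemma rt_al i : nd i -> rt (al i).
Proof. by move=> h; split; [exact: al_neq0|exists (E i); split=> //; left; exact: gsp_E]. Qed.
Lemma rt_al_nd i : rt (al i) -> nd i.
Proof.
move=> [_ [X [X0 [/gsp_al[c e]|/gsp_alN[c e]]]]] h; apply: X0.
  by rewrite e h scaler0.
have eF : cj (simple_lift G i) (F i) = 0 by rewrite (cjSF _ _ hA) h oppr0.
by rewrite e (cj_eq0 eF) scaler0.
Qed.
Lemma gsp_hal b X i : gsp b X -> ad (hal Ms i) X = (pr b i)%:~R *: X.
Proof. by move=> /gsp_wt; exact: hal_wt. Qed.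
(** If e_i = 0, then alpha_i^vee = [e_i, f_i] acts by zero, whereas it acts on a root vector through
    the pairing. *)
Lemma rt_pr x i : rt x -> ~ nd i -> pr x i = 0.
Proof.
move=> [_ [X [X0 hX]]] /contrapT Ei.
have h0 : hal Ms i = 0 by rewrite -ad_EF Ei ad0l.
have key b : gsp b X -> pr b i = 0.
  move=> /(@gsp_hal _ _ i); rewrite h0 ad0l => /esym/eqP.
  by rewrite scaler_eq0 => /orP[|/eqP //]; rewrite intr_eq0 => /eqP.
by case: hX => /key; rewrite ?prN; lia.
Qed.

Definition real x := exists u j, nd j /\ x = act u (al j).

Lemma rt_off x i : rt x -> nneg x -> x <> al i -> exists2 k, k != i & 0 < x 0 k.
Proof.
move=> hx x0 xi; apply: contrapT => h.
have xk k : k != i -> x 0 k = 0.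
  move=> ki; apply: contrapT => e; apply: h; exists k => //.
  by have := x0 k; lia.
have ex : x = x 0 i *: al i.
  apply/rowP => k; rewrite !mxE eqxx /=; have [->|ki] := eqVneq k i.
    by rewrite mulr1.
  by rewrite xk // mulr0.
have := hx; rewrite ex => /rt_mul[] e.
  by apply: xi; rewrite ex e scale1r.
by have := x0 i; rewrite e.
Qed.

Lemma s_pos x i : rt x -> nneg x -> x <> al i -> nneg (s i x).
Proof.
move=> hx x0 xi; have [k ki xk] := rt_off hx x0 xi.
case: (rt_coh (rt_s i hx)) => // /nnegN0/(_ k).
by rewrite s_k // leNgt xk.
Qed.

(** The pairing of x with the coroot of the real root act u (al j), computed from a word for that
    root; on roots the value does not depend on the word ([co_wd]). *)
Definition co u j x := pr (act (rev u) x) j.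

Lemma coD u j x y : co u j (x + y) = co u j x + co u j y.
Proof. by rewrite /co actD prD. Qed.
Lemma coB u j x y : co u j (x - y) = co u j x - co u j y.
Proof. by rewrite /co actB prB. Qed.
Lemma coZ u j c x : co u j (c *: x) = c * co u j x.
Proof. by rewrite /co actZ prZ. Qed.
Lemma co_self u j : co u j (act u (al j)) = 2.
Proof. by rewrite /co actVK pr_al (gcm2 hA). Qed.

Lemma srE u j x : act (u ++ j :: rev u) x = x - co u j x *: act u (al j).
Proof. by rewrite act_cat /= s_def actB actZ actK. Qed.

(* w maps alpha_j to alpha_i, hence alpha_j^vee = [e_j, f_j] to alpha_i^vee. *)
Lemma coroot_transport u j i x : nd j -> act u (al j) = al i -> rt x ->
  pr (act u x) i = pr x j.
Proof.
move=> hj e [_ [X [X0 hX]]]; pose g := word_lift G u.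
have := gsp_W G hA u (gsp_E Ms j); rewrite -/g e => /gsp_al[c ec].
have := gsp_W G hA u (gsp_F Ms j); rewrite -/g actN e => /gsp_alN[c' ec'].
have hh : cj g (hal Ms j) = (c * c') *: hal Ms i.
  by rewrite -ad_EF cj_ad ec ec' adZl adZ ad_EF scalerA.
have key b (Y : op) : gsp b Y -> Y <> 0 -> (pr b j)%:~R = c * c' * (pr (act u b) i)%:~R :> C.
  move=> hY Y0; have := congr1 (cj g) (gsp_hal j hY).
  rewrite cj_ad hh adZl (gsp_hal i (gsp_W G hA u hY)) scalerA cjZ => /eqP.
  rewrite -subr_eq0 -scalerBl scaler_eq0 subr_eq0 => /orP[/eqP-> //|/eqP/cj_eq0 //].
have := key _ _ (gsp_E Ms j) hj; rewrite e !pr_al !(gcm2 hA) => e2.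
have cc : c * c' = 1.
  by apply: (@mulIf _ (2%:~R : C)); rewrite ?intr_eq0 // mul1r -e2.
rewrite cc in key; case: hX => /key/(_ X0); rewrite mul1r => /intr_inj //.
by rewrite actN !prN => /oppr_inj.
Qed.

Lemma co_wd u j v k x : nd j -> act u (al j) = act v (al k) -> rt x ->
  co u j x = co v k x.
Proof.
move=> hj e hx; have e' : act (rev v ++ u) (al j) = al k.
  by rewrite act_cat e actVK.
have := coroot_transport hj e' (rt_act (rev u) hx).
by rewrite act_cat actK => h; rewrite /co -h.
Qed.

(** The exchange condition. The letter k that turns the root negative meets it as alpha_k, and s_k
    then cancels against s_j. The two actions are compared on roots because [coroot_transport]
    compares coroots there. *)
Lemma deletion u j : nd j -> nneg (- act u (al j)) ->
  exists2 v, (size v < size u)%N & forall x, rt x -> act u x = act v (s j x).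
Proof.
move=> hj; elim: u => [|k u IH] /= h.
  by case: (rt_pm (rt_al hj) (@al_nneg _ j)).
have ru := rt_act u (rt_al hj).
case: (rt_coh ru) => hu; last first.
  have [v sv hv] := IH hu; exists (k :: v) => // x hx; by rewrite /= hv.
have e : act u (al j) = al k.
  apply: contrapT => ne; exact: (rt_pm (rt_s k ru) (s_pos ru hu ne) h).
exists u => // x hx; rewrite !s_def actB actZ e.
by rewrite (coroot_transport hj e hx).
Qed.

(** Induction on the length. For a word z followed by k: if z alpha_k is positive, s_k x differs
    from x by a nonnegative multiple of alpha_k, which z keeps positive; if it is negative,
    [deletion] shortens the word. *)
Lemma antidominant_min x z : rt x -> (forall k, pr x k <= 0) -> nneg (act z x - x).
Proof.
move=> hx ax; move: {2}(size z).+1 (ltnSn (size z)) => N.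
elim: N z => // N IH z; case/lastP: z => [_|z k].
  by move=> i; rewrite /= subrr mxE.
rewrite size_rcons => sz; rewrite -cats1 act_cat /=.
have [hk|hk] := pselect (nd k); last first.
  by rewrite s_def (rt_pr hx hk) scale0r subr0; apply: IH; lia.
case: (rt_coh (rt_act z (rt_al hk))) => h; last first.
  have [v sv ->] := deletion hk h; last exact: rt_s.
  by rewrite sK; apply: IH; lia.
rewrite s_def actB actZ addrAC -scaleNr; apply: nnegD; first by apply: IH; lia.
by apply: nnegZ => //; have := ax k; lia.
Qed.

(** The reflection in the positive real root adds - co u j x times that root to x, and it cannot
    lower x. *)
Lemma antidominant_co x u j : rt x -> (forall k, pr x k <= 0) -> nd j ->
  nneg (act u (al j)) -> co u j x <= 0.
Proof.
move=> hx ax hj hu; have := antidominant_min (u ++ j :: rev u) hx ax.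
rewrite srE addrAC subrr add0r => h.
have ru := rt_act u (rt_al hj).
rewrite leNgt; apply/negP => c0; apply: (rt_pm ru hu) => k.
have := h k; rewrite !mxE -mulrN pmulr_rge0 //.
Qed.

Lemma inversions_finite z : exists L : seq 'rV[int]_l, forall x,
  rt x -> nneg x -> nneg (- act z x) -> x \in L.
Proof.
elim: z => [|k z [L IH]]; first by exists [::] => x hx x0 /(rt_pm hx x0).
exists (act (rev z) (al k) :: L) => x hx x0 /= h; rewrite inE.
have rz := rt_act z hx.
case: (rt_coh rz) => hz; last by rewrite IH // orbT.
have e : act z x = al k.
  apply: contrapT => ne; exact: (rt_pm (rt_s k rz) (s_pos rz hz ne) h).
by rewrite -e actVK eqxx.
Qed.

(* Otherwise the reflection in gamma has infinitely many inversions. *)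
Lemma pairing_sign u j i : nd j -> nneg (act u (al j)) -> act u (al j) <> al i ->
  0 < pr (act u (al j)) i -> 0 < co u j (al i).
Proof.
move=> hj; set g := act u (al j) => g0 gi m0; rewrite ltNge; apply/negP => m'0.
set m := pr g i in m0; set m' := co u j (al i) in m'0.
have rg : rt g := rt_act u (rt_al hj).
have [k ki gk] := rt_off rg g0 gi.
(* This is minus the image under s_i s_gamma. As m > 0 >= m', both coefficients stay positive and c
   grows strictly, so roots with arbitrarily large c arise. *)
have step b c : rt (b *: g - c *: al i) ->
    rt ((b - c * m') *: g - (c + m * (b - c * m')) *: al i).
  move=> h; have := rtN (rt_s i (rt_act (u ++ j :: rev u) h)).
  rewrite srE -/g coB !coZ co_self -/m' !s_def; congr rt.
  rewrite !(prB, prZ) -/m pr_al (gcm2 hA).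
  by apply/rowP => t; rewrite !mxE; ring.
have big N : exists b c, [/\ 1 <= b, N%:Z <= c, 1 <= c & rt (b *: g - c *: al i)].
  elim: N => [|N [b [c [b1 cN c1 h]]]].
    exists 1, m; rewrite scale1r; split=> //; first by lia.
    exact: (rt_s i rg).
  have : c * m' <= 0 by rewrite mulr_ge0_le0 //; lia.
  move=> cm; have : 1 <= m * (b - c * m') by rewrite -[1]mulr1 ler_pM //; lia.
  move=> mb; exists (b - c * m'), (c + m * (b - c * m')); split; try lia.
  exact: step.
have [L hL] := inversions_finite (u ++ j :: rev u).
have inL b c : 1 <= b -> 1 <= c -> rt (b *: g - c *: al i) -> b *: g - c *: al i \in L.
  move=> b1 c1 h; apply: hL => //.
    case: (rt_coh h) => // /nnegN0/(_ k); rewrite !mxE (negPf ki) andbF mulr0 subr0.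
    by rewrite leNgt mulr_gt0 // (lt_le_trans ltr01).
  rewrite srE -/g coB !coZ co_self -/m'.
  have -> : - (b *: g - c *: al i - (b * 2 - c * m') *: g) = (b - c * m') *: g + c *: al i.
    by apply/rowP => t; rewrite !mxE; ring.
  apply: nnegD; apply: nnegZ => //; [|lia|exact: al_nneg].
  have : c * m' <= 0 by rewrite mulr_ge0_le0 //; lia.
  lia.
(* B bounds c for x = b gamma - c alpha_i: the k-th coordinate of x is b times a positive integer,
   so the first term is at least b gamma_i, and the second is at least c - b gamma_i. On the finite
   list L it is bounded. *)
pose B (x : 'rV[int]_l) := `|x 0 k| * g 0 i + `|x 0 i|.
have B0 x : 0 <= B x by apply: addr_ge0 => //; apply: mulr_ge0.
pose N := absz (\sum_(x <- L) B x).
have [b [c [b1 cN c1 h]]] := big N.+1.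
have xL := inL _ _ b1 c1 h; set x := b *: g - c *: al i in xL.
have Bx : B x <= N%:Z.
  rewrite /N gez0_abs; last by apply: sumr_ge0.
  by rewrite (big_rem _ xL) /= lerDl; apply: sumr_ge0.
have xk : x 0 k = b * g 0 k by rewrite /x !mxE (negPf ki) andbF mulr0 subr0.
have xi : x 0 i = b * g 0 i - c by rewrite /x !mxE !eqxx mulr1.
have : b * g 0 i <= `|x 0 k| * g 0 i.
  apply: ler_wpM2r => //; rewrite xk ger0_norm; last by apply: mulr_ge0; lia.
  by rewrite -{1}[b]mulr1 ler_wpM2l //; lia.
have : - x 0 i <= `|x 0 i| by rewrite -normrN ler_norm.
move: Bx cN; rewrite /B; set P := `|x 0 k| * g 0 i; set Q := `|x 0 i| => Bx cN h1.
rewrite xi in h1; move: (b * g 0 i) P Q Bx cN h1; clear => T P Q; lia.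
Qed.

Lemma pairing_signN u j i : nd j -> nneg (act u (al j)) -> act u (al j) <> al i ->
  pr (act u (al j)) i < 0 -> co u j (al i) < 0.
Proof.
move=> hj g0 gi m0; have rg := rt_act u (rt_al hj).
have g1 : nneg (act (i :: u) (al j)) by exact: s_pos.
have ne : act (i :: u) (al j) <> al i.
  move=> e; have e' : act u (al j) = - al i.
    by rewrite -[LHS](sK i) -[s i (act _ _)]/(act (i :: u) (al j)) e s_al.
  by have := g0 i; rewrite e' !mxE !eqxx.
have := pairing_sign hj g1 ne; rewrite /= pr_s oppr_gt0 => /(_ m0).
rewrite /co rev_cons -cats1 act_cat /= s_al actN prN; lia.
Qed.

(** A simple reflection with positive pairing lowers the height and keeps the root positive unless
    the root is that simple root; so the process stops at a simple root or at an antidominant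
    one. *)
Lemma real_or_antidominant x : rt x -> nneg x ->
  real x \/ exists z, nneg (act z x) /\ forall k, pr (act z x) k <= 0.
Proof.
move: {2}(absz (\sum_k x 0 k)).+1 (ltnSn (absz (\sum_k x 0 k))) => N.
elim: N x => // N IH x sx hx x0.
have [[k hk]|h] := pselect (exists k, 0 < pr x k); last first.
  right; exists [::]; split=> // k /=; rewrite leNgt; apply/negP => hk.
  by apply: h; exists k.
have [e|ne] := pselect (x = al k).
  by left; exists [::], k; split=> //; apply: rt_al_nd; rewrite -e.
have y0 := s_pos hx x0 ne.
have sm : \sum_t s k x 0 t = \sum_t x 0 t - pr x k.
  have -> : \sum_t s k x 0 t = \sum_t (x 0 t - pr x k * al k 0 t).
    by apply: eq_bigr => t _; rewrite s_def !mxE.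
  by rewrite sumrB -mulr_sumr al_sum mulr1.
have ge0 (y : 'rV[int]_l) : nneg y -> 0 <= \sum_t y 0 t by move=> h; apply: sumr_ge0.
have := ge0 _ x0; have := ge0 _ y0; rewrite sm => h1 h2.
have [] := IH (s k x); rewrite ?sm //; try exact: rt_s.
- by lia.
- move=> [u [j [hj e]]]; left; exists (k :: u), j; split=> //=.
  by rewrite -/(act u _) -e sK.
- move=> [z [z0 hz]]; right; exists (rcons z k); rewrite -cats1 act_cat /=.
  by split.
Qed.

Lemma sub_simple_nneg x i : rt x -> nneg x -> x <> al i -> rt (x - al i) ->
  nneg (x - al i).
Proof.
move=> hx x0 xi h; have [k ki xk] := rt_off hx x0 xi.
case: (rt_coh h) => // /nnegN0/(_ k); rewrite !mxE (negPf ki) andbF subr0.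
by rewrite leNgt xk.
Qed.

(** Otherwise some z takes beta = gamma - alpha_i to a positive antidominant root. As beta pairs
    positively with the coroot of gamma and negatively with alpha_i^vee, z gamma is negative and z
    alpha_i positive; but then z beta is negative. *)
Lemma sub_simple_real u j i : nd j -> nd i -> nneg (act u (al j)) ->
  act u (al j) <> al i -> pr (act u (al j)) i <= 0 -> co u j (al i) <= 0 ->
  rt (act u (al j) - al i) -> real (act u (al j) - al i).
Proof.
set g := act u (al j) => hj hi g0 gi m0 m'0 hb.
have rg : rt g := rt_act u (rt_al hj).
have b0 := sub_simple_nneg rg g0 gi hb.
have [//|[z [z0 az]]] := real_or_antidominant hb b0; exfalso.
have rz := rt_act z hb.
have h1 : nneg (- act z g).
  apply: rt_not; first exact: rt_act.
  move=> zg; have := antidominant_co rz az hj (u := z ++ u).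
  rewrite act_cat => /(_ zg); rewrite /co rev_cat act_cat actVK -/(co u j _).
  by rewrite coB co_self; lia.
have h2 : nneg (act z (al i)).
  rewrite -[act z _]opprK; apply: rt_not; first by apply/rtN/rt_act/rt_al.
  move=> zi; have := antidominant_co rz az hi (u := z ++ [:: i]).
  rewrite act_cat /= s_al actN => /(_ zi); rewrite /co rev_cat act_cat actVK /=.
  by rewrite pr_s prB pr_al (gcm2 hA); lia.
apply: (rt_pm rz z0); rewrite actB opprB addrC; exact: nnegD.
Qed.

(** Undoing u turns the first root into alpha_j. According to the sign of the other root after this,
    [pairing_sign] applies to it or [pairing_signN] to its negative. *)
Lemma co_pos_sym u j v k : nd j -> nd k -> nneg (act u (al j)) -> nneg (act v (al k)) ->
  act u (al j) <> act v (al k) -> 0 < co u j (act v (al k)) -> 0 < co v k (act u (al j)).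
Proof.
move=> hj hk g0 b0 ne c0.
pose w := rev u ++ v; have ew : act w (al k) = act (rev u) (act v (al k)) by rewrite act_cat.
have cw : co w k (al j) = co v k (act u (al j)).
  by rewrite /co rev_cat revK act_cat.
have rw := rt_act w (rt_al hk).
case: (rt_coh rw) => hw.
  rewrite -cw; apply: pairing_sign => //; last by rewrite ew.
  by move=> e; apply: ne; rewrite -e ew actK.
have ew' : act (w ++ [:: k]) (al k) = - act w (al k) by rewrite act_cat /= s_al actN.
have := @pairing_signN (w ++ [:: k]) k j hk; rewrite ew' => /(_ hw).
rewrite /co rev_cat act_cat /= -[act (rev w) _]/(act (rev w) _) pr_s -/(co w k _) cw.
rewrite prN oppr_lt0 ew => h; rewrite -oppr_lt0; apply: h => //.
move=> e; have : nneg (- act v (al k)).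
  by rewrite -[act v _](actK u) -actN e.
by move/(rt_pm (rt_act v (rt_al hk)) b0).
Qed.

(** With beta = gamma - alpha_i the sign lemmas give <alpha_i, beta^vee> < 0 < <gamma, beta^vee> = 2
    + <alpha_i, beta^vee>, hence the value -1. So gamma is the reflection of alpha_i in beta, and
    this reflection makes the two pairings of gamma with alpha_i equal. *)
Lemma sub_simple_string u j i v k : nd j -> nd i -> nd k -> nneg (act u (al j)) ->
  act u (al j) <> al i -> pr (act u (al j)) i <= 0 -> co u j (al i) <= 0 ->
  rt (act u (al j) - al i) -> act u (al j) - al i = act v (al k) ->
  co v k (al i) = -1 /\ co u j (al i) = pr (act u (al j)) i.
Proof.
set g := act u (al j) => hj hi hk g0 gi m0 m'0 hb e.
have rg : rt g := rt_act u (rt_al hj).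
have b0 := sub_simple_nneg rg g0 gi hb; rewrite e in b0 hb.
have bi : act v (al k) <> al i.
  rewrite -e => e2; have : rt (2 *: al i).
    by rewrite -[2]/(1 + 1) scalerDl scale1r -{1}e2 subrK.
  by case/rt_mul.
have prb : pr (act v (al k)) i < 0 by rewrite -e prB pr_al (gcm2 hA); lia.
have c1 := pairing_signN hk b0 bi prb.
have cg : co v k g = 2 + co v k (al i) by rewrite -[g](subrK (al i)) coD e co_self.
have c2 : 0 < co v k g.
  apply: co_pos_sym => //.
    by rewrite -e => e2; case: (rt_al hi) => + _; apply; rewrite -[al i]opprK -[- al i](addKr g) -e2 addNr oppr0.
  by rewrite -e coB co_self; lia.
have c3 : co v k (al i) = -1 by lia.
split=> //.
have eg : g = act (v ++ k :: rev v) (al i).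
  by rewrite srE c3 scaleN1r opprK -e addrC subrK.
rewrite (co_wd hj (eg : act u (al j) = _) (rt_al hi)) /co rev_cat rev_cons revK.
by rewrite -cats1 -catA /= -eg.
Qed.

(** If beta - alpha_i were a root, [sub_simple_string] for beta in place of gamma would give <beta,
    alpha_i^vee> = -1, but it is <gamma, alpha_i^vee> - 2 <= -2. The reflection in beta takes beta +
    gamma to -(beta - alpha_i), which settles the other claim. Both make brackets vanish in
    [star_sign]. *)
Lemma sub_simple_bottom u j i v k : nd j -> nd i -> nd k -> nneg (act u (al j)) ->
  act u (al j) <> al i -> pr (act u (al j)) i <= 0 -> co u j (al i) <= 0 ->
  rt (act u (al j) - al i) -> act u (al j) - al i = act v (al k) ->
  ~ rt (act v (al k) - al i) /\ ~ rt (act v (al k) + act u (al j)).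
Proof.
set g := act u (al j) => hj hi hk g0 gi m0 m'0 hb e.
have rg : rt g := rt_act u (rt_al hj).
have [c3 _] := sub_simple_string hj hi hk g0 gi m0 m'0 hb e.
have b0 := sub_simple_nneg rg g0 gi hb; rewrite e in b0 hb.
have bi : act v (al k) <> al i.
  rewrite -e => e2; have : rt (2 *: al i).
    by rewrite -[2]/(1 + 1) scalerDl scale1r -{1}e2 subrK.
  by case/rt_mul.
have prb : pr (act v (al k)) i = pr g i - 2 by rewrite -e prB pr_al (gcm2 hA).
have nb : ~ rt (act v (al k) - al i).
  move=> h; have [||v' [k' [hk' e']]] := sub_simple_real hk hi b0 bi _ _ h; try lia.
  have [||_ ] := sub_simple_string hk hi hk' b0 bi _ _ h e'; try lia.
split=> // h; apply: nb; have := rtN (rt_act (v ++ k :: rev v) h); congr rt.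
rewrite srE coD co_self -[g](subrK (al i)) e coD co_self c3.
by apply/rowP => t; rewrite !mxE; ring.
Qed.

End Roots.

(** The elements g for which left multiplication by g and by g^-1 preserves P form a subgroup, and
    it contains S. *)
Lemma generated_ind (G : groupType) (S P : set G) : P 1%g ->
  (forall s g, S s -> P g -> P (s * g)%g) -> (forall s, S s -> S (s^-1)%g) ->
  generated_by S `<=` P.
Proof.
move=> P1 PS SV g hg.
pose H : set G := [set g | forall h, P h -> P (g * h)%g /\ P (g^-1 * h)%g].
have HH : is_subgroup H.
  split=> [h Ph|x y Hx Hy h Ph]; first by rewrite invg1 mul1g.
  split; first by rewrite -mulgA; apply: (Hx _ _).1; apply: (Hy _ _).2.
  by rewrite invgM invgK -mulgA; apply: (Hy _ _).1; apply: (Hx _ _).2.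
have SH : S `<=` H by move=> s hs h Ph; split; apply: PS => //; exact: SV.
have Hg : H g by exact: hg.
by have := (Hg _ P1).1; rewrite mulg1.
Qed.

Lemma simple_liftE (R : realType) (l : nat) (A : 'M[int]_l) (D : realization A)
    (G : kac_moody_group R D) (i : 'I_l) :
  simple_lift G i = (km_x G i 1%R * km_y G i (- 1)%R * km_x G i 1%R)%g.
Proof. by []. Qed.
#[global] Opaque simple_lift.

(** * The torus and the minimal parabolic subgroups *)

Section Torus.
Variables (R : realType) (l : nat) (A : 'M[int]_l) (D : realization A).
Variable G : kac_moody_group R D.
Hypothesis hA : is_gcm A.
Local Notation C := R[i].
Local Notation n := (rlz_dim D).
Local Notation md := (integrable_module R D).
Local Notation S i := (simple_lift G i).
Local Notation x_ := (km_x G).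
Local Notation y_ := (km_y G).
Local Notation T_ := (km_t G).
Local Notation torus_char := (@torus_char R l A D).
Implicit Types (t : 'rV[C]_n) (lam mu : 'rV[int]_n) (i : 'I_l) (g h : G) (a b c : C).

Definition fam1 (M : md) : unit -> md := fun=> M.

Lemma rho_inj g h : (forall M, rho (fam1 M) g = rho (fam1 M) h) -> g = h :> G.
Proof.
move=> e; apply: (@mulIg _ (h^-1)%g); rewrite mulgV; apply: km_faithful => M v.
have := congr1 (fun X : op (fam1 M) => X tt v) (congr1 (fun X => X * rho (fam1 M) (h^-1)%g) (e M)).
by rewrite -!rhoM mulgV rho1.
Qed.

(** Every M is tested inside a larger family F M that contains it at the index [i0]; this leaves
    room for the witnesses that [fam] adds. *)
Lemma exp_inj (I : Type) (F : md -> I -> md) (X : forall M, op (F M)) (i0 : I) g h :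
  (forall M, F M i0 = M) -> (forall M, locnil (X M)) ->
  (forall M, is_exp (X M) (rho (F M) g)) -> (forall M, is_exp (X M) (rho (F M) h)) ->
  g = h :> G.
Proof.
move=> hF nX eg eh; apply: rho_inj => M; apply: opP => -[] v.
have e : rho (F M) g = rho (F M) h := is_exp_uniq (nX M) (eg M) (eh M).
have {e} : forall v, km_rep (F M i0) g v = km_rep (F M i0) h v.
  by move=> u; exact: (congr1 (fun X : op (F M) => X i0 u) e).
by rewrite /= hF; apply.
Qed.

Lemma op_wt_ext (I : Type) (Ms : I -> md) (X Y : op Ms) :
  (forall k lam v, weight_vector (@im_h _ _ _ _ (Ms k)) lam v -> X k v = Y k v) -> X = Y.
Proof.
move=> h; apply: opP => k v; have [s [-> hs]] := im_weight v.
rewrite !linear_sum; apply: eq_big_seq => x /hs[lam hx]; exact: h hx.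
Qed.

Lemma opLZ (I : Type) (Ms : I -> md) (X : op Ms) k c v : X k (c *: v) = c *: X k v.
Proof. exact: linearZ. Qed.

Lemma cj_rho (I : Type) (Ms : I -> md) g (X : op Ms) : cj g X * rho Ms g = rho Ms g * X.
Proof. by rewrite /cj -mulrA rhoVl mulr1. Qed.

Lemma rho_T (I : Type) (Ms : I -> md) t k lam v : torus t ->
  weight_vector (@im_h _ _ _ _ (Ms k)) lam v ->
  rho Ms (T_ t) k v = torus_char lam t *: v.
Proof. by move=> ht hv; exact: km_rep_t. Qed.

Definition tmul (t t' : 'rV[C]_n) : 'rV[C]_n := \row_k (t 0 k * t' 0 k).
Lemma tmulP t t' : torus t -> torus t' -> torus (tmul t t').
Proof. by move=> h h' k; rewrite mxE mulf_neq0. Qed.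
Lemma char_neq0 t lam : torus t -> torus_char lam t != 0.
Proof. by move=> h; apply/prodf_neq0 => k _; rewrite expfz_neq0. Qed.
Lemma char_mul t t' lam : torus_char lam (tmul t t') = torus_char lam t * torus_char lam t'.
Proof. by rewrite -big_split; apply: eq_bigr => k _; rewrite mxE expfzMl. Qed.
Lemma charD t lam mu : torus t -> torus_char (lam + mu) t = torus_char lam t * torus_char mu t.
Proof. by move=> h; rewrite -big_split; apply: eq_bigr => k _; rewrite mxE expfzDr. Qed.
Lemma charN t lam : torus t -> torus_char (- lam) t = (torus_char lam t)^-1.
Proof. by move=> h; rewrite /torus_char -prodfV; apply: eq_bigr => k _; rewrite mxE invr_expz. Qed.

Definition tinv (t : 'rV[C]_n) : 'rV[C]_n := \row_k (t 0 k)^-1.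
Lemma tinvP t : torus t -> torus (tinv t).
Proof. by move=> h k; rewrite mxE invr_eq0. Qed.

Lemma T_mul t t' : torus t -> torus t' -> T_ (tmul t t') = (T_ t * T_ t')%g.
Proof.
move=> h h'; apply: rho_inj => M; apply: op_wt_ext => k lam v hv.
rewrite rhoM opME (rho_T (tmulP h h') hv) (rho_T h' hv) opLZ (rho_T h hv).
by rewrite scalerA char_mul mulrC.
Qed.
Lemma T_1 t : (forall k, t 0 k = 1) -> T_ t = 1%g.
Proof.
move=> h; have ht : torus t by move=> k; rewrite h oner_neq0.
apply: rho_inj => M; apply: op_wt_ext => k lam v hv.
rewrite rho1 (rho_T ht hv) op1E /torus_char big1 ?scale1r // => j _.
by rewrite h exp1rz.
Qed.
Lemma T_inv t : torus t -> T_ (tinv t) = ((T_ t)^-1)%g.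
Proof.
move=> h; apply: (@mulIg _ (T_ t)); rewrite mulVg -T_mul //; last exact: tinvP.
by apply: T_1 => k; rewrite !mxE mulVf.
Qed.

Lemma rho_TV (I : Type) (Ms : I -> md) t k lam v : torus t ->
  weight_vector (@im_h _ _ _ _ (Ms k)) lam v ->
  rho Ms ((T_ t)^-1)%g k v = (torus_char lam t)^-1 *: v.
Proof.
move=> ht hv; rewrite -T_inv // (rho_T (tinvP ht) hv); congr (_ *: _).
rewrite /torus_char -prodfV; apply: eq_bigr => j _.
by rewrite mxE exprz_inv invr_expz.
Qed.

Section Family.
Variables (I : Type) (Ms : I -> md).

Lemma wv_E i lam k v : weight_vector (@im_h _ _ _ _ (Ms k)) lam v ->
  weight_vector (@im_h _ _ _ _ (Ms k)) (lam + rwt D (al i)) (oE Ms i k v).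
Proof.
move=> hv m; have := congr1 (fun X : op Ms => X k v) (wt_E Ms i m).
rewrite /ad opDE opNE !opME opZE => /eqP; rewrite subr_eq => /eqP e.
rewrite -[LHS]/(oH Ms m k (oE Ms i k v)) e [oH Ms m k v]hv opLZ.
by rewrite -scalerDl [(lam + _) 0 m]mxE rmorphD addrC.
Qed.
Lemma wv_F i lam k v : weight_vector (@im_h _ _ _ _ (Ms k)) lam v ->
  weight_vector (@im_h _ _ _ _ (Ms k)) (lam - rwt D (al i)) (oF Ms i k v).
Proof.
move=> hv m; have := congr1 (fun X : op Ms => X k v) (wt_F Ms i m).
rewrite /ad opDE opNE !opME opZE => /eqP; rewrite subr_eq => /eqP e.
rewrite -[LHS]/(oH Ms m k (oF Ms i k v)) e [oH Ms m k v]hv opLZ.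
by rewrite -scalerDl rwtN [(lam - _) 0 m]mxE rmorphD addrC.
Qed.

Lemma cjT_E t i : torus t -> cj (T_ t) (oE Ms i) = torus_char (rwt D (al i)) t *: oE Ms i.
Proof.
move=> ht; apply: op_wt_ext => k lam v hv; rewrite !opME (rho_TV ht hv) !opLZ.
rewrite (rho_T ht (wv_E i hv)) opZE scalerA charD // mulrA mulVf ?mul1r //.
exact: char_neq0.
Qed.
Lemma cjT_F t i : torus t ->
  cj (T_ t) (oF Ms i) = (torus_char (rwt D (al i)) t)^-1 *: oF Ms i.
Proof.
move=> ht; apply: op_wt_ext => k lam v hv; rewrite !opME (rho_TV ht hv) !opLZ.
rewrite (rho_T ht (wv_F i hv)) opZE scalerA charD // mulrA mulVf ?mul1r.
  by rewrite charN.
exact: char_neq0.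
Qed.

Definition cpair (lam : 'rV[int]_n) i := \sum_k rlz_coroot D i k * lam 0 k.
Definition wrefl i (lam : 'rV[int]_n) := lam - cpair lam i *: row i (rlz_root D).

Lemma wv_hal i lam k v : weight_vector (@im_h _ _ _ _ (Ms k)) lam v ->
  hal Ms i k v = (cpair lam i)%:~R *: v.
Proof.
move=> hv; rewrite /hal op_sumE rmorph_sum scaler_suml; apply: eq_bigr => m _.
by rewrite opZE [oH _ _ _ _]hv scalerA -rmorphM.
Qed.

Lemma wv_S i lam k v : weight_vector (@im_h _ _ _ _ (Ms k)) lam v ->
  weight_vector (@im_h _ _ _ _ (Ms k)) (wrefl i lam) (rho Ms (S i) k v).
Proof.
move=> hv m; pose r : C := (rlz_root D i m)%:~R.
have e : oH Ms m = cj (S i) (oH Ms m - r *: hal Ms i).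
  by rewrite cjD cjN cjZ (cjSH _ _ hA) (cjSh _ hA) scalerN opprK subrK.
have := congr1 (fun X : op Ms => X k v) (cj_rho (S i) (oH Ms m - r *: hal Ms i)).
rewrite -e !opME opDE opNE opZE [oH _ _ _ v]hv (wv_hal i hv) scalerA -scalerBl opLZ => h.
rewrite -[LHS]/(oH Ms m k (rho Ms (S i) k v)) h.
congr (_ *: _); rewrite /wrefl !mxE rmorphB rmorphM /= -/r; congr (_ - _).
by rewrite mulrC.
Qed.
End Family.

Definition trefl i (t : 'rV[C]_n) : 'rV[C]_n :=
  \row_k (t 0 k * torus_char (row i (rlz_root D)) t ^ (- rlz_coroot D i k)).
Lemma treflP i t : torus t -> torus (trefl i t).
Proof. by move=> h k; rewrite mxE mulf_neq0 // expfz_neq0 // char_neq0. Qed.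

Lemma charZ (z : int) lam t : torus t -> torus_char (z *: lam) t = torus_char lam t ^ z.
Proof.
move=> h; rewrite /torus_char.
have -> : (\prod_k t 0 k ^ lam 0 k) ^ z = \prod_k (t 0 k ^ lam 0 k) ^ z.
  by elim/big_rec2: _ => [|k a b _ <-]; rewrite ?exp1rz // expfzMl.
by apply: eq_bigr => k _; rewrite mxE mulrC exprz_exp.
Qed.

Lemma char_trefl i t lam : torus t -> torus_char lam (trefl i t) = torus_char (wrefl i lam) t.
Proof.
move=> h; rewrite /wrefl charD // charN // charZ // /torus_char.
under eq_bigr do rewrite mxE expfzMl.
rewrite big_split; congr (_ * _); rewrite -/(torus_char (row i (rlz_root D)) t).
set c := torus_char _ _; have c0 : c != 0 by exact: char_neq0.
rewrite invr_expz /cpair -sumrN.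
have -> : c ^ (\sum_k - (rlz_coroot D i k * lam 0 k)) = \prod_k c ^ (- (rlz_coroot D i k * lam 0 k)).
  by elim/big_rec2: _ => [|k a b _ <-]; rewrite ?expr0z // expfzDr.
by apply: eq_bigr => k _; rewrite exprz_exp mulNr.
Qed.

Lemma lift_torus i t : torus t -> ((S i)^-1 * T_ t * S i)%g = T_ (trefl i t).
Proof.
move=> h; apply: rho_inj => M; apply: op_wt_ext => k lam v hv.
rewrite (rhoM _ ((S i)^-1 * T_ t)%g (S i)) (rhoM _ ((S i)^-1)%g (T_ t)) !opME.
rewrite (rho_T h (wv_S i hv)) opLZ -opME rhoVl op1E.
by rewrite (rho_T (treflP i h) hv) char_trefl.
Qed.

Lemma is_expZ_conj (I : Type) (Ms : I -> md) (X : op Ms) a g h c :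
  is_exp (a *: X) (rho Ms h) -> cj g X = c *: X ->
  is_exp ((a * c) *: X) (rho Ms (g * h * g^-1)%g).
Proof. by move=> e ec; have := cj_exp (g:=g) e; rewrite cjZ ec scalerA. Qed.

Lemma T_x t i a : torus t ->
  (T_ t * x_ i a * (T_ t)^-1)%g = x_ i (torus_char (rwt D (al i)) t * a).
Proof.
move=> h; apply: (@exp_inj unit fam1
   (fun M => (a * torus_char (rwt D (al i)) t) *: oE (fam1 M) i) tt) => // M.
- exact: (locnilZ _ (@oE_nil _ _ _ _ _ _ i)).
- by apply: is_expZ_conj (cjT_E _ _ h); exact: exp_x.
- by rewrite mulrC; exact: exp_x.
Qed.
Lemma T_y t i a : torus t ->
  (T_ t * y_ i a * (T_ t)^-1)%g = y_ i ((torus_char (rwt D (al i)) t)^-1 * a).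
Proof.
move=> h; apply: (@exp_inj unit fam1
   (fun M => (a * (torus_char (rwt D (al i)) t)^-1) *: oF (fam1 M) i) tt) => // M.
- exact: (locnilZ _ (@oF_nil _ _ _ _ _ _ i)).
- by apply: is_expZ_conj (cjT_F _ _ h); exact: exp_y.
- by rewrite mulrC; exact: exp_y.
Qed.

Lemma xD i a b : (x_ i a * x_ i b)%g = x_ i (a + b).
Proof.
apply: (@exp_inj unit fam1 (fun M => (a + b) *: oE (fam1 M) i) tt) => // M.
- exact: (locnilZ _ (@oE_nil _ _ _ _ _ _ i)).
- rewrite rhoM scalerDl; apply: is_exp_comm; try exact: exp_x; try exact: (locnilZ _ (@oE_nil _ _ _ _ _ _ i)).
  by rewrite !opZMl !opZMr !scalerA mulrC.
- exact: exp_x.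
Qed.
Lemma yD i a b : (y_ i a * y_ i b)%g = y_ i (a + b).
Proof.
apply: (@exp_inj unit fam1 (fun M => (a + b) *: oF (fam1 M) i) tt) => // M.
- exact: (locnilZ _ (@oF_nil _ _ _ _ _ _ i)).
- rewrite rhoM scalerDl; apply: is_exp_comm; try exact: exp_y; try exact: (locnilZ _ (@oF_nil _ _ _ _ _ _ i)).
  by rewrite !opZMl !opZMr !scalerA mulrC.
- exact: exp_y.
Qed.
Lemma x0 i : x_ i 0 = 1%g.
Proof. by apply: (@mulIg _ (x_ i 0)); rewrite xD addr0 mul1g. Qed.
Lemma y0 i : y_ i 0 = 1%g.
Proof. by apply: (@mulIg _ (y_ i 0)); rewrite yD addr0 mul1g. Qed.
Lemma xV i a : ((x_ i a)^-1)%g = x_ i (- a).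
Proof. by apply: (@mulIg _ (x_ i a)); rewrite xD addNr mulVg x0. Qed.
Lemma yV i a : ((y_ i a)^-1)%g = y_ i (- a).
Proof. by apply: (@mulIg _ (y_ i a)); rewrite yD addNr mulVg y0. Qed.

Lemma lift_x i a : (S i * x_ i a * (S i)^-1)%g = y_ i (- a).
Proof.
apply: (@exp_inj unit fam1 (fun M => (- a) *: oF (fam1 M) i) tt) => // M.
- exact: (locnilZ _ (@oF_nil _ _ _ _ _ _ i)).
- have := cj_exp (g:=S i) (exp_x G (Ms := fam1 M) (i := i) (a := a)).
  by rewrite cjZ (cjSE _ _ hA) scalerN scaleNr.
- exact: exp_y.
Qed.
Lemma lift_y i a : (S i * y_ i a * (S i)^-1)%g = x_ i (- a).
Proof.
apply: (@exp_inj unit fam1 (fun M => (- a) *: oE (fam1 M) i) tt) => // M.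
- exact: (locnilZ _ (@oE_nil _ _ _ _ _ _ i)).
- have := cj_exp (g:=S i) (exp_y G (Ms := fam1 M) (i := i) (a := a)).
  by rewrite cjZ (cjSF _ _ hA) scalerN scaleNr.
- exact: exp_x.
Qed.

Definition cochar (lam : 'rV[int]_n) (c : C) : 'rV[C]_n := \row_k c ^ lam 0 k.
Lemma cocharP lam c : c != 0 -> torus (cochar lam c).
Proof. by move=> h k; rewrite mxE expfz_neq0. Qed.
Definition dot (mu lam : 'rV[int]_n) : int := \sum_k mu 0 k * lam 0 k.
Lemma char_cochar mu lam c : c != 0 -> torus_char mu (cochar lam c) = c ^ dot mu lam.
Proof.
move=> c0; have -> : c ^ dot mu lam = \prod_k c ^ (mu 0 k * lam 0 k).
  by rewrite /dot; elim/big_rec2: _ => [|k a b _ <-]; rewrite ?expr0z // expfzDr.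
by apply: eq_bigr => k _; rewrite mxE exprz_exp mulrC.
Qed.
Definition crefl i (lam : 'rV[int]_n) : 'rV[int]_n :=
  lam - dot (row i (rlz_root D)) lam *: row i (rlz_coroot D).
Lemma trefl_cochar i lam c : c != 0 -> trefl i (cochar lam c) = cochar (crefl i lam) c.
Proof.
move=> c0; apply/rowP => k; rewrite mxE char_cochar // !mxE exprz_exp -expfzDr //.
by rewrite mulrN.
Qed.
Lemma cochar_mul lam c c' : tmul (cochar lam c) (cochar lam c') = cochar lam (c * c').
Proof. by apply/rowP => k; rewrite !mxE expfzMl. Qed.
Lemma cochar_inv lam c : tinv (cochar lam c) = cochar lam c^-1.
Proof. by apply/rowP => k; rewrite !mxE exprz_inv invr_expz. Qed.
Lemma dot_root i j : dot (row j (rlz_root D)) (row i (rlz_coroot D)) = A i j.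
Proof.
have /matrixP/(_ i j) := rlz_pairing D; rewrite mxE => <-.
by apply: eq_bigr => k _; rewrite !mxE mulrC.
Qed.
Definition ch i c := T_ (cochar (row i (rlz_coroot D)) c).

Lemma chM i c c' : c != 0 -> c' != 0 -> (ch i c * ch i c')%g = ch i (c * c').
Proof. by move=> h h'; rewrite /ch -T_mul ?cochar_mul //; exact: cocharP. Qed.
Lemma chV i c : c != 0 -> ((ch i c)^-1)%g = ch i c^-1.
Proof. by move=> h; rewrite /ch -T_inv ?cochar_inv //; exact: cocharP. Qed.
Lemma lift_ch i c : c != 0 -> (S i * ch i (c^-1)%R)%g = (ch i c * S i)%g.
Proof.
move=> c0; have := lift_torus i (cocharP (row i (rlz_coroot D)) c0).
rewrite trefl_cochar // /crefl dot_root (gcm2 hA) => e.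
have -> : ch i c^-1 = ((S i)^-1 * ch i c * S i)%g.
  rewrite e; congr T_; apply/rowP => k; rewrite !mxE exprz_inv; congr (_ ^ _).
  by ring.
by rewrite -(mulgA ((S i)^-1)%g) mulVKg.
Qed.

(* S = x(1)y(-1)x(1) conjugated by a square root of a *)
Lemma n_ch i a : a != 0 -> (x_ i a * y_ i (- a^-1)%R * x_ i a)%g = (ch i a * S i)%g.
Proof.
move=> a0; pose c := sqrtC a; have c2 : c * c = a by rewrite -expr2 sqrtCK.
have c0 : c != 0 by rewrite sqrtC_eq0.
have tc := cocharP (row i (rlz_coroot D)) c0.
have e2 : torus_char (rwt D (al i)) (cochar (row i (rlz_coroot D)) c) = a.
  by rewrite char_cochar // rwt_al dot_root (gcm2 hA) -c2.
have ex : (ch i c * x_ i 1%R * (ch i c)^-1)%g = x_ i a by rewrite T_x // e2 mulr1.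
have ey : (ch i c * y_ i (- 1)%R * (ch i c)^-1)%g = y_ i (- a^-1)%R.
  by rewrite T_y // e2 mulrN1.
rewrite -ex -ey -c2 -chM // -[RHS]mulgA -lift_ch // -chV // simple_liftE.
by rewrite !mulgA !mulgVK.
Qed.
Lemma liftV i : ((S i)^-1)%g = (ch i (-1)%R * S i)%g.
Proof.
rewrite -n_ch ?oppr_eq0 ?oner_neq0 // simple_liftE !invgM !xV yV mulgA.
by rewrite opprK invrN1 opprK.
Qed.
Lemma lift_bruhat i b : b != 0 ->
  y_ i b = (x_ i (b^-1)%R * ch i (- b^-1)%R * S i * x_ i (b^-1)%R)%g.
Proof.
move=> b0; have nb : - b^-1 != 0 by rewrite oppr_eq0 invr_eq0.
have := n_ch i nb; rewrite invrN invrK opprK => /(congr1 (fun g => x_ i (b^-1)%R * g * x_ i (b^-1)%R)%g).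
rewrite !mulgA xD subrr x0 mul1g => <-.
by rewrite -mulgA xD addNr x0 mulg1.
Qed.

End Torus.

(* simple_lift made opaque: unification would unfold it into a product *)
Lemma sl_ex (R : realType) (l : nat) (A : 'M[int]_l) (D : realization A)
  (G : kac_moody_group R D) : {f : 'I_l -> G | forall i, f i = simple_lift G i}.
Proof. by exists (simple_lift G). Qed.

(** * The Borel subgroup and the Bruhat cells of the minimal parabolic subgroups *)

Section Parabolic.
Variables (R : realType) (l : nat) (A : 'M[int]_l) (D : realization A).
Variable G : kac_moody_group R D.
Hypothesis hA : is_gcm A.
Local Notation C := R[i].
Local Notation n := (rlz_dim D).
Local Notation md := (integrable_module R D).
Definition sl (i : 'I_l) : G := sval (sl_ex G) i.
Lemma slE i : sl i = simple_lift G i. Proof. exact: (svalP (sl_ex G)). Qed.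
Local Notation S i := (sl i).
Local Notation x_ := (km_x G).
Local Notation y_ := (km_y G).
Local Notation T_ := (km_t G).
Local Notation W := (word_lift G).
Local Notation ch i c := (@ch R l A D G i c).
Local Notation B := (@borel R l A D G).
Local Notation act := (act A).
Local Notation pr := (pr A).
Implicit Types (u v : seq 'I_l) (i j k : 'I_l) (c : C).

Lemma S_x i a : (S i * x_ i a * (S i)^-1)%g = y_ i (- a).
Proof. by rewrite slE; exact: lift_x. Qed.
Lemma S_y i a : (S i * y_ i a * (S i)^-1)%g = x_ i (- a).
Proof. by rewrite slE; exact: lift_y. Qed.
Lemma S_ch i c : c != 0 -> (S i * ch i (c^-1)%R)%g = (ch i c * S i)%g.
Proof. by rewrite slE; exact: lift_ch. Qed.
Lemma SV i : ((S i)^-1)%g = (ch i (-1)%R * S i)%g.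
Proof. by rewrite slE; exact: liftV. Qed.
Lemma y_bruhat i b : b != 0 ->
  y_ i b = (x_ i (b^-1)%R * ch i (- b^-1)%R * S i * x_ i (b^-1)%R)%g.
Proof. by rewrite slE; exact: lift_bruhat. Qed.
Lemma T_refl i t : torus t -> ((S i)^-1 * T_ t * S i)%g = T_ (trefl i t).
Proof. by rewrite slE; exact: lift_torus. Qed.
Lemma W_cons i u : W (i :: u) = (S i * W u)%g. Proof. by rewrite slE. Qed.

Definition ndg j := exists (M : md) (v : M), @im_e _ _ _ _ M j v <> 0.

Variable M0 : md.

Definition wit j : md := if pselect (ndg j) is left h then projT1 (cid h) else M0.

(* A module together with fixed witnesses that e_j <> 0: a scalar that is
   determined on a witness does not depend on the module. *)
Definition fam (M : md) (o : option 'I_l) : md := if o is Some j then wit j else M.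

Lemma witP j : ndg j -> exists v : wit j, @im_e _ _ _ _ (wit j) j v <> 0.
Proof. by move=> h; rewrite /wit; case: pselect => // h'; case: cid. Qed.

Lemma ndg_nd M j : ndg j -> nd (fam M) j.
Proof.
move=> /witP[v hv] e; apply: hv.
exact: (congr1 (fun X : op (fam M) => X (Some j) v) e).
Qed.
Lemma nd_ndg M j : nd (fam M) j -> ndg j.
Proof.
move=> h; apply: contrapT => nh; apply: h; apply: opP => o v.
by apply: contrapT => hv; apply: nh; exists (fam M o), v.
Qed.

Lemma xr_ex : {f : seq 'I_l -> 'I_l -> C -> G |
  forall u j c, f u j c = (W u * x_ j c * (W u)^-1)%g}.
Proof. by exists (fun u j c => (W u * x_ j c * (W u)^-1)%g). Qed.
Definition xr := sval xr_ex.
Lemma xrE u j c : xr u j c = (W u * x_ j c * (W u)^-1)%g.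
Proof. exact: (svalP xr_ex). Qed.
Definition EW u j (M : md) : op (fam M) := cj (W u) (oE (fam M) j).

Lemma locnilEW u j M c : locnil (c *: EW u j M).
Proof. by apply/locnilZ/cj_locnil/oE_nil. Qed.
Lemma exp_xr u j M c : is_exp (c *: EW u j M) (rho (fam M) (xr u j c)).
Proof. by rewrite xrE -cjZ; apply: cj_exp; exact: exp_x. Qed.
Lemma gsp_EW u j M : gsp (act u (al j)) (EW u j M).
Proof. by apply: gsp_W => //; exact: gsp_E. Qed.

Lemma group_exp_eq (X : forall M, op (fam M)) g h :
  (forall M, locnil (X M)) -> (forall M, is_exp (X M) (rho (fam M) g)) ->
  (forall M, is_exp (X M) (rho (fam M) h)) -> g = h :> G.
Proof. by move=> nX; apply: (@exp_inj _ _ _ _ _ _ fam X None). Qed.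

Lemma borelM g h : B g -> B h -> B (g * h)%g.
Proof. by apply: is_subgroupM; exact: generated_subgroup. Qed.
Lemma borel1 : B 1%g. Proof. by have [] := generated_subgroup (km_t G @` @torus R l A D `|` @positive_root_element R l A D G). Qed.
Lemma borelV g : B g -> B (g^-1)%g.
Proof.
move=> h; rewrite -[(g^-1)%g]mul1g.
by have [_ H] := generated_subgroup (km_t G @` @torus R l A D `|` @positive_root_element R l A D G); apply: H => //; exact: borel1.
Qed.
Lemma borelMl g h : B g -> B (g * h)%g -> B h.
Proof. by move=> hg hgh; rewrite -[h](mulKg g); apply: borelM => //; exact: borelV. Qed.
Lemma borelMr g h : B h -> B (g * h)%g -> B g.
Proof. by move=> hh hgh; rewrite -[g](mulgK h); apply: borelM => //; exact: borelV. Qed.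
Lemma borel_T t : torus t -> B (T_ t).
Proof. by move=> h; apply: generated_sub; left; exists t. Qed.
Lemma borel_ch i c : c != 0 -> B (ch i c).
Proof. by move=> h; apply: borel_T; exact: cocharP. Qed.
Lemma borel_xr u j c : nneg (act u (al j)) -> B (xr u j c).
Proof. by move=> h; apply: generated_sub; right; exists u, j, c; rewrite xrE. Qed.
Lemma borel_x i c : B (x_ i c).
Proof.
have := @borel_xr [::] i c (@al_nneg _ i); rewrite xrE /=.
by rewrite invg1 mulg1 mul1g.
Qed.

(** At the index [Some k] the operators do not depend on M, and W v moves the witness of e_k to a
    vector that [EW v k M] does not kill; the scalar is read off there. *)
Lemma uniform_scalar v k (X : forall M, op (fam M)) : ndg k ->
  (forall M z, X M (Some k) z = X M0 (Some k) z) ->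
  (forall M, exists c, X M = c *: EW v k M) -> exists c, forall M, X M = c *: EW v k M.
Proof.
move=> hk hX hc; have [c0 e0] := hc M0; exists c0 => M; have [c e] := hc M.
have [u hu] := witP hk; pose z : wit k := km_rep (wit k) (W v) u.
have hz : EW v k M (Some k) z <> 0.
  have e3 : oE (fam M) k (Some k) u =
      rho (fam M) (W v)^-1%g (Some k) (EW v k M (Some k) z).
    by rewrite -{1}(cjK (W v) (oE (fam M) k)) {1}/cj invgK.
  by move=> h; apply: hu; rewrite -[LHS]/(oE (fam M) k (Some k) u) e3 h linear0.
suff -> : c0 = c by [].
have := hX M z; rewrite e e0 !opZE => /eqP.
rewrite -[EW v k M0 (Some k) z]/(EW v k M (Some k) z) -subr_eq0 -scalerBl scaler_eq0.
by case/orP => [|/eqP //]; rewrite subr_eq0 eq_sym => /eqP.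
Qed.

Lemma xr_trivial u j c : ~ ndg j -> xr u j c = 1%g.
Proof.
move=> h; have e M : oE (fam M) j = 0.
  by apply: contrapT => hj; apply: h; exact: nd_ndg hj.
apply: (@group_exp_eq (fun M => c *: EW u j M)) => M.
- exact: locnilEW.
- exact: exp_xr.
- by rewrite /EW e cj0 scaler0 rho1; exact: is_exp0.
Qed.

Lemma gsp_not_rt M x (X : op (fam M)) : x <> 0 -> ~ rt (fam M) x -> gsp x X -> X = 0.
Proof.
move=> x0 h hX; apply: contrapT => X0; apply: h; split=> //.
by exists X; split=> //; left.
Qed.

Lemma gsp_SV M i g (X : op (fam M)) : gsp g X ->
  gsp (simple_refl A i g) (cj (S i)^-1%g X).
Proof.
move=> hX; apply: gsum_gsp.
  rewrite slE simple_liftE !invgM !xV // yV // !cjM.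
  apply: (@gsum_cj _ _ _ _ G hA _ _ true); apply: (@gsum_cj _ _ _ _ G hA _ _ false).
  by apply: (@gsum_cj _ _ _ _ G hA _ _ true); exact: gsum_g hX.
move=> k; pose r : C := (rlz_root D i k)%:~R.
have e1 : cj (S i)^-1%g (hal (fam M) i) = - hal (fam M) i.
  have eS : cj (S i) (hal (fam M) i) = - hal (fam M) i by rewrite slE (cjSh _ hA).
  by rewrite -[hal _ i in LHS]opprK -eS cjN cjK.
have -> : oH (fam M) k = cj (S i)^-1%g (oH (fam M) k - r *: hal (fam M) i).
  by rewrite slE -(cjSH G _ hA) cjK.
rewrite -cj_ad adDl -scaleN1r !adZl (hal_wt _ (gsp_wt hX)) (gsp_wt hX) scaleN1r scalerA.
rewrite -scalerBl cjZ; congr (_ *: _).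
rewrite simple_reflE rwtD rwtN rwtZ rwt_al !mxE -rmorphM -rmorphB.
by congr (_%:~R); ring.
Qed.

(** Conjugation by the inverse of W u leads back to the root alpha_j, whose root space is spanned by
    e_j. *)
Lemma gsp_real M u j (X : op (fam M)) : gsp (act u (al j)) X ->
  exists c, X = c *: EW u j M.
Proof.
move=> hX; have WV v g (Y : op (fam M)) : gsp g Y -> gsp (act (rev v) g) (cj (W v)^-1%g Y).
  elim: v g Y => [|i v IH] g Y hY /=; first by rewrite invg1 cj1.
  by rewrite -slE invgM cjM rev_cons -cats1 act_cat; apply: IH; exact: gsp_SV.
have := WV u _ _ hX; rewrite (actVK hA) => /gsp_al[c e]; exists c.
by rewrite -[LHS](cjVK (W u)) e cjZ.
Qed.

(** The series exp (ad (b f_i)) stops after its linear term: if [f_i, e_gamma] is nonzero, it lies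
    in the space of the real root beta = gamma - alpha_i, and neither beta - alpha_i nor beta +
    gamma is a root. The conjugate is then x_gamma(c) x_beta(c b kap), where [kap] is the same in
    all modules. *)
Lemma star_sign i u j b c : ndg i -> ndg j -> nneg (act u (al j)) ->
  act u (al j) <> al i -> pr (act u (al j)) i <= 0 -> co A u j (al i) <= 0 ->
  B (y_ i b * xr u j c * y_ i (- b)%R)%g.
Proof.
set g := act u (al j) => hi hj g0 gi m0 m'0.
pose Y M := ad (oF (fam M) i) (EW u j M).
have hY M : gsp (g - al i) (Y M).
  by rewrite addrC; apply: gsp_br; [exact: gsp_F|exact: gsp_EW].
have nF M : locnil (b *: oF (fam M) i) by apply: locnilZ; exact: oF_nil.
have eF M : is_exp (b *: oF (fam M) i) (rho (fam M) (y_ i b)) by exact: exp_y.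
have expL M : is_exp (cj (y_ i b) (c *: EW u j M)) (rho (fam M) (y_ i b * xr u j c * y_ i (- b)%R)%g).
  by rewrite -yV //; apply: cj_exp; exact: exp_xr.
have [[M1 Y1]|hY0] := pselect (exists M, Y M <> 0); last first.
  have Y0 M : Y M = 0 by apply: contrapT => h; apply: hY0; exists M.
  suff -> : (y_ i b * xr u j c * y_ i (- b)%R)%g = xr u j c by exact: borel_xr.
  apply: (@group_exp_eq (fun M => c *: EW u j M)) => M.
  - exact: locnilEW.
  - have aY : ad (b *: oF (fam M) i) (EW u j M) = 0 by rewrite adZl [ad _ _]Y0 scaler0.
    by have := expL M; rewrite cjZ (cj_lin2 (nF M) (eF M)) aY ?ad0 ?addr0.
  - exact: exp_xr.
have hM M : nd (fam M) i by exact: ndg_nd.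
have hjM M : nd (fam M) j by exact: ndg_nd.
have gne : g - al i <> 0 by move/eqP; rewrite subr_eq0 => /eqP.
have r1 : rt (fam M1) (g - al i) by split=> //; exists (Y M1); split=> //; left.
have [v [k [/nd_ndg hk e]]] := sub_simple_real G hA (hjM M1) (hM M1) g0 gi m0 m'0 r1.
have rM M : rt (fam M) (g - al i) by rewrite e; apply: rt_act => //; apply: rt_al; exact: ndg_nd.
have nb M := sub_simple_bottom G hA (hjM M) (hM M) (@ndg_nd M _ hk) g0 gi m0 m'0 (rM M) e.
have b0 : nneg (act v (al k)).
  rewrite -e; apply: sub_simple_nneg r1 => //.
  exact: (rt_act G hA u (rt_al (hjM M1))).
have [kap hkap] : exists kap, forall M, Y M = kap *: EW v k M.
  apply: uniform_scalar => // M; apply: gsp_real; rewrite -e; exact: hY.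
have bi : act v (al k) - al i <> 0.
  rewrite -e => e2; have : rt (fam M1) (2 *: al i).
    rewrite (_ : 2 *: al i = g); first exact: (rt_act G hA u (rt_al (hjM M1))).
    apply/eqP; rewrite eq_sym -subr_eq0 -[2]/(1 + 1) scalerDl scale1r opprD addrA.
    by rewrite e2.
  by case/rt_mul.
have FY M : ad (oF (fam M) i) (Y M) = 0.
  apply: gsp_not_rt bi (nb M).1 _; rewrite addrC; apply: gsp_br; first exact: gsp_F.
  by rewrite -e; exact: hY.
have YX M : ad (EW v k M) (EW u j M) = 0.
  apply: gsp_not_rt (nb M).2 _; last by apply: gsp_br; exact: gsp_EW.
  move=> e2; have : g = 0.
    apply: nneg0 => // t; have := b0 t; have /rowP/(_ t) := e2; rewrite !mxE => e3.
    by rewrite -[X in _ -> 0 <= - X](addKr (act v (al k) 0 t)) e3 addr0 opprK.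
  by case: (rt_act G hA u (rt_al (hjM M1))).
suff -> : (y_ i b * xr u j c * y_ i (- b)%R)%g = (xr u j c * xr v k (c * b * kap)%R)%g.
  by apply: borelM; exact: borel_xr.
have comm M : (c *: EW u j M) * ((c * b * kap) *: EW v k M) =
              ((c * b * kap) *: EW v k M) * (c *: EW u j M).
  have := YX M; rewrite /ad => /eqP; rewrite subr_eq0 => /eqP h.
  by rewrite !opZMl !opZMr h !scalerA mulrC.
apply: (@group_exp_eq (fun M => c *: EW u j M + (c * b * kap) *: EW v k M)) => M.
- by apply: locnilD => //; exact: locnilEW.
- have := expL M; rewrite cjZ (cj_lin2 (nF M) (eF M)); last first.
    by rewrite !adZl -/(Y M) adZ FY !scaler0.
  by rewrite adZl -/(Y M) hkap scalerDr !scalerA.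
- by rewrite rhoM; apply: is_exp_comm; [|exact: locnilEW|exact: locnilEW|exact: exp_xr|exact: exp_xr].
Qed.

Lemma xr_cons i u j c : xr (i :: u) j c = (S i * xr u j c * (S i)^-1)%g.
Proof. by rewrite !xrE W_cons invgM !mulgA. Qed.

Lemma y_SV i b : b != 0 ->
  (y_ i b * (S i)^-1)%g = (x_ i (b^-1)%R * ch i (- b^-1)%R * y_ i (- b^-1)%R)%g.
Proof.
by move=> b0; rewrite y_bruhat // -S_x -!mulgA.
Qed.

(** By the sign lemmas one of gamma and s_i gamma satisfies the hypotheses of [star_sign]. [flip]
    passes from the one to the other, as y_i(b) S_i^-1 lies in B y_i(-1/b). *)
Lemma star i u j b c : ndg i -> nneg (act u (al j)) -> act u (al j) <> al i ->
  B (y_ i b * xr u j c * y_ i (- b)%R)%g.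
Proof.
move=> hi; set g := act u (al j) => g0 gi.
have [hj|hj] := pselect (ndg j); last first.
  by rewrite xr_trivial // mulg1 (yD G) subrr (y0 G); exact: borel1.
have hjM : nd (fam M0) j by exact: ndg_nd.
have rg := rt_act G hA u (rt_al hjM).
have g1 : nneg (act (i :: u) (al j)) := s_pos G hA rg g0 gi.
have gi1 : act (i :: u) (al j) <> al i.
  move=> e; have e' : g = - al i.
    by rewrite -[LHS](sK hA i) -[simple_refl _ _ g]/(act (i :: u) (al j)) e (s_al hA).
  by have := g0 i; rewrite e' !mxE !eqxx.
have flip : (forall b' c', B (y_ i b' * xr (i :: u) j c' * y_ i (- b')%R)%g) ->
    B (y_ i b * xr u j c * y_ i (- b)%R)%g.
  move=> h; have [->|b0] := eqVneq b 0.
    by rewrite oppr0 (y0 G) mul1g mulg1; exact: borel_xr.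
  have -> : (y_ i b * xr u j c * y_ i (- b)%R)%g = ((y_ i b * (S i)^-1) * xr (i :: u) j c *
      (y_ i b * (S i)^-1)^-1)%g.
    rewrite xr_cons invgM invgK (yV G) !mulgA; congr (_ * _)%g.
    by rewrite !mulgVK.
  rewrite y_SV //; set p := (_ * ch _ _)%g.
  have Bp : B p by apply: borelM; [exact: borel_x|apply: borel_ch; rewrite oppr_eq0 invr_eq0].
  clearbody p; rewrite invgM (yV G) !mulgA; apply: borelM; last exact: borelV.
  by rewrite -!mulgA; apply: borelM => //; rewrite mulgA; exact: h.
have pr1 : pr (act (i :: u) (al j)) i = - pr g i by exact: (pr_s hA).
have co1 : co A (i :: u) j (al i) = - co A u j (al i).
  by rewrite /co rev_cons -cats1 act_cat /= (s_al hA) actN prN.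
have [m0|m0] := leP (pr g i) 0; last first.
  apply: flip => b' c'; apply: star_sign => //; rewrite ?pr1 ?co1 oppr_le0; first exact: ltW.
  exact: ltW (pairing_sign G hA hjM g0 gi m0).
have [m'0|m'0] := leP (co A u j (al i)) 0; first exact: star_sign.
have [e|ne] := eqVneq (pr g i) 0.
  by apply: flip => b' c'; apply: star_sign; rewrite ?pr1 ?co1 ?e ?oppr0 // oppr_le0 ltW.
have := pairing_signN G hA hjM g0 gi; rewrite lt_neqAle ne m0 => /(_ isT).
by rewrite ltNge ltW.
Qed.

Lemma xr_simple u j i : ndg j -> act u (al j) = al i ->
  ndg i /\ exists c0, forall c, xr u j c = x_ i (c * c0).
Proof.
move=> hj e.
have hi : ndg i.
  apply: (@nd_ndg M0); apply: (rt_al_nd G hA); rewrite -e.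
  by apply: (rt_act G hA); apply: rt_al; exact: ndg_nd.
split=> //.
have [c0 hc0] : exists c0, forall M, EW u j M = c0 *: EW [::] i M.
  by apply: uniform_scalar => // M; apply: gsp_real; rewrite /= -e; exact: gsp_EW.
exists c0 => c; apply: (@group_exp_eq (fun M => c *: EW u j M)) => M.
- exact: locnilEW.
- exact: exp_xr.
- by rewrite hc0 scalerA /EW cj1; exact: exp_x.
Qed.

Lemma SVx i a : ((S i)^-1 * x_ i a * S i)%g = y_ i (- a).
Proof.
by rewrite -[in LHS](opprK a) -S_y !mulgA mulVg mul1g mulgVK.
Qed.

Lemma trefl_S i t : torus t -> (T_ t * S i)%g = (S i * T_ (trefl i t))%g.
Proof. by move=> ht; rewrite -T_refl // !mulgA mulgV mul1g. Qed.

Lemma borel_gen s : (km_t G @` @torus R l A D `|` @positive_root_element R l A D G) s ->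
  (exists2 t, torus t & s = T_ t) \/
  exists u j c, nneg (act u (al j)) /\ s = xr u j c.
Proof.
case=> [[t ht <-]|[u [j [c [h ->]]]]]; first by left; exists t.
by right; exists u, j, c; rewrite xrE.
Qed.

Lemma borel_ind (P : set G) : P 1%g ->
  (forall t g, torus t -> P g -> P (T_ t * g)%g) ->
  (forall u j c g, nneg (act u (al j)) -> P g -> P (xr u j c * g)%g) ->
  forall b, B b -> P b.
Proof.
move=> P1 PT Px; apply: generated_ind => // [s g /borel_gen[[t ht ->]|[u [j [c [h ->]]]]]|s].
- exact: PT.
- exact: Px.
case=> [[t ht <-]|[u [j [c [h ->]]]]].
  by left; exists (tinv t); [exact: tinvP|rewrite (T_inv G)].
right; exists u, j, (- c); split=> //.
by rewrite !invgM invgK (xV G) mulgA.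
Qed.

(** B preserves the open cell x_i(C) S_i B. The torus rescales t, the root subgroup of alpha_i
    translates it, and any other positive real root subgroup passes x_i(t) S_i = S_i y_i(-t) by
    [star]. *)
Lemma borel_S i b t : ndg i -> B b ->
  exists t' b', B b' /\ (b * x_ i t * S i)%g = (x_ i t' * S i * b')%g.
Proof.
move=> hi hb; move: b hb t; apply: borel_ind.
- by move=> t; exists t, 1%g; rewrite mul1g mulg1; split=> //; exact: borel1.
- move=> t0 g ht IH t; have [t' [b' [hb' e]]] := IH t.
  exists (torus_char (rwt D (al i)) t0 * t'), (T_ (trefl i t0) * b')%g.
  split; first by apply: borelM => //; apply: borel_T; exact: treflP.
  rewrite -!mulgA (mulgA g) e !mulgA; congr (_ * b')%g.
  by rewrite -[RHS]mulgA -trefl_S // -(T_x G) // !mulgA mulgVK.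
move=> u j c g h IH t; have [t' [b' [hb' e]]] := IH t.
rewrite -!mulgA (mulgA g) e !mulgA.
have [hj|hj] := pselect (ndg j); last first.
  by exists t', b'; rewrite xr_trivial // mul1g.
have [eg|gi] := pselect (act u (al j) = al i).
  have [_ [c0 ->]] := xr_simple hj eg.
  by exists (c * c0 + t'), b'; rewrite (xD G).
exists t', (((x_ i t' * S i)^-1 * xr u j c * (x_ i t' * S i)) * b')%g; split; last first.
  by rewrite !mulgA mulgV mul1g.
apply: borelM => //.
have -> : (x_ i t' * S i)%g = (S i * y_ i (- t')%R)%g by rewrite -SVx !mulgA mulgV mul1g.
have h1 : B (S i * y_ i (- t') * S i)%g -> True by [].
rewrite invgM (yV G) opprK SV.
have -> : (y_ i t' * (ch i (-1)%R * S i) * xr u j c * (S i * y_ i (- t')%R))%g =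
    (y_ i t' * (ch i (-1)%R * xr (i :: u) j c * (ch i (-1)%R)^-1) * y_ i (- t')%R)%g.
  rewrite xr_cons !mulgA; congr (_ * _)%g.
  rewrite -!mulgA; do 4! congr (_ * _)%g.
  by rewrite -[RHS]invgK invgM !invgK -SV invgK.
have c1 : (-1 : C) != 0 by rewrite oppr_eq0 oner_neq0.
have tc := cocharP (row i (rlz_coroot D)) c1.
set q := torus_char (rwt D (al i)) (cochar (row i (rlz_coroot D)) (-1)) : C.
have q0 : q != 0 by exact: char_neq0.
have yq a : (y_ i a * ch i (-1)%R)%g = (ch i (-1)%R * y_ i (q * a)%R)%g.
  have := @T_y _ _ _ _ G _ i (q * a) tc; rewrite mulKf // => <-.
  by rewrite !mulgVK.
have -> : (y_ i t' * (ch i (-1)%R * xr (i :: u) j c * (ch i (-1)%R)^-1) * y_ i (- t')%R)%g =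
   (ch i (-1)%R * (y_ i (q * t')%R * xr (i :: u) j c * y_ i (- (q * t'))%R) * (ch i (-1)%R)^-1)%g.
  have e2 : ((ch i (-1)%R)^-1 * y_ i (- t')%R = y_ i (- (q * t'))%R * (ch i (-1)%R)^-1)%g.
    apply: (@mulgI _ (ch i (-1)%R)); rewrite mulVKg mulgA -mulrN -yq.
    by rewrite mulgK.
  by rewrite -!mulgA e2 !mulgA yq.
have hjM : nd (fam M0) j by exact: ndg_nd.
have rg := rt_act G hA u (rt_al hjM).
apply: borelM; last by apply: borelV; exact: borel_ch.
apply: borelM; first exact: borel_ch.
apply: star => //; first exact: (s_pos G hA rg h gi).
move=> e1; have e' : act u (al j) = - al i.
  by rewrite -[LHS](sK hA i) -[simple_refl _ _ (act u _)]/(act (i :: u) (al j)) e1 (s_al hA).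
by have := h i; rewrite e' !mxE !eqxx.
Qed.

Lemma y_cell i t : t != 0 -> exists b, B b /\ y_ i t = (x_ i (t^-1)%R * S i * b)%g.
Proof.
move=> t0; have nt : - t^-1 != 0 by rewrite oppr_eq0 invr_eq0.
exists (ch i (- t^-1)^-1%R * x_ i (t^-1)%R)%g; split.
  by apply: borelM; [apply: borel_ch; rewrite invr_eq0|exact: borel_x].
by rewrite y_bruhat // [RHS]mulgA -(mulgA (x_ i _) (S i)) S_ch // !mulgA.
Qed.

Lemma x_cell i t : t != 0 -> exists b, B b /\ (x_ i t * S i)%g = (y_ i (t^-1)%R * b)%g.
Proof.
move=> t0; have [|b [hb e]] := @y_cell i t^-1; first by rewrite invr_eq0.
by exists (b^-1)%g; split; [exact: borelV|rewrite e invrK mulgK].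
Qed.

Lemma parabolic_cells i g : ndg i -> min_parabolic i g ->
  B g \/ exists t b, B b /\ g = (x_ i t * S i * b)%g.
Proof.
move=> hi; pose P : set G := [set g | B g \/ exists t b, B b /\ g = (x_ i t * S i * b)%g].
have PB b g' : B b -> P g' -> P (b * g')%g.
  move=> hb [h|[t [b' [hb' ->]]]]; first by left; exact: borelM.
  have [t' [b2 [h2 e]]] := borel_S t hi hb; right; exists t', (b2 * b')%g.
  by split; [exact: borelM|rewrite !mulgA e].
have Pr g' b : P g' -> B b -> P (g' * b)%g.
  move=> [h|[t [b' [hb' ->]]]] hb; first by left; exact: borelM.
  by right; exists t, (b' * b)%g; split; [exact: borelM|rewrite !mulgA].
have Py t : P (y_ i t).
  have [->|t0] := eqVneq t 0; first by left; rewrite (y0 G); exact: borel1.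
  by have [b [hb ->]] := y_cell i t0; right; exists t^-1, b.
apply: (@generated_ind G _ P).
- by left; exact: borel1.
- move=> s g' [hs|[t _ <-]] hg'; first exact: PB.
  case: hg' => [h|[t' [b [hb ->]]]]; first exact: Pr.
  rewrite mulgA; apply: (Pr) => //; have [->|t0] := eqVneq t 0.
    by rewrite (y0 G) mul1g; right; exists t', 1%g; rewrite mulg1; split=> //; exact: borel1.
  have nt : - t^-1 != 0 by rewrite oppr_eq0 invr_eq0.
  rewrite y_bruhat // !mulgA -(mulgA _ (x_ i _) (x_ i _)) (xD G).
  have -> : (x_ i (t^-1)%R * ch i (- t^-1)%R * S i * x_ i (t^-1 + t')%R * S i)%g =
     ((x_ i (t^-1)%R * ch i (- t^-1)%R) * (y_ i (- (t^-1 + t'))%R * (S i * S i)))%g.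
    by rewrite -S_x -!mulgA mulKg.
  apply: PB; first by apply: borelM; [exact: borel_x|exact: borel_ch].
  apply: (Pr) => //.
  have c1 : (-1 : C) != 0 by rewrite oppr_eq0 oner_neq0.
  suff -> : (S i * S i)%g = ((ch i (-1)%R)^-1)%g by apply: borelV; exact: borel_ch.
  apply: (@mulgI _ (ch i (-1)%R)); rewrite mulgV mulgA -SV mulVg //.
- move=> s [h|[t _ <-]]; first by left; exact: borelV.
  by right; exists (- t); rewrite ?(yV G).
Qed.

End Parabolic.

(** * Matrix coefficients *)

Section Extract.
Variables (F : fieldType) (V : lmodType F) (X : Type).

Definition is_subspace (K : V -> Prop) :=
  [/\ K 0, forall u v, K u -> K v -> K (u + v) & forall c u, K u -> K (c *: u)].

(** A linear form that is zero on K and 1 at v would give y as the combination of the coefficient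
    functions with its values. Instead of choosing such a form, the induction over s disposes of one
    vector at a time: either it is a multiple of v modulo K, or it is added to K. *)
Lemma extract_coef (Rg : (X -> F) -> Prop) (s : seq ((X -> F) * V)) :
  Rg (fun=> 0) -> (forall f g, Rg f -> Rg g -> Rg (fun x => f x + g x)) ->
  (forall c f, Rg f -> Rg (fun x => c * f x)) ->
  (forall p, List.In p s -> Rg p.1) ->
  forall K v, is_subspace K -> ~ K v ->
  exists2 f, Rg f & forall x y, K (\sum_(p <- s) p.1 x *: p.2 - y *: v) -> y = f x.
Proof.
move=> R0 RD RZ; elim: s => [|p s IH] hs K v [K0 KD KZ] Kv.
  exists (fun=> 0) => // x y; rewrite big_nil sub0r -scaleNr => h.
  apply: contrapT => /eqP y0; apply: Kv.
  by have := KZ (- y)^-1 _ h; rewrite scalerA mulVf ?scale1r // oppr_eq0.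
have hp : Rg p.1 by apply: hs; left.
have {}hs q : List.In q s -> Rg q.1 by move=> h; apply: hs; right.
have [[c hc]|nK] := pselect (exists c, K (v - c *: p.2)).
  have c0 : c != 0 by apply/eqP => e; apply: Kv; move: hc; rewrite e scale0r subr0.
  have [f hf fE] := IH hs K v (And3 K0 KD KZ) Kv.
  exists (fun x => f x + c^-1 * p.1 x); first by apply: RD => //; exact: RZ.
  move=> x y; rewrite big_cons => h.
  suff : y - c^-1 * p.1 x = f x by move=> <-; rewrite subrK.
  apply: fE; have := KD _ _ h (KZ (c^-1 * p.1 x) _ hc); congr K.
  rewrite scalerBr scalerA mulrAC mulVf // mul1r scalerBl opprB.
  rewrite (addrC (p.1 x *: p.2)) -!addrA; congr (_ + _).
  by rewrite addrCA [RHS]addrC; congr (_ + _); rewrite addrCA subrr addr0.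
have sK : is_subspace (fun w => exists c, K (w - c *: p.2)).
  split.
  - by exists 0; rewrite scale0r subr0.
  - move=> u w [c hc] [d hd]; exists (c + d).
    by have := KD _ _ hc hd; rewrite scalerDl opprD addrACA.
  - move=> c u [d hd]; exists (c * d).
    by have := KZ c _ hd; rewrite scalerBr scalerA.
have [f hf fE] := IH hs _ v sK nK.
exists f => // x y; rewrite big_cons => h; apply: fE; exists (- p.1 x).
by rewrite scaleNr opprK addrC addrA.
Qed.
End Extract.

Section Affine.
Variables (R : realType) (l : nat) (A : 'M[int]_l) (D : realization A).
Variable G : kac_moody_group R D.
Hypothesis hA : is_gcm A.
Local Notation C := R[i].
Local Notation n := (rlz_dim D).
Local Notation md := (integrable_module R D).
Local Notation S i := (sl G i).
Local Notation x_ := (km_x G).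
Local Notation y_ := (km_y G).
Local Notation T_ := (km_t G).
Local Notation B := (@borel R l A D G).
Local Notation act := (act A).
Implicit Types (u : seq 'I_l) (i j k : 'I_l) (c : C).

Section Module.
Variables (M : md) (mu : 'rV[int]_n).
Local Notation wv := (weight_vector (@im_h _ _ _ _ M)).
Local Notation rw := (rwt D).
Local Notation fm := (fam M M).
Local Notation xr := (xr G).
Local Notation EWm u j := (EW G M u j M).
Lemma int_scale0 m (z : int) (x : 'rV[int]_m) : z *: x = 0 -> z <> 0 -> x = 0.
Proof.
move=> e z0; apply/rowP => k; move/rowP/(_ k): e; rewrite !mxE => /eqP.
by rewrite mulf_eq0 => /orP[/eqP//|/eqP].
Qed.
Lemma EW_nil j : EWm [::] j = oE fm j.
Proof. by rewrite /EW cj1. Qed.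
Lemma xr_nil j c : xr [::] j c = x_ j c.
Proof. by rewrite xrE /= invg1 mulg1 mul1g. Qed.

Inductive wsum (P : 'rV[int]_l -> Prop) : M -> Prop :=
| ws0 : wsum P 0
| wsD b x y : P b -> wv (mu + rw b) x -> wsum P y -> wsum P (x + y).

Lemma wsum_add P x y : wsum P x -> wsum P y -> wsum P (x + y).
Proof.
elim=> [|b x' y' Pb wx _ IH] h; first by rewrite add0r.
by rewrite -addrA; apply: wsD wx (IH h).
Qed.
Lemma wvZ lam c x : wv lam x -> wv lam (c *: x).
Proof. by move=> h k; rewrite linearZ /= h !scalerA mulrC. Qed.
Lemma wsum_scale P c x : wsum P x -> wsum P (c *: x).
Proof.
elim=> [|b x' y' Pb wx _ IH]; first by rewrite scaler0; exact: ws0.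
by rewrite scalerDr; apply: wsD Pb (wvZ c wx) IH.
Qed.
Lemma wsum_le (P Q : 'rV[int]_l -> Prop) x : (forall b, P b -> Q b) -> wsum P x -> wsum Q x.
Proof.
move=> PQ; elim=> [|b x' y' Pb wx _ IH]; first exact: ws0.
by apply: wsD wx IH; exact: PQ.
Qed.
Lemma wsum1 (P : 'rV[int]_l -> Prop) b x : P b -> wv (mu + rw b) x -> wsum P x.
Proof. by move=> Pb h; rewrite -[x]addr0; apply: wsD Pb h (ws0 P). Qed.

Lemma wsum_sep (P : 'rV[int]_l -> Prop) b x : ~ P b -> wv (mu + rw b) x -> wsum P x -> x = 0.
Proof.
move=> nP wx hx.
pose Sp (lam : 'rV[int]_n) (y : M) :=
  wv lam y /\ (y <> 0 -> exists2 b, P b & lam = mu + rw b).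
suff [_ h] : Sp (mu + rw b) x.
  apply: contrapT => /h[b' Pb' e]; apply: nP.
  by move/addrI: e => /rwt_inj ->.
have [s [hs es]] : exists s : seq ('rV[int]_n * M), (forall p, p \in s -> Sp p.1 p.2) /\
    x = \sum_(p <- s) p.2.
  elim: hx => [|b' y z Pb wy _ [s [hs es]]]; first by exists [::]; rewrite big_nil.
  exists ((mu + rw b', y) :: s); rewrite big_cons es; split=> // p; rewrite inE.
  by case/orP => [/eqP ->|/hs //]; split=> //= _; exists b'.
have EC := @eigen_component R (im_sort M) n (fun (k : 'I_n) y => im_h M k y) Sp.
refine (EC _ _ _ _ _ s _ _ hs wx es).
- by move=> k a y z; rewrite linearP.
- by move=> lam; split=> // k; rewrite linear0 scaler0.
- move=> lam y z [h1 h2] [k1 k2]; split; first by move=> k; rewrite linearD h1 k1 scalerDr.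
  have [->|/eqP y0] := eqVneq y 0; first by rewrite add0r.
  by move=> _; exact: h2.
- move=> lam c y [h1 h2]; split; first exact: wvZ.
  by move=> h; apply: h2 => e; apply: h; rewrite e scaler0.
- by move=> lam y k [h1 _]; rewrite h1.
Qed.

Lemma wv_op (X : op fm) g lam (x : M) : has_wt (rw g) X -> wv lam x ->
  wv (lam + rw g) (X None x : M).
Proof.
move=> hX hv m; have := congr1 (fun Y : op fm => Y None x) (hX m).
rewrite /ad opDE opNE !opME opZE => /eqP; rewrite subr_eq => /eqP e.
rewrite -[LHS]/(oH fm m None (X None x)) e [oH fm m None x]hv opLZ.
by rewrite -scalerDl [(lam + _) 0 m]mxE rmorphD addrC.
Qed.

Lemma wv_opX (X : op fm) g b x (k : nat) : has_wt (rw g) X -> wv (mu + rw b) x ->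
  wv (mu + rw (b + k%:Z *: g)) ((X ^+ k) None x : M).
Proof.
move=> hX hv; elim: k => [|k IH]; first by rewrite scale0r addr0.
rewrite exprS opME (_ : _ + _ = mu + rw (b + k%:Z *: g) + rw g); first exact: wv_op.
rewrite -addrA -rwtD; congr (mu + rw _).
have -> : k.+1%:Z = k%:Z + 1 by rewrite -addn1 PoszD.
by rewrite scalerDl scale1r addrA.
Qed.

(* g v = v + (terms of weights mu + b + k gamma with k > 0) *)
Lemma xr_expand u j c (x : M) b : wv (mu + rw b) x ->
  exists2 y, km_rep M (xr u j c) x = x + c *: (EWm u j None x : M) + y &
  wsum (fun b' => exists2 k, (1 < k)%N & b' = b + k%:Z *: act u (al j)) y.
Proof.
move=> hx; have hX : has_wt (rw (act u (al j))) (EWm u j) by apply: gsp_wt; exact: gsp_EW.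
have [m hm] := @locnilEW _ _ _ _ G M u j M c None x.
have hm2 := nil_le (leq_addr 2 m) hm.
have := @exp_xr _ _ _ _ G M u j M c None x _ hm2; rewrite addn2.
rewrite !big_nat_recl // fact0 (_ : 1`! = 1%N) // invr1 !scale1r expr0 op1E expr1 opZE addrA => e.
exists (\sum_(0 <= k < m) (k.+2`!%:R^-1 : C) *: ((c *: EWm u j) ^+ k.+2) None x : M).
  exact: e.
elim/big_rec: _ => [|k y _ hy]; first exact: ws0.
apply: (@wsD _ (b + k.+2%:Z *: act u (al j))) => //; first by exists k.+2.
by apply: wvZ; rewrite opZX opZE; apply: wvZ; exact: wv_opX.
Qed.

Lemma wv_EW u j b x : wv (mu + rw b) x -> wv (mu + rw (b + act u (al j))) (EWm u j None x : M).
Proof.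
move=> hx; rewrite rwtD addrA; apply: wv_op => //.
by apply: gsp_wt; exact: gsp_EW.
Qed.

Definition up (b : 'rV[int]_l) (b' : 'rV[int]_l) := nneg (b' - b).

Lemma up_trans (a b c : 'rV[int]_l) : up a b -> up b c -> up a c.
Proof. by move=> h1 h2; rewrite /up -(subrKA b) addrC; apply: nnegD. Qed.
Lemma up_refl a : up a a. Proof. by move=> k; rewrite subrr mxE. Qed.

Lemma xr_up u j c a y : nneg (act u (al j)) -> wsum (up a) y ->
  wsum (up a) (km_rep M (xr u j c) y).
Proof.
move=> h; elim=> [|b x' y' Pb wx _ IH]; first by rewrite linear0; exact: ws0.
rewrite linearD; apply: wsum_add => //; have [z -> hz] := xr_expand u j c wx.
apply: wsum_add.
  apply: wsum_add; first exact: wsum1 wx.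
  apply: wsum_scale; apply: wsum1 (wv_EW _ _ wx).
  by apply: (up_trans Pb); rewrite /up addrC addKr.
apply: wsum_le hz => b' [k _ ->]; apply: (up_trans Pb).
by rewrite /up addrC addKr; apply: nnegZ.
Qed.

Lemma T_wsum t P y : torus t -> wsum P y -> wsum P (km_rep M (T_ t) y).
Proof.
move=> ht; elim=> [|b x' y' Pb wx _ IH]; first by rewrite linear0; exact: ws0.
by rewrite linearD (km_rep_t G ht wx); apply: wsD Pb (wvZ _ wx) IH.
Qed.

Lemma borel_up a y b : B b -> wsum (up a) y -> wsum (up a) (km_rep M b y).
Proof.
move=> hb; move: b hb y; apply: borel_ind => //.
- by move=> y; rewrite km_rep1.
- by move=> t g ht IH y hy; rewrite km_repM; apply: T_wsum => //; exact: IH.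
- by move=> u j c g hu IH y hy; rewrite km_repM; apply: xr_up => //; exact: IH.
Qed.

Variables (i : 'I_l) (v0 : M).
Hypotheses (hv0 : wv mu v0) (hi : im_e M i v0 <> 0).
Let v1 : M := im_e M i v0.

Lemma hv00 : wv (mu + rw 0) v0. Proof. by rewrite /rwt mul0mx addr0. Qed.
Lemma hv1 : wv (mu + rw (al i)) v1.
Proof. exact: (@wv_E _ _ _ _ _ (fun _ : unit => M) i _ tt _ hv0). Qed.

(** The weights mu + b above mu other than mu + alpha_i. Nothing above such a weight is mu or mu +
    alpha_i, so their span N is B-stable, and modulo N only v0 and v1 = e_i v0 matter. *)
Definition hi_wt (b : 'rV[int]_l) := [/\ nneg b, b <> 0 & b <> al i].
Local Notation N := (wsum hi_wt).

Lemma hi_up a b : hi_wt a -> up a b -> hi_wt b.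
Proof.
move=> [a0 an ai] h; have b0 : nneg b by rewrite -[b](subrK a); apply: nnegD.
split=> // e.
  by apply: an; apply: nneg0 => //; move: h; rewrite /up e sub0r.
have ak k : k != i -> a 0 k = 0.
  move=> ki; have := h k; have := a0 k; rewrite e !mxE (negPf ki) andbF sub0r oppr_ge0 => h1 h2.
  by apply/eqP; rewrite eq_le h1 h2.
have ea : a = a 0 i *: al i.
  apply/rowP => k; rewrite !mxE eqxx /=; have [->|ki] := eqVneq k i; first by rewrite mulr1.
  by rewrite ak // mulr0.
have := h i; have := a0 i; rewrite e !mxE !eqxx /= => h1 h2.
have : a 0 i = 0 \/ a 0 i = 1 by lia.
by case=> e2; [apply: an|apply: ai]; rewrite ea e2 ?scale0r ?scale1r.
Qed.

Lemma borel_N y b : B b -> N y -> N (km_rep M b y).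
Proof.
move=> hb; elim=> [|a x' y' Pb wx _ IH]; first by rewrite linear0; exact: ws0.
rewrite linearD; apply: wsum_add => //.
have := borel_up hb (wsum1 (up_refl a) wx); apply: wsum_le => b'; exact: hi_up.
Qed.

Lemma sub_N0 : is_subspace (fun w => exists c, N (w - c *: v1)).
Proof.
split; first by exists 0; rewrite scale0r subr0; exact: ws0.
  by move=> a b [c hc] [d hd]; exists (c + d); rewrite scalerDl opprD addrACA; apply: wsum_add.
by move=> c a [d hd]; exists (c * d); rewrite -scalerA -scalerBr; apply: wsum_scale.
Qed.
Lemma sub_N1 : is_subspace (fun w => exists c, N (w - c *: v0)).
Proof.
split; first by exists 0; rewrite scale0r subr0; exact: ws0.
  by move=> a b [c hc] [d hd]; exists (c + d); rewrite scalerDl opprD addrACA; apply: wsum_add.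
by move=> c a [d hd]; exists (c * d); rewrite -scalerA -scalerBr; apply: wsum_scale.
Qed.

Lemma al_ne0 : al i <> 0 :> 'rV[int]_l. Proof. exact: al_neq0. Qed.

Lemma v0_neq0 : v0 <> 0. Proof. by move=> e; apply: hi; rewrite e linear0. Qed.

Lemma not_N0 : ~ exists c, N (v0 - c *: v1).
Proof.
move=> [c hc]; apply: v0_neq0.
apply: (@wsum_sep (fun b => b <> 0) 0) => //; first exact: hv00.
rewrite -[v0](subrK (c *: v1)); apply: wsum_add; first by apply: wsum_le hc => b [].
by apply: wsum_scale; apply: wsum1 hv1; exact: al_ne0.
Qed.
Lemma not_N1 : ~ exists c, N (v1 - c *: v0).
Proof.
move=> [c hc]; apply: hi; rewrite -/v1.
apply: (@wsum_sep (fun b : 'rV[int]_l => b <> al i) (al i)) => //; first exact: hv1.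
rewrite -[v1](subrK (c *: v0)); apply: wsum_add; first by apply: wsum_le hc => b [].
by apply: wsum_scale; apply: wsum1 hv00 => /esym/al_ne0.
Qed.

Definition eqN (x y : M) := N (x - y).
Lemma eqN_refl x : eqN x x. Proof. by rewrite /eqN subrr; exact: ws0. Qed.
Lemma eqN_trans x y z : eqN x y -> eqN y z -> eqN x z.
Proof. by move=> h1 h2; rewrite /eqN -(subrKA y); exact: wsum_add. Qed.
Lemma eqN_sym x y : eqN x y -> eqN y x.
Proof. by move=> h; rewrite /eqN -opprB -scaleN1r; exact: wsum_scale. Qed.
Lemma eqN_add x y x' y' : eqN x y -> eqN x' y' -> eqN (x + x') (y + y').
Proof. by move=> h1 h2; rewrite /eqN opprD addrACA; exact: wsum_add. Qed.
Lemma eqN_scale c x y : eqN x y -> eqN (c *: x) (c *: y).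
Proof. by move=> h; rewrite /eqN -scalerBr; exact: wsum_scale. Qed.
Lemma eqN_N x y : N y -> eqN (x + y) x.
Proof. by move=> h; rewrite /eqN addrC addKr. Qed.
Lemma eqN_borel b x y : B b -> eqN x y -> eqN (km_rep M b x) (km_rep M b y).
Proof. by move=> hb h; rewrite /eqN -linearB; exact: borel_N. Qed.

Lemma eqN_sep a p a' p' : eqN (a *: v0 + p *: v1) (a' *: v0 + p' *: v1) -> a = a' /\ p = p'.
Proof.
rewrite /eqN opprD addrACA -!scalerBl => h.
have e : a = a'.
  apply: contrapT => /eqP; rewrite -subr_eq0 => n0; apply: not_N0.
  exists (- ((a - a')^-1 * (p - p'))).
  have := wsum_scale (a - a')^-1 h.
  by rewrite scalerDr !scalerA mulVf // scale1r scaleNr opprK.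
split=> //; apply/eqP; rewrite -subr_eq0; apply: contrapT => /negP n0; apply: not_N1.
exists 0; rewrite scale0r subr0; have := wsum_scale (p - p')^-1 h.
by rewrite e subrr scale0r add0r scalerA mulVf // scale1r.
Qed.

Lemma mul_neq0 u j (k : nat) : ndg R D j -> (0 < k)%N -> k%:Z *: act u (al j) <> 0.
Proof.
move=> hj k0; have rg : rt fm (act u (al j)) by apply: rt_act => //; apply: rt_al; exact: ndg_nd.
by move/int_scale0 => h; case: rg => e _; apply: e; apply: h; lia.
Qed.

Lemma hi_mul u j (k : nat) : ndg R D j -> nneg (act u (al j)) -> (1 < k)%N ->
  hi_wt (k%:Z *: act u (al j)).
Proof.
move=> hj h k1; split; [exact: nnegZ|apply: mul_neq0 => //; lia|].
move/(congr1 (fun x : 'rV_l => x 0 i)); rewrite [LHS]mxE !mxE !eqxx /= => e.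
have : 0 <= act u (al j) 0 i by exact: h.
move: (act u (al j) 0 i) e => z e h0.
have z0 : z <> 0 by move=> e0; move: e; rewrite e0 mulr0.
have : 2 * 1 <= k%:Z * z by apply: ler_pM => //; lia.
by rewrite e.
Qed.

Lemma x_v0 t : eqN (km_rep M (x_ i t) v0) (v0 + t *: v1).
Proof.
have := xr_expand [::] i t hv00; rewrite xr_nil EW_nil => -[y -> hy].
rewrite -[oE fm i None v0]/v1; apply: eqN_N; apply: wsum_le hy => b' [k k1 ->].
rewrite add0r; have hj : ndg R D i by exists M, v0.
by apply: (@hi_mul [::]) => //; exact: al_nneg.
Qed.

Lemma x_v1 t : eqN (km_rep M (x_ i t) v1) v1.
Proof.
have := xr_expand [::] i t hv1; rewrite xr_nil => -[y -> hy].
have hj : ndg R D i by exists M, v0.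
have key (k : nat) : (0 < k)%N -> hi_wt (al i + k%:Z *: al i).
  move=> k0; have -> : al i + k%:Z *: al i = k.+1%:Z *: act [::] (al i).
    by rewrite -{1}[al i]scale1r -scalerDl -PoszD add1n.
  by apply: hi_mul => //; exact: al_nneg.
rewrite -addrA; apply: eqN_N; apply: wsum_add.
  apply: wsum_scale; apply: wsum1 (wv_EW [::] i hv1).
  by have := key 1%N isT; rewrite scale1r.
by apply: wsum_le hy => b' [k k1 ->]; apply: key; lia.
Qed.

Lemma xr_v0 u j c : nneg (act u (al j)) ->
  exists k : C, eqN (km_rep M (xr u j c) v0) (v0 + k *: v1).
Proof.
move=> h; have [hj|hj] := pselect (ndg R D j); last first.
  exists 0; rewrite (xr_trivial G M) // km_rep1 scale0r addr0; exact: eqN_refl.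
have rg : rt fm (act u (al j)) by apply: rt_act => //; apply: rt_al; exact: ndg_nd.
have [eg|ng] := pselect (act u (al j) = al i).
  by have [_ [c0 ->]] := xr_simple G hA M hj eg; exists (c * c0); exact: x_v0.
have [y -> hy] := xr_expand u j c hv00.
exists 0; rewrite scale0r addr0 -addrA; apply: eqN_N; apply: wsum_add.
  apply: wsum_scale; apply: wsum1 (wv_EW u j hv00).
  by rewrite add0r; split=> //; case: rg.
by apply: wsum_le hy => b' [k k1 ->]; rewrite add0r; exact: hi_mul.
Qed.

Lemma xr_v1 u j c : nneg (act u (al j)) -> eqN (km_rep M (xr u j c) v1) v1.
Proof.
move=> h; have [hj|hj] := pselect (ndg R D j); last first.
  by rewrite (xr_trivial G M) // km_rep1; exact: eqN_refl.
have [y -> hy] := xr_expand u j c hv1.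
have key (k : nat) : (0 < k)%N -> hi_wt (al i + k%:Z *: act u (al j)).
  move=> k0; have zg0 := mul_neq0 (u:=u) hj k0.
  split; first by apply: nnegD; [exact: al_nneg|exact: nnegZ].
    move=> e; apply: zg0; apply: nneg0; first exact: nnegZ.
    by rewrite (_ : - _ = al i); [exact: al_nneg|apply/eqP; rewrite eq_sym -addr_eq0 e].
  by rewrite -[RHS]addr0 => /addrI.
rewrite -addrA; apply: eqN_N; apply: wsum_add.
  apply: wsum_scale; apply: wsum1 (wv_EW u j hv1).
  by have := key 1%N isT; rewrite scale1r.
by apply: wsum_le hy => b' [k k1 ->]; apply: key; lia.
Qed.

(** The entries (a, p, c) of the triangular matrix of b on v0 and v1 modulo N: b v0 = a v0 + p v1
    and b v1 = c v1. *)
Definition bcoef (b : G) (p : C * C * C) :=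
  [/\ p.1.1 != 0, p.2 != 0, eqN (km_rep M b v0) (p.1.1 *: v0 + p.1.2 *: v1) &
      eqN (km_rep M b v1) (p.2 *: v1)].

Lemma bcoefM b b' p p' : B b -> bcoef b p -> bcoef b' p' ->
  bcoef (b * b')%g (p.1.1 * p'.1.1, p'.1.1 * p.1.2 + p'.1.2 * p.2, p.2 * p'.2).
Proof.
move=> hb [a0 c0 h0 h1] [a0' c0' h0' h1']; split; rewrite /= ?mulf_neq0 //.
  rewrite km_repM; apply: (eqN_trans (eqN_borel hb h0')).
  rewrite linearD !linearZ /=.
  apply: (eqN_trans (eqN_add (eqN_scale _ h0) (eqN_scale _ h1))).
  rewrite scalerDr !scalerA scalerDl addrA (mulrC p.1.1); exact: eqN_refl.
rewrite km_repM; apply: (eqN_trans (eqN_borel hb h1')); rewrite linearZ /= mulrC -scalerA.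
exact: eqN_scale.
Qed.

Lemma bcoef_exists b : B b -> exists p, bcoef b p.
Proof.
move=> hb; suff [_ //] : B b /\ exists p, bcoef b p.
move: b hb; apply: borel_ind => //.
- split; first exact: borel1.
  exists (1, 0, 1); split; rewrite ?oner_neq0 // km_rep1 !scale1r ?scale0r ?addr0; exact: eqN_refl.
- move=> t g ht [hg [p hp]]; split; first by apply: borelM => //; exact: borel_T.
  pose ct := torus_char mu t; pose ct1 := torus_char (mu + rw (al i)) t.
  eexists; apply: bcoefM hp; first exact: borel_T.
  have e0 : km_rep M (T_ t) v0 = ct *: v0 by exact: km_rep_t.
  have e1 : km_rep M (T_ t) v1 = ct1 *: v1 by apply: km_rep_t => //; exact: hv1.
  instantiate (1 := (ct, 0, ct1)); split; rewrite /= ?char_neq0 // ?e0 ?e1 ?scale0r ?addr0;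
    exact: eqN_refl.
move=> u j c g hu [hg [p hp]]; have Bx : B (xr u j c) by exact: borel_xr.
split; first exact: borelM.
have [k hk] := xr_v0 c hu; have h2 := xr_v1 c hu.
eexists; apply: bcoefM hp => //.
by instantiate (1 := (1, k, 1)); split; rewrite /= ?oner_neq0 // scale1r.
Qed.

Lemma wrefl_rw b : wrefl i (mu + rw b) = mu + rw (simple_refl A i b - cpair mu i *: al i).
Proof.
have cD (a c : 'rV[int]_n) : cpair (a + c) i = cpair a i + cpair c i.
  by rewrite /cpair -big_split; apply: eq_bigr => k _; rewrite mxE mulrDr.
rewrite /wrefl cD -[cpair (rw b) i]/(\sum_k _) -(pr_rwt D b i) simple_reflE.
rewrite !(rwtD, rwtN, rwtZ, rwt_al) scalerDl opprD !addrA.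
by rewrite addrAC.
Qed.

Lemma S_wv lam x : wv lam x -> wv (wrefl i lam) (km_rep M (S i) x).
Proof.
move=> h; rewrite slE.
exact: (@wv_S _ _ _ _ G hA _ (fun _ : unit => M) i lam tt x h).
Qed.
Lemma SV_wv lam x : wv lam x -> wv (wrefl i lam) (km_rep M ((S i)^-1)%g x).
Proof.
move=> /S_wv h; rewrite (SV G hA) km_repM (km_rep_t G _ h); first exact: wvZ.
by apply: cocharP; rewrite oppr_eq0 oner_neq0.
Qed.

Lemma S_wsum (P : 'rV[int]_l -> Prop) y : wsum P y ->
  wsum (fun b' => exists2 b, P b & b' = simple_refl A i b - cpair mu i *: al i)
    (km_rep M (S i) y).
Proof.
elim=> [|b x' y' Pb wx _ IH]; first by rewrite linear0; exact: ws0.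
rewrite linearD; apply: wsD (IH); first by exists b.
by rewrite -wrefl_rw; exact: S_wv.
Qed.

(* S b S^-1 only involves weights mu + s_i(Q_+), which omit mu + alpha_i. *)
Lemma psi_conj b p : B b -> bcoef (S i * b * (S i)^-1)%g p -> p.1.2 = 0.
Proof.
move=> hb [_ _ h _]; set m := cpair mu i.
have w0 : wv (mu + rw (- (m *: al i))) (km_rep M (S i)^-1%g v0).
  have := SV_wv hv00; rewrite wrefl_rw -/m; congr (weight_vector _ (mu + rw _)).
  by rewrite simple_reflE /pr big1 ?scale0r ?subr0 ?sub0r // => k _; rewrite mxE mul0r.
have h1 := S_wsum (borel_up hb (wsum1 (up_refl _) w0)).
have h2 : wsum (fun c : 'rV[int]_l => c <> al i) (km_rep M (S i * b * (S i)^-1)%g v0).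
  rewrite !km_repM; apply: wsum_le h1 => c [d hd ->].
  have -> : d = - (m *: al i) + (d - - (m *: al i)) by rewrite addrC subrK.
  move: (d - _) (hd : nneg (d - _)) => e he; rewrite (sD A i) (sN A i) (sZ A i) (s_al hA) scalerN opprK.
  rewrite addrAC subrr add0r => e1; have : nneg (- al i).
    by rewrite -(s_al hA) -e1 (sK hA).
  by move/(_ i); rewrite !mxE !eqxx.
apply: contrapT => /eqP p0; apply: hi; rewrite -/v1.
apply: (@wsum_sep (fun c : 'rV[int]_l => c <> al i) (al i)) => //; first exact: hv1.
have -> : v1 = p.1.2^-1 *: (p.1.2 *: v1) by rewrite scalerA mulVf ?scale1r.
apply: wsum_scale; move: h; rewrite /eqN opprD addrA => h.
set w := km_rep M _ v0 in h h2.
have -> : p.1.2 *: v1 = (w - p.1.1 *: v0) - (w - p.1.1 *: v0 - p.1.2 *: v1).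
  by rewrite opprB addrC subrK.
apply: wsum_add.
  apply: wsum_add => //; rewrite -scaleNr; apply: wsum_scale; apply: wsum1 hv00.
  by move/esym/al_ne0.
by rewrite -scaleN1r; apply: wsum_scale; apply: wsum_le h => c [].
Qed.

Lemma bcoef_x t : bcoef (x_ i t) (1, t, 1).
Proof. by split; rewrite /= ?oner_neq0 // scale1r; [exact: x_v0|exact: x_v1]. Qed.

Lemma bcoef_uniq b p p' : bcoef b p -> bcoef b p' -> p = p'.
Proof.
case: p p' => [[a q] c] [[a' q'] c'] [/= _ _ h0 h1] [/= _ _ h0' h1'].
have [-> ->] := eqN_sep (eqN_trans (eqN_sym h0) h0').
have h2 : eqN (0 *: v0 + c *: v1) (0 *: v0 + c' *: v1).
  by rewrite scale0r !add0r; exact: eqN_trans (eqN_sym h1) h1'.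
by have [_ ->] := eqN_sep h2.
Qed.

(** The equation says x_i(t') bh = b x_i(t) with bh = S_i b' S_i^-1 in B, and bh has no off-diagonal
    entry by [psi_conj]. Comparing triangular matrices gives a t' = p + t c. *)
Lemma affine_formula b p t t' b' : B b -> bcoef b p -> B b' ->
  (b * x_ i t * S i = x_ i t' * S i * b')%g -> t' = (p.1.2 + t * p.2) / p.1.1.
Proof.
move=> hb hp hb' e; pose bh := (S i * b' * (S i)^-1)%g.
have eh : (x_ i t' * bh = b * x_ i t)%g.
  by apply: (@mulIg _ (S i)); rewrite e /bh !mulgA mulgVK.
have Bh : B bh.
  apply: (borelMl (g := x_ i t')); first exact: borel_x.
  by rewrite eh; apply: borelM => //; exact: borel_x.
have [q hq] := bcoef_exists Bh; have q0 := psi_conj hb' hq.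
have h1 := bcoefM (borel_x i t') (bcoef_x t') hq; rewrite eh in h1.
have h2 := bcoefM hb hp (bcoef_x t).
have := bcoef_uniq h1 h2; rewrite /= q0 !mul1r !mulr1 addr0 => -[e1 e2 _].
case: hp => a0 _ _ _; rewrite -e2 e1.
by rewrite (mulrC _ t') mulfK.
Qed.

Lemma S_not_borel : ~ B (S i).
Proof.
move=> hb; have [[[a q] c] [/= a0 c0 h0 h1]] := bcoef_exists hb.
set m := cpair mu i.
(* If S_i were in B, then S_i v0 would have a component along v0, and S_i v1 one along v1. Their
   weights are mu - m alpha_i and mu - (m + 1) alpha_i: for m = -2 the first differs from mu, and
   otherwise the second differs from mu + alpha_i. *)
have [m2|m2] := eqVneq m (-2).
  have w0 : wv (mu + rw (2 *: al i)) (km_rep M (S i) v0).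
    have := S_wv hv00; rewrite wrefl_rw -/m m2; congr (weight_vector _ (mu + rw _)).
    rewrite simple_reflE /pr big1 ?scale0r ?subr0 ?sub0r; last by move=> k _; rewrite mxE mul0r.
    by rewrite scaleNr opprK.
  apply: v0_neq0; apply: (@wsum_sep (fun b => b <> 0) 0) => //; first exact: hv00.
  have -> : v0 = a^-1 *: (a *: v0) by rewrite scalerA mulVf ?scale1r.
  apply: wsum_scale.
  have -> : a *: v0 = (km_rep M (S i) v0 - q *: v1) -
       (km_rep M (S i) v0 - (a *: v0 + q *: v1)).
    by rewrite opprB addrC addrA subrK addrK.
  apply: wsum_add; last first.
    by rewrite -scaleN1r; apply: wsum_scale; apply: wsum_le h0 => b [].
  apply: wsum_add.
    apply: wsum1 w0 => /int_scale0 h; apply: al_ne0; exact: h.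
  by rewrite -scaleNr; apply: wsum_scale; apply: wsum1 hv1; exact: al_ne0.
have w1 : wv (mu + rw (- (m + 1) *: al i)) (km_rep M (S i) v1).
  have := S_wv hv1; rewrite wrefl_rw -/m; congr (weight_vector _ (mu + rw _)).
  by rewrite (s_al hA) -scaleN1r -scalerBl; congr (_ *: _); ring.
apply: hi; apply: (@wsum_sep (fun b : 'rV[int]_l => b <> al i) (al i)) => //; first exact: hv1.
have -> : im_e M i v0 = c^-1 *: (c *: v1) by rewrite scalerA mulVf ?scale1r.
apply: wsum_scale.
have -> : c *: v1 = km_rep M (S i) v1 - (km_rep M (S i) v1 - c *: v1).
  by rewrite opprB addrC subrK.
apply: wsum_add; last first.
  by rewrite -scaleN1r; apply: wsum_scale; apply: wsum_le h1 => b [].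
apply: wsum1 w1 => /(congr1 (fun x : 'rV_l => x 0 i)); rewrite !mxE !eqxx mulr1 => e.
by move/eqP: m2; apply; lia.
Qed.

End Module.

Section Regular.
Variables (X : Type) (Rg : (X -> C) -> Prop) (Om : X -> Prop).
Hypotheses (R0 : Rg (fun=> 0)) (RD : forall f g, Rg f -> Rg g -> Rg (fun x => f x + g x)).
Hypothesis RM : forall f g, Rg f -> Rg g -> Rg (fun x => f x * g x).
Hypothesis RC : forall c, Rg (fun=> c).

(* matrix coefficients in integrable modules are regular *)
Definition reg_fam (u : X -> G) := forall (M : md) (v : M),
  exists s : seq ((X -> C) * M), (forall p, List.In p s -> Rg p.1) /\
    forall x, Om x -> km_rep M (u x) v = \sum_(p <- s) p.1 x *: p.2.

Lemma reg_fam_const g : reg_fam (fun=> g).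
Proof.
move=> M v; exists [:: (fun=> 1, km_rep M g v)]; split=> [p [<-|[]]//|x _]; first exact: RC.
by rewrite big_cons big_nil addr0 scale1r.
Qed.

Lemma reg_famM (u u' : X -> G) : reg_fam u -> reg_fam u' -> reg_fam (fun x => u x * u' x)%g.
Proof.
move=> hu hu' M v; have [s [hs es]] := hu' M v.
suff [s' [hs' es']] : exists s' : seq ((X -> C) * M), (forall p, List.In p s' -> Rg p.1) /\
    forall x, Om x -> km_rep M (u x) (\sum_(p <- s) p.1 x *: p.2) = \sum_(p <- s') p.1 x *: p.2.
  by exists s'; split=> // x hx; rewrite km_repM es // es'.
elim: s hs {es} => [|p s IH] hs.
  by exists [::]; split=> // x _; rewrite !big_nil linear0.
have [|s1 [h1 e1]] := IH; first by move=> q hq; apply: hs; right.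
have [s2 [h2 e2]] := hu M p.2.
exists ([seq (fun x => p.1 x * q.1 x, q.2) | q <- s2] ++ s1); split.
  move=> q; rewrite -[_ ++ _]/(List.app _ _) => /(List.in_app_or _ _ _) [].
    have -> : [seq (fun x => p.1 x * q.1 x, q.2) | q <- s2] = List.map (fun q => (fun x => p.1 x * q.1 x, q.2)) s2 by [].
    move=> /(List.in_map_iff _ _ _).1 [q' [<- hq']] /=; apply: RM; first by apply: hs; left.
    exact: h2.
  exact: h1.
move=> x hx; rewrite big_cons linearD linearZ /= e1 // e2 // big_cat big_map scaler_sumr /=.
by congr (_ + _); apply: eq_bigr => q _; rewrite scalerA.
Qed.

Lemma reg_fam_exp b i (f : X -> C) : Rg f -> reg_fam (fun x => kg G b i (f x)).
Proof.
move=> hf M v; have [m hm] := @Es_locnil _ _ _ _ _ (fun _ : unit => M) b i 1 tt v.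
exists [seq (fun x => k`!%:R^-1 * f x ^+ k, (Es (fun _ : unit => M) b i ^+ k) tt v) | k : nat <- iota 0 m].
split.
  move=> p; have RX (k : nat) : Rg (fun x => f x ^+ k).
    elim: k => [|k IH]; first exact: RC.
    have -> : (fun x => f x ^+ k.+1) = (fun x => f x * f x ^+ k) by apply/funext => x; rewrite exprS.
    exact: RM hf IH.
  move=> /(List.in_map_iff _ _ _).1 [k [<- _]] /=; exact: RM.
move=> x _; have e := @exp_kg _ _ _ _ G _ (fun _ : unit => M) b i (f x) tt v m.
rewrite big_map.
have -> : km_rep M (kg G b i (f x)) v = rho (fun _ : unit => M) (kg G b i (f x)) tt v by [].
rewrite e; first by rewrite /index_iota subn0; apply: eq_bigr => k _; rewrite opZX opZE scalerA.
by move: hm; rewrite scale1r opZX opZE => ->; rewrite scaler0.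
Qed.

(** The three entries of the triangular matrix of u x are coefficients of u x v0 and u x v1 modulo
    subspaces, so [extract_coef] makes them regular functions of x. *)
Lemma affine_coeffs i (u : X -> G) : ndg R D i -> (forall x, Om x -> B (u x)) -> reg_fam u ->
  exists a p c : X -> C, [/\ Rg a, Rg p, Rg c & forall x, Om x ->
    [/\ a x != 0, c x != 0 & forall t t' b', B b' ->
      (u x * x_ i t * S i = x_ i t' * S i * b')%g -> t' = (p x + t * c x) / a x]].
Proof.
move=> [M [v hv]] Bu hu.
have [mu [v0 [hv0 hi]]] : exists mu v0, weight_vector (@im_h _ _ _ _ M) mu v0 /\ im_e M i v0 <> 0.
  apply: contrapT => h; apply: hv; have [s [-> hs]] := im_weight v.
  rewrite linear_sum big1_seq // => w /andP[_ /hs[lam hw]].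
  by apply: contrapT => hw'; apply: h; exists lam, w.
pose v1 := im_e M i v0.
have [s0 [hs0 e0]] := hu M v0; have [s1 [hs1 e1]] := hu M v1.
have RZ c f : Rg f -> Rg (fun x => c * f x) by move=> hf; exact: RM.
have [a ha aE] := extract_coef R0 RD RZ hs0 (sub_N0 mu i v0) (not_N0 hv0 hi).
have [p hp pE] := extract_coef R0 RD RZ hs0 (sub_N1 mu i v0) (not_N1 hv0 hi).
have [c hc cE] := extract_coef R0 RD RZ hs1 (sub_N1 mu i v0) (not_N1 hv0 hi).
exists a, p, c; split=> // x hx; have [q hq] := bcoef_exists hv0 hi (Bu x hx).
have [q0 q2 h0 h1] := hq.
have ea : q.1.1 = a x.
  apply: aE; rewrite -e0 //; exists q.1.2; by rewrite -addrA -opprD.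
have ep : q.1.2 = p x.
  apply: pE; rewrite -e0 //; exists q.1.1; by rewrite addrAC -addrA -opprD.
have ec : q.2 = c x.
  by apply: cE; rewrite -e1 //; exists 0; rewrite scale0r subr0.
rewrite -ea -ec -ep; split=> // t t' b' hb' e.
exact: (affine_formula hv0 hi (Bu x hx) hq hb' e).
Qed.

End Regular.

Lemma S_notB i : ndg R D i -> ~ B (S i).
Proof.
move=> [M [v hv]].
have [mu [v0 [hv0 hi]]] : exists mu v0, weight_vector (@im_h _ _ _ _ M) mu v0 /\ im_e M i v0 <> 0.
  apply: contrapT => h; apply: hv; have [s [-> hs]] := im_weight v.
  rewrite linear_sum big1_seq // => w /andP[_ /hs[lam hw]].
  by apply: contrapT => hw'; apply: h; exists lam, w.
exact: (S_not_borel hv0 hi).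
Qed.

Lemma y_notB i c : ndg R D i -> c != 0 -> ~ B (y_ i c).
Proof.
move=> hi c0 hy; have [b [hb e]] := y_cell G hA i c0; apply: (S_notB hi).
apply: (borelMl (borel_x i c^-1)).
by apply: (borelMr hb); rewrite -e.
Qed.
End Affine.

(** * Sheaf cohomology *)

Section SheafTheory.
Variable X : topologicalType.
Implicit Types (F G J K : sheaf X) (U V W : set X).

Lemma res0 F U V (UV : V `<=` U) : open U -> open V -> res UV (0 : F U) = 0.
Proof.
by move=> oU oV; apply: (addrI (res UV (0 : F U))); rewrite -res_additive // !addr0.
Qed.
Lemma resN F U V (UV : V `<=` U) (s : F U) : open U -> open V -> res UV (- s) = - res UV s.
Proof.
by move=> oU oV; apply: (addrI (res UV s)); rewrite -res_additive // !subrr res0.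
Qed.
Lemma resB F U V (UV : V `<=` U) (s t : F U) : open U -> open V ->
  res UV (s - t) = res UV s - res UV t.
Proof. by move=> oU oV; rewrite res_additive // resN. Qed.

Lemma glue_on F (I : Type) (U : I -> set X) W (s : forall i, F (U i)) :
  (forall i, open (U i)) -> \bigcup_i U i = W ->
  (forall i j V (iV : V `<=` U i) (jV : V `<=` U j), open V -> res iV (s i) = res jV (s j)) ->
  exists t : F W, forall i (iW : U i `<=` W), res iW t = s i.
Proof. by move=> oU; case: W / => h; have [t [ht _]] := sheaf_glue oU h; exists t. Qed.

Lemma sep_on F (I : Type) (U : I -> set X) W (t t' : F W) :
  (forall i, open (U i)) -> \bigcup_i U i = W ->
  (forall i (iW : U i `<=` W), res iW t = res iW t') -> t = t'.
Proof.
move=> oU e; case: W / e t t' => t t' h.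
have oW : open (\bigcup_i U i) by exact: bigcup_open.
have hs i : U i `<=` \bigcup_i U i by move=> x Ux; exists i.
have [|t0 [_ u]] := @sheaf_glue X F I U (fun i => res (hs i) t') oU.
  by move=> i j V iV jV oV; rewrite !(res_comp _ _ (subset_trans iV (hs i))).
have P : forall A B (h1 h2 : B `<=` A), h1 = h2 by move=> *; apply: Prop_irrelevance.
rewrite -(u t) => [|i iU]; last by rewrite h (P _ _ _ iU (hs i)).
by apply: (u t') => i iU; rewrite (P _ _ _ iU (hs i)).
Qed.

Lemma sep_local F W (t t' : F W) : open W ->
  (forall x, W x -> exists V (h : V `<=` W), [/\ open V, V x & res h t = res h t']) -> t = t'.
Proof.
move=> oW h.
pose I := {V : set X | open V /\ exists h : V `<=` W, res h t = res h t'}.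
apply: (@sep_on F I (fun i => sval i)) => [i||i iW].
- by have [] := svalP i.
- apply/seteqP; split=> [x [[V [oV [VW _]]] _ /=]|x Wx]; first exact: VW.
  by have [V [VW [oV Vx e]]] := h x Wx; exists (exist _ V (conj oV (ex_intro _ VW e))).
by have [_ [VW e]] := svalP i; rewrite (Prop_irrelevance iW VW).
Qed.

Lemma sec_set0 F (s t : F set0) : s = t.
Proof. by apply: sep_local => //; exact: open0. Qed.

Section Morphism.
Variables (F G : sheaf X) (phi : sheaf_map F G).
Hypothesis m : is_sheaf_morphism phi.
Lemma sm0 U : open U -> phi (0 : F U) = 0.
Proof. by case: m => mD _ oU; apply: (addrI (phi (0 : F U))); rewrite -mD // !addr0. Qed.
Lemma smD U (s t : F U) : open U -> phi (s + t) = phi s + phi t.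
Proof. by case: m => mD _ oU; rewrite mD. Qed.
Lemma smN U (s : F U) : open U -> phi (- s) = - phi s.
Proof. by move=> oU; apply: (addrI (phi s)); rewrite -smD // !subrr sm0. Qed.
Lemma smB U (s t : F U) : open U -> phi (s - t) = phi s - phi t.
Proof. by move=> oU; rewrite smD // smN. Qed.
Lemma sm_res U V (UV : V `<=` U) (s : F U) : open U -> open V ->
  phi (res UV s) = res UV (phi s).
Proof. by case: m => _; apply. Qed.
End Morphism.

(** * Extension by zero and flasqueness of injective sheaves *)

Section ExtensionByZero.
Variable U : set X.

(** The sections over W of the extension by zero of the constant sheaf Z on U: integer functions,
    locally constant on W, that vanish off U. They are functions on all of X, zero off W, so that
    restriction is truncation. *)
Definition lc_section W (n : X -> int) :=
  (forall x, ~ (W x /\ U x) -> n x = 0) /\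
  forall x, W x -> exists V, [/\ open V, V x, V `<=` W & forall y, V y -> n y = n x].
Definition lc_pred W : {pred X -> int} := fun n => `[< lc_section W n >].

Lemma lc_zmod_closed W : open W -> zmod_closed (lc_pred W).
Proof.
move=> oW; split=> [|n n' /asboolP [h0 h] /asboolP[h0' h']]; apply/asboolP.
  by split=> // x Wx; exists W; split.
split=> [x hx|x Wx]; first by rewrite -[LHS]/(n x - n' x) h0 // h0' // subr0.
have [V [oV Vx VW hV]] := h x Wx; have [V' [oV' Vx' VW' hV']] := h' x Wx.
exists (V `&` V'); split=> //; [exact: openI|by move=> y [/VW]|].
by move=> y [Vy Vy']; rewrite -[LHS]/(n y - n' y) hV // hV'.
Qed.

(* outside the open sets the sections are irrelevant *)
Definition lc_pred' W : {pred X -> int} :=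
  fun n => if pselect (open W) is left _ then lc_pred W n else n == 0.
Lemma lc_zmod_closed' W : zmod_closed (lc_pred' W).
Proof.
rewrite /lc_pred'; case: pselect => oW; last first.
  split=> [|n n']; first exact: eqxx.
  by rewrite -![_ \in _]/(_ == 0) => /eqP -> /eqP ->; rewrite subr0.
exact: lc_zmod_closed.
Qed.
HB.instance Definition _ W :=
  GRing.isZmodClosed.Build (X -> int) (lc_pred' W) (lc_zmod_closed' W).
Record lcsec W := LcSec { lcval :> X -> int; lcvalP : lcval \in lc_pred' W }.
HB.instance Definition _ W := [isSub for @lcval W].
HB.instance Definition _ W := [Choice of lcsec W by <:].
HB.instance Definition _ W := [SubChoice_isSubZmodule of lcsec W by <:].

Lemma lcP W n : open W -> n \in lc_pred' W -> lc_section W n.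
Proof. by move=> oW; rewrite -[_ \in _]/(lc_pred' W n) /lc_pred'; case: pselect => // _ /asboolP. Qed.
Lemma lc_in W n : open W -> lc_section W n -> n \in lc_pred' W.
Proof. by move=> oW h; rewrite -[_ \in _]/(lc_pred' W n) /lc_pred'; case: pselect => // _; apply/asboolP. Qed.
Lemma lc_eq W (s t : lcsec W) : lcval s =1 lcval t -> s = t.
Proof. by move=> st; apply: val_inj; apply/funext. Qed.

Definition lc_cut W (n : X -> int) : X -> int := fun x => if `[< W x >] then n x else 0.
Lemma lc_cutP V W (VW : V `<=` W) (s : lcsec W) : open W -> open V -> lc_cut V s \in lc_pred' V.
Proof.
move=> oW oV; apply: lc_in => //; have [h0 h] := lcP oW (lcvalP s); split=> x.
  by rewrite /lc_cut; case: asboolP => // Vx nx; apply: h0 => -[_ Ux]; apply: nx.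
move=> Vx; have [V' [oV' Vx' VW' hV']] := h x (VW _ Vx).
exists (V `&` V'); split=> //; [exact: openI|].
by move=> y [Vy Vy']; rewrite /lc_cut !asboolT // hV'.
Qed.
Definition lc_res W V (VW : V `<=` W) (s : lcsec W) : lcsec V :=
  match pselect (open W /\ open V) with
  | left h => LcSec (lc_cutP VW s h.1 h.2) | right _ => 0 end.
Lemma lc_resE W V (VW : V `<=` W) (s : lcsec W) x : open W -> open V -> V x ->
  lc_res VW s x = s x.
Proof. by move=> oW oV Vx; rewrite /lc_res; case: pselect => [h|[]] //=; rewrite /lc_cut asboolT. Qed.
Lemma lc_out W (s : lcsec W) x : open W -> ~ W x -> s x = 0.
Proof. by move=> oW nW; have [h0 _] := lcP oW (lcvalP s); apply: h0 => -[]. Qed.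
Lemma lc_res_ext W (s t : lcsec W) : open W -> (forall x, W x -> s x = t x) -> s = t.
Proof.
move=> oW h; apply: lc_eq => x; have [Wx|nW] := pselect (W x); first exact: h.
by rewrite !lc_out.
Qed.

Lemma lc_glue (I : Type) (O : I -> set X) (s : forall i, lcsec (O i)) :
  (forall i, open (O i)) ->
  (forall i j V (iV : V `<=` O i) (jV : V `<=` O j), open V ->
    lc_res iV (s i) = lc_res jV (s j)) ->
  exists! t : lcsec (\bigcup_i O i),
    forall i (iO : O i `<=` \bigcup_i O i), lc_res iO t = s i.
Proof.
move=> oO h; have oW : open (\bigcup_i O i) by exact: bigcup_open.
have agree i j x : O i x -> O j x -> s i x = s j x.
  move=> ix jx; have oV := openI (oO i) (oO j).
  have := congr1 (fun u : lcsec _ => u x) (h i j _ (@subIsetl _ _ _) (@subIsetr _ _ _) oV).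
  by rewrite /= !lc_resE.
pose f x : int := if pselect (exists i, O i x) is left e then s (sval (cid e)) x else 0.
have fE i x : O i x -> f x = s i x.
  by move=> ix; rewrite /f; case: pselect => [e|[]]; [apply: agree => //; case: cid|exists i].
have fP : f \in lc_pred' (\bigcup_i O i).
  apply: lc_in => //; split=> [x nx|x [i _ ix]].
    rewrite /f; case: pselect => // e; case: cid => i ix /=.
    by have [h0 _] := lcP (oO i) (lcvalP (s i)); apply: h0 => -[_ Ux]; apply: nx; split=> //; exists i.
  have [_ /(_ x ix) [V [oV Vx VO hV]]] := lcP (oO i) (lcvalP (s i)).
  exists V; split=> // [y /VO iy|y Vy]; first by exists i.
  by rewrite !(fE i) ?hV //; exact: VO.
exists (LcSec fP); split=> [i iO|t ht].
  by apply: lc_res_ext => // x ix; rewrite lc_resE //= (fE i).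
by apply: lc_res_ext => // x [i _ ix]; rewrite /= (fE i) // -(ht i (fun y iy => ex_intro2 _ _ i Logic.I iy)) lc_resE.
Qed.

Definition lc_sheaf : sheaf X.
Proof.
refine (@Sheaf X (fun W => lcsec W) lc_res _ _ _ lc_glue).
- move=> W V VW oW oV s t; apply: lc_res_ext => // x Vx.
  by rewrite -[RHS]/(lc_res VW s x + lc_res VW t x) !lc_resE.
- by move=> W WW s oW; apply: lc_res_ext => // x Wx; rewrite lc_resE.
- move=> W1 W2 W3 h12 h23 h13 s o1 o2 o3; apply: lc_res_ext => // x Wx.
  by rewrite !lc_resE //; exact: h23.
Defined.
End ExtensionByZero.

Section Flasque.
Variables (J : sheaf X) (U : set X) (s : J U).
Hypothesis oU : open U.

Definition lc_char W (n : lc_sheaf U W) (t : J W) :=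
  forall (m : int) V (VW : V `<=` W), open V -> (forall x, V x -> lcval n x = m) ->
    (forall VU : V `<=` U, res VW t = res VU s *~ m) /\ (m = 0 -> res VW t = 0).

Lemma resMz F W V (VW : V `<=` W) (t : F W) (m : int) : open W -> open V ->
  res VW (t *~ m) = res VW t *~ m.
Proof.
move=> oW oV; have h k : res VW (t *+ k) = res VW t *+ k.
  by elim: k => [|k IH]; rewrite ?mulr0n ?res0 // !mulrS res_additive // IH.
by case: m => k; rewrite ?NegzE ?mulrNz -?pmulrn ?resN // h.
Qed.

Lemma lc_level W (n : lcsec U W) m : open W -> open (W `&` [set x | lcval n x = m]).
Proof.
move=> oW; rewrite openE => x [Wx nx]; have [_ /(_ x Wx) [V [oV Vx VW hV]]] := lcP oW (lcvalP n).
apply: (@filterS _ (nbhs x) _ V); last exact: open_nbhs_nbhs.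
by move=> y Vy; split; [exact: VW|rewrite /= hV].
Qed.

Lemma lc_char_exists W (n : lc_sheaf U W) : open W -> exists t, lc_char n t.
Proof.
move=> oW; pose O m := W `&` [set x | lcval n x = m].
have OU m : m <> 0 -> O m `<=` U.
  move=> m0 x [Wx nx]; apply: contrapT => nU; apply: m0; rewrite -nx.
  by have [h0 _] := lcP oW (lcvalP n); apply: h0 => -[].
have oO m : open (O m) by exact: lc_level.
pose si m : J (O m) := if pselect (m <> 0) is left h then res (OU m h) s *~ m else 0.
have cO : \bigcup_m O m = W.
  by apply/seteqP; split=> [x [m _ []]//|x Wx]; exists (lcval n x).
have [i j V iV jV oV|t ht] := @glue_on J _ O W si oO cO.
  have [[x Vx]|e] := pselect (V !=set0); last first.
    have e0 : V = set0 by apply: contrapT => /eqP/set0P.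
  by move: iV jV; rewrite {}e0 => iV jV; exact: sec_set0.
  have [_ /= ei] := iV x Vx; have [_ /= ej] := jV x Vx.
  have eij : i = j by rewrite -ei -ej.
  by case: j / eij jV {ej} => jV; rewrite (Prop_irrelevance iV jV).
exists t => m V VW oV hV; have VO : V `<=` O m by move=> x Vx; split; [exact: VW|exact: hV].
have Om : O m `<=` W by move=> x [].
rewrite -(res_comp Om VO) // ht /si; case: pselect => [h|h]; last first.
  have m0 : m = 0 by apply: contrapT.
  by rewrite res0 //; split=> // VU; rewrite m0 mulr0z.
split=> [VU|//]; first by rewrite resMz // (res_comp _ _ VU).
Qed.

Lemma lc_char_uniq W (n : lc_sheaf U W) t t' : open W -> lc_char n t -> lc_char n t' -> t = t'.
Proof.
move=> oW h h'; apply: sep_local => // x Wx; pose V := W `&` [set y | lcval n y = lcval n x].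
have oV : open V by exact: lc_level.
exists V, (@subIsetl _ _ _); split=> //; have hV y : V y -> lcval n y = lcval n x by case.
have [h1 h2] := h _ V (@subIsetl _ _ _) oV hV; have [h1' h2'] := h' _ V (@subIsetl _ _ _) oV hV.
have [e|ne] := pselect (lcval n x = 0); first by rewrite h2 // h2'.
suff VU : V `<=` U by rewrite (h1 VU) (h1' VU).
move=> y [Wy e]; apply: contrapT => nU; apply: ne; rewrite -e.
by have [h0 _] := lcP oW (lcvalP n); apply: h0 => -[].
Qed.

Definition lc_map : sheaf_map (lc_sheaf U) J := fun W n =>
  if pselect (open W) is left oW then sval (cid (lc_char_exists n oW)) else 0.
Lemma lc_mapP W n : open W -> lc_char n (lc_map n : J W).
Proof. by move=> oW; rewrite /lc_map; case: pselect => // oW'; case: cid. Qed.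

Lemma lc_map_morphism : is_sheaf_morphism lc_map.
Proof.
split=> [W oW n n'|W V VW n oW oV].
  apply: sep_local => // x Wx.
  pose V := (W `&` [set y | lcval n y = lcval n x]) `&` (W `&` [set y | lcval n' y = lcval n' x]).
  have oV : open V by apply: openI; exact: lc_level.
  have VW : V `<=` W by move=> y [[]].
  exists V, VW; split=> //; rewrite res_additive //.
  have [h1 h2] := lc_mapP oW (n:=n) VW oV (fun y (h : V y) => h.1.2).
  have [h1' h2'] := lc_mapP oW (n:=n') VW oV (fun y (h : V y) => h.2.2).
  have hs y : V y -> lcval ((n : lcsec U W) + (n' : lcsec U W)) y = lcval n x + lcval n' x.
    by move=> [[_ e] [_ e']]; rewrite -[LHS]/(lcval n y + lcval n' y) e e'.
  have [k1 k2] := lc_mapP oW (n:=n + n') VW oV hs.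
  have [VU|nVU] := pselect (V `<=` U); first by rewrite (k1 VU) (h1 VU) (h1' VU) mulrzDr.
  have z (q : lcsec U W) c : (forall y, V y -> lcval q y = c) -> c = 0.
    move=> hq; apply: contrapT => c0; apply: nVU => y Vy; apply: contrapT => nU; apply: c0.
    by rewrite -(hq y Vy); have [h0 _] := lcP oW (lcvalP q); apply: h0 => -[].
  have e1 := z n _ (fun y (h : V y) => h.1.2); have e2 := z n' _ (fun y (h : V y) => h.2.2).
  by rewrite h2 // h2' // k2 ?e1 ?e2 ?addr0.
apply: (lc_char_uniq (n := lc_res VW n) oV); first exact: lc_mapP.
move=> m V' VV' oV' hV'.
have VW' : V' `<=` W by exact: (subset_trans VV' VW).
have [|h1 h2] := lc_mapP oW (n:=n) VW' oV' (m := m).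
  by move=> y Vy; rewrite -(hV' y Vy) /= lc_resE //; exact: VV'.
by rewrite (res_comp _ _ VW').
Qed.
End Flasque.

(** The section s is a morphism to J from the extension by zero of Z on U. It extends along the
    inclusion into the constant sheaf, and the image of the global section 1 restricts to s. *)
Lemma injective_flasque J U (s : J U) : injective_sheaf J -> open U ->
  exists t : J setT, forall h : U `<=` setT, res h t = s.
Proof.
move=> hJ oU.
have inP W (n : lc_sheaf U W) : open W -> lcval n \in lc_pred' setT W.
  move=> oW; apply: lc_in => //; have [h0 h] := lcP oW (lcvalP n); split=> // x hx.
  by apply: h0 => -[Wx _]; apply: hx.
pose i : sheaf_map (lc_sheaf U) (lc_sheaf setT) := fun W n =>
  if pselect (open W) is left oW then LcSec (inP W n oW) else 0.
have iE W (n : lc_sheaf U W) : open W -> lcval (i W n) = lcval n.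
  by rewrite /i; case: pselect.
have mi : is_monomorphism i.
  split; last first.
    move=> W oW n n' e; apply: (@lc_eq U W) => x.
    by rewrite -!(iE W) // e.
  split=> [W oW n n'|W V VW n oW oV]; apply: (@lc_eq setT) => x; rewrite ?iE //.
    by rewrite -[RHS]/(lcval (i W n) x + lcval (i W n') x) !iE.
  have [Vx|nV] := pselect (V x); last by rewrite !lc_out.
  by rewrite /= !lc_resE // iE.
have [g mg hg] := hJ _ _ _ _ mi (lc_map_morphism s oU).
have one A B : open A -> open B -> A `<=` B -> lc_cut A (fun=> 1) \in lc_pred' B A.
  move=> oA oB AB; apply: lc_in => //; split=> x.
    by rewrite /lc_cut; case: asboolP => // Ax nx; case: nx; split=> //; exact: AB.
  by move=> Ax; exists A; split=> // y Ay; rewrite /lc_cut !asboolT.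
exists (g setT (LcSec (one _ _ openT openT (@subset_refl _ _)))) => h.
case: (mg) => _ mr; rewrite -(mr _ _ h _ openT oU).
pose nU : lc_sheaf U U := LcSec (one _ _ oU oU (@subset_refl _ _)).
have -> : res h (LcSec (one _ _ openT openT (@subset_refl _ _)) : lc_sheaf setT setT) = i U nU.
  apply: (@lc_res_ext setT) => // x Ux.
    rewrite iE // -[LHS]/(lcval (lc_res h _) x) lc_resE //; last exact: openT.
  by rewrite /= /lc_cut !asboolT.
rewrite hg //; have [|h1 _] := lc_mapP s oU oU (n := nU) (@subset_refl _ _) oU (m := 1).
  by move=> y Uy; rewrite /= /lc_cut asboolT.
have := h1 (@subset_refl _ U); rewrite !res_id // mulr1z; exact.
Qed.

Lemma injective_flasque_sub J U V (UV : V `<=` U) (s : J V) : injective_sheaf J ->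
  open U -> open V -> exists t : J U, res UV t = s.
Proof.
move=> hJ oU oV; have [t ht] := injective_flasque s hJ oV.
exists (res (@subsetT _ U) t); rewrite (res_comp _ _ (@subsetT _ V)) //; exact: openT.
Qed.

Section Resolution.
Variables (F : sheaf X) (J : injective_resolution F).
Local Notation obj n := (ir_obj J n).
Local Notation d n := (@ir_d X F J n).
Local Notation eta := (@ir_eta X F J).

Definition coboundary n U (s : obj n.+1 U) := exists t, d n t = s.
(** The vanishing of H^(n+1)(U, F), tested on the resolution J. *)
Definition acyclic n U := forall s : obj n.+1 U, d n.+1 s = 0 -> coboundary s.

Lemma d_res n U V (UV : V `<=` U) (s : obj n U) : open U -> open V ->
  d n (res UV s) = res UV (d n s).
Proof. exact: (sm_res (ir_d_morphism J n)). Qed.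
Lemma dB n U (s t : obj n U) : open U -> d n (s - t) = d n s - d n t.
Proof. exact: (smB (ir_d_morphism J n)). Qed.
Lemma dd n U (s : obj n U) : open U -> d n.+1 (d n s) = 0.
Proof. by move=> oU; have [] := ir_exact J n oU. Qed.

Lemma coboundary_res n U V (UV : V `<=` U) (s : obj n.+1 U) : open U -> open V ->
  coboundary s -> coboundary (res UV s).
Proof. by move=> oU oV [t <-]; exists (res UV t); rewrite d_res. Qed.

Lemma kernel_eta U (s : obj 0 U) : open U -> d 0 s = 0 -> exists f : F U, eta f = s.
Proof.
move=> oU ds; have [me inj] := ir_eta_mono J; have [_ ex] := ir_exact0 J oU.
pose I := {V : set X | open V /\ exists (h : V `<=` U) (f : F V), eta f = res h s}.
have oI (i : I) : open (sval i) by have [] := svalP i.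
have sI (i : I) : exists f : F (sval i), forall h : sval i `<=` U, eta f = res h s.
  by have [_ [h [f e]]] := svalP i; exists f => h'; rewrite (Prop_irrelevance h' h).
have cI : \bigcup_(i : I) sval i = U.
  apply/seteqP; split=> [x [i _]|x Ux]; first by have [_ [h _]] := svalP i; exact: h.
  have [V [h [f [oV Vx e]]]] := ex s ds x Ux.
  by exists (exist _ V (conj oV (ex_intro _ h (ex_intro _ f e)))).
have sub (i : I) : sval i `<=` U by have [_ [h _]] := svalP i.
have [i j V iV jV oV|f hf] := @glue_on F I (fun i => sval i) U (fun i => sval (cid (sI i))) oI cI.
  apply: (inj V oV); rewrite !(sm_res me) // (svalP (cid (sI i)) (sub i)) (svalP (cid (sI j)) (sub j)).
  by rewrite !(res_comp _ _ (subset_trans iV (sub i))).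
exists f; apply: (@sep_on _ I (fun i => sval i)) => // i iU.
by rewrite -(sm_res me) // hf (svalP (cid (sI i)) iU).
Qed.

(** Primitives a and b over U and V differ over the intersection by a cocycle. In degree 0 it comes
    from a section of F, which is split by hypothesis; in higher degree it is d c, and c extends to
    U by flasqueness. After correction the primitives glue. *)
Lemma mayer_vietoris n U V W (s : obj n.+1 W) (hU : U `<=` W) (hV : V `<=` W) :
  open U -> open V -> U `|` V = W -> coboundary (res hU s) -> coboundary (res hV s) ->
  (if n is m.+1 then acyclic m (U `&` V) else
    forall f : F (U `&` V), exists (a : F U) (b : F V),
      f = res (@subIsetl _ U V) a - res (@subIsetr _ U V) b) ->
  coboundary s.
Proof.
move=> oU oV eW [a ha] [b hb]; have oW : open W by rewrite -eW; exact: openU.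
have oI := openI oU oV; set iU := @subIsetl _ U V; set iV := @subIsetr _ U V.
have glue (t : obj n U) (t' : obj n V) : d n t = res hU s -> d n t' = res hV s ->
    res iU t = res iV t' -> coboundary s.
  move=> ht ht' e.
  pose O (c : bool) := if c then U else V.
  pose si c : obj n (O c) := if c return obj n (O c) then t else t'.
  have oO c : open (O c) by case: c.
  have cO : \bigcup_c O c = W.
    rewrite -eW; apply/seteqP; split=> [x [[] _]|x [Ux|Vx]]; first by left.
    - by right.
    - by exists true.
    - by exists false.
  have [i j Y iY jY oY|q hq] := @glue_on _ _ O W si oO cO.
    have key (h1 : Y `<=` U) (h2 : Y `<=` V) : res h1 t = res h2 t'.
      have hY : Y `<=` U `&` V by move=> x Yx; split; [exact: h1|exact: h2].
      by rewrite -(res_comp iU hY) // e (res_comp iV hY h2).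
    case: i iY => iY; case: j jY => jY /=; rewrite ?(key iY jY) ?(key jY iY) //;
      by rewrite (Prop_irrelevance iY jY).
  exists q; apply: (@sep_on _ _ O) => // i iW; rewrite -d_res // hq.
  by case: i iW => iW /=; rewrite ?ht ?ht'; congr (res _ _); exact: Prop_irrelevance.
have dab : d n (res iU a - res iV b) = 0.
  rewrite dB // !d_res // ha hb !(res_comp _ _ (subset_trans iU hU)) //; exact: subrr.
case: n s a ha b hb glue dab => [|m] s a ha b hb glue dab H.
  have [f hf] := kernel_eta oI dab; have [fa [fb e]] := H f.
  have [me _] := ir_eta_mono J; have [ex0 _] := ir_exact0 J oU; have [ex0' _] := ir_exact0 J oV.
  apply: (glue (a - eta fa) (b - eta fb)); rewrite ?dB ?ex0 ?ex0' ?subr0 //.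
  have E : res iU a - res iV b = res iU (eta fa) - res iV (eta fb).
    by rewrite -hf e (smB me) // !(sm_res me).
  have EA : res iU a = res iU (eta fa) - res iV (eta fb) + res iV b by rewrite -E subrK.
  by rewrite !resB // EA addrAC (addrAC (res iU _)) subrr add0r addrC.
have [c hc] := H _ dab.
have [c' hc'] := injective_flasque_sub iU c (@ir_injective X F J m) oU oI.
apply: (glue (a - d m c') b) => //; first by rewrite dB // dd // subr0.
by rewrite resB // -d_res // hc' hc opprB addrC subrK.
Qed.

Lemma local_coboundary n U (s : obj n.+1 U) x : open U -> d n.+1 s = 0 -> U x ->
  exists V (h : V `<=` U), [/\ open V, V x & coboundary (res h s)].
Proof.
move=> oU ds Ux; have [_ ex] := ir_exact J n oU.
by have [V [h [t [oV Vx e]]]] := ex s ds x Ux; exists V, h; split=> //; exists t.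
Qed.

End Resolution.

Section ProductSheaf.
Variables J K : sheaf X.
Definition prod_res U V (UV : V `<=` U) (s : (J U * K U)%type) : (J V * K V)%type :=
  (res UV s.1, res UV s.2).
Definition prod_sheaf : sheaf X.
Proof.
refine (@Sheaf X (fun U => (J U * K U)%type : zmodType) prod_res _ _ _ _).
- by move=> U V UV oU oV [s1 s2] [t1 t2]; rewrite /prod_res /= !res_additive.
- by move=> U UU [s1 s2] oU; rewrite /prod_res /= !res_id.
- move=> U V W UV VW UW [s1 s2] oU oV oW; rewrite /prod_res /=.
  by rewrite !(res_comp _ _ UW).
- move=> I U s oU h.
  have h1 i j V (iV : V `<=` U i) (jV : V `<=` U j) : open V -> res iV (s i).1 = res jV (s j).1.
    by move=> oV; have [] := h i j V iV jV oV.
  have h2 i j V (iV : V `<=` U i) (jV : V `<=` U j) : open V -> res iV (s i).2 = res jV (s j).2.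
    by move=> oV; have [] := h i j V iV jV oV.
  have [t1 [e1 u1]] := sheaf_glue oU h1; have [t2 [e2 u2]] := sheaf_glue oU h2.
  exists (t1, t2); split=> [i iU|[x1 x2] hx]; first by rewrite /prod_res /= e1 e2 -surjective_pairing.
  congr pair; [apply: u1|apply: u2] => i iU; have := hx i iU; rewrite /prod_res /= => <-//.
Defined.
End ProductSheaf.

(** * Cohomology of the zero sheaf *)

Section ZeroSheaf.
Variables (F : sheaf X) (J : injective_resolution F).
Hypothesis F0 : forall U (f : F U), open U -> f = 0.
Local Notation obj n := (ir_obj J n).
Local Notation d n := (@ir_d X F J n).

(** Exactness of a resolution is local, so vanishing over X is derived from a contraction by sheaf
    morphisms. Given h with d h d = d, the map pi = d h is idempotent, and s |-> (pi s, d s) is a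
    monomorphism by local exactness. Extending 1 - pi along it, by injectivity, gives the next map
    h'. *)
Lemma homotopy n : exists2 h : sheaf_map (obj n.+1) (obj n), is_sheaf_morphism h &
  exists2 h' : sheaf_map (obj n.+2) (obj n.+1), is_sheaf_morphism h' &
    forall U, open U -> forall s : obj n.+1 U, s = d n (h U s) + h' U (d n.+1 s).
Proof.
have step n' (h : sheaf_map (obj n'.+1) (obj n')) : is_sheaf_morphism h ->
    (forall U, open U -> forall s : obj n' U, d n' (h U (d n' s)) = d n' s) ->
    exists2 h' : sheaf_map (obj n'.+2) (obj n'.+1), is_sheaf_morphism h' &
    forall U, open U -> forall s : obj n'.+1 U, s = d n' (h U s) + h' U (d n'.+1 s).
  move=> mh hd.
  pose pi : sheaf_map (obj n'.+1) (obj n'.+1) := fun U s => d n' (h U s).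
  pose mu : sheaf_map (obj n'.+1) (prod_sheaf (obj n'.+1) (obj n'.+2)) :=
    fun U s => (pi U s, d n'.+1 s).
  pose psi : sheaf_map (obj n'.+1) (obj n'.+1) := fun U s => s - pi U s.
  have md := ir_d_morphism J.
  have piD U s t : open U -> pi U (s + t) = pi U s + pi U t.
    by move=> oU; rewrite /pi (smD mh) // (smD (md _)).
  have piN U s : open U -> pi U (- s) = - pi U s.
    by move=> oU; rewrite /pi (smN mh) // (smN (md _)).
  have pir U V (UV : V `<=` U) s : open U -> open V -> pi V (res UV s) = res UV (pi U s).
    by move=> oU oV; rewrite /pi (sm_res mh) // d_res.
  have pipi U s : open U -> pi U (pi U s) = pi U s by move=> oU; rewrite /pi hd.
  have dpi U s : open U -> d n'.+1 (pi U s) = 0 by move=> oU; exact: dd.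
  have mmu : is_sheaf_morphism mu.
    split=> [U oU s t|U V UV s oU oV]; first by rewrite /mu piD // (smD (md _)).
    by rewrite /mu pir // d_res.
  have mpsi : is_sheaf_morphism psi.
    split=> [U oU s t|U V UV s oU oV]; first by rewrite /psi piD // opprD addrACA.
    by rewrite /psi pir // resB.
  have mono : is_monomorphism mu.
    split=> // U oU s t e; apply/eqP; rewrite -subr_eq0; apply/eqP.
    have [e1 e2] : pi U (s - t) = 0 /\ d n'.+1 (s - t) = 0.
      have := congr1 fst e; have := congr1 snd e; rewrite /= => e2 e1.
      by split; [rewrite piD // piN // e1 subrr|rewrite dB // e2 subrr].
    apply: sep_local => // x Ux; have [V [h0 [oV Vx [t0 ht0]]]] := local_coboundary oU e2 Ux.
    exists V, h0; split=> //; rewrite res0 // -ht0 -hd // ht0 -[LHS]/(pi V _) pir // e1 res0 //.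
  have [g mg hg] := @ir_injective X F J n'.+1 _ _ _ _ mono mpsi.
  exists (fun U x => g U (0, x)).
    split=> [U oU s t|U V UV s oU oV].
      by rewrite -(smD mg) //; congr (g _ _); rewrite -[RHS]/(0 + 0, s + t) addr0.
    rewrite -(sm_res mg) //; congr (g _ _); rewrite /= /prod_res /= res0 //.
  move=> U oU s; have := hg U oU (psi U s); rewrite /mu {1}/psi piD // piN // pipi // subrr.
  rewrite {1}/psi dB // dpi // subr0 => ->; rewrite /psi piD // piN // pipi // subrr subr0.
  by rewrite addrC subrK.
suff [h mh hd] : exists2 h : sheaf_map (obj n.+1) (obj n), is_sheaf_morphism h &
    forall U, open U -> forall s : obj n U, d n (h U (d n s)) = d n s.
  by exists h => //; exact: step.
elim: n => [|n [h mh hd]]; last first.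
  have [h' mh' e] := step n h mh hd; exists h' => // U oU s.
  have := congr1 (fun x => d n.+1 x) (e U oU s); rewrite (smD (ir_d_morphism J _)) // dd // add0r.
  by move=> <-.
have mono : is_monomorphism (d 0).
  split; first exact: ir_d_morphism.
  move=> U oU s t e; apply/eqP; rewrite -subr_eq0; apply/eqP.
  have [|f <-] := @kernel_eta F J U (s - t) oU; first by rewrite dB // e subrr.
  by rewrite (F0 f oU); apply: sm0 => //; case: (ir_eta_mono J).
have [|g mg hg] := @ir_injective X F J 0 _ _ _ (fun U s => s) mono _; first by [].
by exists g => // U oU s; rewrite hg.
Qed.

Lemma zero_sheaf_acyclic j : (0 < j)%N -> forall s : obj j setT, d j s = 0 ->
  global_coboundary s.
Proof.
case: j => // n _ s ds; have [h mh [h' mh' e]] := homotopy n.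
exists (h setT s); rewrite [RHS](e _ openT) ds (sm0 mh') ?addr0 //; exact: openT.
Qed.
End ZeroSheaf.
End SheafTheory.

(** Nested closed intervals, each step avoiding one of the finite sets; the supremum of the left
    ends lies in all of them. This feeds the countability argument in [coordinate_value]. *)
Lemma real_uncountable (R : realType) (s : nat -> seq R) : exists x, forall n, x \notin s n.
Proof.
have third (a b x : R) : a < b -> exists a' b', [/\ a <= a', a' < b', b' <= b & ~ (a' <= x <= b')].
  move=> ab; have [h|h] := ltP x ((a + b) / 2).
    exists ((a + b) / 2), b; split; [lra|lra|by []|by move=> /andP[]; rewrite leNgt h].
  exists a, (a + (b - a) / 3); split; [by []|lra|lra|move=> /andP[_ h']; lra].
have avoid (l : seq R) (a b : R) : a < b ->
    exists p : R * R, [/\ a <= p.1, p.1 < p.2, p.2 <= b & forall x, x \in l -> ~ (p.1 <= x <= p.2)].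
  elim: l a b => [|y l IH] a b ab; first by exists (a, b).
  have [a1 [b1 [h1 h2 h3 h4]]] := third a b y ab; have [p [k1 k2 k3 k4]] := IH a1 b1 h2.
  exists p; split; [exact: le_trans k1|by []|exact: le_trans h3|].
  move=> x; rewrite inE => /orP[/eqP -> /andP[e1 e2]|/k4//].
  by apply: h4; rewrite (le_trans k1 e1) (le_trans e2 k3).
pose next n (p : R * R) := if pselect (p.1 < p.2) is left h then sval (cid (avoid (s n) _ _ h)) else p.
pose I := fix I n := if n is n'.+1 then next n' (I n') else (0, 1).
have I_lt n : (I n).1 < (I n).2.
  elim: n => [|n IH] /=; first exact: ltr01.
  by rewrite /next; case: pselect => // h; case: cid => p [].
have IS n : [/\ (I n).1 <= (I n.+1).1, (I n.+1).2 <= (I n).2 &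
    forall x, x \in s n -> ~ ((I n.+1).1 <= x <= (I n.+1).2)].
  by rewrite /= /next; case: pselect (I_lt n) => // h _; case: cid => p [].
have mono n k : (I n).1 <= (I (n + k)%N).1 /\ (I (n + k)%N).2 <= (I n).2.
  elim: k => [|k [h1 h2]]; rewrite ?addn0 // addnS; have [k1 k2 _] := IS (n + k)%N.
  by rewrite (le_trans h1 k1) (le_trans k2 h2).
have cross n k : (I n).1 <= (I k).2.
  have [h1 _] := mono n k; have [_ h2] := mono k n; rewrite addnC in h2.
  exact: le_trans (le_trans h1 (ltW (I_lt _))) h2.
pose E := [set x | exists n, x = (I n).1].
have ubE k : ubound E (I k).2 by move=> _ [n ->]; exact: cross.
have hE : has_sup E by split; [exists (I 0%N).1, 0%N|exists (I 0%N).2; exact: ubE].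
exists (sup E) => n; apply/negP => hn; have [_ _ h] := IS n; apply: (h _ hn); apply/andP; split.
  by apply: ub_le_sup; [case: hE|exists n.+1].
by apply: ge_sup; [case: hE|exact: ubE].
Qed.

(** * Polynomial functions *)

Section PolynomialFunctions.
Variables (R : realType) (r : nat).
Local Notation C := R[i].
Local Notation P := (mpoly.mpoly r C).
Local Notation peval t p := (@mpoly.meval r C t p).
Local Notation pt := ('I_r -> C).
Local Notation PC c := (@mpoly.mpolyC r C c).
Local Notation PX i := (mpoly.mpolyX C (mpoly.mnm1 i) : P).
Implicit Types (f g : pt -> C) (t : pt) (k : 'I_r).

Lemma mpoly_induction (K : P -> Prop) : (forall c, K (PC c)) -> (forall i, K (PX i)) ->
  (forall p q, K p -> K q -> K (p + q)) -> (forall p q, K p -> K q -> K (p * q)) ->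
  forall p, K p.
Proof.
move=> KC KX KD KM; elim/(@mpoly.mpolyind r C) => [|c m p _ _ hp].
  by rewrite -mpoly.mpolyC0.
apply: (KD) => //; rewrite -mpoly.mul_mpolyC; apply: (KM) => //; rewrite mpoly.mpolyXE_id.
apply: (@big_ind _ K) => [||i _]; [exact: KC|exact: KM|].
by elim: (m i) => [|n IH]; [exact: KC|rewrite exprS; apply: (KM)].
Qed.

Definition pfun f := exists p : P, forall t, f t = peval t p.

Lemma pfunC c : pfun (fun=> c).
Proof. by exists (PC c) => t; rewrite mpoly.mevalC. Qed.
Lemma pfunX k : pfun (fun t => t k).
Proof. by exists (PX k) => t; rewrite mpoly.mevalXU. Qed.
Lemma pfunD f g : pfun f -> pfun g -> pfun (fun t => f t + g t).
Proof. by move=> [p hp] [q hq]; exists (p + q) => t; rewrite mpoly.mevalD hp hq. Qed.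
Lemma pfunM f g : pfun f -> pfun g -> pfun (fun t => f t * g t).
Proof. by move=> [p hp] [q hq]; exists (p * q) => t; rewrite mpoly.mevalM hp hq. Qed.
Lemma pfun_ext f g : (forall t, f t = g t) -> pfun f -> pfun g.
Proof. by move=> e [p hp]; exists p => t; rewrite -e. Qed.
Lemma pfunN f : pfun f -> pfun (fun t => - f t).
Proof.
by move=> hf; apply: pfun_ext (pfunM (pfunC (-1)) hf) => t; rewrite mulN1r.
Qed.
Lemma pfunB f g : pfun f -> pfun g -> pfun (fun t => f t - g t).
Proof. by move=> hf hg; exact: pfunD (pfunN hg). Qed.
Lemma pfunXn f n : pfun f -> pfun (fun t => f t ^+ n).
Proof.
move=> hf; elim: n => [|n IH]; first exact: pfunC.
by apply: pfun_ext (pfunM hf IH) => t; rewrite exprS.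
Qed.
Lemma pfun_prod (I : Type) (s : seq I) (Q : pred I) (f : I -> pt -> C) :
  (forall i, Q i -> pfun (f i)) -> pfun (fun t => \prod_(i <- s | Q i) f i t).
Proof.
move=> h; elim: s => [|i s IH].
  by apply: pfun_ext (pfunC 1) => t; rewrite big_nil.
have [Qi|nQi] := boolP (Q i).
  by apply: pfun_ext (pfunM (h i Qi) IH) => t; rewrite big_cons Qi.
by apply: pfun_ext IH => t; rewrite big_cons (negPf nQi).
Qed.

Lemma pfun_ind (K : (pt -> C) -> Prop) : (forall f g, (forall t, f t = g t) -> K f -> K g) ->
  (forall c, K (fun=> c)) -> (forall k, K (fun t => t k)) ->
  (forall f g, pfun f -> pfun g -> K f -> K g -> K (fun t => f t + g t)) ->
  (forall f g, pfun f -> pfun g -> K f -> K g -> K (fun t => f t * g t)) ->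
  forall f, pfun f -> K f.
Proof.
move=> Ke KC KX KD KM f [p hp].
have pp q : pfun (fun t => peval t q) by exists q.
apply: (Ke (fun t => peval t p)) => //; elim/mpoly_induction: p {f hp} => [c|i|p q hp hq|p q hp hq].
- by apply: Ke (KC c) => t; rewrite mpoly.mevalC.
- by apply: Ke (KX i) => t; rewrite mpoly.mevalXU.
- by apply: Ke (KD _ _ (pp p) (pp q) hp hq) => t; rewrite mpoly.mevalD.
- by apply: Ke (KM _ _ (pp p) (pp q) hp hq) => t; rewrite mpoly.mevalM.
Qed.

Lemma pfun_comp f (s : 'I_r -> pt -> C) : pfun f -> (forall i, pfun (s i)) ->
  pfun (fun t => f (fun i => s i t)).
Proof.
move=> hf hs; elim/pfun_ind: f / hf => [f g e|c|k|f g _ _ h1 h2|f g _ _ h1 h2].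
- by apply: pfun_ext => t; rewrite e.
- exact: pfunC.
- exact: hs.
- exact: pfunD.
- exact: pfunM.
Qed.

Lemma pfun_line f x y : pfun f -> exists F : {poly C}, forall s, f (fun i => x i + s * (y i - x i)) = F.[s].
Proof.
elim/pfun_ind => {f} [f g e [F hF]|c|k|f g _ _ [F hF] [G hG]|f g _ _ [F hF] [G hG]].
- by exists F => s; rewrite -e.
- by exists c%:P => s; rewrite hornerC.
- by exists ((x k)%:P + 'X * (y k - x k)%:P) => s; rewrite !hornerE.
- by exists (F + G) => s; rewrite hornerD hF hG.
- by exists (F * G) => s; rewrite hornerM hF hG.
Qed.

Lemma poly_nonroot (F : {poly C}) : F != 0 -> exists s, F.[s] != 0.
Proof.
move=> F0; apply: contrapT => h.
have := max_poly_roots (rs := [seq i%:R | i <- iota 0 (size F)]) F0.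
rewrite size_map size_iota ltnn map_inj_uniq ?iota_uniq; last first.
  by move=> i j /eqP; rewrite eqr_nat => /eqP.
suff -> : all (root F) [seq i%:R | i <- iota 0 (size F)] by move=> /(_ isT isT).
apply/allP => s _; apply/eqP; apply: contrapT => /eqP hs; apply: h; by exists s.
Qed.

(** The line through a point where f is nonzero and a point where g is nonzero reduces the claim to
    polynomials in one variable. *)
Lemma pfun_integral f g : pfun f -> pfun g -> (exists x, f x != 0) -> (exists x, g x != 0) ->
  exists x, f x * g x != 0.
Proof.
move=> hf hg [x hx] [y hy]; have [F hF] := pfun_line x y hf; have [G hG] := pfun_line x y hg.
have F0 : F != 0.
  apply: contraNneq hx => e; have := hF 0; rewrite e horner0.
  by under [X in f X]eq_fun do rewrite mul0r addr0; move=> ->.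
have G0 : G != 0.
  apply: contraNneq hy => e; have := hG 1; rewrite e horner0.
  by under [X in g X]eq_fun do rewrite mul1r addrC subrK; move=> ->.
have [s hs] := poly_nonroot (mulf_neq0 F0 G0).
by exists (fun i => x i + s * (y i - x i)); rewrite hF hG -hornerM.
Qed.

Lemma pfun_dense f g : pfun f -> pfun g -> (exists x, g x != 0) ->
  (forall t, g t != 0 -> f t = 0) -> forall t, f t = 0.
Proof.
move=> hf hg g0 h t; apply: contrapT => /eqP ft.
have [|x] := pfun_integral hf hg _ g0; first by exists t.
by rewrite mulf_eq0 negb_or => /andP[fx /h e]; rewrite e eqxx in fx.
Qed.

Definition upd t k (c : C) : pt := fun i => if i == k then c else t i.
Lemma upd_eq t k c : upd t k c k = c. Proof. by rewrite /upd eqxx. Qed.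
Lemma upd_neq t k c i : i != k -> upd t k c i = t i. Proof. by rewrite /upd => /negPf ->. Qed.
Lemma upd_upd t k c d : upd (upd t k c) k d = upd t k d.
Proof. by apply/funext => i; rewrite /upd; case: eqP. Qed.
Lemma upd_id t k : upd t k (t k) = t.
Proof. by apply/funext => i; rewrite /upd; case: eqP => // ->. Qed.

Lemma pfun_upd f k c : pfun f -> pfun (fun t => f (upd t k c)).
Proof.
move=> hf; apply: (@pfun_comp f (fun i t => upd t k c i)) => // i; rewrite /upd.
by case: eqP => _; [exact: pfunC|exact: pfunX].
Qed.

Lemma pfun_div f k : pfun f ->
  exists2 f1, pfun f1 & forall t, f t = f (upd t k 0) + t k * f1 t.
Proof.
elim/pfun_ind => {f} [f g e [f1 h1 e1]|c|i|f g _ _ [f1 h1 e1] [g1 k1 e2]|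
    f g pf pg [f1 h1 e1] [g1 k1 e2]].
- by exists f1 => // t; rewrite -!e e1.
- by exists (fun=> 0); [exact: pfunC|move=> t; rewrite mulr0 addr0].
- have [->|ik] := eqVneq i k.
    by exists (fun=> 1); [exact: pfunC|move=> t; rewrite upd_eq mulr1 add0r].
  by exists (fun=> 0); [exact: pfunC|move=> t; rewrite upd_neq // mulr0 addr0].
- exists (fun t => f1 t + g1 t); first exact: pfunD.
  by move=> t; rewrite e1 e2; ring.
- exists (fun t => f (upd t k 0) * g1 t + f1 t * g t).
    by apply: pfunD; apply: pfunM => //; exact: pfun_upd.
  by move=> t; rewrite (e2 t) {1}(e1 t); ring.
Qed.

Lemma pfun_trunc f k n : pfun f -> exists (L : nat -> pt -> C) (H : pt -> C),
  [/\ forall m, pfun (L m), forall m t c, L m (upd t k c) = L m t, pfun H &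
      forall t, f t = \sum_(m < n) L m t * t k ^+ m + t k ^+ n * H t].
Proof.
move=> hf; elim: n => [|n [L [H [hL Lk hH e]]]].
  by exists (fun _ _ => 0), f; split=> // [_|t]; [exact: pfunC|rewrite big_ord0 add0r mul1r].
have [H1 hH1 eH] := pfun_div k hH.
exists (fun m => if m == n then fun t => H (upd t k 0) else L m), H1; split=> //.
- by move=> m; case: eqP => // _; exact: pfun_upd.
- by move=> m t c; case: eqP => // _; rewrite upd_upd.
- move=> t; rewrite e eH big_ord_recr /= eqxx exprS.
  under [in RHS]eq_bigr => i _ do rewrite (ltn_eqF (ltn_ord i)).
  ring.
Qed.

(** The prime t_k does not divide W. On the hyperplane t_k = 0 the product f W vanishes while W is
    not identically zero, so f vanishes there and a factor t_k can be split off; repeat n times. *)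
Lemma pfun_remove f W M k n : pfun f -> pfun W -> pfun M ->
  (exists2 t, t k = 0 & W t != 0) -> (forall t, f t * W t = t k ^+ n * M t) ->
  exists2 f', pfun f' & forall t, f t = t k ^+ n * f' t.
Proof.
move=> hf hW hM [t0 t0k Wt0]; elim: n f hf => [|n IH] f hf e.
  by exists f => // t; rewrite mul1r.
have [f1 hf1 e1] := pfun_div k hf.
have f0 t : f (upd t k 0) = 0.
  apply: (pfun_dense (pfun_upd k 0 hf) (pfun_upd k 0 hW)).
    by exists t0; move: Wt0; rewrite -{1}(upd_id t0 k) t0k.
  move=> {}t Wt; have := e (upd t k 0); rewrite upd_eq exprS !mul0r => /eqP.
  by rewrite mulf_eq0 (negPf Wt) orbF => /eqP.
have [|f' hf' e'] := IH f1 hf1; last first.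
  by exists f' => // t; rewrite e1 f0 add0r e' exprS mulrA.
move=> t; apply/eqP; rewrite -subr_eq0; apply/eqP; move: t.
apply: (@pfun_dense (fun t => f1 t * W t - t k ^+ n * M t) (fun t => t k)).
- by apply: pfunB; apply: pfunM => //; apply: pfunXn; exact: pfunX.
- exact: pfunX.
- by exists (fun=> 1); rewrite oner_neq0.
move=> t tk; apply: (mulfI tk); rewrite mulr0 mulrBr mulrA mulrA -exprS -e e1 f0 add0r.
by rewrite subrr.
Qed.

(** * The Nullstellensatz, by the uncountability of the field *)

Section Nullstellensatz.

Definition is_ideal (I : P -> Prop) :=
  [/\ I 0, forall x y, I x -> I y -> I (x + y) & forall x y, I x -> I (x * y)].

Variables (I : P -> Prop) (q : P).
Hypothesis hI : is_ideal I.
Hypothesis nozero : forall t, peval t q != 0 -> exists2 p, I p & peval t p != 0.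

Definition avoids (m : P -> Prop) :=
  [/\ is_ideal m, forall p, I p -> m p & forall n, ~ m (q ^+ n)].

Lemma ideal_sum m (J : Type) (s : seq J) (F : J -> P) : is_ideal m ->
  (forall i, m (F i)) -> m (\sum_(i <- s) F i).
Proof. by move=> [m0 mD _] h; apply: big_ind. Qed.

Lemma maximal_avoiding : (forall n, ~ I (q ^+ n)) -> exists2 m, avoids m &
  forall x, ~ m x -> exists u n, m (q ^+ n - x * u).
Proof.
move=> hq.
have [F Fs tot|m [Pm mmax]] := @Zorn_bigcup P (fun S => S = set0 \/ avoids S).
  have [[S0 FS0 aS0]|none] := pselect (exists2 S, F S & avoids S); last first.
    left; apply/seteqP; split=> // x [S FS Sx]; have [e|a] := Fs S FS.
      by rewrite e in Sx.
    by case: none; exists S.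
  have av S : F S -> S !=set0 -> avoids S.
    by move=> FS [x Sx]; case: (Fs S FS) => // e; rewrite e in Sx.
  right; split.
  - have [[z0 _ _] _ _] := aS0; split; first by exists S0.
      move=> x y [S1 FS1 Sx] [S2 FS2 Sy].
      have [h|h] := tot S1 S2 FS1 FS2.
        by have [|[_ D _] _ _] := av S2 FS2; [exists y|exists S2 => //; apply: D => //; exact: h].
      by have [|[_ D _] _ _] := av S1 FS1; [exists x|exists S1 => //; apply: D => //; exact: h].
    move=> x y [S FS Sx]; exists S => //.
    by have [|[_ _ M] _ _] := av S FS; [exists x|exact: M].
  - by move=> p Ip; exists S0 => //; case: aS0 => _ + _; apply.
  - by move=> n [S FS Sn]; have [|_ _ h] := av S FS; [exists (q ^+ n)|exact: (h n)].
have aI : avoids I by split.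
have am : avoids m.
  case: Pm => // e; exfalso; apply: (mmax I); last by right.
  by rewrite e; split=> //; case: hI => I0 _ _ /(_ _ I0).
exists m => // x nx; have [[m0 mD mM] mI mq] := am.
pose S p := exists u, m (p - x * u).
have iS : is_ideal S.
  split; first by exists 0; rewrite mulr0 subr0.
  - by move=> y z [u hu] [v hv]; exists (u + v); rewrite mulrDr opprD addrACA; exact: mD.
  - by move=> y z [u hu]; exists (u * z); rewrite mulrA -mulrBl; exact: mM.
apply: contrapT => h; apply: (mmax S); last first.
  right; split=> // [p Ip|n [u hu]]; last by apply: h; exists u, n.
  by exists 0; rewrite mulr0 subr0; exact: mI.
split=> [p mp|]; first by exists 0; rewrite mulr0 subr0.
by move=> /(_ x) SS; apply: nx; apply: SS; exists 1; rewrite mulr1 subrr.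
Qed.

Section Max.
Variable m : P -> Prop.
Hypotheses (am : avoids m) (mm : forall x, ~ m x -> exists u n, m (q ^+ n - x * u)).

Lemma max_prime x y : m (x * y) -> m x \/ m y.
Proof.
have [[m0 mD mM] mI mq] := am; move=> hxy.
have [mx|nx] := pselect (m x); first by left.
have [my|ny] := pselect (m y); first by right.
have [u [a hu]] := mm nx; have [v [b hv]] := mm ny; exfalso; apply: (mq (a + b)%N).
have -> : q ^+ (a + b) = (q ^+ a - x * u) * q ^+ b + ((q ^+ b - y * v) * (x * u) + x * y * (u * v)).
  by rewrite exprD; ring.
by apply: (mD); [exact: mM|apply: (mD); exact: mM].
Qed.

Lemma maxN x : m x -> m (- x).
Proof. by have [[_ _ mM] _ _] := am => h; rewrite -mulrN1; exact: mM. Qed.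
Lemma maxC c : m (PC c) -> c = 0.
Proof.
have [[_ _ mM] _ mq] := am; move=> h; apply: contrapT => /eqP c0; apply: (mq 0%N).
by rewrite expr0 -mpoly.mpolyC1 -(mulfV c0) mpoly.mpolyCM; exact: mM.
Qed.

Lemma lin_dep (M K : nat) (u : 'I_K -> P) : (forall j, (mpoly.msize (u j) <= M)%N) ->
  (#|{: mpoly.bmultinom r M}| < K)%N -> exists v : 'I_K -> C, (exists j, v j != 0) /\
    \sum_j PC (v j) * u j = 0.
Proof.
move=> hu hK; pose n := #|{: mpoly.bmultinom r M}|.
pose A : 'M[C]_(K, n) := \matrix_(j, b) mpoly.mcoeff (enum_val b : mpoly.bmultinom r M) (u j).
have : kermx A != 0.
  rewrite -mxrank_eq0 mxrank_ker -lt0n subn_gt0; apply: leq_ltn_trans hK.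
  exact: rank_leq_col.
move=> /rowV0Pn[v /sub_kermxP vA v0]; exists (fun j => v 0 j); split.
  have /existsP[j hj] : [exists j, v 0 j != 0].
    by apply: contraNT v0; rewrite negb_exists => /forallP h; apply/eqP/rowP => j;
      rewrite mxE; apply/eqP; have := h j; rewrite negbK.
  by exists j.
apply/mpoly.mpolyP => b; rewrite mpoly.mcoeff0 raddf_sum /=.
have [hb|hb] := ltnP (mpoly.mdeg b) M.
  move/rowP/(_ (enum_rank (mpoly.BMultinom hb))): vA; rewrite !mxE => {2}<-.
  by apply: eq_bigr => j _; rewrite mpoly.mul_mpolyC mpoly.mcoeffZ mxE enum_rankK.
rewrite big1 // => j _; rewrite mpoly.mul_mpolyC mpoly.mcoeffZ mpoly.memN_msupp_eq0 ?mulr0 //.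
exact: mpoly.msize_mdeg_ge (leq_trans (hu j) hb).
Qed.

(** Otherwise every c has some u with q^n = (X_i - c) u modulo m. As C is uncountable, more values
    c_j than there are monomials of the degree in question share the same n and the same degree
    bound for u. A linear relation among these u_j, multiplied by the product of all X_i - c_j, puts
    q^n G(X_i) into m with G <> 0; m is prime and contains no power of q, so it contains X_i - a for
    a root a of G. *)
Lemma coordinate_value i : exists c, m (PX i - PC c).
Proof.
have [[m0 mD mM] mI mq] := am; apply: contrapT => none.
have hc c : {un : P * nat | m (q ^+ un.2 - (PX i - PC c) * un.1)}.
  apply: cid; have [|u [n h]] := @mm (PX i - PC c); last by exists (u, n).
  by move=> h; apply: none; exists c.
pose code (x : R) : nat := pickle (mpoly.msize (sval (hc (Complex x 0))).1, (sval (hc (Complex x 0))).2).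
(* The code records the size of u and the exponent n. If every fibre of it were finite, the real
   numbers would be a countable union of finite sets. *)
have [b hb] : exists b : nat, forall K, exists s : seq R, [/\ uniq s, size s = K & forall x, x \in s -> code x = b].
  apply: contrapT => fin.
  have fib b : exists s : seq R, forall x, code x = b -> x \in s.
    apply: contrapT => nfib; apply: fin; exists b; elim=> [|K [s [us ss hs]]]; first by exists [::].
    have [x [hx nx]] : exists x, code x = b /\ x \notin s.
      apply: contrapT => h; apply: nfib; exists s => x hx.
      by apply: contrapT => /negP nx; apply: h; exists x.
    exists (x :: s); split; rewrite /= ?nx ?ss // => y.
    by rewrite inE => /orP[/eqP ->|/hs].
  have [x hx] := real_uncountable (fun b => sval (cid (fib b))).
  by have := hx (code x); case: cid => s /= /(_ x erefl) ->.
have [[M n] eb] : exists p : nat * nat, pickle p = b.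
  have [s [_ ss hs]] := hb 1%N; case: s ss hs => // x s _ /(_ x (mem_head _ _)) <-.
  by eexists.
pose K := #|{: mpoly.bmultinom r M}|.+1.
have [s [us ss hs]] := hb K.
pose c (j : 'I_K) : C := Complex (nth 0 s j) 0.
have cj (j : 'I_K) : (mpoly.msize (sval (hc (c j))).1, (sval (hc (c j))).2) = (M, n).
  by apply: (pcan_inj pickleK); rewrite eb; apply: hs; rewrite mem_nth ?ss.
have c_inj (j k : 'I_K) : c j = c k -> j = k.
  by move=> [/eqP]; rewrite nth_uniq ?ss // => /eqP /val_inj.
pose u (j : 'I_K) := (sval (hc (c j))).1.
have hu j : m (q ^+ n - (PX i - PC (c j)) * u j).
  by have := svalP (hc (c j)); case: (cj j) => _ ->.
have [v [[j0 vj0] dep]] : exists v : 'I_K -> C, (exists j, v j != 0) /\ \sum_j PC (v j) * u j = 0.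
  by apply: (@lin_dep M) => // j; case: (cj j) => -> _.
have [ev [evX evC]] : exists ev : {rmorphism {poly C} -> P},
    (forall a, ev ('X - a%:P) = PX i - PC a) /\ forall a, ev a%:P = PC a.
  exists (horner_alg (PX i)); split=> a; last by rewrite /= horner_algC mpoly.alg_mpolyC.
  by rewrite rmorphB /= horner_algX horner_algC mpoly.alg_mpolyC.
have evM (a1 a2 : {poly C}) : ev (a1 * a2) = ev a1 * ev a2 by exact: rmorphM.
pose G : {poly C} := \sum_j (v j)%:P * \prod_(k | k != j) ('X - (c k)%:P).
have G0 : G != 0.
  have [e|//] := eqVneq G 0; have /eqP := congr1 (fun p : {poly C} => p.[c j0]) e.
  rewrite horner0 horner_sum (bigD1 j0) //= [X in _ + X]big1 ?addr0 => [|j hj]; last first.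
    have hj' : j0 != j by rewrite eq_sym.
    by rewrite hornerM horner_prod (bigD1 j0) //= hornerXsubC subrr mul0r mulr0.
  rewrite hornerM hornerC mulf_eq0 (negPf vj0) horner_prod => /prodf_eq0 [k hk].
  by rewrite hornerXsubC subr_eq0 => /eqP/c_inj e'; rewrite e' eqxx in hk.
have mG : m (ev G).
  have : m (q ^+ n * ev G).
    have -> : q ^+ n * ev G = \sum_j (q ^+ n - (PX i - PC (c j)) * u j) * (PC (v j) * ev (\prod_(k | k != j) ('X - (c k)%:P))) +
        ev (\prod_k ('X - (c k)%:P)) * (\sum_j PC (v j) * u j).
      rewrite mulr_sumr -big_split rmorph_sum mulr_sumr; apply: eq_bigr => j _ /=.
      have -> : \prod_k ('X - (c k)%:P) = ('X - (c j)%:P) * \prod_(k | k != j) ('X - (c k)%:P).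
        by rewrite (bigD1 j).
      rewrite !evM evC evX.
      move: (ev _) (PX i - _) (q ^+ n) (PC _) (u j) => x1 x2 x3 x4 x5; ring.
    rewrite dep mulr0 addr0; apply: ideal_sum => // j; exact: mM.
  by case/max_prime => // /mq.
have [rs eG] := closed_field_poly_normal G.
move: mG; rewrite eG -mul_polyC evM evC => /max_prime [/maxC/eqP|].
  by rewrite lead_coef_eq0 (negPf G0).
elim: rs {eG} => [|a rs IH]; first by rewrite big_nil rmorph1 => /(mq 0%N).
rewrite big_cons evM evX => /max_prime [h|//].
by apply: none; exists a.
Qed.

Lemma common_zero : exists2 t, peval t q != 0 & forall p, I p -> peval t p = 0.
Proof.
have [[m0 mD mM] mI mq] := am.
pose t i := sval (cid (coordinate_value i)).
have ht i : m (PX i - PC (t i)) by rewrite /t; case: cid.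
have hp p : m (p - PC (peval t p)).
  elim/mpoly_induction: p => [c|i|p p' h h'|p p' h h'].
  - by rewrite mpoly.mevalC subrr.
  - by rewrite mpoly.mevalXU.
  - by rewrite mpoly.mevalD mpoly.mpolyCD opprD addrACA; exact: mD.
  - rewrite mpoly.mevalM mpoly.mpolyCM.
    have -> : p * p' - PC (peval t p) * PC (peval t p') =
      (p - PC (peval t p)) * p' + (p' - PC (peval t p')) * PC (peval t p) by ring.
    by apply: mD; exact: mM.
exists t => [|p /mI mp].
  apply/eqP => e; apply: (mq 1%N); rewrite expr1.
  by have := hp q; rewrite e mpoly.mpolyC0 subr0.
apply: maxC; have -> : PC (peval t p) = p + - (p - PC (peval t p)) by ring.
by apply: mD => //; apply: maxN.
Qed.
End Max.

Lemma nullstellensatz : exists n, I (q ^+ n).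
Proof.
apply: contrapT => h; have [|m am mm] := maximal_avoiding; first by move=> n hn; apply: h; exists n.
have [t qt ht] := common_zero am mm; have [p Ip] := nozero qt.
by rewrite ht ?eqxx.
Qed.
End Nullstellensatz.

(** The denominators valid for h on Q <> 0 form an ideal without a common zero there, so it contains
    a power of Q. Values where T = 0 are disregarded: T will be an equation of the boundary, off
    which sections are determined. *)
Lemma local_fraction (Q T : pt -> C) (h : pt -> C) : pfun Q -> pfun T ->
  (forall t, Q t != 0 -> exists p d, [/\ pfun p, pfun d, d t != 0 &
     forall t', Q t' != 0 -> T t' != 0 -> d t' != 0 -> h t' * d t' = p t']) ->
  exists N p, pfun p /\ forall t, Q t != 0 -> T t != 0 -> h t * Q t ^+ N = p t.
Proof.
move=> [q hq] _ loc.
pose I (d : P) := exists p : P, forall t, Q t != 0 -> T t != 0 -> h t * peval t d = peval t p.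
have iI : is_ideal I.
  split.
  - by exists 0 => t _ _; rewrite mpoly.meval0 mulr0.
  - move=> x y [p hp] [p' hp']; exists (p + p') => t Qt Tt.
    by rewrite !mpoly.mevalD mulrDr hp // hp'.
  - by move=> x y [p hp]; exists (p * y) => t Qt Tt; rewrite !mpoly.mevalM mulrA hp.
have [|N [p hp]] := @nullstellensatz I q iI.
  move=> t; rewrite -hq => /loc [p [d [[p' ep] [d' ed] dt hd]]].
  (* With the denominator squared and the numerator multiplied by d', the identity holds also where
     d' vanishes, both sides being 0. *)
  exists (d' * d'); last by rewrite mpoly.mevalM -ed mulf_neq0.
  exists (p' * d') => t' Qt' Tt'; rewrite !mpoly.mevalM -ed -ep mulrA.
  by have [->|d0] := eqVneq (d t') 0; [rewrite !mulr0|rewrite hd].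
exists N, (fun t => peval t p); split; first by exists p.
by move=> t Qt Tt; rewrite -hp // rmorphXn /= hq.
Qed.

End PolynomialFunctions.

(** * Regular functions on principal open subsets of affine space *)

Section Fractions.
Variables (R : realType) (r : nat).
Local Notation C := R[i].
Local Notation pt := ('I_r -> C).
Implicit Types (f g Q : pt -> C).

(* regular functions on the principal open set Q != 0 *)
Definition reg Q f := exists N p, pfun p /\ forall t, Q t != 0 -> f t * Q t ^+ N = p t.

Lemma reg_pfun Q f : pfun f -> reg Q f.
Proof. by move=> hf; exists 0%N, f; split=> // t _; rewrite mulr1. Qed.
Lemma regC Q c : reg Q (fun=> c). Proof. exact/reg_pfun/pfunC. Qed.
Lemma reg_ext Q f g : (forall t, Q t != 0 -> f t = g t) -> reg Q f -> reg Q g.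
Proof. by move=> e [N [p [hp h]]]; exists N, p; split=> // t Qt; rewrite -e // h. Qed.

Section FixedQ.
Variable Q : pt -> C.
Hypothesis hQ : pfun Q.

Lemma regD f g : reg Q f -> reg Q g -> reg Q (fun t => f t + g t).
Proof.
move=> [N [p [hp h]]] [M [p' [hp' h']]]; exists (N + M)%N, (fun t => p t * Q t ^+ M + p' t * Q t ^+ N).
split; first by apply: pfunD; apply: pfunM => //; exact: pfunXn.
by move=> t Qt; rewrite -h // -h' // exprD; ring.
Qed.
Lemma regM f g : reg Q f -> reg Q g -> reg Q (fun t => f t * g t).
Proof.
move=> [N [p [hp h]]] [M [p' [hp' h']]]; exists (N + M)%N, (fun t => p t * p' t).
split; first exact: pfunM.
by move=> t Qt; rewrite -h // -h' // exprD; ring.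
Qed.
Lemma regXn f n : reg Q f -> reg Q (fun t => f t ^+ n).
Proof.
move=> hf; elim: n => [|n IH]; first exact: regC.
by apply: reg_ext (regM hf IH) => t _; rewrite exprS.
Qed.
Lemma reg_sum (I : Type) (s : seq I) (F : I -> pt -> C) :
  (forall i, reg Q (F i)) -> reg Q (fun t => \sum_(i <- s) F i t).
Proof.
move=> h; elim: s => [|i s IH]; first by apply: reg_ext (regC Q 0) => t _; rewrite big_nil.
by apply: reg_ext (regD (h i) IH) => t _; rewrite big_cons.
Qed.
Lemma reg_prod (I : Type) (s : seq I) (K : pred I) (F : I -> pt -> C) :
  (forall i, K i -> reg Q (F i)) -> reg Q (fun t => \prod_(i <- s | K i) F i t).
Proof.
move=> h; elim: s => [|i s IH]; first by apply: reg_ext (regC Q 1) => t _; rewrite big_nil.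
have [Ki|nKi] := boolP (K i).
  by apply: reg_ext (regM (h i Ki) IH) => t _; rewrite big_cons Ki.
by apply: reg_ext IH => t _; rewrite big_cons (negPf nKi).
Qed.
Lemma reg_comp f (s : 'I_r -> pt -> C) : pfun f -> (forall i, reg Q (s i)) ->
  reg Q (fun t => f (fun i => s i t)).
Proof.
move=> hf hs; elim/pfun_ind: f / hf => [f g e|c|k|f g _ _ h1 h2|f g _ _ h1 h2].
- by apply: reg_ext => t _; rewrite e.
- exact: regC.
- exact: hs.
- exact: regD.
- exact: regM.
Qed.
Lemma reg_fz f g (n : int) : (forall t, Q t != 0 -> g t = (f t)^-1) -> reg Q f -> reg Q g ->
  reg Q (fun t => f t ^ n).
Proof.
move=> e hf hg; case: n => n; first exact: regXn.
by apply: reg_ext (regXn n.+1 hg) => t Qt; rewrite e // exprVn.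
Qed.
End FixedQ.

Lemma reg_mul Q Q' f : pfun Q' -> reg Q f -> reg (fun t => Q t * Q' t) f.
Proof.
move=> hQ' [N [p [hp h]]]; exists N, (fun t => p t * Q' t ^+ N); split.
  by apply: pfunM => //; exact: pfunXn.
by move=> t; rewrite mulf_eq0 negb_or => /andP[Qt _]; rewrite exprMn mulrA h.
Qed.

Lemma regV Q f : pfun Q -> reg Q f -> exists p, [/\ pfun p,
  forall t, Q t != 0 -> (p t != 0) = (f t != 0) & reg (fun t => Q t * p t) (fun t => (f t)^-1)].
Proof.
move=> hQ [N [p [hp h]]]; exists p; split=> // [t Qt|].
  by rewrite -h // mulf_eq0 (negPf (expf_neq0 _ Qt)) orbF.
exists 1%N, (fun t => Q t ^+ N.+1); split; first exact: pfunXn.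
move=> t; rewrite mulf_eq0 negb_or => /andP[Qt pt0]; rewrite expr1 -h // exprS.
have f0 : f t != 0 by move: pt0; rewrite -h // mulf_eq0 negb_or => /andP[].
by rewrite mulrCA mulKf.
Qed.
End Fractions.

(** * Charts and transition maps *)

Section Charts.
Variables (R : realType) (l : nat) (A : 'M[int]_l) (D : realization A).
Variable G : kac_moody_group R D.
Hypothesis hA : is_gcm A.
Variables (r : nat) (w : 'I_r -> 'I_l).
Hypothesis hw : forall i, ndg R D (w i).
Local Notation C := R[i].
Local Notation pt := ('I_r -> C).
Local Notation S i := (sl G i).
Local Notation x_ := (km_x G).
Local Notation y_ := (km_y G).
Local Notation B := (@borel R l A D G).
Local Notation chart := (@chart R l A D G r w).
Local Notation bs_rel := (@bs_rel R l A D G r).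
Implicit Types (e : 'I_r -> bool) (s t : pt) (i k : 'I_r).

Definition cc i (e : bool) (a : C) : G :=
  if e then y_ (w i) a else (x_ (w i) a * S (w i))%g.
Lemma ccE i (e : bool) a : chart_coord G (w i) e a = cc i e a.
Proof. by rewrite /cc slE. Qed.

(** The relation [bs_rel] unrolled: b is carried from left to right past the factors of p and turns
    them into those of q. Indexing b by natural numbers allows a chain to start at any factor k,
    with any element of B. *)
Definition chain_on (k n : nat) (p q : 'I_r -> G) (b : nat -> G) := forall i : 'I_r, (k <= i < n)%N ->
  B (b i.+1) /\ (b i * p i = q i * b i.+1)%g.
Definition chain (k : nat) (u : G) e s e' s' := exists2 b : nat -> G, b k = u &
  chain_on k r (fun i => cc i (e i) (s i)) (fun i => cc i (e' i) (s' i)) b.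

Lemma bs_relP p q : bs_rel p q <-> exists2 b : nat -> G, b 0%N = 1%g & chain_on 0 r p q b.
Proof.
split=> [[b [b0 Bb e]]|[b b0 hb]].
  exists (fun n => (b (inord n))^-1)%g => [|i _].
    by rewrite (_ : inord 0 = ord0) ?b0 ?invg1 //; apply/val_inj; rewrite /= inordK.
  split; first exact: borelV.
  have e1 : widen_ord (leqnSn r) i = inord i by apply/val_inj; rewrite /= inordK // ltnS ltnW.
  have e2 : lift ord0 i = inord i.+1 by apply/val_inj; rewrite /= inordK // ltnS.
  by rewrite e e1 e2 mulgK.
exists (fun n : 'I_r.+1 => (b n)^-1)%g; split=> [|n|i]; first by rewrite b0 invg1.
  apply: borelV; case: n => -[|n] h /=; first by rewrite b0; exact: borel1.
  by have [] := hb (Ordinal (h : (n < r)%N)) h.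
have [_ e] := hb i (ltn_ord i); rewrite invgK -[val (widen_ord _ _)]/(val i).
by rewrite e mulgK.
Qed.

Lemma bs_rel_refl p : bs_rel p p.
Proof. by apply/bs_relP; exists (fun=> 1%g) => // i _; rewrite mul1g mulg1; split=> //; exact: borel1. Qed.
Lemma bs_rel_trans p q q' : bs_rel p q -> bs_rel q q' -> bs_rel p q'.
Proof.
move=> /bs_relP[b b0 hb] /bs_relP[c c0 hc]; apply/bs_relP.
exists (fun n => c n * b n)%g => [|i hi]; first by rewrite b0 c0 mulg1.
have [h1 e1] := hb i hi; have [h2 e2] := hc i hi.
by split; [exact: borelM|rewrite -mulgA e1 !mulgA e2].
Qed.
Lemma bs_rel_sym p q : bs_rel p q -> bs_rel q p.
Proof.
move=> /bs_relP[b b0 hb]; apply/bs_relP; exists (fun n => (b n)^-1)%g; first by rewrite b0 invg1.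
move=> i hi; have [h1 e1] := hb i hi; split; first exact: borelV.
by apply: (@mulgI _ (b i)); rewrite mulVKg mulgA e1 mulgK.
Qed.

Lemma bsdh_eq (z z' : bsdh G w) : sval z = sval z' -> z = z'.
Proof. by case: z z' => [z hz] [z' hz'] /= e; exact: eq_exist. Qed.

Lemma class_eq p q : bs_rel p q -> [set x | bs_rel p x] = [set x | bs_rel q x].
Proof.
move=> h; apply/seteqP; split=> x /=; first exact/bs_rel_trans/bs_rel_sym.
exact: bs_rel_trans.
Qed.

Definition cpt e s : 'I_r -> G := fun i => cc i (e i) (s i).
Lemma chart_sval e s : sval (chart e s) = [set q | bs_rel (cpt e s) q].
Proof.
by rewrite /= (_ : cpt e s = fun i => chart_coord G (w i) (e i) (s i)) //;
  apply/funext => i; rewrite ccE.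
Qed.

Lemma chart_rel z p : sval z p -> forall e s, bs_rel p (cpt e s) -> z = chart e s.
Proof.
move=> zp e s h; apply: bsdh_eq; rewrite chart_sval -(class_eq h).
case: (svalP z) => p' _ e'; move: zp; rewrite e' => h'; exact: class_eq.
Qed.

Lemma chart_eqP e s e' s' : chart e s = chart e' s' <-> chain 0 1%g e s e' s'.
Proof.
split=> [h|/bs_relP h]; last first.
  apply: (@chart_rel _ (cpt e s)) => //; rewrite chart_sval; exact: bs_rel_refl.
have := congr1 sval h; rewrite !chart_sval => /(congr1 (fun Z => Z (cpt e' s'))) /= E.
by apply/bs_relP; rewrite E; exact: bs_rel_refl.
Qed.

Lemma cc_y0 i : cc i true 0 = 1%g. Proof. exact: y0. Qed.

(** In the cell of y_i the reason is that y_i(c) is not in B for c <> 0. In the other cell the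
    affine formula for the constant family 1 computes both coordinates from the same data. *)
Lemma cell_uniq i (e : bool) (t t' : C) b b' : B b -> B b' -> (cc i e t * b = cc i e t' * b')%g ->
  t = t' /\ b = b'.
Proof.
move=> hb hb' h; suff tt : t = t' by split=> //; apply: (@mulgI _ (cc i e t)); rewrite {2}tt.
case: e h => /= h.
  apply: contrapT => /eqP; rewrite -subr_eq0 => n0; apply: (y_notB (G:=G) hA (hw i) n0).
  have -> : y_ (w i) (t - t') = (b' * b^-1)%g.
    apply: (@mulgI _ (y_ (w i) t')); rewrite yD addrC subrK mulgA -h.
    by rewrite mulgK.
  by apply: borelM => //; exact: borelV.
have [a [p [c [_ _ _ hapc]]]] := @affine_coeffs R l A D G hA unit (fun=> True) (fun=> True) I
  (fun _ _ _ _ => I) (fun _ _ _ _ => I) (fun _ => I) (w i) (fun=> 1%g) (hw i)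
  (fun _ _ => @borel1 R l A D G) (@reg_fam_const R l A D G unit (fun=> True) (fun=> True) (fun _ => I) 1%g).
have [_ _ H] := hapc tt I.
have e1 : t' = (p tt + t * c tt) / a tt.
  apply: (H t t' (b' * b^-1)%g); first by apply: borelM => //; exact: borelV.
  by rewrite mul1g mulgA -h mulgK.
have e2 : t = (p tt + t * c tt) / a tt.
  by apply: (H t t 1%g); [exact: borel1|rewrite mul1g mulg1].
exact: etrans e2 (esym e1).
Qed.

Lemma S_y_cell i (t : C) b b' : B b -> B b' -> (S (w i) * b)%g <> (y_ (w i) t * b')%g.
Proof.
move=> hb hb' h; have [t0|t0] := eqVneq t 0.
  apply: (S_notB (G:=G) hA (hw i)); apply: (borelMr hb); rewrite h t0 y0 mul1g //.
have [b0 [hb0 e]] := y_cell G hA (w i) t0.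
have E : (cc i false 0 * b = cc i false t^-1%R * (b0 * b'))%g.
  by rewrite /= x0 mul1g h e mulgA.
have [/eqP] := cell_uniq hb (borelM hb0 hb') E.
by rewrite eq_sym invr_eq0 (negPf t0).
Qed.

Lemma chain_on_prefix e s e' s' b (n k : nat) : b 0%N = 1%g ->
  chain_on 0 n (cpt e s) (cpt e' s') b -> (forall i : 'I_r, (i < k)%N -> e i = e' i) ->
  (forall m, (m <= k)%N -> (m <= n)%N -> (m <= r)%N -> b m = 1%g) /\
  (forall i : 'I_r, (i < k)%N -> (i < n)%N -> s i = s' i).
Proof.
move=> b0 hb he.
have key i : (i < k)%N -> (i < n)%N -> b i = 1%g -> s i = s' i /\ b i.+1 = 1%g.
  move=> ik i_n bi; have [h1 h2] := hb i i_n; move: h2; rewrite bi mul1g /cpt he // => h2.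
  rewrite -[LHS]mulg1 in h2.
  by have [-> <-] := cell_uniq (@borel1 _ _ _ _ G) h1 h2.
have hb1 m : (m <= k)%N -> (m <= n)%N -> (m <= r)%N -> b m = 1%g.
  elim: m => // m IH mk mn mr; have [] := key (Ordinal mr) mk mn => //; apply: IH; exact: ltnW.
split=> // i ik i_n; have [] := key i ik i_n => //; apply: hb1; exact: ltnW.
Qed.

Lemma chart_prefix e s e' s' (k : nat) : chart e s = chart e' s' ->
  (forall i : 'I_r, (i < k)%N -> e i = e' i) -> forall i : 'I_r, (i < k)%N -> s i = s' i.
Proof.
by move=> /chart_eqP[b b0 hb] he i ik; have [_] := chain_on_prefix b0 hb he; apply.
Qed.
Lemma chart_inj e s s' : chart e s = chart e s' -> s = s'.
Proof. by move=> h; apply/funext => i; apply: (chart_prefix (k := r) h). Qed.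

(** Where the bits agree, the chain from one chart to the other is trivial through the factor k, so
    the k-th coordinate may be changed in both charts at once. *)
Lemma chart_curve e s e' s' k c : chart e s = chart e' s' ->
  (forall i : 'I_r, (i <= k)%N -> e i = e' i) -> chart e (upd s k c) = chart e' (upd s' k c).
Proof.
move=> /chart_eqP[b b0 hb] he; have [h1 h2] := chain_on_prefix (k := k.+1) b0 hb he.
apply/chart_eqP; exists b => // i hi; have [k1 k2] := hb i hi; split=> //.
have [->|ik] := eqVneq i k; last by rewrite !upd_neq.
by rewrite !upd_eq he // !h1 ?mul1g ?mulg1 // ?(ltnW (ltn_ord k)) // ltnW.
Qed.

Lemma chart_flip e s e' s' k : chart e s = chart e' s' -> (forall i : 'I_r, (i < k)%N -> e i = e' i) ->
  e k != e' k -> s k * s' k = 1.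
Proof.
wlog ek : e s e' s' / e k = true.
  move=> W h he hk; case ek: (e k); first exact: (W _ _ _ _ ek h).
  rewrite mulrC; apply: (W _ _ _ _ _ (esym h)); rewrite 1?eq_sym //.
    by case: (e' k) hk; rewrite ek.
  by move=> i ik; rewrite he.
move=> /chart_eqP[b b0 hb] he; rewrite ek; case ek': (e' k) => // _.
have [h1 _] := chain_on_prefix b0 hb he; have [h2 h3] := hb k (ltn_ord k).
move: h3; rewrite h1 ?mul1g ?(ltnW (ltn_ord k)) // ek ek' /= => h3.
have s0 : s k != 0.
  apply/eqP => s0; move: h3; rewrite s0 y0 => h3; apply: (S_notB (G:=G) hA (hw k)).
  apply: (borelMr h2); apply: (borelMl (borel_x (w k) (s' k))); rewrite mulgA -h3; exact: borel1.
have [b1 [hb1 e1]] := y_cell G hA (w k) s0.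
have E : (cc k false (s' k) * b k.+1 = cc k false (s k)^-1%R * b1)%g by rewrite /= -h3 e1.
by have [-> _] := cell_uniq h2 hb1 E; exact: mulfV.
Qed.

Lemma cells i u g : B u -> min_parabolic (w i) g ->
  exists et : bool * C, exists2 b, B b & (u * g = cc i et.1 et.2 * b)%g.
Proof.
move=> hu hg; have hug : min_parabolic (w i) (u * g)%g.
  apply: (is_subgroupM (generated_subgroup _)) => //.
  by apply: generated_sub; left.
have [M _] := hw i.
have [h|[t [b [hb e]]]] := parabolic_cells hA M (hw i) hug.
  by exists (true, 0), (u * g)%g => //; rewrite cc_y0 mul1g.
by exists (false, t), b => //; rewrite e.
Qed.

Lemma cover_from (p : 'I_r -> G) (k : nat) u : bs_tuple w p -> B u ->
  exists e s b, b k = u /\ chain_on k r p (cpt e s) b.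
Proof.
move=> hp hu.
have F0 (n : nat) (v : G) : {x : bool * C * G | B x.2 /\ forall i, n = i -> B v -> (v * p i = cc i x.1.1 x.1.2 * x.2)%g}.
  apply: cid; have [hn|hn] := ltnP n r; last first.
    exists (true, 0, 1%g); split=> [|i ni]; first exact: borel1.
    by move: hn; rewrite ni leqNgt ltn_ord.
  have [hv|hv] := pselect (B v); last by exists (true, 0, 1%g); split=> //; exact: borel1.
  have [et [b hb e]] := cells hv (hp (Ordinal hn)).
  exists (et.1, et.2, b); split=> // i ni _; have -> // : i = Ordinal hn by exact: val_inj.
pose bb := fix bb m : G := if m is m'.+1 then (sval (F0 (k + m')%N (bb m'))).2 else u.
pose b n := bb (n - k)%N.
exists (fun i => (sval (F0 i (b i))).1.1), (fun i => (sval (F0 i (b i))).1.2), b.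
have Bb n : B (b n) by rewrite /b; case: (n - k)%N => //= m; case: (F0 _ _) => x [].
split=> [|i /andP[ki _]]; first by rewrite /b subnn.
split=> //; have e : b i.+1 = (sval (F0 i (b i))).2 by rewrite /b subSn //= subnKC.
by rewrite e /cpt; case: (F0 i (b i)) => x [_ /= h]; exact: h.
Qed.

Lemma chart_cover z : exists e s, z = chart e s.
Proof.
have [p hp ez] := svalP z.
have [e [s [b [b0 hb]]]] := cover_from 0 hp (@borel1 _ _ _ _ G).
exists e, s; apply: (@chart_rel _ p); last by apply/bs_relP; exists b.
by rewrite ez; exact: bs_rel_refl.
Qed.

Lemma cc_flip i (e : bool) (t : C) : t != 0 -> exists2 b, B b & (cc i e t = cc i (~~ e) t^-1%R * b)%g.
Proof.
move=> t0; case: e => /=; first by have [b [hb e]] := y_cell G hA (w i) t0; exists b.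
by have [b [hb e]] := x_cell G hA (w i) t0; exists b.
Qed.

Lemma chart_flipped e s k : s k != 0 -> exists e' s',
  [/\ chart e s = chart e' s', forall i : 'I_r, (i < k)%N -> e' i = e i, e' k = ~~ e k,
      forall i : 'I_r, (i < k)%N -> s' i = s i & s' k = (s k)^-1].
Proof.
move=> sk; have [b1 hb1 e1] := cc_flip k (e k) sk.
have hp : bs_tuple w (cpt e s) by move=> i; rewrite /cpt -ccE; exact: (@chart_tuple R l A D G r w e s i).
have [e' [s' [b [b0 hb]]]] := cover_from k.+1 hp hb1.
pose pick T (f : 'I_r -> T) c g i := if (i < k)%N then f i else if i == k then c else g i : T.
exists (pick _ e (~~ e k) e'), (pick _ s (s k)^-1 s'); rewrite /pick; split.
- apply/chart_eqP; exists (fun n => if (n <= k)%N then 1%g else b n) => //= i _.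
  case: (ltngtP i k) => ik.
  + by rewrite mul1g mulg1; split=> //; exact: borel1.
  + have -> : (i == k) = false by rewrite -val_eqE /= gtn_eqF.
    by apply: hb; rewrite ik ltn_ord.
  + have -> : i = k by exact: val_inj.
    by rewrite eqxx mul1g b0.
- by move=> i ->.
- by rewrite ltnn eqxx.
- by move=> i ->.
- by rewrite ltnn eqxx.
Qed.

Lemma divisor_chart i e s : bs_divisor i (chart e s) <-> e i /\ s i = 0.
Proof.
split; last first.
  move=> [ei si]; exists (cpt e s); first by rewrite chart_sval; exact: bs_rel_refl.
  by rewrite /cpt ei si cc_y0; exact: borel1.
move=> [p]; rewrite chart_sval => /bs_relP[b b0 hb] Bp.
have [h1 h2] := hb i (ltn_ord i).
have Bi (j : nat) : (j <= r)%N -> B (b j).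
  by case: j => [|j jr]; [rewrite b0 => _; exact: borel1|case: (hb (Ordinal jr) jr)].
have : B (cpt e s i).
  by apply: (borelMl (Bi i (ltnW (ltn_ord i)))); rewrite h2; exact: borelM.
rewrite /cpt /cc; case: (e i) => h.
  split=> //; apply: contrapT => /eqP si; exact: (y_notB (G:=G) hA (hw i) si h).
by case: (S_notB (G:=G) hA (hw i)); apply: (borelMl (borel_x (w i) (s i))).
Qed.

End Charts.

(** * Transition functions between charts *)

Section Transition.
Variables (R : realType) (l : nat) (A : 'M[int]_l) (D : realization A).
Variable G : kac_moody_group R D.
Hypothesis hA : is_gcm A.
Variables (r : nat) (w : 'I_r -> 'I_l).
Hypothesis hw : forall i, ndg R D (w i).
Local Notation C := R[i].
Local Notation pt := ('I_r -> C).
Local Notation S i := (sl G i).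
Local Notation x_ := (km_x G).
Local Notation y_ := (km_y G).
Local Notation B := (@borel R l A D G).
Local Notation cc := (@cc R l A D G r w).
Implicit Types (Q : pt -> C) (i k : 'I_r).

Definition regfam Q (u : pt -> G) := reg_fam (reg Q) (fun t => Q t != 0) u.

Lemma regfamM Q u u' : pfun Q -> regfam Q u -> regfam Q u' -> regfam Q (fun t => u t * u' t)%g.
Proof.
by move=> hQ; apply: (reg_famM (Rg := reg Q)); exact: regM.
Qed.

Lemma regfam_x Q j f : pfun Q -> reg Q f -> regfam Q (fun t => x_ j (f t)).
Proof.
move=> hQ hf; have := @reg_fam_exp R l A D G pt (reg Q) (fun t => Q t != 0) _ _ true j f.
by rewrite /regfam /kg; apply => //; [exact: regM|exact: regC].
Qed.
Lemma regfam_y Q j f : pfun Q -> reg Q f -> regfam Q (fun t => y_ j (f t)).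
Proof.
move=> hQ hf; have := @reg_fam_exp R l A D G pt (reg Q) (fun t => Q t != 0) _ _ false j f.
by rewrite /regfam /kg; apply => //; [exact: regM|exact: regC].
Qed.
Lemma regfam_const Q g : regfam Q (fun=> g).
Proof. by apply: reg_fam_const; exact: regC. Qed.
Lemma regfam_cc Q i (e : bool) f : pfun Q -> reg Q f -> regfam Q (fun t => cc i e (f t)).
Proof.
move=> hQ hf; case: e; first exact: regfam_y.
apply: regfamM => //; first exact: regfam_x. exact: regfam_const.
Qed.
Lemma regfam_ccV Q i (e : bool) f : pfun Q -> reg Q f -> regfam Q (fun t => (cc i e (f t))^-1%g).
Proof.
move=> hQ hf; have hN : reg Q (fun t => - f t).
  have h := regM (regC Q (-1)) hf.
  by apply: (reg_ext _ h) => t _; rewrite mulN1r.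
case: e => /=.
  have -> : (fun t => (y_ (w i) (f t))^-1%g) = (fun t => y_ (w i) (- f t)).
    by apply/funext => t; rewrite yV.
  exact: regfam_y.
have -> : (fun t => (x_ (w i) (f t) * S (w i))^-1%g) =
    (fun t => (S (w i))^-1%g * x_ (w i) (- f t))%g.
  by apply/funext => t; rewrite invgM xV.
apply: regfamM => //; last exact: regfam_x. exact: regfam_const.
Qed.
Lemma regfam_sub Q Q' u : (forall t, Q' t != 0 -> Q t != 0) -> (forall f, reg Q f -> reg Q' f) ->
  regfam Q u -> regfam Q' u.
Proof.
move=> h1 h2 hu M v; have [s [hs es]] := hu M v.
by exists s; split=> [p /hs/h2|t /h1/es].
Qed.

(* the coordinate in the chart e' of u x, for x in the cell e, in terms of the
   action s |-> (p + s c) / a of u on the cell false; it is defined on tdom != 0 *)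
Definition tdom (e e' : bool) (p c s : C) : C :=
  if e' then (if e then p * s + c else p + s * c) else (if e then s else 1).
Definition tnum (e e' : bool) (a p c s : C) : C :=
  if e' then (if e then a * s else a) else (if e then p * s + c else p + s * c).
Definition tau (e e' : bool) (a p c s : C) : C :=
  tnum e e' a p c s * (if e' then 1 else a^-1) * (tdom e e' p c s)^-1.

Section Pointwise.
Variables (i : 'I_r) (u : G) (a p c : C).
Hypotheses (hu : B u) (a0 : a != 0) (c0 : c != 0).
Hypothesis H : forall t t' b', B b' ->
  (u * x_ (w i) t * S (w i) = x_ (w i) t' * S (w i) * b')%g -> t' = (p + t * c) / a.

Lemma cell_ff s : exists2 b, B b & (u * cc i false s = cc i false ((p + s * c) / a)%R * b)%g.
Proof.
have [M _] := hw i.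
have [t' [b' [hb' e]]] := borel_S hA M s (hw i) hu.
by exists b' => //; rewrite -(H hb' e) /= mulgA.
Qed.

Lemma y0_bad b t : B b -> B (cc i false t * b)%g -> False.
Proof.
move=> hb h; apply: (S_notB (G:=G) hA (hw i)).
apply: (borelMl (borel_x (w i) t)); exact: (borelMr hb).
Qed.

Lemma cell_action (e e' : bool) s : tdom e e' p c s != 0 -> exists2 b, B b &
  (u * cc i e s = cc i e' (tau e e' a p c s) * b)%g.
Proof.
have ft d : p + d * c != 0 -> exists2 b, B b & (u * cc i false d = cc i true (a / (p + d * c))%R * b)%g.
  move=> h; have [b1 hb1 e1] := cell_ff d.
  have q0 : (p + d * c) / a != 0 by rewrite mulf_neq0 // invr_eq0.
  have [b2 hb2 e2] := cc_flip G hA w i false q0.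
  by exists (b2 * b1)%g; [exact: borelM|rewrite e1 e2 mulgA invf_div].
rewrite /tau /tnum /tdom; case: e e' => [] [].
- move=> h; have [s0|s0] := eqVneq s 0.
    by exists u; rewrite // s0 mulr0 !mul0r /cc !y0 mulg1 mul1g.
  have [b1 hb1 e1] := cc_flip G hA w i true s0.
  have E : p + s^-1 * c = (p * s + c) / s by field.
  have [|b2 hb2 e2] := ft s^-1; first by rewrite E mulf_neq0 // invr_eq0.
  exists (b2 * b1)%g; first exact: borelM.
  rewrite e1 mulgA e2 E -mulgA; congr (cc i true _ * _)%g; field.
  by rewrite h s0.
- move=> s0; have [b1 hb1 e1] := cc_flip G hA w i true s0.
  have [b2 hb2 e2] := cell_ff s^-1.
  exists (b2 * b1)%g; first exact: borelM.
  rewrite e1 mulgA e2 -mulgA; congr (cc i false _ * _)%g; field.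
  by rewrite s0 a0.
- by move=> /ft; rewrite mulr1.
- by move=> _; have [b hb e] := cell_ff s; exists b; rewrite // invr1 mulr1.
Qed.

Lemma cell_action_dom (e e' : bool) s t' b : B b -> (u * cc i e s = cc i e' t' * b)%g ->
  tdom e e' p c s != 0.
Proof.
have bad d t b1 b2 : B b1 -> B b2 -> (u * cc i false d * b1 = cc i true t * b2)%g -> p + d * c != 0.
  move=> hb1 hb2 h; apply/eqP => z; have [b3 hb3 e3] := cell_ff d.
  move: h; rewrite e3 z mul0r /= x0 mul1g -mulgA.
  by apply: S_y_cell => //; exact: borelM.
rewrite /tdom; case: e e' => [] [] hb h.
- apply/eqP => z; have s0 : s != 0.
    by apply: contraNneq c0 => s0; move: z; rewrite s0 mulr0 add0r => ->.
  have [b1 hb1 e1] := cc_flip G hA w i true s0.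
  have : p + s^-1 * c != 0 by apply: (@bad s^-1 t' b1 b) => //; rewrite -mulgA -e1.
  have E : p + s^-1 * c = (p * s + c) / s by field.
  by rewrite E z mul0r eqxx.
- apply/eqP => s0; apply: (@y0_bad b t') => //; rewrite -h s0 /= y0 mulg1 //.
- by apply: (@bad s t' 1%g b) => //; [exact: borel1|rewrite mulg1].
- exact: oner_neq0.
Qed.
End Pointwise.

(** The equation of Z_i in a chart with i-th bit e. *)
Definition bit_coord (e : bool) (s : C) : C := if e then s else 1.

(** Carrying u past one factor. The unit v compares the equations of Z_i in the two charts, and the
    last clause states that Q' <> 0 is the full domain of the transition. *)
Lemma step_transition Q u s i (e e' : bool) : pfun Q -> regfam Q u ->
  (forall t, Q t != 0 -> B (u t)) -> reg Q s ->
  exists (Q' : pt -> C) (tt v : pt -> C) (u' : pt -> G),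
    [/\ pfun Q', forall t, Q' t != 0 -> Q t != 0, forall f, reg Q f -> reg Q' f,
        [/\ reg Q' tt, reg Q' v, reg Q' (fun t => (v t)^-1) & regfam Q' u'] &
        (forall t, Q' t != 0 -> [/\ v t != 0, bit_coord e' (tt t) = bit_coord e (s t) * v t,
            B (u' t) & (u t * cc i e (s t) = cc i e' (tt t) * u' t)%g]) /\
        (forall t t' b', Q t != 0 -> B b' -> (u t * cc i e (s t) = cc i e' t' * b')%g -> Q' t != 0)].
Proof.
move=> hQ hu Bu hs.
have [a [p [c [ha hp hc H]]]] := @affine_coeffs R l A D G hA pt (reg Q) (fun t => Q t != 0)
  (regC Q 0) (@regD _ _ _ hQ) (@regM _ _ Q) (regC Q) (w i) u (hw i) Bu hu.
pose d t := tdom e e' (p t) (c t) (s t).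
have hd : reg Q d.
  rewrite /d /tdom; case: (e') (e) => [] [].
  - exact: (regD hQ (regM hp hs) hc).
  - exact: (regD hQ hp (regM hs hc)).
  - exact: hs.
  - exact: regC.
have [pa [hpa pa0 hav]] := regV hQ ha; pose Q1 t := Q t * pa t.
have hQ1 : pfun Q1 by exact: pfunM.
have m1 f : reg Q f -> reg Q1 f by exact: reg_mul.
have [pd [hpd pd0 hdv]] := regV hQ1 (m1 _ hd); pose Q2 t := Q1 t * pd t.
have hQ2 : pfun Q2 by exact: pfunM.
have m2 f : reg Q f -> reg Q2 f by move=> /m1; exact: reg_mul.
have ha2 : reg Q2 (fun t => (a t)^-1) by exact: reg_mul.
have Q20 t : Q2 t != 0 -> Q t != 0 /\ d t != 0.
  rewrite mulf_eq0 negb_or => /andP[q1]; rewrite pd0 // => dt; split=> //.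
  by move: q1; rewrite mulf_eq0 negb_or => /andP[].
have M2 := @regM _ _ Q2; have D2 := regD hQ2.
pose tt t := tau e e' (a t) (p t) (c t) (s t).
have htt : reg Q2 tt.
  apply: (M2) => //; apply: (M2).
    rewrite /tnum; case: (e') (e) => [] [].
    - by apply: (M2); exact: m2.
    - exact: m2.
    - by apply: (D2); [apply: (M2)|]; exact: m2.
    - by apply: (D2); [|apply: (M2)]; exact: m2.
  by case: (e') => //; exact: regC.
pose v t := (if e' then a t else 1) * (d t)^-1.
exists Q2, tt, v, (fun t => (cc i e' (tt t))^-1 * (u t * cc i e (s t)))%g; split=> //.
- by move=> t /Q20[].
- split=> //.
  + by apply: (M2) => //; case: (e'); [exact: m2|exact: regC].
  + apply: (reg_ext (f := fun t => (if e' then (a t)^-1 else 1) * d t)).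
      by move=> t Qt; rewrite /v invfM invrK; case: (e') => //; rewrite invr1.
    by apply: (M2); [case: (e') => //; exact: regC|exact: m2].
  + apply: regfamM => //; first exact: regfam_ccV.
    apply: regfamM => //; first by apply: (regfam_sub _ m2 hu) => t /Q20[].
    by apply: regfam_cc => //; exact: m2.
- split=> [t Qt|t t' b' Qt hb' h].
  have [Qt0 dt] := Q20 t Qt; have [a0 c0 Ht] := H t Qt0.
  have [b hb eb] := cell_action (Bu t Qt0) a0 Ht dt.
  split.
  + by apply: mulf_neq0; [case: (e'); rewrite ?oner_neq0|rewrite invr_eq0].
  + rewrite /bit_coord /v /tt /tau /tnum /d /tdom; move: dt; rewrite /d /tdom.
    case: (e') (e) => [] [] dt; rewrite ?mulr1 ?mul1r ?invr1 ?mulfV //.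
    by rewrite mulrCA mulrA.
  + by rewrite eb mulKg.
  + by rewrite mulVKg.
  have [a0 c0 Ht] := H t Qt.
  have := cell_action_dom (Bu t Qt) c0 Ht hb' h => dt.
  have q1 : Q1 t != 0 by rewrite mulf_neq0 // pa0.
  by rewrite mulf_neq0 // pd0.
Qed.

(** The start at any k, with any regular u and s, serves [good_chart], which carries x(- t_k) past
    coordinates already rescaled by a cocharacter. *)
Lemma transition Q (k : nat) u (s : 'I_r -> pt -> C) (e e' : 'I_r -> bool) : pfun Q -> regfam Q u ->
  (forall t, Q t != 0 -> B (u t)) -> (forall i, reg Q (s i)) -> (k <= r)%N ->
  exists (Q' : pt -> C) (tt v : 'I_r -> pt -> C),
    [/\ pfun Q', forall t, Q' t != 0 -> Q t != 0, forall f, reg Q f -> reg Q' f,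
        (forall i, (k <= i)%N -> [/\ reg Q' (tt i), reg Q' (v i), reg Q' (fun t => (v i t)^-1) &
           forall t, Q' t != 0 -> v i t != 0 /\
             bit_coord (e' i) (tt i t) = bit_coord (e i) (s i t) * v i t]) &
        (forall t, Q' t != 0 -> chain w k (u t) e (fun i => s i t) e' (fun i => tt i t)) /\
        forall t s', Q t != 0 -> chain w k (u t) e (fun i => s i t) e' s' -> Q' t != 0].
Proof.
move=> hQ hu Bu hs kr.
pose K (m : nat) := exists (Q' : pt -> C) (tt v : 'I_r -> pt -> C) (bb : nat -> pt -> G),
    [/\ [/\ pfun Q', forall t, Q' t != 0 -> Q t != 0 & forall f, reg Q f -> reg Q' f],
        regfam Q' (bb (k + m)%N) /\ (forall t, Q' t != 0 -> B (bb (k + m)%N t)),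
        (forall i : 'I_r, (k <= i < k + m)%N -> [/\ reg Q' (tt i), reg Q' (v i), reg Q' (fun t => (v i t)^-1) &
           forall t, Q' t != 0 -> v i t != 0 /\
             bit_coord (e' i) (tt i t) = bit_coord (e i) (s i t) * v i t]),
        (forall t, Q' t != 0 -> bb k t = u t /\
          chain_on k (k + m) (cpt G w e (fun i => s i t)) (cpt G w e' (fun i => tt i t)) (bb ^~ t)) &
        forall t s' b, Q t != 0 -> b k = u t ->
          chain_on k (k + m) (cpt G w e (fun i => s i t)) (cpt G w e' s') b -> Q' t != 0].
have main m : (k + m <= r)%N -> K m.
  elim: m => [|m IH] hm.
    exists Q, (fun _ _ => 0), (fun _ _ => 1), (fun _ => u); rewrite addn0; split=> //.
    - by move=> i /andP[h1 h2]; move: (leq_ltn_trans h1 h2); rewrite ltnn.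
    - by move=> t _; split=> // i /andP[h1 h2]; move: (leq_ltn_trans h1 h2); rewrite ltnn.
  have [|Q1 [tt [v [bb [[hQ1 s1 m1] [hbb Bbb] hv hch hconv]]]]] := IH.
    by apply: leq_trans hm; rewrite leq_add2l.
  have hi : (k + m < r)%N by rewrite -addnS.
  pose i0 := Ordinal hi.
  have [Q2 [t2 [v2 [u2 [hQ2 s2 m2 [ht2 hv2 hvi2 hu2] [p2 c2]]]]]] :=
    step_transition i0 (e i0) (e' i0) hQ1 hbb Bbb (m1 _ (hs i0)).
  have old (i : 'I_r) : (k <= i < k + m.+1)%N -> i != i0 -> (k <= i < k + m)%N.
    move=> /andP[-> h2] /= ne; move: h2; rewrite addnS ltnS leq_eqVlt => /orP[/eqP ei|//].
    by case/eqP: ne; apply/val_inj.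
  exists Q2, (fun i => if i == i0 then t2 else tt i), (fun i => if i == i0 then v2 else v i),
    (fun n => if n == (k + m).+1 then u2 else bb n); rewrite addnS eqxx; split.
  - by split=> // [t /s2/s1|f /m1/m2].
  - by split=> // t /p2[].
  - move=> i hik; case: eqP => [->|/eqP ne]; last first.
      have [|h1 h2 h3 h4] := hv i; first by apply: old; rewrite ?addnS.
      by split; [exact: m2|exact: m2|exact: m2|move=> t /s2/h4].
    by split=> // t /p2[].
  - move=> t Qt; have [hk hc] := hch t (s2 t Qt).
    rewrite ltn_eqF ?ltnS ?leq_addr //; split=> // i hik; rewrite /cpt.
    have [->|ne] := eqVneq i i0.
      rewrite /= eqxx ltn_eqF //; by have [_ _ h3 h4] := p2 t Qt.
    have hi' : (k <= i < k + m)%N by apply: old; rewrite ?addnS.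
    have [_ hlt] := andP hi'.
    have n1 : (i.+1 == (k + m).+1) = false by rewrite eqSS ltn_eqF.
    have n2 : (val i == (k + m).+1) = false by rewrite ltn_eqF // ltnS ltnW.
    by rewrite n1 n2; exact: hc.
  - move=> t s' b Qt bk hb.
    have hb1 : chain_on k (k + m) (cpt G w e (fun i => s i t)) (cpt G w e' s') b.
      by move=> i /andP[h1 h2]; apply: hb; rewrite h1 ltnS ltnW.
    have Q1t := hconv t s' b Qt bk hb1; have [hk hc] := hch t Q1t.
    have bE n : (n <= m)%N -> b (k + n)%N = bb (k + n)%N t.
      elim: n => [|n IHn] hn; first by rewrite addn0 bk hk.
      have hn' : (k + n < r)%N by apply: (leq_ltn_trans _ (hi)); rewrite leq_add2l ltnW.
      have hin : (k <= Ordinal hn' < k + m)%N by rewrite /= leq_addr ltn_add2l.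
      have [h1 h2] := hb1 _ hin; have [h3 h4] := hc _ hin.
      have bn : bb (Ordinal hn') t = b (Ordinal hn') by symmetry; apply: IHn; exact: ltnW.
      have E := etrans (esym h4) (etrans (congr1 (fun x => x * _)%g bn) h2).
      by rewrite addnS; have [_ ->] := cell_uniq hA hw h3 h1 E.
    have [|h1 h2] := hb i0; first by rewrite /= leq_addr ltnSn.
    by apply: (c2 t (s' i0) (b i0.+1)) => //; rewrite -(bE m) //.
have [|Q' [tt [v [bb [[hQ' s1 m1] _ hv hch hconv]]]]] := main (r - k)%N; first by rewrite subnKC.
rewrite subnKC // in hv hch hconv.
exists Q', tt, v; split=> //.
- by move=> i ki; apply: hv; rewrite ki /=.
- split=> [t Qt|t s' Qt [b bk hb]]; last exact: (hconv t s' b).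
  by have [h1 h2] := hch t Qt; exists (bb ^~ t).
Qed.

Lemma chart_transition (e e' : 'I_r -> bool) :
  exists (Q : pt -> C) (tt v : 'I_r -> pt -> C),
    [/\ pfun Q, 
        (forall i, [/\ reg Q (tt i), reg Q (v i), reg Q (fun t => (v i t)^-1) &
           forall t, Q t != 0 -> v i t != 0 /\
             bit_coord (e' i) (tt i t) = bit_coord (e i) (t i) * v i t]),
        (forall t, Q t != 0 -> chart G w e t = chart G w e' (fun i => tt i t)) &
        forall t s', chart G w e t = chart G w e' s' -> Q t != 0].
Proof.
have [|||||Q' [tt [v [hQ _ _ hv [h1 h2]]]]] := @transition (fun=> 1) 0 (fun=> 1%g) (fun i t => t i) e e'.
- exact: pfunC.
- exact: regfam_const.
- by move=> t _; exact: borel1.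
- by move=> i; apply: reg_pfun; exact: pfunX.
- by [].
exists Q', tt, v; split=> //.
- by move=> i; apply: hv.
- by move=> t /h1 h; apply/(chart_eqP G w).
- by move=> t s' /(chart_eqP G w) h; apply: h2 h; exact: oner_neq0.
Qed.

End Transition.

(** * Sections of O(sum g_i Z_i) *)

Section Sections.
Variables (R : realType) (l : nat) (A : 'M[int]_l) (D : realization A).
Variable G : kac_moody_group R D.
Hypothesis hA : is_gcm A.
Variables (r : nat) (w : 'I_r -> 'I_l).
Hypothesis hw : forall i, ndg R D (w i).
Local Notation C := R[i].
Local Notation pt := ('I_r -> C).
Local Notation Z := (bsdh G w).
Local Notation chart := (chart G w).
Local Notation bdry := (@bs_boundary R l A D G r w).
Implicit Types (e : 'I_r -> bool) (t : pt) (W V U K : set Z) (i k : 'I_r).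

Definition inv_chart e (z : Z) : pt := xget (fun=> 0) [set t | chart e t = z].
Lemma inv_chartK e t : inv_chart e (chart e t) = t.
Proof.
have h : exists t', [set t' | chart e t' = chart e t] t' by exists t.
by apply: (chart_inj (G:=G) hA hw (e := e)); exact: (xgetPex (fun=> 0) h).
Qed.

(** Locally over W, h is a fraction of polynomials in the chart e, with the equation asserted at
    points of K: [setT] for regular functions, the complement of the boundary for sections. *)
Definition lfrac W K e (h : pt -> C) := forall t, W (chart e t) -> exists p d,
  [/\ pfun p, pfun d, d t != 0 & forall t', W (chart e t') -> K (chart e t') -> d t' != 0 ->
     h t' * d t' = p t'].

Lemma open_bsdh U : open U <-> forall e t, U (chart e t) ->
  exists2 q, pfun q & q t != 0 /\ forall t', q t' != 0 -> U (chart e t').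
Proof.
split=> [oU e t Ut|h].
  have [q [qt hq]] := (oU : bsdh_open U) e t Ut.
  by exists (fun t => mpoly.meval t q); [exists q|].
rewrite -[open U]/(bsdh_open U) => e t Ut; have [q [q' eq] [qt hq]] := h e t Ut.
by exists q'; rewrite -eq; split=> // t'; rewrite -eq => /hq.
Qed.

Lemma regular_onP W (h : Z -> C) : regular_on W h <-> forall e, lfrac W setT e (fun t => h (chart e t)).
Proof.
split=> [H e t Wt|H e t Wt].
  have [p [q [qt pq]]] := H e t Wt; exists (fun t => mpoly.meval t p), (fun t => mpoly.meval t q).
  split=> //; [by exists p|by exists q|].
  by move=> t' Wt' _ q't; rewrite pq // divfK.
have [p [d [[p' ep] [d' ed] dt hpd]]] := H e t Wt; exists p', d'; rewrite -ed; split=> // t' Wt'.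
by rewrite -ed -ep => d0; rewrite -hpd // mulfK.
Qed.

Lemma lfrac_sub W V K e h : V `<=` W -> lfrac W K e h -> lfrac V K e h.
Proof.
move=> VW H t /VW /H[p [d [hp hd dt hpd]]]; exists p, d; split=> // t' /VW; exact: hpd.
Qed.

Lemma lfracM W K e h h' : lfrac W K e h -> lfrac W K e h' -> lfrac W K e (fun t => h t * h' t).
Proof.
move=> H H' t Wt; have [p [d [hp hd dt hpd]]] := H t Wt.
have [p' [d' [hp' hd' dt' hpd']]] := H' t Wt.
exists (fun t => p t * p' t), (fun t => d t * d' t); split; [exact: pfunM|exact: pfunM|exact: mulf_neq0|].
move=> s Ws Ks; rewrite mulf_eq0 negb_or => /andP[d0 d0'].
by rewrite mulrACA hpd // hpd'.
Qed.

Lemma lfrac_pull Q (tt : 'I_r -> pt -> C) (h h' c : pt -> C) e e' W K :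
  pfun Q -> (forall i, reg Q (tt i)) ->
  (forall t, Q t != 0 -> chart e' t = chart e (fun i => tt i t)) ->
  (forall t, W (chart e' t) -> Q t != 0) -> reg Q c ->
  (forall t, Q t != 0 -> K (chart e' t) -> h' t = h (fun i => tt i t) * c t) ->
  lfrac W K e h -> lfrac W K e' h'.
Proof.
move=> hQ htt ech WQ hc eh H t Wt; have Qt := WQ t Wt.
have Wtt : W (chart e (fun i => tt i t)) by rewrite -ech.
have [p [d [hp hd dt hpd]]] := H _ Wtt.
have [N [p1 [hp1 ep1]]] := reg_comp hQ hp htt.
have [M [d1 [hd1 ed1]]] := reg_comp hQ hd htt.
have [L [c1 [hc1 ec1]]] := hc.
exists (fun t => p1 t * c1 t * Q t ^+ M * Q t), (fun t => d1 t * Q t ^+ (N + L) * Q t).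
have pQ n : pfun (fun t => Q t ^+ n) by exact: pfunXn.
split.
- by do ![apply: pfunM => //].
- by do ![apply: pfunM => //].
- by rewrite -ed1 // !mulf_neq0 // expf_neq0.
move=> t' Wt' Kt'; rewrite !mulf_eq0 !negb_or => /andP[/andP[d0 _] Qt'].
have dtt : d (fun i => tt i t') != 0.
  by move: d0; rewrite -ed1 // mulf_eq0 negb_or => /andP[].
rewrite eh // -ep1 // -ec1 // -ed1 // -hpd -?ech // exprD; ring.
Qed.

Lemma lfrac_transfer W K e h : W `<=` range (chart e) -> lfrac W K e h ->
  forall e' h', (exists c : 'I_r -> int, forall t t', chart e' t = chart e t' -> K (chart e' t) ->
     forall v : 'I_r -> C, (forall i, v i != 0 /\ bit_coord (e i) (t' i) = bit_coord (e' i) (t i) * v i) ->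
     h' t = h t' * \prod_i v i ^ c i) -> lfrac W K e' h'.
Proof.
move=> We H e' h' [c hc].
have [Q [tt [v [hQ htt h1 h2]]]] := chart_transition G hA hw e' e.
apply: (@lfrac_pull Q tt h h' (fun t => \prod_i v i t ^ c i)) H => //.
- by move=> i; have [] := htt i.
- by move=> t /We[s _ /esym es]; exact: h2 es.
- apply: reg_prod => i _; have [_ hv hvi _] := htt i.
  by apply: (reg_fz _ _ hv hvi).
- move=> t Qt Kt; apply: (hc t (fun i => tt i t)) => //; first exact: h1.
  by move=> i; have [_ _ _ /(_ t Qt)] := htt i.
Qed.

Lemma regular_of_chart W e (h : Z -> C) : W `<=` range (chart e) ->
  lfrac W setT e (fun t => h (chart e t)) -> regular_on W h.
Proof.
move=> We H; apply/regular_onP => e'; apply: (lfrac_transfer We H) => //.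
exists (fun=> 0) => t t' -> _ v _; rewrite big1 ?mulr1 // => i _; exact: expr0z.
Qed.

Lemma regular_onM W (h k : Z -> C) : regular_on W h -> regular_on W k ->
  regular_on W (fun x => h x * k x).
Proof. by move=> /regular_onP H /regular_onP K; apply/regular_onP => e; exact: lfracM. Qed.

Lemma regular_on1 W : regular_on W (fun=> 1 : C).
Proof.
apply/regular_onP => e t _; exists (fun=> 1), (fun=> 1); split; rewrite ?oner_neq0 //.
- exact: pfunC.
- exact: pfunC.
- by move=> *; rewrite mulr1.
Qed.
Lemma regular_onX W (h : Z -> C) n : regular_on W h -> regular_on W (fun x => h x ^+ n).
Proof.
move=> H; elim: n => [|n IH]; first exact: regular_on1.
have -> : (fun x => h x ^+ n.+1) = (fun x => h x * h x ^+ n) by apply/funext => x; rewrite exprS.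
exact: regular_onM.
Qed.
Lemma regular_on_prod W (h : 'I_r -> Z -> C) : (forall i, regular_on W (h i)) ->
  regular_on W (fun x => \prod_i h i x).
Proof.
move=> H; have -> : (fun x => \prod_i h i x) = (fun x => \prod_(i <- index_enum 'I_r) h i x) by [].
elim: (index_enum _) => [|i s IH].
  have -> : (fun x => \prod_(i <- [::]) h i x) = fun=> 1 by apply/funext => x; rewrite big_nil.
  exact: regular_on1.
have -> : (fun x => \prod_(j <- i :: s) h j x) = (fun x => h i x * \prod_(j <- s) h j x).
  by apply/funext => x; rewrite big_cons.
exact: regular_onM.
Qed.

Lemma lfrac_zero W K e (h T : pt -> C) : open W -> lfrac W K e h -> pfun T ->
  (exists t, T t != 0) -> (forall t, W (chart e t) -> T t != 0 -> K (chart e t) /\ h t = 0) ->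
  forall t, W (chart e t) -> K (chart e t) -> h t = 0.
Proof.
move=> /open_bsdh oW H hT T0 hz t Wt Kt.
have [p [d [hp hd dt hpd]]] := H t Wt; have [q hq [qt Wq]] := oW e t Wt.
apply: (mulIf dt); rewrite mul0r hpd //.
apply: (pfun_dense hp (pfunM hT (pfunM hd hq))).
  apply: pfun_integral => //; [exact: pfunM|by exists t; rewrite mulf_neq0].
move=> s; rewrite !mulf_eq0 !negb_or => /and3P[Ts ds qs].
have Ws := Wq s qs; have [Ks hs] := hz s Ws Ts.
by rewrite -hpd // hs mul0r.
Qed.

Definition pchart e (q : pt -> C) : set Z := [set z | exists2 t, q t != 0 & z = chart e t].
Lemma pchartE e q t : pchart e q (chart e t) <-> q t != 0.
Proof. by split=> [[t' qt /(chart_inj (G:=G) hA hw) ->]|qt]; [|exists t]. Qed.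
Lemma pchart_range e q : pchart e q `<=` range (chart e).
Proof. by move=> _ [t _ ->]; exists t. Qed.

Lemma open_pchart e q : pfun q -> open (pchart e q).
Proof.
move=> hq; apply/open_bsdh => e' t [t' qt' et].
have [Q [tt [v [hQ htt h1 h2]]]] := chart_transition G hA hw e' e.
have Qt := h2 _ _ et; have [N [p [hp ep]]] := reg_comp hQ hq (fun i => let: And4 h _ _ _ := htt i in h).
exists (fun t => Q t * p t); first exact: pfunM.
have tt_t : (fun i => tt i t) = t' by apply: (chart_inj (G:=G) hA hw (e := e)); rewrite -h1.
split; first by rewrite mulf_neq0 // -ep // tt_t mulf_neq0 // expf_neq0.
move=> s; rewrite mulf_eq0 negb_or => /andP[Qs]; rewrite -ep // mulf_eq0 negb_or => /andP[qs _].
by exists (fun i => tt i s); rewrite ?h1.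
Qed.

Lemma open_range e : open (range (chart e)).
Proof.
have -> : range (chart e) = pchart e (fun=> 1).
  apply/seteqP; split=> [_ [t _ <-]|_ [t _ ->]]; last by exists t.
  by exists t; rewrite ?oner_neq0.
by apply: open_pchart; exact: pfunC.
Qed.

Definition Tb e t : C := \prod_i bit_coord (e i) (t i).
Lemma pfun_Tb e : pfun (Tb e).
Proof. by apply: pfun_prod => i _; rewrite /bit_coord; case: (e i); [exact: pfunX|exact: pfunC]. Qed.
Lemma Tb_neq0 e t : (Tb e t != 0) <-> forall i, bit_coord (e i) (t i) != 0.
Proof. by split=> [/prodf_neq0 h i|h]; [exact: h|apply/prodf_neq0 => i _]. Qed.
Lemma Tb1 e : exists t, Tb e t != 0.
Proof.
exists (fun=> 1); apply/Tb_neq0 => i; rewrite /bit_coord; case: ifP => _; exact: oner_neq0.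
Qed.
Lemma bdry_chart e t : bdry (chart e t) <-> Tb e t = 0.
Proof.
split=> [[i _ /(divisor_chart G hA hw)[ei ti]]|/eqP].
  by apply/eqP/prodf_eq0; exists i; rewrite // /bit_coord ei ti.
move=> /prodf_eq0[i _]; rewrite /bit_coord; case ei: (e i); last by rewrite oner_eq0.
by move=> /eqP ti; exists i => //; apply/(divisor_chart G hA hw).
Qed.
Lemma nbdry_chart e t : ~ bdry (chart e t) <-> Tb e t != 0.
Proof. by rewrite bdry_chart; split=> [/eqP|/eqP]. Qed.

Definition zeta e i (z : Z) : C := bit_coord (e i) (inv_chart e z i).

Lemma zeta_generator e i W : open W -> W `<=` range (chart e) ->
  ideal_generator (@bs_divisor R l A D G r w i) W (zeta e i).
Proof.
move=> oW We; split.
- apply: (regular_of_chart We) => t _; exists (fun t => bit_coord (e i) (t i)), (fun=> 1).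
  split; rewrite ?oner_neq0 //; [|exact: pfunC|].
    by rewrite /bit_coord; case: (e i); [exact: pfunX|exact: pfunC].
  by move=> t' _ _ _; rewrite mulr1 /zeta inv_chartK.
- move=> x /We[t _ <-] /(divisor_chart G hA hw)[ei ti].
  by rewrite /zeta inv_chartK /bit_coord ei ti.
move=> V h oV VW hr h0; have Ve := subset_trans VW We.
case ei: (e i); last first.
  by exists h => // x /Ve[t _ <-]; rewrite /zeta inv_chartK /bit_coord ei mul1r.
pose loc t (p1 d : pt -> C) := [/\ pfun p1, pfun d, d t != 0 &
  forall t', V (chart e t') -> d t' != 0 -> h (chart e t') * d t' = t' i * p1 t'].
have ex t : V (chart e t) -> exists p1 d, loc t p1 d.
  move=> Vt; have [p [d [hp hd dt hpd]]] := (regular_onP V h).1 hr e t Vt.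
  have [q hq [qt qV]] := (open_bsdh V).1 oV e t Vt.
  (* The factor d q makes the numerator vanish on the whole hyperplane t_i = 0 and not only on its
     part inside V, so t_i divides it. *)
  have hpq : pfun (fun t => p t * (d t * q t)) by do ![apply: pfunM => //].
  have [p1 hp1 ep1] := pfun_div i hpq.
  exists p1, (fun t => d t * (d t * q t)); split=> //; first by do ![apply: pfunM => //].
    by rewrite !mulf_neq0.
  move=> t' Vt'; rewrite !mulf_eq0 !negb_or => /and3P[d0 _ q0].
  rewrite mulrA hpd // ep1; set s := upd t' i 0.
  suff -> : p s * (d s * q s) = 0 by rewrite add0r.
  have [->|ds] := eqVneq (d s) 0; first by rewrite mul0r mulr0.
  have [->|qs] := eqVneq (q s) 0; first by rewrite !mulr0.
  have Vs := qV s qs; have Ys : @bs_divisor R l A D G r w i (chart e s).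
    by apply/(divisor_chart G hA hw); rewrite /s upd_eq.
  by rewrite -hpd // h0 // !mul0r.
have uq t p1 d p1' d' : V (chart e t) -> loc t p1 d -> loc t p1' d' -> p1 t / d t = p1' t / d' t.
  move=> Vt [hp hd dt H] [hp' hd' dt' H']; have [q hq [qt qV]] := (open_bsdh V).1 oV e t Vt.
  apply/eqP; rewrite eqr_div // -subr_eq0; apply/eqP.
  apply: (@pfun_dense _ _ (fun t => p1 t * d' t - p1' t * d t) (fun t => t i * (d t * (d' t * q t)))).
  - by apply: pfunB; apply: pfunM.
  - by apply: pfunM; [exact: pfunX|do ![apply: pfunM => //]].
  - apply: pfun_integral; [exact: pfunX|by do ![apply: pfunM => //]| |].
      by exists (fun=> 1); rewrite oner_neq0.
    by exists t; rewrite !mulf_neq0.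
  move=> s; rewrite !mulf_eq0 !negb_or => /and4P[si ds ds' qs].
  have Vs := qV s qs; apply: (mulfI si); rewrite mulr0 mulrBr !mulrA -H // -H' //; ring.
pose k z : C := xget 0 [set y | exists p1 d, loc (inv_chart e z) p1 d /\ y = p1 (inv_chart e z) / d (inv_chart e z)].
have kE t p1 d : V (chart e t) -> loc t p1 d -> k (chart e t) = p1 t / d t.
  move=> Vt L; rewrite /k inv_chartK; case: xgetP => [y _ [p1' [d' [L' ->]]]|/(_ (p1 t / d t))[]].
    exact: uq L' L.
  by exists p1, d.
exists k.
  apply: (regular_of_chart Ve) => t Vt; have [p1 [d L]] := ex t Vt; have [hp hd dt H] := L.
  by exists p1, d; split=> // t' Vt' _ dt'; rewrite (kE t' p1 d) ?divfK.
move=> x Vx; have [t _ et] := Ve x Vx; move: Vx; rewrite -et => Vt.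
have [p1 [d L]] := ex t Vt; have [hp hd dt H] := L.
by rewrite (kE t p1 d) // /zeta inv_chartK /bit_coord ei mulrA -H // mulfK.
Qed.

Section Divisor.
Variable g : 'I_r -> int.

Definition mono e t : C := \prod_i bit_coord (e i) (t i) ^ g i.
Lemma mono_neq0 e t : Tb e t != 0 -> mono e t != 0.
Proof.
move=> /Tb_neq0 h; apply/prodf_neq0 => i _; exact: expfz_neq0.
Qed.

Definition local_section U (f : Z -> C) := forall e, lfrac U (~` bdry) e (fun t => f (chart e t) * mono e t).

Lemma local_section_of_chart U e f : U `<=` range (chart e) ->
  lfrac U (~` bdry) e (fun t => f (chart e t) * mono e t) -> local_section U f.
Proof.
move=> Ue H e'; apply: (lfrac_transfer Ue H) => //; exists (fun i => - g i).
move=> t t' et _ v hv; rewrite et -!mulrA; congr (_ * _); rewrite /mono -big_split /=.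
apply: eq_bigr => i _; have [v0 ->] := hv i.
by rewrite expfzMl -mulrA -expfzDr // subrr expr0z mulr1.
Qed.

(** The condition for the generators [zeta e i] suffices: any other generator z_i is [zeta e i]
    times a function k, which is a unit because k k' = 1 off the boundary, hence everywhere by
    density. *)
Lemma local_sectionP U f : open U -> divisor_section g U f <->
  (forall x, ~ (U `\` bdry) x -> f x = 0) /\ local_section U f.
Proof.
move=> oU; split=> [[f0 fs]|[f0 fs]]; split=> //.
  move=> e t Ut; pose W := U `&` range (chart e).
  have oW : open W by apply: openI => //; exact: open_range.
  have We : W `<=` range (chart e) by move=> x [].
  have Wx : W (chart e t) by split=> //; exists t.
  have [V [h [oV Vx VW hr hE]]] := fs W (zeta e) oW (@subIsetl _ _ _) (fun i => zeta_generator i oW We) _ Wx.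
  have [p [d [hp hd dt hpd]]] := (regular_onP V h).1 hr e t Vx.
  have [q hq [qt qV]] := (open_bsdh V).1 oV e t Vx.
  exists (fun t => p t * q t), (fun t => d t * q t); split; [exact: pfunM|exact: pfunM|exact: mulf_neq0|].
  move=> t' Ut' nb; rewrite mulf_eq0 negb_or => /andP[d0 q0].
  have := hE _ (qV t' q0) nb; rewrite mulrA => E.
  rewrite -hpd //; last exact: qV.
  congr (_ * _ * _); rewrite -E; congr (_ * _); apply: eq_bigr => i _.
  by rewrite /zeta inv_chartK.
move=> W z oW WU hz x Wx; have [e [t ex]] := chart_cover (G:=G) hA hw x.
move: Wx; rewrite {}ex => Wt {x}.
pose W1 := W `&` range (chart e).
have oW1 : open W1 by apply: openI => //; exact: open_range.
have W1e : W1 `<=` range (chart e) by move=> x [].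
have W1W : W1 `<=` W by move=> x [].
have gz i : ideal_generator (@bs_divisor R l A D G r w i) W1 (zeta e i) by exact: zeta_generator.
have hz1 i : ideal_generator (@bs_divisor R l A D G r w i) W1 (z i) by exact: ideal_generatorS (hz i).
have hk i : exists k : Z -> C, regular_on W1 k /\ forall x, W1 x -> z i x = zeta e i x * k x.
  have [zr z0 _] := hz1 i; have [_ _ /(_ W1 (z i) oW1 (@subset_refl _ _) zr z0)[k h1 h2]] := gz i.
  by exists k.
have hk' i : exists k : Z -> C, regular_on W1 k /\ forall x, W1 x -> zeta e i x = z i x * k x.
  have [zr z0 _] := gz i; have [_ _ /(_ W1 _ oW1 (@subset_refl _ _) zr z0)[k h1 h2]] := hz1 i.
  by exists k.
pose k i := sval (cid (hk i)); pose k' i := sval (cid (hk' i)).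
have kr i : regular_on W1 (k i) by rewrite /k; case: cid => ? [].
have kr' i : regular_on W1 (k' i) by rewrite /k'; case: cid => ? [].
have kE i x : W1 x -> z i x = zeta e i x * k i x by rewrite /k; case: cid => ? [] /= _; apply.
have kE' i x : W1 x -> zeta e i x = z i x * k' i x by rewrite /k'; case: cid => ? [] /= _; apply.
have kk i x : W1 x -> k i x * k' i x = 1.
  move=> W1x; have [s _ es] := W1e x W1x; move: W1x; rewrite -es => W1s {x es}.
  apply/eqP; rewrite -subr_eq0; apply/eqP; move: W1s.
  have reg1 : regular_on W1 (fun x => k i x * k' i x - 1).
    by apply: regular_onB; [exact: regular_onM|exact: regular_on1].
  move=> W1s.
  apply: (lfrac_zero oW1 ((regular_onP _ _).1 reg1 e) (pfun_Tb e) (Tb1 e) _ W1s) => //.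
  move=> {W1s} u W1u /Tb_neq0/(_ i) u0; split=> //.
  have := kE' i _ W1u; rewrite kE // /zeta inv_chartK -mulrA -{1}[bit_coord _ _]mulr1.
  by move/(mulfI u0) => <-; rewrite subrr.
pose kz i x : C := k i x ^ g i.
have kzr i : regular_on W1 (kz i).
  rewrite /kz; case: (g i) => n; first exact: regular_onX.
  have : regular_on W1 (fun x => k' i x ^+ n.+1) by exact: regular_onX.
  move=> /regular_onP H; apply: (regular_of_chart W1e) => s W1s.
  have [p [d [hp hd dt hpd]]] := H e s W1s; exists p, d; split=> // s' W1s' _ ds'.
  rewrite -hpd //; congr (_ * _); rewrite NegzE -exprnN -exprVn; congr (_ ^+ _).
  have k0 : k i (chart e s') != 0.
    by apply/eqP => e0; have /eqP := kk i _ W1s'; rewrite e0 mul0r eq_sym oner_eq0.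
  by apply: (mulfI k0); rewrite kk // mulfV.
have [p [d [hp hd dt hpd]]] := fs e t (WU _ Wt).
have [q hq [qt qW]] := (open_bsdh W).1 oW e t Wt.
pose V := pchart e (fun t => d t * q t).
have oV : open V by apply: open_pchart; exact: pfunM.
have VW1 : V `<=` W1.
  move=> _ [s + ->]; rewrite mulf_eq0 negb_or => /andP[_ qs].
  by split; [exact: qW|exists s].
pose P x := p (inv_chart e x) / d (inv_chart e x).
exists V, (fun x => P x * \prod_i kz i x); split=> //.
- by exists t => //; rewrite mulf_neq0.
- exact: subset_trans W1W.
- apply: regular_onM; last by apply: regular_on_prod => i; apply: regular_onS (kzr i).
  apply: (regular_of_chart (e := e)); first exact: pchart_range.
  move=> s /pchartE; rewrite mulf_eq0 negb_or => /andP[ds _]; exists p, d; split=> // s' _ _ ds'.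
  by rewrite /P inv_chartK divfK.
move=> y Vy nb; have W1y := VW1 y Vy; have [s qs ys] := Vy; move: qs; rewrite mulf_eq0 negb_or => /andP[ds qs].
have -> : \prod_i z i y ^ g i = (\prod_i zeta e i y ^ g i) * \prod_i kz i y.
  by rewrite -big_split; apply: eq_bigr => i _ /=; rewrite kE // expfzMl.
rewrite mulrA; congr (_ * _); rewrite /P ys inv_chartK.
have := hpd s; rewrite -ys => /(_ _ nb ds) <-; last by apply: WU; exact: W1W.
rewrite mulfK //; congr (_ * _); apply: eq_bigr => i _.
by rewrite /zeta ys inv_chartK.
Qed.

End Divisor.
End Sections.

(** * Acyclicity of principal open subsets of a chart *)

Section Affine.
Variables (R : realType) (l : nat) (A : 'M[int]_l) (D : realization A).
Variable G : kac_moody_group R D.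
Hypothesis hA : is_gcm A.
Variables (r : nat) (w : 'I_r -> 'I_l).
Hypothesis hw : forall i, ndg R D (w i).
Variable g : 'I_r -> int.
Local Notation C := R[i].
Local Notation pt := ('I_r -> C).
Local Notation Z := (bsdh G w).
Local Notation chart := (chart G w).
Local Notation bdry := (@bs_boundary R l A D G r w).
Local Notation pchart := (@pchart R l A D G r w).
Local Notation F := (divisor_sheaf G w g).
Let pchE := @pchartE R l A D G hA r w hw.
Let opP := @open_pchart R l A D G hA r w hw.
Let invK := @inv_chartK R l A D G hA r w hw.
Let nbd := @nbdry_chart R l A D G hA r w hw.
Let lsP := @local_sectionP R l A D G hA r w hw g.
Implicit Types (e : 'I_r -> bool) (t : pt) (W V U : set Z) (i k : 'I_r).

Lemma dsection_ext U (s t : dsection g U) : (forall z, U z -> ~ bdry z -> s z = t z) -> s = t.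
Proof.
move=> h; apply: dsection_eq => z.
have [[Uz nb]|n] := pselect ((U `\` bdry) z); first exact: h.
have [s0 _] := dsectionP s; have [t0 _] := dsectionP t.
by rewrite s0 // t0.
Qed.

Lemma dsection_mk U (f : Z -> C) : open U -> local_section g U f ->
  exists s : dsection g U, forall z, U z -> ~ bdry z -> s z = f z.
Proof.
move=> oU hf; pose f0 z : C := if pselect (U z /\ ~ bdry z) then f z else 0.
have f0E z : U z -> ~ bdry z -> f0 z = f z by move=> Uz nb; rewrite /f0; case: pselect => // -[].
have P : f0 \in section_pred g U.
  apply/asboolP/lsP => //; split=> [z nz|e t Ut].
    by rewrite /f0; case: pselect.
  have [p [d [hp hd dt hpd]]] := hf e t Ut; exists p, d; split=> // t' Ut' nb d0.
  by rewrite f0E // hpd.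
by exists (DSection P).
Qed.

Lemma dsection_local U (s : dsection g U) : open U -> local_section g U s.
Proof. by move=> oU; have /(lsP _ oU)[] := dsectionP s. Qed.

Lemma dresE U V (UV : V `<=` U) (s : dsection g U) z : V z -> dres UV s z = s z.
Proof. by move=> Vz; rewrite /= /restrict_fun asboolT. Qed.

Lemma pchart_section e q (f : Z -> C) : pfun q -> local_section g (pchart e q) f ->
  exists N P, pfun P /\ forall t, q t != 0 -> Tb e t != 0 ->
    f (chart e t) * mono g e t * q t ^+ N = P t.
Proof.
move=> hq hf.
apply: (@local_fraction R r q (Tb e) (fun t => f (chart e t) * mono g e t) hq (@pfun_Tb R r e)) => t qt.
have [p [d [hp hd dt H]]] := hf e t ((pchE e q t).2 qt).
exists p, d; split=> // t' qt' Tt' dt'; apply: H => //; first exact/pchE.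
exact/nbd.
Qed.

Lemma pchart_section_mk e q N P : pfun q -> pfun P -> exists s : dsection g (pchart e q),
  forall t, q t != 0 -> Tb e t != 0 -> s (chart e t) = P t / q t ^+ N / mono g e t.
Proof.
move=> hq hP; pose f (z : Z) : C := let t := inv_chart e z in P t / q t ^+ N / mono g e t.
have [|s hs] := @dsection_mk (pchart e q) f (@opP e _ hq).
  apply: (@local_section_of_chart R l A D G hA r w hw g _ e); first exact: pchart_range.
  move=> t /pchE qt; exists P, (fun t => q t ^+ N); split; rewrite ?expf_neq0 //.
    exact: pfunXn.
  move=> t' _ /nbd/(mono_neq0 g) m0 q0.
  by rewrite /f invK mulfVK // divfK.
exists s => t qt Tt; rewrite hs ?/f ?invK //; first exact/pchE.
exact/nbd.
Qed.

Lemma power_split (x y : pt -> C) (a b : nat) : pfun x -> pfun y ->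
  exists p q, [/\ pfun p, pfun q & forall t, (x t + y t) ^+ (a + b) = x t ^+ a * p t + y t ^+ b * q t].
Proof.
move=> hx hy; elim: a b => [|a IHa] b.
  exists (fun t => (x t + y t) ^+ b), (fun=> 0); split.
  - by apply: pfunXn; exact: pfunD.
  - exact: pfunC.
  - by move=> t; rewrite mulr0 addr0 mul1r.
elim: b => [|b [p [q [hp hq e]]]].
  exists (fun=> 0), (fun t => (x t + y t) ^+ a.+1); split.
  - exact: pfunC.
  - by apply: pfunXn; exact: pfunD.
  - by move=> t; rewrite addn0 mulr0 add0r mul1r.
have [p' [q' [hp' hq' e']]] := IHa b.+1.
exists (fun t => p' t + y t * p t), (fun t => x t * q' t + q t); split.
- by apply: pfunD => //; exact: pfunM.
- by apply: pfunD => //; exact: pfunM.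
move=> t; rewrite addSn exprS mulrDl {1}e' addnS -addSn e !exprS; ring.
Qed.

Lemma pchartI e q q' : pchart e q `&` pchart e q' = pchart e (fun t => q t * q' t).
Proof.
apply/seteqP; split=> [_ [[t qt ->] /pchE qt']|_ [t + ->]].
  by exists t; rewrite ?mulf_neq0.
by rewrite mulf_eq0 negb_or => /andP[qt qt']; split; exists t.
Qed.

(** A partition of unity: (p1 + p2)^(2N) = p1^N c1 + p2^N c2 splits the numerator. The factor m
    makes p1 + p2 invertible, so that the two pieces cover m <> 0. *)
Lemma pchart_surj e (p1 p2 q : pt -> C) (m := fun t => (p1 t + p2 t) * q t)
    (U1 := pchart e (fun t => p1 t * m t)) (U2 := pchart e (fun t => p2 t * m t)) :
  pfun p1 -> pfun p2 -> pfun q ->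
  forall f : F (U1 `&` U2), exists (a : F U1) (b : F U2),
    f = res (@subIsetl _ U1 U2) a - res (@subIsetr _ U1 U2) b.
Proof.
move=> h1 h2 hq f.
have hm : pfun m by apply: pfunM => //; exact: pfunD.
have hq1 : pfun (fun t => p1 t * m t) by exact: pfunM.
have hq2 : pfun (fun t => p2 t * m t) by exact: pfunM.
have oU := openI (@opP e _ hq1) (@opP e _ hq2).
have hf := dsection_local (f : dsection g _) oU.
have [|N [P [hP eP]]] := @pchart_section e _ (dsval f) (pfunM hq1 hq2); first by rewrite -pchartI.
have [c1 [c2 [hc1 hc2 ec]]] := power_split N N h1 h2.
have pX c p : pfun c -> pfun p -> pfun (fun t => P t * c t * q t ^+ (N + N) * p t ^+ (N + (N + N))).
  by move=> hc hp; do ![apply: pfunM => //]; exact: pfunXn.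
(* The section has the denominator (p1 p2)^N m^(2N), and the splitting adds (p1 + p2)^(2N). With
   q^(2N) in the numerator, these powers combine to m^(4N). *)
pose M := (N + N + (N + N))%N.
have [a ea] := pchart_section_mk e M hq1 (pX c2 p1 hc2 h1).
have [b eb] := pchart_section_mk e M hq2 (pfunN (pX c1 p2 hc1 h2)).
exists a, b; apply: dsection_ext => z [[t + ->] /pchE].
rewrite !mulf_eq0 !negb_or => /and3P[n1 ns nq] /andP[n2 _] /nbd Tt.
have m0 : m t != 0 by rewrite mulf_neq0.
have q10 : p1 t * m t != 0 by rewrite mulf_neq0.
have q20 : p2 t * m t != 0 by rewrite mulf_neq0.
rewrite -[RHS]/(dsval (dres (@subIsetl _ U1 U2) a) (chart e t) -
  dsval (dres (@subIsetr _ U1 U2) b) (chart e t)) !dresE; try by split; exact/pchE.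
rewrite ea // eb //; have mo := mono_neq0 g Tt.
apply: (mulIf mo); rewrite mulrBl !divfK //.
have := eP t (mulf_neq0 q10 q20) Tt; set X := dsval f _ * _ => eX.
have qN : (p1 t * m t * (p2 t * m t)) ^+ N != 0 by rewrite expf_neq0 // mulf_neq0.
apply: (mulIf qN); rewrite eX; have := ec t.
rewrite /M !exprD !exprMn.
have := expf_neq0 N n1; have := expf_neq0 N n2; have := expf_neq0 N ns; have := expf_neq0 N nq.
move: (p1 t ^+ N) (p2 t ^+ N) ((p1 t + p2 t) ^+ N) (q t ^+ N) (c1 t) (c2 t) (P t) => u v ss qq x1 x2 y.
move=> q0 s0 v0 u0 es; field : es.
by rewrite q0 s0 v0 u0.
Qed.

Section Resolution.
Variable J : injective_resolution F.

Lemma coboundary_eq n U V (h : V `<=` U) (s : ir_obj J n.+1 U) : open U -> V = U ->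
  coboundary (res h s) -> coboundary s.
Proof. by move=> oU e; case: U / e s h oU => s h oU; rewrite res_id. Qed.

(** The polynomials p such that s becomes a coboundary over p q <> 0 form an ideal: sums are handled
    by [mayer_vietoris]. A cocycle is locally a coboundary, so this ideal has no zero where q <> 0
    and contains a power of q. *)
Lemma acyclic_step n e q (s : ir_obj J n.+1 (pchart e q)) : pfun q -> @ir_d _ _ J n.+1 _ s = 0 ->
  (forall p1 p2, pfun p1 -> pfun p2 ->
    let m t := (p1 t + p2 t) * q t in
    let U1 := pchart e (fun t => p1 t * m t) in let U2 := pchart e (fun t => p2 t * m t) in
    if n is m.+1 then acyclic J m (U1 `&` U2) else
    forall f : F (U1 `&` U2), exists (a : F U1) (b : F U2),
      f = res (@subIsetl _ U1 U2) a - res (@subIsetr _ U1 U2) b) ->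
  coboundary s.
Proof.
move=> hq ds H; have oq := @opP e _ hq; have [qm eq] := hq.
pose I (p : mpoly.mpoly r C) := forall V (h : V `<=` pchart e q),
  V = pchart e (fun t => mpoly.meval t p * q t) -> coboundary (res h s).
have pm (p : mpoly.mpoly r C) : pfun (fun t => mpoly.meval t p) by exists p.
have pmq (p : mpoly.mpoly r C) : pfun (fun t => mpoly.meval t p * q t) by exact: pfunM.
have subq f : pchart e (fun t => f t * q t) `<=` pchart e q.
  by move=> _ [t + ->]; rewrite mulf_eq0 negb_or => /andP[_ qt]; exists t.
have iI : is_ideal I.
  split.
  - move=> V h eV; have V0 : V = set0.
      apply/seteqP; split=> // x; rewrite eV => -[t]; rewrite mpoly.meval0 mul0r eqxx //.
    move: h; rewrite V0 => h; exists 0; exact: sec_set0.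
  - move=> p1 p2 I1 I2 V h eV.
    pose m t := (mpoly.meval t p1 + mpoly.meval t p2) * q t.
    have hm : pfun m by apply: pfunM => //; exact: pfunD.
    pose U1 := pchart e (fun t => mpoly.meval t p1 * m t).
    pose U2 := pchart e (fun t => mpoly.meval t p2 * m t).
    have oU1 : open U1 by apply: opP; exact: pfunM.
    have oU2 : open U2 by apply: opP; exact: pfunM.
    have eVm : V = pchart e m.
      by rewrite eV; congr (pchart e _); apply/funext => t; rewrite mpoly.mevalD.
    have oV : open V by rewrite eVm; exact: opP.
    have U1V : U1 `<=` V.
      by rewrite eVm => _ [t + ->]; rewrite mulf_eq0 negb_or => /andP[_ mt]; exists t.
    have U2V : U2 `<=` V.
      by rewrite eVm => _ [t + ->]; rewrite mulf_eq0 negb_or => /andP[_ mt]; exists t.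
    have cob (p : mpoly.mpoly r C) (U := pchart e (fun t => mpoly.meval t p * m t)) (UV : U `<=` V) :
        I p -> coboundary (res UV (res h s)).
      move=> Ip; have Upq : U `<=` pchart e (fun t => mpoly.meval t p * q t).
        move=> _ [t + ->]; rewrite !mulf_eq0 !negb_or => /and3P[pt _ qt].
        by exists t; rewrite ?mulf_neq0.
      have oU : open U by apply: opP; exact: pfunM.
      rewrite (res_comp _ _ (subset_trans Upq (subq _))) //.
      rewrite -(res_comp (subq _) Upq) //; last exact: opP.
      by apply: coboundary_res => //; [exact: opP|exact: Ip].
    apply: (mayer_vietoris (U := U1) (V := U2) (hU := U1V) (hV := U2V)) => //.
    + apply/seteqP; split=> [x [/U1V|/U2V] //|x].
      rewrite eVm => -[t mt ->]; have : mpoly.meval t p1 + mpoly.meval t p2 != 0.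
        by move: mt; rewrite mulf_eq0 negb_or => /andP[].
      have [->|n1] := eqVneq (mpoly.meval t p1) 0; last by left; exists t => //; exact: mulf_neq0.
      by rewrite add0r => n2; right; exists t => //; exact: mulf_neq0.
    + exact: cob.
    + exact: cob.
    + exact: (H _ _ (pm p1) (pm p2)).
  - move=> p y Ip V h eV.
    have VU : V `<=` pchart e (fun t => mpoly.meval t p * q t).
      rewrite eV => _ [t + ->]; rewrite mpoly.mevalM !mulf_eq0 !negb_or => /andP[/andP[pt _] qt].
      by exists t; rewrite ?mulf_neq0.
    have oV : open V by rewrite eV; exact: opP.
    rewrite -(res_comp (subq _) VU) //; last exact: opP.
    by apply: coboundary_res => //; [exact: opP|exact: Ip].
have [|N IN] := @nullstellensatz R r I qm iI.
  move=> t; rewrite -eq => qt; have ct : pchart e q (chart e t) by exact/pchE.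
  have [V [h [oV Vt cV]]] := local_coboundary oq ds ct.
  have [p hp [pt pV]] := (open_bsdh V).1 oV e t Vt.
  have [pp epp] := hp; exists pp; last by rewrite -epp.
  move=> V' h' eV'; have V'V : V' `<=` V.
    rewrite eV' => _ [u + ->]; rewrite mulf_eq0 negb_or -epp => /andP[pu _]; exact: pV.
  have oV' : open V' by rewrite eV'; exact: opP.
  by rewrite -(res_comp h V'V) //; apply: coboundary_res.
have eN : pchart e (fun t => mpoly.meval t (qm ^+ N) * q t) = pchart e q.
  apply/seteqP; split; first exact: subq.
  by move=> _ [t qt ->]; exists t => //; rewrite rmorphXn /= -eq mulf_neq0 // expf_neq0.
apply: (coboundary_eq (h := subq _) oq eN); exact: IN.
Qed.

Lemma acyclic_pchart n e q : pfun q -> acyclic J n (pchart e q).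
Proof.
elim: n q => [|n IH] q hq s ds.
  apply: (acyclic_step hq ds) => p1 p2 h1 h2; exact: pchart_surj.
apply: (acyclic_step hq ds) => p1 p2 h1 h2 m U1 U2; rewrite /U1 /U2 pchartI; apply: IH.
by do ![apply: pfunM => //]; exact: pfunD.
Qed.
End Resolution.
End Affine.

(** * Vanishing *)

Section GoodChart.
Variables (R : realType) (l : nat) (A : 'M[int]_l) (D : realization A).
Variable G : kac_moody_group R D.
Hypothesis hA : is_gcm A.
Variables (r : nat) (w : 'I_r -> 'I_l).
Hypothesis hw : forall i, ndg R D (w i).
Local Notation C := R[i].
Local Notation n := (rlz_dim D).
Local Notation pt := ('I_r -> C).
Local Notation B := (@borel R l A D G).
Local Notation T_ := (km_t G).
Local Notation x_ := (km_x G).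
Local Notation y_ := (km_y G).
Local Notation S i := (sl G i).
Local Notation cc := (@cc R l A D G r w).
Local Notation chart := (chart G w).
Local Notation cochar lam c := (@cochar R l A D lam c).
Local Notation rt i := (row i (rlz_root D)).
Local Notation crt i := (row i (rlz_coroot D)).
Implicit Types (e : 'I_r -> bool) (t : pt) (i k : 'I_r).

Lemma x_S_flip j a : a != 0 ->
  (x_ j a * S j = y_ j (a^-1)%R * (x_ j (- a) * @ch R l A D G j (- a)))%g.
Proof.
move=> a0; have na : - a != 0 by rewrite oppr_eq0.
rewrite y_bruhat ?invr_eq0 // invrK -[RHS]mulgA.
have -> : (x_ j a * (x_ j (- a) * @ch R l A D G j (- a)) = @ch R l A D G j (- a))%g.
  by rewrite mulgA xD subrr x0 mul1g.
rewrite -(mulgA (x_ j a)) -S_ch // mulgA -mulgA chM ?invr_eq0 // mulVf //.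
have -> : @ch R l A D G j 1 = 1%g.
  by apply: (@mulgI _ (@ch R l A D G j 1)); rewrite chM ?oner_neq0 // !mulr1 mulg1.
by rewrite mulg1.
Qed.

(** Past k the coordinates are chosen factor by factor, 0 where the bits agree and 1 on the y side
    where they differ, so that the point lies in both charts. With t_k = 0 prescribed this supplies
    the common point needed in [extends_all]. *)
Lemma charts_meet e e' t0 k : (forall i, (i <= k)%N -> e i = e' i) -> exists t t',
  chart e t = chart e' t' /\ forall i, (i <= k)%N -> t i = t0 i.
Proof.
move=> he; have [M _] := hw k.
have step i (u : G) : {x : C * C * G | B x.2 /\
    (B u -> (u * cc i (e i) x.1.1 = cc i (e' i) x.1.2 * x.2)%g)}.
  apply: cid; have [hu|hu] := pselect (B u); last by exists (0, 0, 1%g); split=> //; exact: borel1.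
  have bS v c : B v -> exists c' b, B b /\ (v * cc i false c = cc i false c' * b)%g.
    move=> hv; have [c' [b [hb eb]]] := borel_S hA M c (hw i) hv.
    by exists c', b; split=> //; rewrite /= mulgA.
  have [b0 hb0 e0] := cc_flip G hA w i true (oner_neq0 C).
  rewrite invr1 /= in e0.
  case: (e i) (e' i) => [] [].
  - by exists (0, 0, u); split=> // _; rewrite /= !y0 mul1g mulg1.
  - have [c' [b [hb eb]]] := bS u 1 hu; exists (1, c', (b * b0)%g); split; first exact: borelM.
    by move=> _; rewrite /= e0 mulgA eb mulgA.
  - have [c' [b [hb eb]]] := bS (u^-1)%g 1 (borelV hu).
    exists (c', 1, (b0^-1 * b^-1)%g); split; first by apply: borelM; exact: borelV.
    move=> _; have E0 : cc i true 1%R = (cc i false 1%R * b0)%g by [].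
    have E1 : (u * cc i false c' = cc i false 1%R * b^-1)%g.
      apply: (@mulgI _ (u^-1)%g); rewrite mulKg mulgA eb mulgK //.
    by rewrite [LHS]E1 E0 mulgA mulgK.
  - have [c' [b [hb eb]]] := bS u 0 hu; exists (0, c', b); split=> //.
pose F (m : nat) (u : G) : C * C * G := if insub m is Some i then sval (step i u) else (0, 0, 1%g).
pose bb := fix bb m : G := if m is m'.+1 then (F (k.+1 + m')%N (bb m')).2 else 1%g.
pose b m := if (m <= k)%N then 1%g else bb (m - k.+1)%N.
have FB m u : B (F m u).2.
  by rewrite /F; case: insubP => [i _ _|_]; [case: (step i u) => x []|exact: borel1].
have Bb m : B (b m).
  by rewrite /b; case: ifP => _; [exact: borel1|case: (m - _)%N => [|m']; [exact: borel1|exact: FB]].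
exists (fun i => if (i <= k)%N then t0 i else (F i (b i)).1.1).
exists (fun i => if (i <= k)%N then t0 i else (F i (b i)).1.2).
split=> [|i -> //]; apply/(chart_eqP G w).
exists b => [|i _]; first by rewrite /b leq0n.
split=> //; case: (leqP i k) => ik.
  rewrite he // /b ik mul1g; case: ifP => [_|]; first by rewrite mulg1.
  move/negbT; rewrite -ltnNge ltnS => ki; have -> : i = k by apply/val_inj/anti_leq; rewrite /= ik.
  by rewrite subnn mulg1.
have Fi : F i (b i) = sval (step i (b i)) by rewrite /F valK.
have -> : b i.+1 = (F i (b i)).2.
  by rewrite {1}/b ltnNge (ltnW ik) /= subSS -(subnSK ik) /= subnKC // /b leqNgt ik.
by rewrite Fi; case: (step i (b i)) => x [_ /=]; apply.
Qed.

Variable k : 'I_r.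

(* The cocharacter left over after moving alpha_k^vee past the coordinates of
   index smaller than m, in the chart whose bits are chosen along the way so
   that it rescales the coordinates by nonnegative powers only. *)
Definition lam_step (m : nat) (lam : 'rV[int]_n) : 'rV[int]_n :=
  if insub m is Some i then
    if dot (rt (w i)) lam <= 0 then lam else crefl (w i) lam
  else lam.
Definition lam (m : nat) : 'rV[int]_n :=
  (fix f j := if j is j'.+1 then lam_step (k.+1 + j') (f j') else crt (w k)) (m - k.+1)%N.
Definition wgt (i : 'I_r) : int := dot (rt (w i)) (lam i).

Lemma lam0 : lam k.+1 = crt (w k). Proof. by rewrite /lam subnn. Qed.
Lemma lamS i : (k < i)%N -> lam i.+1 = if wgt i <= 0 then lam i else crefl (w i) (lam i).
Proof. by move=> ki; rewrite /wgt {1}/lam subSn //= subnKC // /lam_step valK. Qed.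

(** Let n be the pairing of alpha_i with mu. In the cell of y_i the torus element scales t by
    c^(-n); in the other it scales t by c^n and is then reflected by S_i. The bit chosen by the sign
    of n makes the exponent |n|. *)
Lemma torus_step i (e : bool) (mu : 'rV[int]_n) (c t : C) : c != 0 ->
  e = (dot (rt (w i)) mu <= 0) ->
  (T_ (cochar mu c) * cc i e t =
   cc i e ((c ^+ `|dot (rt (w i)) mu|)%R * t)%R * T_ (cochar (if e then mu else crefl (w i) mu) c))%g.
Proof.
move=> c0 ->; have tc := @cocharP R l A D mu c c0.
have chE : torus_char (rwt D (al (w i))) (cochar mu c) = c ^ dot (rt (w i)) mu.
  by rewrite rwt_al char_cochar.
case: ifP => h /=.
  have -> : c ^+ `|dot (rt (w i)) mu| = (c ^ dot (rt (w i)) mu)^-1.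
    case: (dot _ _) h => m h; last by rewrite -[c ^ Negz m]/((c ^+ m.+1)^-1) invrK.
    have -> : m = 0%N by lia.
    by rewrite expr0z invr1.
  by rewrite -chE -(T_y G (w i) t tc) mulgVK.
have -> : c ^+ `|dot (rt (w i)) mu| = c ^ dot (rt (w i)) mu.
  by move/negbT: h; rewrite -ltNge; case: (dot _ _).
rewrite -(trefl_cochar _ _ c0) -mulgA -trefl_S // mulgA -chE mulgA -(T_x G (w i) t tc).
by rewrite mulgVK.
Qed.

(** The passage from the cell x S to the cell y at the factor k. The later coordinates stay regular
    across t_k = 0 although the k-th becomes 1 / t_k, and the equations of the Z_i pick up only
    powers t_k^|n_i| and units. *)
Lemma good_chart e : e k = false -> (forall i, (k < i)%N -> e i = (wgt i <= 0)) ->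
  exists (Q : pt -> C) (sg v : 'I_r -> pt -> C),
    [/\ pfun Q, forall t, t k = 0 -> Q t != 0,
        forall i, (k < i)%N -> [/\ reg Q (sg i), reg Q (v i) & reg Q (fun t => (v i t)^-1)],
        forall t, Q t != 0 -> forall i, (k < i)%N -> v i t != 0 /\
          bit_coord (e i) (sg i t) = (if e i then t k ^+ `|wgt i| else 1) * bit_coord (e i) (t i) * v i t &
        forall t, Q t != 0 -> t k != 0 -> chart e t =
          chart (fun i => if i == k then true else e i)
            (fun i => if (i < k)%N then t i else if i == k then (t k)^-1 else sg i t)].
Proof.
move=> ek he; pose sc i t : C := (- t k) ^+ `|wgt i| * t i.
have hN : pfun (fun t => - t k) by apply: pfunN; exact: pfunX.
have hsc i : pfun (sc i) by apply: pfunM; [exact: pfunXn|exact: pfunX].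
have kr : (k.+1 <= r)%N by [].
(* By [x_S_flip] the element x(- t_k) alpha_k^vee(- t_k) remains to be moved to the right. Its torus
   part produces the coordinates [sc]; what is transported here is x(- t_k), which is trivial for
   t_k = 0, so the domain contains that hyperplane. *)
have [|||Q [sg [v [hQ _ _ hv [h1 h2]]]]] := @transition R l A D G hA r w hw (fun=> 1) k.+1
   (fun t => x_ (w k) (- t k)) sc e e (@pfunC R r 1) _ _ _ kr.
- by apply: regfam_x; [exact: pfunC|exact: reg_pfun].
- by move=> t _; exact: borel_x.
- by move=> i; exact: reg_pfun.
(* The sign between (- t_k)^|n_i| and t_k^|n_i| is absorbed in the unit. *)
pose sgn i : C := if e i then (-1) ^+ `|wgt i| else 1.
have sgn2 i : sgn i * sgn i = 1.
  by rewrite /sgn; case: (e i); rewrite ?mulr1 // -exprMn mulrNN mulr1 expr1n.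
have sgn0 i : sgn i != 0 by apply/eqP => s0; have /eqP := sgn2 i; rewrite s0 mul0r eq_sym oner_eq0.
exists Q, sg, (fun i t => sgn i * v i t); split=> //.
- move=> t tk; apply: (h2 t (fun i => sc i t)); first exact: oner_neq0.
  exists (fun=> 1%g); first by rewrite tk oppr0 x0.
  by move=> i _; rewrite mul1g mulg1; split=> //; exact: borel1.
- move=> i ki; have [r1 r2 r3 _] := hv i ki; split=> //; first by apply: regM => //; exact: regC.
  apply: (reg_ext (f := fun t => sgn i * (v i t)^-1)); last by apply: regM => //; exact: regC.
  move=> t _; rewrite invfM; congr (_ * _); apply: (mulfI (sgn0 i)).
  by rewrite sgn2 mulfV.
- move=> t Qt i ki; have [_ _ _ /(_ t Qt)[v0 e0]] := hv i ki.
  split; first exact: mulf_neq0.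
  rewrite e0 /sc /sgn /bit_coord; case: (e i); last by rewrite !mul1r.
  by move: (absz (wgt i)) => N; rewrite (exprNn (t k)); move: ((-1) ^+ N) (t k ^+ N) (t i) (v i t) => a1 a2 a3 a4; ring.
move=> t Qt tk; have [b bk hb] := h1 t Qt; apply/(chart_eqP G w).
have ntk : - t k != 0 by rewrite oppr_eq0.
pose T (m : nat) := T_ (cochar (lam m) (- t k)).
exists (fun m => if (m <= k)%N then 1%g else (b m * T m)%g) => // i _.
case: (ltngtP i k) => ik.
- have -> : (i == k) = false by rewrite -val_eqE /= ltn_eqF.
  by rewrite mul1g mulg1; split=> //; exact: borel1.
- have -> : (i == k) = false by rewrite -val_eqE /= gtn_eqF.
  have hi : (k.+1 <= i < r)%N by rewrite ik ltn_ord.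
  have [Bb eb] := hb i hi.
  have ts : (T i * cc i (e i) (t i) = cc i (e i) (sc i t) * T i.+1)%g.
    by rewrite /T lamS // -he //; apply: torus_step => //; exact: he.
  split; first by apply: borelM => //; apply: borel_T; exact: cocharP.
  by rewrite -[LHS]mulgA ts [LHS]mulgA eb -[LHS]mulgA.
have -> : i = k by exact: val_inj.
rewrite eqxx ?ltnn /T lam0 bk ek; split.
  by apply: borelM; [exact: borel_x|apply: borel_T; exact: cocharP].
have tk' : (t k)^-1 != 0 by rewrite invr_eq0.
by rewrite mul1g /= x_S_flip.
Qed.

End GoodChart.

Section Laurent.
Variables (R : realType) (r : nat).
Local Notation C := R[i].
Local Notation pt := ('I_r -> C).

Lemma poly_eq_nz (A B : {poly C}) : (forall c, c != 0 -> A.[c] = B.[c]) -> A = B.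
Proof.
move=> h; apply/eqP; rewrite -subr_eq0; apply/eqP; apply: contrapT => /eqP n0.
have X0 : ('X : {poly C}) != 0 by rewrite polyX_eq0.
have [c] := poly_nonroot (mulf_neq0 n0 X0).
rewrite hornerM hornerX mulf_eq0 negb_or => /andP[+ c0].
by rewrite hornerD hornerN h // subrr eqxx.
Qed.

(** Uniqueness of the polynomial part of a Laurent polynomial: after clearing denominators, a
    nonzero A - A' would give a degree that the other terms cannot reach. *)
Lemma laurent_uniq (A A' : {poly C}) (N N' : nat) (b b' : nat -> C) :
  (forall c, c != 0 -> A.[c] + (\sum_(m < N) b m * c ^+ m) / c ^+ N =
                       A'.[c] + (\sum_(m < N') b' m * c ^+ m) / c ^+ N') -> A = A'.
Proof.
move=> h; apply/eqP; rewrite -subr_eq0; apply/eqP; apply: contrapT => /eqP n0.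
pose P := \poly_(m < N) b m; pose P' := \poly_(m < N') b' m.
have E : (A - A') * 'X^(N + N') = P' * 'X^N - P * 'X^N'.
  apply: poly_eq_nz => c c0; have := h c c0.
  move=> hc.
  have -> : ((A - A') * 'X^(N + N')).[c] = (A.[c] - A'.[c]) * (c ^+ N * c ^+ N').
    by rewrite hornerM hornerD hornerN hornerXn exprD.
  have -> : (P' * 'X^N - P * 'X^N').[c] = (\sum_(m < N') b' m * c ^+ m) * c ^+ N - (\sum_(m < N) b m * c ^+ m) * c ^+ N'.
    by rewrite hornerD hornerN !hornerM !hornerXn !horner_poly.
  move: hc.
  have := expf_neq0 N c0; have := expf_neq0 N' c0.
  move: (c ^+ N) (c ^+ N') (\sum_(m < N) _) (\sum_(m < N') _) A.[c] A'.[c] => x y u v p p' y0 x0 e.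
  have -> : p - p' = v / y - u / x.
    by apply/eqP; rewrite subr_eq addrAC -subr_eq opprK e addrC.
  by field; rewrite y0 x0.
have := congr1 (fun p : {poly C} => size p) E; rewrite size_mulXn // => E'.
have : (size (P' * 'X^N - P * 'X^N')%R <= N + N')%N.
  apply: leq_trans (size_polyD _ _) _; rewrite geq_max size_polyN; apply/andP; split.
    apply: leq_trans (size_polyMleq _ _) _; rewrite size_polyXn addnS /= addnC leq_add2l.
    exact: size_poly.
  apply: leq_trans (size_polyMleq _ _) _; rewrite size_polyXn addnS /= leq_add2r.
  exact: size_poly.
by rewrite -E' -{2}[(N + N')%N]addn0 leq_add2l leqn0 size_poly_eq0 (negPf n0).
Qed.

Lemma pfun_upd_poly (f : pt -> C) t k : pfun f -> exists A : {poly C}, forall c, f (upd t k c) = A.[c].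
Proof.
move=> hf; have [A hA] := pfun_line (upd t k 0) (upd t k 1) hf; exists A => c.
rewrite -hA; congr (f _); apply/funext => i; rewrite /upd; case: eqP => _.
  by rewrite add0r subr0 mulr1.
by rewrite subrr mulr0 addr0.
Qed.
End Laurent.

(** * Open sets on which the first factors lie in given cells *)

Section Tubes.
Variables (R : realType) (l : nat) (A : 'M[int]_l) (D : realization A).
Variable G : kac_moody_group R D.
Hypothesis hA : is_gcm A.
Variables (r : nat) (w : 'I_r -> 'I_l).
Hypothesis hw : forall i, ndg R D (w i).
Variable g : 'I_r -> int.
Local Notation C := R[i].
Local Notation pt := ('I_r -> C).
Local Notation Z := (bsdh G w).
Local Notation chart := (chart G w).
Local Notation pchart := (@pchart R l A D G r w).
Let opP := @open_pchart R l A D G hA r w hw.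
Let nbd := @nbdry_chart R l A D G hA r w hw.
Implicit Types (e : 'I_r -> bool) (t : pt) (W V U : set Z) (i k : 'I_r).

(** Points whose first m factors lie in the cells given by e, cut down by q <> 0. For q depending on
    the first m coordinates the condition does not depend on the chart, since all these charts share
    those coordinates ([chart_prefix]). *)
Definition tube (m : nat) e (q : pt -> C) : set Z :=
  [set z | exists e' t, [/\ forall i, (i < m)%N -> e' i = e i, q t != 0 & z = chart e' t]].
Definition prefixed (m : nat) (q : pt -> C) :=
  forall t t', (forall i, (i < m)%N -> t i = t' i) -> q t = q t'.

Lemma tubeE m e q e' t : prefixed m q -> (forall i, (i < m)%N -> e' i = e i) ->
  tube m e q (chart e' t) <-> q t != 0.
Proof.
move=> pq he; split=> [[e1 [t1 [he1 qt1 E]]]|qt]; last by exists e', t.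
rewrite (pq t t1) // => i im; apply: (chart_prefix (G:=G) hA hw E (k := m)) => // j jm.
by rewrite he // he1.
Qed.

Lemma pchart_tube m e q e' : (forall i, (i < m)%N -> e' i = e i) -> pchart e' q `<=` tube m e q.
Proof. by move=> he _ [t qt ->]; exists e', t. Qed.

Lemma open_tube m e q : pfun q -> open (tube m e q).
Proof.
move=> hq; apply/open_bsdh => e1 t1 [e' [t [he qt E]]].
have [p hp [pt1 pP]] := (open_bsdh _).1 (@opP e' _ hq) e1 t1 (ex_intro2 _ _ t qt E).
by exists p => //; split=> // s /pP; exact: pchart_tube.
Qed.

Definition setb e k (b : bool) i : bool := if i == k then b else e i.
Lemma setb_prefix e e' k b : (forall i, (i < k.+1)%N -> e' i = setb e k b i) <->
  (forall i, (i < k)%N -> e' i = e i) /\ e' k = b.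
Proof.
split=> [h|[h hk] i].
  split=> [i ik|]; last by rewrite h // /setb eqxx.
  have ik' : (i == k) = false by rewrite -val_eqE /= ltn_eqF.
  by rewrite h ?ltnS ?(ltnW ik) // /setb ik'.
rewrite ltnS leq_eqVlt /setb => /orP[/eqP/val_inj ->|ik]; first by rewrite eqxx.
have ik' : (i == k) = false by rewrite -val_eqE /= ltn_eqF.
by rewrite ik' h.
Qed.

Lemma prefixedS k q : prefixed k q -> prefixed k.+1 q.
Proof. by move=> pq t t' h; apply: pq => i ik; apply: h; exact: ltnW. Qed.

Lemma tube_other e q e' t k b : prefixed k q -> (forall i, (i < k)%N -> e' i = e i) -> e' k = b ->
  tube k.+1 (setb e k (~~ b)) q (chart e' t) <-> q t != 0 /\ t k != 0.
Proof.
move=> pq he hk; split=> [[e1 [t1 [/setb_prefix[h1 h1k] qt1 E]]]|[qt tk]].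
  have hee i : (i < k)%N -> e' i = e1 i by move=> ik; rewrite he // h1.
  have tt := chart_prefix hA hw E hee.
  split; first by rewrite (pq t t1).
  have n : e' k != e1 k by rewrite hk h1k; case: (b).
  have := chart_flip (G:=G) hA hw E hee n => tk; apply/eqP => t0.
  by move/eqP: tk; rewrite t0 mul0r eq_sym oner_eq0.
have [e1 [t1 [E h1 h1k h2 _]]] := chart_flipped G hA hw e' tk.
exists e1, t1; split=> //; last by rewrite -(pq t) // => i ik; rewrite h2.
by apply/setb_prefix; split=> [i ik|]; [rewrite h1 // he|rewrite h1k hk].
Qed.

Lemma local_section_sub U V f : V `<=` U -> local_section g U f -> local_section g V f.
Proof. by move=> VU h e; exact: lfrac_sub (h e). Qed.

Lemma glue_charts m e q (Pr : ('I_r -> bool) -> (Z -> C) -> Prop) : pfun q -> prefixed m q ->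
  (forall e', (forall i, (i < m)%N -> e' i = e i) ->
     exists f, Pr e' f /\ local_section g (pchart e' q) f) ->
  (forall e1 f1 t1 e2 f2 t2, (forall i, (i < m)%N -> e1 i = e i) -> (forall i, (i < m)%N -> e2 i = e i) ->
     Pr e1 f1 -> Pr e2 f2 -> local_section g (pchart e1 q) f1 -> local_section g (pchart e2 q) f2 ->
     chart e1 t1 = chart e2 t2 -> q t1 != 0 -> Tb e1 t1 != 0 ->
     f1 (chart e1 t1) = f2 (chart e2 t2)) ->
  exists a : dsection g (tube m e q), forall e', (forall i, (i < m)%N -> e' i = e i) ->
    exists2 f, Pr e' f & forall t, q t != 0 -> Tb e' t != 0 -> a (chart e' t) = f (chart e' t).
Proof.
move=> hq pq ex agree.
have ex' e' : {f | (forall i, (i < m)%N -> e' i = e i) -> Pr e' f /\ local_section g (pchart e' q) f}.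
  apply: cid; have [h|n] := pselect (forall i, (i < m)%N -> e' i = e i).
    by have [f hf] := ex e' h; exists f.
  by exists (fun=> 0).
pose ff e' := sval (ex' e').
have ffP e' : (forall i, (i < m)%N -> e' i = e i) -> Pr e' (ff e') /\ local_section g (pchart e' q) (ff e').
  exact: svalP (ex' e').
pose f (z : Z) : C := if pselect (exists e', (forall i, (i < m)%N -> e' i = e i) /\ pchart e' q z) is left h
  then ff (sval (cid h)) z else 0.
have fE e' t : (forall i, (i < m)%N -> e' i = e i) -> q t != 0 -> Tb e' t != 0 ->
    f (chart e' t) = ff e' (chart e' t).
  move=> he qt Tt; rewrite /f; case: pselect => [h|[]]; last by exists e'; split=> //; exists t.
  case: cid => e1 /= [h1 [t1 qt1 E]]; rewrite {1}E.
  have [P1 L1] := ffP e1 h1; have [P2 L2] := ffP e' he.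
  apply: agree P1 P2 L1 L2 _ _ _ => //.
  by apply/nbd; rewrite -E; exact/nbd.
have [|a ha] := @dsection_mk R l A D G hA r w hw g (tube m e q) f (@open_tube m e q hq).
  move=> e1 t1 [e' [t [he qt E]]]; have [P L] := ffP e' he.
  have oP := @opP e' _ hq; have et : pchart e' q (chart e1 t1) by rewrite E; exists t.
  have [p [d [hp hd dt hpd]]] := L e1 t1 et.
  have [q1 hq1 [q1t q1P]] := (open_bsdh _).1 oP e1 t1 et.
  exists (fun t => p t * q1 t), (fun t => d t * q1 t); split; [exact: pfunM|exact: pfunM|exact: mulf_neq0|].
  move=> s _ nb; rewrite mulf_eq0 negb_or => /andP[ds qs].
  have es := q1P s qs; rewrite mulrA -(hpd s es nb ds); congr (_ * _ * _ * _).
  have [s' qs' Es] := es; rewrite Es; apply: fE => //; apply/nbd; rewrite -Es //.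
exists a => e' he; have [P L] := ffP e' he; exists (ff e') => // t qt Tt.
rewrite ha ?fE //; last exact/nbd.
by exists e', t.
Qed.

Lemma Tb_upd e t k c : e k = true -> c != 0 -> Tb e t != 0 -> Tb e (upd t k c) != 0.
Proof.
move=> ek c0 /Tb_neq0 h; apply/Tb_neq0 => i; have [->|ik] := eqVneq i k.
  by rewrite upd_eq /bit_coord ek.
by rewrite upd_neq.
Qed.

Lemma mono_upd e t k c : e k = true -> mono g e (upd t k c) = c ^ g k * mono g (setb e k false) t.
Proof.
move=> ek; rewrite /mono (bigD1 k) //= [in RHS](bigD1 k) //= upd_eq /bit_coord ek /setb eqxx exp1rz mul1r.
congr (_ * _); apply: eq_bigr => i ik; by rewrite upd_neq // (negPf ik).
Qed.

Section Split.
Variables (k : 'I_r) (e : 'I_r -> bool) (q : pt -> C).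
Hypotheses (hq : pfun q) (pq : prefixed k q).
Local Notation U := (tube k.+1 (setb e k true) q).
Local Notation V := (tube k.+1 (setb e k false) q).
Variable f : dsection g (U `&` V).

Let oUV : open (U `&` V) := openI (@open_tube k.+1 (setb e k true) q hq) (@open_tube k.+1 (setb e k false) q hq).
Let hqk : pfun (fun t => q t * t k) := pfunM hq (@pfunX R r k).

Lemma UV_chart e' t : (forall i, (i < k)%N -> e' i = e i) -> (U `&` V) (chart e' t) <-> q t != 0 /\ t k != 0.
Proof.
move=> he; have h1 b : e' k = b -> tube k.+1 (setb e k b) q (chart e' t) <-> q t != 0.
  by move=> hk; apply: tubeE; [exact: prefixedS|apply/setb_prefix].
have h2 b : e' k = b -> tube k.+1 (setb e k (~~ b)) q (chart e' t) <-> q t != 0 /\ t k != 0.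
  by move=> hk; apply: tube_other.
by case hk: (e' k); split=> [[/= a b]|/= [a b]]; first [exact/(h2 _ hk)|split; first [exact/(h1 _ hk)|exact/(h2 _ hk)]].
Qed.

Lemma pchart_UV e' : (forall i, (i < k)%N -> e' i = e i) -> pchart e' (fun t => q t * t k) `<=` U `&` V.
Proof.
move=> he _ [t + ->]; rewrite mulf_eq0 negb_or => /andP[qt tk]; exact/UV_chart.
Qed.

Lemma section_UV (h : dsection g (U `&` V)) e' : (forall i, (i < k)%N -> e' i = e i) ->
  exists N P, pfun P /\ forall t, q t != 0 -> t k != 0 -> Tb e' t != 0 ->
    h (chart e' t) * mono g e' t * (q t * t k) ^+ N = P t.
Proof.
move=> he; have L := local_section_sub (pchart_UV he) (dsection_local hA hw h oUV).
have [N [P [hP eP]]] := pchart_section hA hw hqk L.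
by exists N, P; split=> // t qt tk Tt; apply: eP => //; exact: mulf_neq0.
Qed.

(** In the chart e' the section f is (sum_m L_m t_k^(m - N) + H) / q^N divided by the monomial; h
    keeps the term H, the nonnegative powers of t_k. *)
Definition plus_part e' (h : Z -> C) := exists N L H,
  [/\ forall m : nat, pfun (L m), forall m t c, L m (upd t k c) = L m t, pfun H,
    forall t, q t != 0 -> t k != 0 -> Tb e' t != 0 ->
      f (chart e' t) * mono g e' t * (q t * t k) ^+ N = \sum_(m < N) L m t * t k ^+ m + t k ^+ N * H t &
    forall t, q t != 0 -> Tb e' t != 0 -> h (chart e' t) = H t / q t ^+ N / mono g e' t].

Lemma q_upd t c : q (upd t k c) = q t.
Proof. by apply: pq => i ik; rewrite upd_neq // -val_eqE /= ltn_eqF. Qed.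

(** Along the curve where only t_k = c varies, f c^(g_k) is a Laurent polynomial in c and h c^(g_k)
    its polynomial part. By [chart_curve] the curve is the same in all charts concerned, so by
    [laurent_uniq] the parts h glue. *)
Lemma plus_part_poly e' h t : e' k = true -> plus_part e' h -> q t != 0 -> Tb e' t != 0 ->
  exists (B : {poly C}) (N : nat) (b : nat -> C),
    (forall c, c != 0 -> f (chart e' (upd t k c)) * c ^ g k = B.[c] + (\sum_(m < N) b m * c ^+ m) / c ^+ N) /\
    h (chart e' t) * t k ^ g k = B.[t k].
Proof.
move=> ek [N [L [H [hL Lk hH eP eh]]]] qt Tt.
have [B0 hB0] := pfun_upd_poly t k hH.
pose M := mono g (setb e' k false) t.
have tk : t k != 0 by move/Tb_neq0/(_ k): Tt; rewrite /bit_coord ek.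
have mE c : mono g e' (upd t k c) = c ^ g k * M by exact: mono_upd.
have mt : mono g e' t = t k ^ g k * M by rewrite -{1}(upd_id t k) mE.
have M0 : M != 0.
  have := mono_neq0 g Tt; rewrite mt mulf_eq0 negb_or => /andP[] //.
pose z := q t ^+ N * M; have z0 : z != 0 by rewrite mulf_neq0 // expf_neq0.
exists (z^-1 *: B0), N, (fun m => z^-1 * L m t); split=> [c c0|]; last first.
  have ck : t k ^ g k != 0 by exact: expfz_neq0.
  rewrite eh // hornerZ -hB0 upd_id mt /z.
  have := expf_neq0 N qt; move: (q t ^+ N) (H t) (t k ^ g k) ck => a b c c0 a0.
  by field; rewrite a0 M0 c0.
have := eP (upd t k c); rewrite q_upd upd_eq mE hB0 => /(_ qt c0 (Tb_upd ek c0 Tt)) E.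
have cN := expf_neq0 N c0; have qN := expf_neq0 N qt.
have -> : \sum_(m < N) z^-1 * L m t * c ^+ m = z^-1 * \sum_(m < N) L m (upd t k c) * c ^+ m.
  by rewrite mulr_sumr; apply: eq_bigr => m _; rewrite Lk mulrA.
rewrite hornerZ; move: E; rewrite exprMn /z; move: (c ^ g k) (\sum_(m < N) _) (f _) B0.[c] => a s y b.
move: (c ^+ N) (q t ^+ N) cN qN => cc qq c0' q0' E.
have -> : y * a = (y * (a * M) * (qq * cc)) / (M * qq * cc) by field; rewrite c0' q0' M0.
by rewrite E; field; rewrite c0' q0' M0.
Qed.

Lemma plus_section : exists a : dsection g U, forall e',
  (forall i, (i < k.+1)%N -> e' i = setb e k true i) ->
  exists2 h, plus_part e' h & forall t, q t != 0 -> Tb e' t != 0 -> a (chart e' t) = h (chart e' t).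
Proof.
apply: glue_charts => //; first exact: prefixedS.
  move=> e' /setb_prefix[he hk]; have [N [P [hP eP]]] := section_UV f he.
  have [L [H [hL Lk hH eT]]] := pfun_trunc k N hP.
  have [s hs] := pchart_section_mk G hA hw g e' N hq hH.
  exists s; split; last exact: (dsection_local hA hw s (@opP e' _ hq)).
  exists N, L, H; split=> // t qt tk Tt; by rewrite eP // eT.
move=> e1 h1 t1 e2 h2 t2 /setb_prefix[he1 k1] /setb_prefix[he2 k2] P1 P2 _ _ E q1 T1.
have hee i : (i <= k)%N -> e1 i = e2 i.
  by rewrite leq_eqVlt => /orP[/eqP/val_inj ->|ik]; [rewrite k1 k2|rewrite he1 // he2].
have tt i : (i < k.+1)%N -> t1 i = t2 i by apply: (chart_prefix (G:=G) hA hw E (k := k.+1)).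
have q2 : q t2 != 0 by rewrite -(pq (t := t1)) // => i ik; apply: tt; exact: ltnW.
have T2 : Tb e2 t2 != 0 by apply/nbd; rewrite -E; exact/nbd.
have [B1 [N1 [b1 [E1 V1]]]] := plus_part_poly k1 P1 q1 T1.
have [B2 [N2 [b2 [E2 V2]]]] := plus_part_poly k2 P2 q2 T2.
have eB : B1 = B2.
  have lu := @laurent_uniq R B1 B2 N1 N2 b1 b2; apply: lu => c c0.
  by rewrite -E1 // -E2 // (chart_curve (G:=G) hA hw c E hee).
have tk : t1 k != 0 by move/Tb_neq0/(_ k): T1; rewrite /bit_coord k1.
have : h1 (chart e1 t1) * t1 k ^ g k = h2 (chart e2 t2) * t1 k ^ g k.
  by rewrite V1 eB tt // V2.
by apply: mulIf; exact: expfz_neq0.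
Qed.

End Split.
End Tubes.

Section Remove.
Variables (R : realType) (r : nat).
Local Notation C := R[i].
Local Notation pt := ('I_r -> C).

(* A Hartogs argument: the pole along t_k = 0 can be removed if this is
   possible near one point with t_k = 0. *)
Lemma remove_pole (k : 'I_r) (q T P W M F : pt -> C) (N : nat) :
  pfun q -> pfun T -> pfun P -> pfun W -> pfun M ->
  (exists t, q t != 0) -> (exists t, T t != 0) -> (exists2 t, t k = 0 & W t != 0) ->
  (forall t, q t != 0 -> t k != 0 -> T t != 0 -> F t * (q t * t k) ^+ N = P t) ->
  (forall t, W t != 0 -> q t != 0 -> t k != 0 -> T t != 0 -> F t * W t = M t) ->
  exists P', pfun P' /\ forall t, q t != 0 -> t k != 0 -> T t != 0 -> F t * q t ^+ N = P' t.
Proof.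
move=> hq hT hP hW hM q0 T0 [tw twk Wt] eP eM.
have hk : pfun (fun t : pt => t k) by exact: pfunX.
have k0 : exists t : pt, t k != 0 by exists (fun=> 1); exact: oner_neq0.
have [x1 n1] := pfun_integral hq hk q0 k0.
have [x2 n2] := pfun_integral (pfunM hq hk) hT (ex_intro _ x1 n1) T0.
have [x3 n3] := pfun_integral (pfunM (pfunM hq hk) hT) hW (ex_intro _ x2 n2) (ex_intro _ tw Wt).
have E t : P t * W t = t k ^+ N * (q t ^+ N * M t).
  apply/eqP; rewrite -subr_eq0; apply/eqP; move: t.
  apply: (pfun_dense _ (pfunM (pfunM (pfunM hq hk) hT) hW) (ex_intro _ x3 n3)).
    by apply: pfunB; apply: pfunM => //; [exact: pfunXn|apply: pfunM => //; exact: pfunXn].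
  move=> t; rewrite !mulf_eq0 !negb_or => /andP[/andP[/andP[qt tk] Tt] wt].
  by rewrite -eP // -eM // exprMn; ring.
have [P' hP' eP'] := pfun_remove hP hW (pfunM (pfunXn N hq) hM) (ex_intro2 _ _ tw twk Wt) E.
exists P'; split=> // t qt tk Tt; apply: (mulfI (expf_neq0 N tk)).
by rewrite -eP' -eP // exprMn; ring.
Qed.
End Remove.

(** * Splitting of sections and the descending induction *)

Section Surjectivity.
Variables (R : realType) (l : nat) (A : 'M[int]_l) (D : realization A).
Variable G : kac_moody_group R D.
Hypothesis hA : is_gcm A.
Variables (r : nat) (w : 'I_r -> 'I_l).
Hypothesis hw : forall i, ndg R D (w i).
Variable g : 'I_r -> int.
Local Notation C := R[i].
Local Notation pt := ('I_r -> C).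
Local Notation Z := (bsdh G w).
Local Notation chart := (chart G w).
Local Notation bdry := (@bs_boundary R l A D G r w).
Local Notation pchart := (@pchart R l A D G r w).
Local Notation F := (divisor_sheaf G w g).
Local Notation tube := (@tube R l A D G r w).
Local Notation wg := (wgt D w).
Let pchE := @pchartE R l A D G hA r w hw.
Let opP := @open_pchart R l A D G hA r w hw.
Let nbd := @nbdry_chart R l A D G hA r w hw.
Implicit Types (e : 'I_r -> bool) (t : pt) (i : 'I_r).

Lemma lfracB W K e (h h' : pt -> C) : lfrac (G:=G) (w:=w) W K e h -> lfrac W K e h' ->
  lfrac W K e (fun t => h t - h' t).
Proof.
move=> H H' t Wt; have [p [d [hp hd dt E]]] := H t Wt; have [p' [d' [hp' hd' dt' E']]] := H' t Wt.
exists (fun t => p t * d' t - p' t * d t), (fun t => d t * d' t); split.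
- by apply: pfunB; exact: pfunM.
- exact: pfunM.
- exact: mulf_neq0.
- move=> s Ws Ks; rewrite mulf_eq0 negb_or => /andP[ds ds'].
  by rewrite -E // -E' //; ring.
Qed.

Section Split.
Variables (k : 'I_r) (e : 'I_r -> bool) (q : pt -> C).
Hypotheses (hq : pfun q) (pq : prefixed k q).
Hypothesis delta : 0 <= g k - \sum_(i < r | (k < i)%N && (wg k i <= 0)) `|wg k i|%N%:Z * g i.
Local Notation U := (tube k.+1 (setb e k true) q).
Local Notation V := (tube k.+1 (setb e k false) q).

Definition polar_part (f : dsection g (U `&` V)) := forall e', (forall i, (i < k)%N -> e' i = e i) -> e' k = true ->
  exists N L, [/\ forall m : nat, pfun (L m), forall m t c, L m (upd t k c) = L m t &
    forall t, q t != 0 -> t k != 0 -> Tb e' t != 0 ->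
      f (chart e' t) * mono g e' t * (q t * t k) ^+ N = \sum_(m < N) L m t * t k ^+ m].

Lemma polar_split (f : F (U `&` V)) : exists (a : F U) (f' : F (U `&` V)),
  polar_part f' /\ f = res (@subIsetl _ U V) a + f'.
Proof.
have [a ha] := plus_section hA hw hq pq f.
exists a; exists (f - @res _ F _ _ (@subIsetl _ U V) a); split; last by rewrite addrCA subrr addr0.
move=> e' he hk; have [|h [N [L [H [hL Lk hH eP eh]]]] ea] := ha e'.
  exact/setb_prefix.
exists N, L; split=> // t qt tk Tt.
have zUV : (U `&` V) (chart e' t) by apply/(UV_chart G hA hw pq).
rewrite -[_ (chart e' t)]/(f (chart e' t) - dres (@subIsetl _ U V) a (chart e' t)).
rewrite dresE // ea // eh // !mulrBl eP //.
have := mono_neq0 g Tt; have := expf_neq0 N qt; rewrite exprMn.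
move: (mono g e' t) (q t ^+ N) (t k ^+ N) (H t) (\sum_(m < N) _) => x y z u s y0 x0.
by field; rewrite x0 y0.
Qed.

Variable f : dsection g (U `&` V).
Hypothesis fpol : polar_part f.

Definition extends e' := exists N P, pfun P /\ forall t, q t != 0 -> t k != 0 -> Tb e' t != 0 ->
  f (chart e' t) * mono g e' t * q t ^+ N = P t.

Lemma extends_near e' (W M : pt -> C) : (forall i, (i < k)%N -> e' i = e i) -> pfun W -> pfun M ->
  ((exists t, q t != 0) -> exists2 t, t k = 0 & W t != 0) ->
  (forall t, W t != 0 -> q t != 0 -> t k != 0 -> Tb e' t != 0 ->
     f (chart e' t) * mono g e' t * W t = M t) -> extends e'.
Proof.
move=> he hW hM W0 eM; have [N [P [hP eP]]] := section_UV hA hw hq pq f he.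
have [q0|nq] := pselect (exists t, q t != 0); last first.
  by exists 0%N, (fun=> 0); split=> [|t qt]; [exact: pfunC|case: nq; exists t].
have [P' [hP' eP']] := @remove_pole R r k q (Tb e') P W M (fun t => f (chart e' t) * mono g e' t) N
  hq (pfun_Tb R e') hP hW hM q0 (Tb1 R e') (W0 q0) eP eM.
by exists N, P'; split=> // t; exact: eP'.
Qed.

Definition greedy i : bool := if (i < k)%N then e i else if i == k then false else wg k i <= 0.

Lemma mono_split e' t : mono g e' t = (\prod_(i < r | (i < k)%N) bit_coord (e' i) (t i) ^ g i) *
  bit_coord (e' k) (t k) ^ g k * \prod_(i < r | (k < i)%N) bit_coord (e' i) (t i) ^ g i.
Proof.
rewrite /mono (bigD1 k) //= mulrC mulrAC; congr (_ * _).
rewrite (bigID (fun i : 'I_r => (i < k)%N)) /=; congr (_ * _); apply: eq_bigl => i.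
  by rewrite andb_idl // -val_eqE /= => ik; rewrite neq_ltn ik.
by rewrite -leqNgt -val_eqE /= ltn_neqAle eq_sym.
Qed.

Lemma exprz_prod (I : finType) (Q : pred I) (n : I -> int) (c : C) : c != 0 ->
  \prod_(i | Q i) c ^ n i = c ^ (\sum_(i | Q i) n i).
Proof.
move=> c0; apply/esym; elim/big_rec2: _ => [|i y x _ <-]; first by rewrite expr0z.
by rewrite expfzDr.
Qed.

Lemma extends_greedy : extends greedy.
Proof.
have ek : greedy k = false by rewrite /greedy ltnn eqxx.
have egt i : (k < i)%N -> greedy i = (wg k i <= 0).
  by move=> ki; rewrite /greedy ltnNge (ltnW ki) /= -val_eqE /= gtn_eqF.
have elt i : (i < k)%N -> greedy i = e i by move=> ik; rewrite /greedy ik.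
have [Q [sg [v [hQ Qk rg cv ch]]]] := good_chart G hA hw ek egt.
pose e1 i := if i == k then true else greedy i.
pose ss t i := if (i < k)%N then t i else if i == k then (t k)^-1 else sg i t.
have nk i : (i < k)%N -> (i == k) = false by move=> ik; rewrite -val_eqE /= ltn_eqF.
have nk' i : (k < i)%N -> (i == k) = false by move=> ik; rewrite -val_eqE /= gtn_eqF.
have e1lt i : (i < k)%N -> e1 i = e i by move=> ik; rewrite /e1 nk // elt.
have e1k : e1 k = true by rewrite /e1 eqxx.
have [N [L [hL Lk eL]]] := fpol e1lt e1k.
(* The coefficients L m do not depend on the k-th coordinate, so its value 1 / t_k may be replaced
   by 0, which is regular. *)
pose s0 i t := if (i < k)%N then t i else if (k < i)%N then sg i t else 0.
have rs0 i : reg Q (s0 i).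
  rewrite /s0 /=; case ik: (i < k)%N; first exact/reg_pfun/pfunX.
  by case ki: (k < i)%N; [have [] := rg i ki|exact: regC].
pose dl := g k - \sum_(i < r | (k < i)%N && (wg k i <= 0)) `|wg k i|%N%:Z * g i.
(* As the k-th coordinate is inverted, a polar term of exponent m - N in the chart e1 has exponent N
   - m here. The change of monomials contributes t_k^dl and units, and dl >= 0 by [delta]. *)
pose rhs t := (\sum_(m < N) L m (fun i => s0 i t) * t k ^+ (N - m)) * t k ^+ `|dl|%N *
   \prod_(i < r | (k < i)%N) (v i t)^-1 ^ g i.
have rr : reg Q rhs.
  apply: regM; first apply: regM.
  - apply: (reg_sum hQ) => m; apply: regM; last exact/reg_pfun/pfunXn/pfunX.
    exact: (reg_comp hQ).
  - exact/reg_pfun/pfunXn/pfunX.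
  - apply: reg_prod => i ki; have [_ rv rv'] := rg i ki.
    apply: (reg_fz (g := v i)) => // t Qt; by rewrite invrK.
have [N2 [M [hM eM]]] := rr.
apply: (@extends_near greedy (fun t => q t ^+ N * Q t ^+ N2.+1) (fun t => M t * Q t)) => //.
- by apply: pfunM; apply: pfunXn.
- exact: pfunM.
- case=> t0 qt0; exists (upd t0 k 0); first by rewrite upd_eq.
  rewrite mulf_neq0 // expf_neq0 ?(q_upd pq) //; apply: Qk; by rewrite upd_eq.
move=> t; rewrite mulf_eq0 negb_or => /andP[_]; rewrite expf_eq0 /= => Qt qt tk Tt.
rewrite -eM // exprSr !mulrA; congr (_ * _ * _).
have cht := ch t Qt tk.
have qs : q (ss t) = q t by apply: pq => i ik; rewrite /ss ik.
have sk : ss t k = (t k)^-1 by rewrite /ss ltnn eqxx.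
have Ts : Tb e1 (ss t) != 0 by apply/nbd; rewrite -cht; exact/nbd.
have := eL (ss t); rewrite qs sk -cht => /(_ qt (invr_neq0 tk) Ts) E.
(* The factor k of the monomial, absent in the greedy chart, contributes t_k^(- g_k); each i > k
   with n_i <= 0 contributes t_k^(|n_i| g_i). Together this is t_k^(- dl). *)
have mE : mono g e1 (ss t) = mono g greedy t * (t k ^ dl)^-1 * \prod_(i < r | (k < i)%N) v i t ^ g i.
  rewrite !mono_split e1k ek sk /bit_coord exp1rz mulr1.
  have -> : \prod_(i < r | (i < k)%N) (if e1 i then ss t i else 1) ^ g i =
      \prod_(i < r | (i < k)%N) (if greedy i then t i else 1) ^ g i.
    by apply: eq_bigr => i ik; rewrite e1lt // elt // /ss ik.
  rewrite -!mulrA; congr (_ * _).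
  have -> : \prod_(i < r | (k < i)%N) (if e1 i then ss t i else 1) ^ g i =
      (\prod_(i < r | (k < i)%N) (if greedy i then t i else 1) ^ g i) *
      ((\prod_(i < r | (k < i)%N) (if greedy i then t k ^+ `|wg k i| else 1) ^ g i) *
       \prod_(i < r | (k < i)%N) v i t ^ g i).
    rewrite -!big_split /=; apply: eq_bigr => i ki.
    have [_] := cv t Qt i ki; rewrite /bit_coord /e1 nk' // /ss ltnNge (ltnW ki) /= nk' // => ->.
    by rewrite !expfzMl mulrA; congr (_ * _); rewrite mulrC.
  have -> : \prod_(i < r | (k < i)%N) (if greedy i then t k ^+ `|wg k i| else 1) ^ g i =
      t k ^ (\sum_(i < r | (k < i)%N && (wg k i <= 0)) `|wg k i|%N%:Z * g i).
    rewrite -exprz_prod // big_mkcondr /=; apply: eq_bigr => i ki; rewrite egt //.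
    by case: ifP => _; rewrite ?exp1rz // exprnP exprz_exp.
  have -> : (t k ^ dl)^-1 = (t k)^-1 ^ g k * t k ^ (\sum_(i < r | (k < i)%N && (wg k i <= 0)) `|wg k i|%N%:Z * g i).
    by rewrite exprz_inv -expfzDr // invr_expz /dl opprB addrC.
  by rewrite mulrCA !mulrA.
have sE m : L m (ss t) = L m (fun i => s0 i t).
  rewrite -(Lk m (ss t) 0); congr (L m _); apply/funext => i; rewrite /upd /ss /s0.
  by case: eqP => [->|/eqP ik]; [rewrite ltnn|case: ltngtP ik => // /val_inj ->; rewrite eqxx].
have SE : \sum_(m < N) L m (fun i => s0 i t) * t k ^+ (N - m) =
    t k ^+ N * \sum_(m < N) L m (ss t) * (t k)^-1 ^+ m.
  rewrite mulr_sumr; apply: eq_bigr => m _; rewrite sE mulrCA; congr (_ * _).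
  by rewrite exprVn -expfB ?(ltnW (ltn_ord m)) // expfB_cond.
have VE : \prod_(i < r | (k < i)%N) (v i t)^-1 ^ g i = (\prod_(i < r | (k < i)%N) v i t ^ g i)^-1.
  by rewrite -prodfV; apply: eq_bigr => i _; rewrite expfV.
have V0 : \prod_(i < r | (k < i)%N) v i t ^ g i != 0.
  by apply/prodf_neq0 => i ki; apply: expfz_neq0; have [] := cv t Qt i ki.
have dlE : t k ^+ `|dl|%N = t k ^ dl by rewrite exprnP gez0_abs.
rewrite /rhs SE VE dlE -E mE exprMn exprVn.
have := expfz_neq0 dl tk; have := expf_neq0 N tk; move: V0.
move: (\prod_(i < r | _) _) (t k ^ dl) (t k ^+ N) (q t ^+ N) (mono g greedy t) (f _) => x y z a b c x0 z0 y0.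
by field; rewrite x0 y0 z0.
Qed.

(** A chart with the same bits as the greedy one through k shares with it a point on t_k = 0
    ([charts_meet]). Near it the extension is known, and [extends_near] spreads it over the
    chart. *)
Lemma extends_all e' : (forall i, (i < k)%N -> e' i = e i) -> e' k = false -> extends e'.
Proof.
move=> he hk; have [N [P [hP eP]]] := extends_greedy.
have hee i : (i <= k)%N -> e' i = greedy i.
  rewrite leq_eqVlt /greedy => /orP[/eqP/val_inj ->|ik]; first by rewrite ltnn eqxx.
  by rewrite ik he.
have [Q [tt [v [hQ rg ch cov]]]] := chart_transition G hA hw e' greedy.
have rr : reg Q (fun t => P (fun i => tt i t) * \prod_i (v i t)^-1 ^ g i).
  apply: regM; first by apply: reg_comp => // i; have [] := rg i.
  apply: reg_prod => i _; have [_ rv rv' _] := rg i.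
  by apply: (reg_fz (g := v i)) => // t Qt; rewrite invrK.
have [N2 [M [hM eM]]] := rr.
apply: (@extends_near e' (fun t => q t ^+ N * Q t ^+ N2.+1) (fun t => M t * Q t)) => //.
- by apply: pfunM; apply: pfunXn.
- exact: pfunM.
- case=> t0 qt0; have [t [t' [E h]]] := charts_meet G hA hw (upd t0 k 0) hee.
  exists t; first by rewrite h // upd_eq.
  rewrite mulf_neq0 // expf_neq0 //; last exact: cov E.
  by rewrite (pq (t' := t0)) // => i ik; rewrite h ?(ltnW ik) // upd_neq // -val_eqE /= ltn_eqF.
move=> t; rewrite mulf_eq0 negb_or => /andP[_]; rewrite expf_eq0 /= => Qt qt tk Tt.
have E := ch t Qt.
have te i : (i < k.+1)%N -> t i = tt i t by apply: (chart_prefix (G:=G) hA hw E (k := k.+1)).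
have qtt : q (fun i => tt i t) = q t by apply: pq => i ik; rewrite -te // ltnW.
have Ts : Tb greedy (fun i => tt i t) != 0 by apply/nbd; rewrite -E; exact/nbd.
have := eP (fun i => tt i t); rewrite qtt -te // -E => /(_ qt tk Ts) e0.
rewrite -eM // exprSr -e0.
have -> : mono g greedy (fun i => tt i t) = mono g e' t * \prod_i v i t ^ g i.
  rewrite /mono -big_split /=; apply: eq_bigr => i _; have [_ _ _ /(_ t Qt)[_ ->]] := rg i.
  by rewrite expfzMl.
have -> : \prod_i (v i t)^-1 ^ g i = (\prod_i v i t ^ g i)^-1.
  by rewrite -prodfV; apply: eq_bigr => i _; rewrite expfV.
have : \prod_i v i t ^ g i != 0.
  by apply/prodf_neq0 => i _; apply: expfz_neq0; have [_ _ _ /(_ t Qt)[]] := rg i.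
move: (\prod_i _) => x x0; field; exact: x0.
Qed.

Lemma minus_section : exists b : F V, f = res (@subIsetr _ U V) b.
Proof.
pose Pr e' (h : Z -> C) := forall t, q t != 0 -> t k != 0 -> Tb e' t != 0 ->
  h (chart e' t) = f (chart e' t).
have [|e' /setb_prefix[he hk]||b hb] := @glue_charts R l A D G hA r w hw g k.+1 (setb e k false) q Pr hq.
- exact: prefixedS.
- have [N [P [hP eP]]] := extends_all he hk.
  have [s hs] := pchart_section_mk G hA hw g e' N hq hP.
  exists s; split; last exact: (dsection_local hA hw s (@opP e' _ hq)).
  move=> t qt tk Tt; rewrite hs // -eP //.
  by rewrite mulfK ?expf_neq0 // mulfK // (mono_neq0 g Tt).
- move=> e1 f1 t1 e2 f2 t2 /setb_prefix[he1 k1] /setb_prefix[he2 k2] P1 P2 L1 L2 E q1 T1.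
  pose W := pchart e1 q `&` pchart e2 q.
  have oW : open W by apply: openI; exact: opP.
  have W1 : W `<=` pchart e1 q by exact: subIsetl.
  have W2 : W `<=` pchart e2 q by exact: subIsetr.
  have l1 : local_section g W f1 by exact: local_section_sub L1.
  have l2 : local_section g W f2 by exact: local_section_sub L2.
  have lf := lfracB (l1 e1) (l2 e1).
  have hee i : (i <= k)%N -> e1 i = e2 i.
    by rewrite leq_eqVlt => /orP[/eqP/val_inj ->|ik]; [rewrite k1 k2|rewrite he1 // he2].
  have tte t t' : chart e1 t = chart e2 t' -> forall i, (i < k.+1)%N -> t i = t' i.
    by move=> E' i; apply: (chart_prefix (G:=G) hA hw E' (k := k.+1)).
  have qtt t t' : chart e1 t = chart e2 t' -> q t = q t'.
    by move=> /tte h; apply: pq => i ik; apply: h; exact: ltnW.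
  have hk : pfun (fun t : pt => t k) by exact: pfunX.
  have k0 : exists t : pt, t k != 0 by exists (fun=> 1); exact: oner_neq0.
  have : f1 (chart e1 t1) * mono g e1 t1 - f2 (chart e1 t1) * mono g e1 t1 = 0.
    apply: (@lfrac_zero R l A D G r w W (~` bdry) e1
      (fun t => f1 (chart e1 t) * mono g e1 t - f2 (chart e1 t) * mono g e1 t) (fun t => Tb e1 t * t k)
      oW lf (pfunM (pfun_Tb R e1) hk) (pfun_integral (pfun_Tb R e1) hk (Tb1 R e1) k0) _ t1).
    + move=> t [/pchE qt [t' qt' E']]; rewrite mulf_eq0 negb_or => /andP[Tt tk].
      have nb : ~ bdry (chart e1 t) by exact/nbd.
      split=> //; rewrite P1 // E' P2 ?subrr //; first by rewrite -(tte _ _ E').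
      by apply/nbd; rewrite -E'.
    + by split; [exists t1|exists t2 => //; rewrite -(qtt _ _ E)].
    + exact/nbd.
  by rewrite -mulrBl => /eqP; rewrite mulf_eq0 (negPf (mono_neq0 g T1)) orbF subr_eq0 E => /eqP.
exists b; apply: dsection_ext => z zUV nb; rewrite dresE //.
have [_ [e' [t [/setb_prefix he qt Ez]]]] := zUV; have [he' hk] := he.
move: zUV nb; rewrite Ez => zUV /nbd Tt.
have [_ tk] := (UV_chart G hA hw pq _ he').1 zUV.
have [|h Ph eh] := hb e'; first exact/setb_prefix.
by rewrite eh // Ph.
Qed.
End Split.

Lemma tubes_split (k : 'I_r) e q (U := tube k.+1 (setb e k true) q) (V := tube k.+1 (setb e k false) q) :
  pfun q -> prefixed k q ->
  0 <= g k - \sum_(i < r | (k < i)%N && (wg k i <= 0)) `|wg k i|%N%:Z * g i ->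
  forall f : F (U `&` V), exists (a : F U) (b : F V),
    f = res (@subIsetl _ U V) a - res (@subIsetr _ U V) b.
Proof.
move=> hq pq dl f; have [a [f' [hf' ->]]] := polar_split hq pq f.
have [b ->] := minus_section hq pq dl hf'; exists a, (- b).
by rewrite resN ?opprK //; [exact: open_tube|apply: openI; exact: open_tube].
Qed.

Section Induction.
Hypothesis delta : forall k : 'I_r,
  0 <= g k - \sum_(i < r | (k < i)%N && (wg k i <= 0)) `|wg k i|%N%:Z * g i.
Variable J : injective_resolution F.

Lemma acyclic_tube d n e q m : (n + d = r)%N -> pfun q -> prefixed n q -> acyclic J m (tube n e q).
Proof.
elim: d n e q m => [|d IH] n e q m ndr hq pq.
  have -> : tube n e q = pchart e q.
    apply/seteqP; split; last by apply: pchart_tube.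
    move=> _ [e' [t [he qt ->]]]; exists t => //; congr (chart _ _); apply/funext => i.
    by apply: he; rewrite -(addn0 n) ndr.
  exact: acyclic_pchart.
have nr : (n < r)%N by rewrite -ndr addnS ltnS leq_addr.
pose k := Ordinal nr; have pqk : prefixed k q := pq; rewrite -[n]/(k : nat).
set U := tube k.+1 (setb e k true) q; set V := tube k.+1 (setb e k false) q.
have sb b : tube k.+1 (setb e k b) q `<=` tube k e q.
  by move=> _ [e' [t [/setb_prefix[he _] qt ->]]]; exists e', t.
have hU : U `<=` tube k e q := sb true; have hV : V `<=` tube k e q := sb false.
have oU : open U by exact: open_tube.
have oV : open V by exact: open_tube.
have oW : open (tube k e q) by exact: open_tube.
have aU b m' : acyclic J m' (tube k.+1 (setb e k b) q).
  by apply: IH => //; [rewrite /= addSnnS|exact: prefixedS].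
move=> s ds.
apply: (mayer_vietoris (U := U) (V := V) (hU := hU) (hV := hV)) => //.
- apply/seteqP; split=> [x [/hU|/hV] //|_ [e' [t [he qt ->]]]].
  by case hk: (e' k); [left|right]; exists e', t; split=> //; exact/setb_prefix.
- by apply: aU; rewrite d_res // ds res0.
- by apply: aU; rewrite d_res // ds res0.
case: m s ds => [|m] s ds; first exact: tubes_split.
(* The intersection is again a set of the same kind, with q replaced by q t_k; the induction carries
   q along for this purpose. *)
have -> : U `&` V = tube k.+1 (setb e k true) (fun t => q t * t k).
  have pq' : prefixed k.+1 (fun t : pt => q t * t k).
    by move=> t t' h; rewrite (pq t t') ?h // => i ik; apply: h; exact: ltnW.
  apply/seteqP; split=> [z zz|_ [e' [t [/setb_prefix[he hk] + ->]]]].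
    have [[e' [t [/setb_prefix[he hk] qt Ez]]] _] := zz; move: zz; rewrite Ez => zz.
    have [_ tk] := (UV_chart G hA hw pqk _ he).1 zz.
    by exists e', t; split=> //; [exact/setb_prefix|exact: mulf_neq0].
  by rewrite mulf_eq0 negb_or => /andP[qt tk]; apply/(UV_chart G hA hw pqk _ he).
apply: IH; [by rewrite /= addSnnS|by apply: pfunM => //; exact: pfunX|].
by move=> t t' h; rewrite (pq t t') ?h // => i ik; apply: h; exact: ltnW.
Qed.

Lemma divisor_sheaf_vanishing m : acyclic J m setT.
Proof.
have <- : tube 0 (fun=> true) (fun=> 1) = setT.
  apply/seteqP; split=> // z _; have [e [t ->]] := chart_cover hA hw z.
  by exists e, t; split=> //; exact: oner_neq0.
by apply: (@acyclic_tube r) => //; exact: pfunC.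
Qed.
End Induction.
End Surjectivity.

(** * The primitive relations *)

Section Fan.
Variables (R : realType) (l : nat) (A : 'M[int]_l) (D : realization A).
Variables (r : nat) (w : 'I_r -> 'I_l).
Local Notation N := (pairing A w).
Local Notation gen := (ray_gen R A w).
Local Notation wg := (wgt D w).

Definition rays_sum (c : ray r -> R) : 'rV[R]_r := \sum_i (c (i, true) *: gen (i, true) + c (i, false) *: gen (i, false)).

Lemma rays_sumE c (j : 'I_r) : rays_sum c 0 j =
  c (j, true) - c (j, false) - \sum_(i < r | (i < j)%N) c (i, false) * (N i j)%:~R.
Proof.
have gE i : (c (i, true) *: gen (i, true) + c (i, false) *: gen (i, false)) 0 j =
    (c (i, true) - c (i, false)) *+ (j == i) - (if (i < j)%N then c (i, false) * (N i j)%:~R else 0).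
  rewrite !mxE /= summxE ?eqxx /=.
  have -> : \sum_(m < r | (i < m)%N) ((N i m)%:~R *: delta_mx 0 m : 'rV[R]_r) 0 j =
      if (i < j)%N then (N i j)%:~R else 0.
    rewrite big_mkcond (bigD1 j) //= big1 ?addr0 => [|m mj].
      by case: ifP => // _; rewrite !mxE !eqxx mulr1.
    by case: ifP => // _; rewrite !mxE [j == m]eq_sym (negPf mj) andbF mulr0.
  by case: ifP => _; case: (j == i); rewrite ?mulr1n ?mulr0n; ring.
rewrite summxE (eq_bigr _ (fun i _ => gE i)) sumrB -big_mkcond; congr (_ - _).
rewrite (bigD1 j) //= eqxx big1 ?addr0 // => i ij.
by rewrite eq_sym (negPf ij).
Qed.

Lemma complementary_uniq (x y x' y' : R) : 0 <= x -> 0 <= y -> 0 <= x' -> 0 <= y' ->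
  x * y = 0 -> x' * y' = 0 -> x - y = x' - y' -> x = x' /\ y = y'.
Proof.
move=> x0 y0 x0' y0' /eqP; rewrite mulf_eq0 => h /eqP; rewrite mulf_eq0 => h' e.
by case/orP: h => /eqP h; case/orP: h' => /eqP h'; split; lra.
Qed.

(** The system is triangular: given the coefficients of smaller index, the j-th coordinate
    determines c(rho_j^+) - c(rho_j^-), and two nonnegative numbers with product 0 are determined by
    their difference. *)
Lemma rays_sum_inj (c c' : ray r -> R) : (forall rho, 0 <= c rho) -> (forall rho, 0 <= c' rho) ->
  (forall i, c (i, true) * c (i, false) = 0) -> (forall i, c' (i, true) * c' (i, false) = 0) ->
  rays_sum c = rays_sum c' -> forall i b, c (i, b) = c' (i, b).
Proof.
move=> c0 c0' cc cc' e.
suff H n (i : 'I_r) : (i < n)%N -> c (i, true) = c' (i, true) /\ c (i, false) = c' (i, false).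
  by move=> i [] ; have [] := H i.+1 i (ltnSn i).
elim: n i => // n IH i; rewrite ltnS => ni; apply: complementary_uniq => //.
have := congr1 (fun v : 'rV[R]_r => v 0 i) e; rewrite !rays_sumE.
rewrite (eq_bigr (fun j : 'I_r => c' (j, false) * (N j i)%:~R)) => [|j ji]; first exact: addIr.
by have [_ ->] := IH j (leq_trans ji ni).
Qed.

Lemma cone_expansion_sum (v : 'rV[R]_r) sc : cone_expansion A w v sc ->
  [/\ forall rho, 0 <= sc.2 rho, forall i, sc.2 (i, true) * sc.2 (i, false) = 0,
      v = rays_sum sc.2 & forall F : ray r -> R, \sum_(rho in sc.1) sc.2 rho * F rho =
        \sum_i (sc.2 (i, true) * F (i, true) + sc.2 (i, false) * F (i, false))].
Proof.
case=> fc cp cz ->.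
have sumE (V : nmodType) (F : ray r -> V) : (forall rho, sc.2 rho = 0 -> F rho = 0) ->
    \sum_(rho in sc.1) F rho = \sum_i (F (i, true) + F (i, false)).
  move=> F0; rewrite big_mkcond (eq_bigr F) => [|rho _]; last first.
    by case: ifP => // /negbT /cz /F0.
  rewrite (eq_bigr (fun rho => F (rho.1, rho.2))) => [|[] //].
  rewrite -(pair_bigA _ (fun i b => F (i, b))) /=; apply: eq_bigr => i _; by rewrite big_bool.
split.
- by move=> rho; have [/cp/ltW|/cz ->] := boolP (rho \in sc.1).
- move=> i; have [h|/cz ->] := boolP ((i, true) \in sc.1); last by rewrite mul0r.
  have [h'|/cz ->] := boolP ((i, false) \in sc.1); last by rewrite mulr0.
  by have := fc i (conj h h').
- by apply: sumE => rho ->; rewrite scale0r.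
- by move=> F; apply: sumE => rho ->; rewrite mul0r.
Qed.

Section Relation.
Variable k : 'I_r.

Lemma dotBl (mu nu lam : 'rV[int]_(rlz_dim D)) : dot mu (lam - nu) = dot mu lam - dot mu nu.
Proof. by rewrite /dot -sumrB; apply: eq_bigr => i _; rewrite !mxE mulrBr. Qed.
Lemma dotZl (mu lam : 'rV[int]_(rlz_dim D)) (c : int) : dot mu (c *: lam) = c * dot mu lam.
Proof. by rewrite /dot mulr_sumr; apply: eq_bigr => i _; rewrite !mxE mulrCA. Qed.

Lemma dot_lam (m : nat) (mu : 'rV[int]_(rlz_dim D)) : (k < m <= r)%N ->
  dot mu (lam D w k m) = dot mu (row (w k) (rlz_coroot D)) -
    \sum_(i < r | (k < i < m)%N && (0 < wg k i)) wg k i * dot mu (row (w i) (rlz_coroot D)).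
Proof.
elim: m => // m IH /andP[]; rewrite ltnS leq_eqVlt => /orP[/eqP <- kr|km mr].
  rewrite lam0 big_pred0 ?subr0 // => i.
  by rewrite ltnS; case: ltngtP.
pose i := Ordinal mr; have -> : lam D w k m.+1 = lam D w k (i : nat).+1 by [].
rewrite lamS // (bigID (fun j => j == i)) /=.
have -> : \sum_(j < r | (k < j < m.+1)%N && (0 < wg k j) && (j != i)) wg k j * dot mu (row (w j) (rlz_coroot D)) =
    \sum_(j < r | (k < j < m)%N && (0 < wg k j)) wg k j * dot mu (row (w j) (rlz_coroot D)).
  apply: eq_bigl => j; rewrite -val_eqE /= ltnS [(j < m)%N]ltn_neqAle.
  by case: (k < j)%N; case: (j <= m)%N; case: (0 < _); case: eqP.
have [ni|ni] := lerP (wg k i) 0.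
  rewrite [X in _ - (X + _)]big1 ?add0r => [|j /andP[/andP[_ h] /eqP ij]]; last first.
    by rewrite ij in h; have := lt_le_trans h ni; rewrite ltxx.
  by rewrite IH // km ltnW.
rewrite (big_pred1 i) => [|j]; last first.
  rewrite [RHS]/=; case: eqP => [->|_]; last by rewrite andbF.
  by rewrite /= ltnSn km ni.
by rewrite /crefl dotBl dotZl IH ?km 1?ltnW // opprD addrA addrAC.
Qed.

(** This is also the recursion for expanding e_k^+ + e_k^- in the fan. Its coordinates are - N k j;
    removing n_i e_i^- for each earlier n_i > 0 leaves - n_j at j, to be covered by rho_j^+ if n_j
    <= 0 and by rho_j^- otherwise. *)
Lemma wgtE (j : 'I_r) : (k < j)%N ->
  wg k j = N k j - \sum_(i < r | (k < i < j)%N && (0 < wg k i)) wg k i * N i j.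
Proof.
move=> kj; rewrite {1}/wgt dot_lam ?dot_root; last by rewrite kj ltnW.
by congr (_ - _); apply: eq_bigr => i _; rewrite dot_root.
Qed.

Definition greedy_coef (rho : ray r) : R :=
  if (k < rho.1)%N && (rho.2 == (wg k rho.1 <= 0)) then (`|wg k rho.1|%N%:Z)%:~R else 0.

Lemma greedy_coef_ge0 rho : 0 <= greedy_coef rho.
Proof. by rewrite /greedy_coef; case: ifP => // _; rewrite ler0z. Qed.
Lemma greedy_coef_compl i : greedy_coef (i, true) * greedy_coef (i, false) = 0.
Proof.
rewrite /greedy_coef /=; case: (_ < _)%N => /=; last by rewrite mul0r.
by case: (_ <= _) => /=; rewrite ?mul0r ?mulr0.
Qed.

Lemma greedy_coefB i : greedy_coef (i, true) - greedy_coef (i, false) =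
  if (k < i)%N then - (wg k i)%:~R else 0.
Proof.
rewrite /greedy_coef /=; case: (_ < _)%N => /=; last by rewrite subr0.
by case: lerP => h /=; rewrite ?subr0 ?sub0r -?mulrNz; congr (_%:~R); lia.
Qed.

Lemma greedy_relation : gen (k, true) + gen (k, false) = rays_sum greedy_coef.
Proof.
pose u (rho : ray r) : R := (rho.1 == k)%:R.
have -> : gen (k, true) + gen (k, false) = rays_sum u.
  rewrite /rays_sum (bigD1 k) //= big1 ?addr0 => [|i ik]; first by rewrite /u /= eqxx !scale1r.
  by rewrite /u /= (negPf ik) !scale0r addr0.
apply/rowP => j; rewrite !rays_sumE greedy_coefB /u /= subrr sub0r.
have -> : \sum_(i < r | (i < j)%N) (i == k)%:R * (N i j)%:~R = (if (k < j)%N then (N k j)%:~R else 0) :> R.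
  case: ifP => kj; last first.
    by rewrite big1 // => i ij; case: eqP => [e|]; rewrite ?mul0r //; move: ij; rewrite e kj.
  rewrite (bigD1 k) //= eqxx mul1r big1 ?addr0 // => i /andP[_ /negPf ->]; by rewrite mul0r.
have gf (i : 'I_r) : greedy_coef (i, false) = if (k < i)%N && (0 < wg k i) then (wg k i)%:~R else 0.
  rewrite /greedy_coef /=; case: (_ < _)%N => //=; case: lerP => //= h.
  by congr (_%:~R); lia.
have -> : \sum_(i < r | (i < j)%N) greedy_coef (i, false) * (N i j)%:~R =
    \sum_(i < r | (k < i < j)%N && (0 < wg k i)) (wg k i * N i j)%:~R.
  rewrite big_mkcond [RHS]big_mkcond; apply: eq_bigr => i _; rewrite gf intrM.
  by case: (k < i)%N; case: (i < j)%N; case: (0 < _); rewrite ?mul0r.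
case: ifP => kj.
  rewrite (wgtE kj) rmorphB /= rmorph_sum /=; ring.
rewrite oppr0 sub0r big_pred0 ?oppr0 // => i; apply/negP => /andP[/andP[ki ij] _].
by rewrite (ltn_trans ki ij) in kj.
Qed.

Lemma primitive_relationP :
  cone_expansion A w (gen (k, true) + gen (k, false)) (primitive_relation R A w k).
Proof.
apply: xgetPex; pose gam := [set rho : ray r | 0 < greedy_coef rho]%SET.
have gz rho : rho \notin gam -> greedy_coef rho = 0.
  by rewrite inE -leNgt => h; apply/eqP; rewrite eq_le h greedy_coef_ge0.
exists (gam, [ffun rho => greedy_coef rho]); split=> /=.
- move=> i [] /=; rewrite !inE => h1 h2.
  by have := mulr_gt0 h1 h2; rewrite greedy_coef_compl ltxx.
- by move=> rho; rewrite inE ffunE.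
- by move=> rho /gz; rewrite ffunE.
rewrite greedy_relation /rays_sum [RHS]big_mkcond /=.
rewrite [RHS](eq_bigr (fun rho => greedy_coef rho *: gen rho)) => [|rho _]; last first.
  by rewrite ffunE; case: ifP => // /negbT/gz ->; rewrite scale0r.
rewrite [RHS](eq_bigr (fun rho => greedy_coef (rho.1, rho.2) *: gen (rho.1, rho.2))) => [|[] //].
rewrite -(pair_bigA _ (fun i b => greedy_coef (i, b) *: gen (i, b))) /=.
by apply: eq_bigr => i _; rewrite big_bool.
Qed.

Lemma primitive_relation_sum (F : ray r -> R) :
  \sum_(rho in (primitive_relation R A w k).1) (primitive_relation R A w k).2 rho * F rho =
  \sum_i (greedy_coef (i, true) * F (i, true) + greedy_coef (i, false) * F (i, false)).
Proof.
have [c0 cc e ->] := cone_expansion_sum primitive_relationP.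
have E i b := rays_sum_inj c0 greedy_coef_ge0 cc greedy_coef_compl (etrans (esym e) greedy_relation) i b.
by apply: eq_bigr => i _; rewrite !E.
Qed.
End Relation.

Section Degrees.
Variable a : ray r -> int.
Local Notation g := (g_coef A w a).

(** The recursion for h says that the matrix H of the h_j^i is inverse to the transpose of the
    unitriangular matrix of pairings; so the definition of g can be solved for the coefficients of
    the rho_i^-. *)
Lemma g_coefE i : a (i, false) =
  (g i - a (i, true)) + \sum_(j < r | (i < j)%N) N i j * (g j - a (j, true)).
Proof.
pose H : 'M[int]_r := \matrix_(j, m) h_coef A w j m.
pose M : 'M[int]_r := \matrix_(m, j) if (m < j)%N then N m j else (m == j)%:R.
have hH : M^T *m H = 1%:M.
  apply/matrixP => j i'; rewrite !mxE.
  rewrite (eq_bigr (fun m : 'I_r => (if (m < j)%N then N m j * h_coef A w m i' else 0) +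
      (m == j)%:R * h_coef A w m i')) => [|m _]; last first.
    rewrite !mxE; case: ltngtP => mj; rewrite ?mul0r ?addr0 ?add0r //.
      by rewrite -val_eqE /= ltn_eqF // mul0r addr0.
  rewrite big_split /= [X in _ + X](bigD1 j) //= eqxx mul1r [X in _ + (_ + X)]big1 ?addr0 => [|m /negPf ->]; last first.
    by rewrite mul0r.
  rewrite -big_mkcond; have [ij|ji] := ltnP i' j.
    rewrite (h_coef_lt A w ij) (bigID (fun m : 'I_r => (i' <= m)%N)) /= [X in _ + X + _]big1 ?addr0.
      rewrite -val_eqE /= gtn_eqF // -[RHS](addrN (\sum_(m < r | (i' <= m < j)%N) N m j * h_coef A w m i')).
      by congr (_ - _); apply: eq_bigl => m; rewrite andbC.
    by move=> m /andP[_]; rewrite -ltnNge => mi; rewrite h_coef_gt // mulr0.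
  rewrite big1 ?add0r => [|m mj]; last by rewrite h_coef_gt ?mulr0 // (leq_trans mj).
  move: ji; rewrite leq_eqVlt => /orP[/eqP/val_inj ->|ji]; first by rewrite h_coef_diag eqxx.
  by rewrite h_coef_gt // -val_eqE /= ltn_eqF.
have {}hH : H *m M^T = 1%:M by exact: mulmx1C.
pose am : 'rV[int]_r := \row_j a (j, false).
have gE m : (am *m H) 0 m = g m - a (m, true).
  rewrite /g_coef addrAC subrr add0r mxE (bigID (fun j : 'I_r => (m <= j)%N)) /= [X in _ + X]big1 ?addr0.
    by apply: eq_bigr => j _; rewrite !mxE.
  by move=> j; rewrite -ltnNge !mxE => jm; rewrite h_coef_gt // mulr0.
have : (am *m H *m M^T) 0 i = a (i, false) by rewrite -mulmxA hH mulmx1 mxE.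
move=> <-; rewrite mxE (bigD1 i) //= gE !mxE ltnn eqxx mulr1; congr (_ + _).
rewrite big_mkcond [RHS]big_mkcond /=; apply: eq_bigr => j _; rewrite gE !mxE.
case: eqP => [->|/eqP ji] /=; first by rewrite ltnn.
by case: ifP => _; rewrite 1?mulrC // eq_sym (negPf ji) mul0r.
Qed.

(** The linear form phi takes the value a(rho_j^+) - g_j at e_j^+ and, by [g_coefE], the value
    a(rho_j^-) at e_j^-. A linear form contributes nothing to d_k, since both sides of the primitive
    relation are the same vector; what remains is g_j on the rho_j^+. *)
Lemma d_coefE k : d_coef R A w a k =
  (g k - \sum_(i < r | (k < i)%N && (wg k i <= 0)) `|wg k i|%N%:Z * g i)%:~R.
Proof.
pose phi (v : 'rV[R]_r) := \sum_j v 0 j * (a (j, true) - g j)%:~R.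
have phiD u v : phi (u + v) = phi u + phi v.
  by rewrite -big_split; apply: eq_bigr => j _; rewrite mxE mulrDl.
have phiZ c v : phi (c *: v) = c * phi v.
  by rewrite mulr_sumr; apply: eq_bigr => j _; rewrite mxE mulrA.
have phiS (F : 'I_r -> 'rV[R]_r) (P : pred 'I_r) : phi (\sum_(j | P j) F j) = \sum_(j | P j) phi (F j).
  elim/big_rec2: _ => [|j y x _ <-]; last exact: phiD.
  by rewrite /phi big1 // => j _; rewrite mxE mul0r.
have phi_t j : phi (gen (j, true)) = (a (j, true) - g j)%:~R.
  rewrite /phi (bigD1 j) //= mxE !eqxx mul1r big1 ?addr0 // => m mj.
  by rewrite mxE (negPf mj) mul0r.
have phi_f j : phi (gen (j, false)) = (a (j, false))%:~R.
  rewrite /ray_gen /= -scaleN1r phiD phiZ phi_t -scaleN1r phiZ phiS g_coefE.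
  rewrite [in RHS]intrD [in RHS]rmorph_sum /= !mulN1r -rmorphN opprB; congr (_ + _).
  rewrite -sumrN; apply: eq_bigr => m _; rewrite phiZ phi_t rmorphM /= !rmorphB; ring.
have aE j b : (a (j, b))%:~R = phi (gen (j, b)) + (if b then (g j)%:~R else 0).
  by case: b; rewrite ?phi_f ?addr0 // phi_t rmorphB subrK.
have E : d_coef R A w a k = (a (k, true))%:~R + (a (k, false))%:~R -
    \sum_(rho in (primitive_relation R A w k).1) (primitive_relation R A w k).2 rho * (a rho)%:~R.
  by rewrite /d_coef; case: (primitive_relation R A w k).
rewrite E primitive_relation_sum !aE /= addr0 [X in X - _]addrAC -phiD greedy_relation /rays_sum phiS.
rewrite rmorphB rmorph_sum /=.
have -> : \sum_i (greedy_coef k (i, true) * (a (i, true))%:~R + greedy_coef k (i, false) * (a (i, false))%:~R) =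
    \sum_i phi (greedy_coef k (i, true) *: gen (i, true) + greedy_coef k (i, false) *: gen (i, false)) +
    \sum_i greedy_coef k (i, true) * (g i)%:~R.
  rewrite -big_split /=; apply: eq_bigr => i _; rewrite !aE [in RHS]phiD !phiZ addr0; ring.
have -> : \sum_i greedy_coef k (i, true) * (g i)%:~R =
    \sum_(i < r | (k < i)%N && (wg k i <= 0)) (`|wg k i|%N%:Z * g i)%:~R.
  rewrite [RHS]big_mkcond; apply: eq_bigr => i _; rewrite /greedy_coef /= [true == _]eq_sym eqb_id.
  by case: ifP => _; rewrite ?mul0r // rmorphM.
by ring.
Qed.
End Degrees.
End Fan.

(** * The case of a factor with P_i = B *)

Section Degenerate.
Variables (R : realType) (l : nat) (A : 'M[int]_l) (D : realization A).
Variable G : kac_moody_group R D.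
Hypothesis hA : is_gcm A.
Local Notation C := R[i].

(** If e_i = 0 in all modules, then alpha_i^vee = [e_i, f_i] = 0, and [alpha_i^vee, f_i] = -2 f_i
    gives f_i = 0. *)
Lemma y_trivial i a : ~ ndg R D i -> km_y G i a = 1%g.
Proof.
move=> nd; apply: km_faithful => M v.
have e0 u : @im_e _ _ _ _ M i u = 0 by apply: contrapT => h; apply: nd; exists M, u.
have h0 u : \sum_k (rlz_coroot D i k)%:~R *: @im_h _ _ _ _ M k u = 0.
  by have := im_ef i i u; rewrite eqxx /ad_op !e0 linear0 subr0 => <-.
have f0 : @im_f _ _ _ _ M i v = 0.
  have : \sum_k (rlz_coroot D i k)%:~R *: ad_op (@im_h _ _ _ _ M k) (@im_f _ _ _ _ M i) v = 0.
    rewrite /ad_op (eq_bigr (fun k => (rlz_coroot D i k)%:~R *: im_h M k (im_f M i v) -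
      im_f M i ((rlz_coroot D i k)%:~R *: im_h M k v))) => [|k _]; last by rewrite scalerBr [im_f M i (_ *: _)]linearZ.
    by rewrite sumrB h0 -linear_sum h0 linear0 subr0.
  rewrite (eq_bigr (fun k => - (((rlz_coroot D i k * rlz_root D i k)%:~R : C) *: @im_f _ _ _ _ M i v))) => [|k _].
    rewrite sumrN -scaler_suml -rmorph_sum /=.
    have -> : \sum_k rlz_coroot D i k * rlz_root D i k = 2.
      by rewrite -(gcm2 hA i) -(dot_root D); apply: eq_bigr => k _; rewrite !mxE mulrC.
    move/eqP; rewrite oppr_eq0 scaler_eq0 => /orP[|/eqP //].
    by rewrite pnatr_eq0.
  by rewrite im_hf scalerN scalerA rmorphM.
have -> := @km_rep_y _ _ _ _ G M i a 1%N v f0; by rewrite big_nat1 /= expr0 divr1 scale1r.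
Qed.

Variables (r : nat) (w : 'I_r -> 'I_l).

Lemma degenerate_boundary k : ~ ndg R D (w k) -> @bs_boundary R l A D G r w = setT.
Proof.
move=> nd; apply/seteqP; split=> // z _; exists k => //.
have [p hp zp] := svalP z; exists p; first by rewrite zp; exact: bs_rel_refl.
apply: (hp k); split; first exact: generated_subgroup.
by move=> x [//|[a _ <-]]; rewrite y_trivial //; exact: borel1.
Qed.

Lemma degenerate_vanishing g k j : ~ ndg R D (w k) -> (0 < j)%N ->
  cohomology_vanishes (divisor_sheaf G w g) j.
Proof.
move=> nd j0 J; apply: zero_sheaf_acyclic => // U f _.
apply: dsection_eq => z; have [+ _] := dsectionP f; apply => -[_].
by rewrite (degenerate_boundary nd); apply.
Qed.
End Degenerate.

Theorem lemma5p2 (R : realType) (l : nat) (A : 'M[int]_l) (hA : is_gcm A)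
    (D : realization A) (G : kac_moody_group R D)
    (r : nat) (w : 'I_r -> 'I_l) (a : ray r -> int)
    (hd : forall i : 'I_r, 0 <= d_coef R A w a i) (j : nat) (hj : (0 < j)%N) :
  cohomology_vanishes (divisor_sheaf G w (g_coef A w a)) j.
Proof.
have [hw|] := pselect (forall i, ndg R D (w i)); last first.
  by move/existsNP => [k nd]; exact: degenerate_vanishing nd hj.
case: j hj => // m _ J s; apply: (divisor_sheaf_vanishing hA hw) => k.
by have := hd k; rewrite (@d_coefE R l A D r w a k) ler0z.
Qed.
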